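(* Let $u(\cdot,t),v(\cdot,t)$, $0<t\le T$, be given solutions (defined on a common interval $[0,T_* )$, with $0<T<T_*$) of $$u_t+\operatorname{div} f(x,t,u)+\operatorname{div} g(t,u)=\mu(t)\operatorname{div}\big(|\nabla u|^{p-2}\nabla u\big),$$ where $p>2$ and $|f(x,t,\mathrm{u})|\le F(t)|\mathrm{u}|^{\kappa+1}$ for all $x\in\mathbb{R}^n$, $t\ge 0$, $\mathrm{u}\in\mathbb{R}$, corresponding to initial states $u_0,v_0\in L^1(\mathbb{R}^n)\cap L^\infty(\mathbb{R}^n)$, respectively (all data and the notion of solution being as specified in the context). Then $$u_0(\cdot)\le v_0(\cdot)\quad\Longrightarrow\quad u(\cdot,t)\le v(\cdot,t)\qquad\forall\ 0<t\le T$$ (inequalities holding almost everywhere in $\mathbb{R}^n$), provided that one of the following holds: (i) $p\ge n$, and for every $M>0$ and $0<T'<T_*$ there are constants $K_f(M,T'),K_g(M,T')$ such that $$|f(x,t,\mathrm{u})-f(x,t,\mathrm{v})|\le K_f(M,T')\,|\mathrm{u}-\mathrm{v}|^{1-\frac1p},\qquad |g(t,\mathrm{u})-g(t,\mathrm{v})|\le K_g(M,T')\,|\mathrm{u}-\mathrm{v}|^{1-\frac1p}$$ for all $x\in\mathbb{R}^n$, $0\le t\le T'$, $|\mathrm{u}|\le M$, $|\mathrm{v}|\le M$; (ii) $2<p<n$, $\kappa\ge 1-2/p$, $\gamma\ge 1-2/p$, and for every $M>0$ and $0<T'<T_*$ there are constants $F_{\mathrm{u}}(M,T'),G_{\mathrm{u}}(M,T')$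 such that the derivatives $f_{\mathrm{u}}=\partial f/\partial\mathrm{u}$ and $g_{\mathrm{u}}=\partial g/\partial\mathrm{u}$ satisfy $$|f_{\mathrm{u}}(x,t,\mathrm{u})|\le F_{\mathrm{u}}(M,T')\,|\mathrm{u}|^{\kappa},\qquad |g_{\mathrm{u}}(t,\mathrm{u})|\le G_{\mathrm{u}}(M,T')\,|\mathrm{u}|^{\gamma}$$ for all $x\in\mathbb{R}^n$, $0\le t\le T'$, $|\mathrm{u}|\le M$.
   Context: Standing assumptions: $n\ge 1$; $p>2$ is constant; $\mu\in C^0([0,\infty))$ is positive everywhere; $f=(f_1,\dots,f_n)$ on $\mathbb{R}^n\times[0,\infty)\times\mathbb{R}$ and $g=(g_1,\dots,g_n)$ on $[0,\infty)\times\mathbb{R}$ are given continuous fields with $g(t,0)=0$ for all $t\ge 0$; $f$ satisfies the growth condition $|f(x,t,\mathrm{u})|\le F(t)|\mathrm{u}|^{\kappa+1}$ for all $x\in\mathbb{R}^n$, $t\ge0$, $\mathrm{u}\in\mathbb{R}$, for some $F\in C^0([0,\infty))$ and some constant $\kappa\ge 0$. In (ii), $\kappa$ is this same constant and $\gamma$ is a constant. Here $|\cdot|$ is the absolute value (scalars) or Euclidean norm (vectors), and $\operatorname{div}$, $\nabla$ are taken in $x$ (so $\operatorname{div} f(x,t,u)$ is the divergence of $x\mapsto f(x,t,u(x,t))$). A (bounded) solution on $[0,T_* )$, with $0<T_*\le\infty$, corresponding to the initial state $u_0$, is a function $u\in C^0([0,T_* ),L^1_{\mathrm{loc}}(\mathbb{R}^n))\cap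 L^p_{\mathrm{loc}}([0,T_* ),W^{1,p}_{\mathrm{loc}}(\mathbb{R}^n))\cap L^\infty_{\mathrm{loc}}([0,T_* ),L^1(\mathbb{R}^n)\cap L^\infty(\mathbb{R}^n))$ satisfying the equation in $\mathcal{D}'(\mathbb{R}^n\times(0,T_* ))$, with $u(\cdot,0)=u_0$. The $L^\infty_{\mathrm{loc}}$ condition means that for every $0<T'<T_*$ the norms $\|u(\cdot,t)\|_{L^1(\mathbb{R}^n)}$ and $\|u(\cdot,t)\|_{L^\infty(\mathbb{R}^n)}$ are bounded uniformly in $0\le t\le T'$. *)

(* Defs.v *)
From HB Require Import structures.
From mathcomp Require Import all_boot all_order all_algebra.
From mathcomp Require Import all_classical all_reals all_analysis.

Set Implicit Arguments.
Unset Strict Implicit.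
Unset Printing Implicit Defensive.

Import Order.TTheory GRing.Theory Num.Theory.
Import numFieldNormedType.Exports.

Local Open Scope classical_set_scope.
Local Open Scope ring_scope.

Definition measure_rV_display : measure_display -> measure_display.
Proof. exact. Qed.

(* 'rV[T]_n carries the product sigma-algebra, i.e. the Borel sigma-algebra
   when T = R. *)
Section measurable_rV.
Context {d : measure_display} {T : measurableType d} {n : nat}.

Let coord (i : 'I_n) (v : 'rV[T]_n) : T := v ord0 i.

Let rV_set0 : g_sigma_preimage coord set0.
Proof. exact: sigma_algebra0. Qed.

Let rV_setC A : g_sigma_preimage coord A -> g_sigma_preimage coord (~` A).
Proof. exact: sigma_algebraC. Qed.

Let rV_bigcup (F : _^nat) : (forall i, g_sigma_preimage coord (F i)) ->
  g_sigma_preimage coord (\bigcup_i (F i)).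
Proof. exact: sigma_algebra_bigcup. Qed.

HB.instance Definition _ := @isMeasurable.Build (measure_rV_display d)
  'rV[T]_n (g_sigma_preimage coord) rV_set0 rV_setC rV_bigcup.

End measurable_rV.

Lemma measurable_coord d (T : measurableType d) n (i : 'I_n) :
  measurable_fun [set: 'rV[T]_n] (fun v : 'rV[T]_n => v ord0 i).
Proof.
move=> _ Y mY; rewrite setTI; apply: sub_sigma_algebra => /=.
rewrite -bigcup_seq/=; exists i => /=; first by rewrite mem_index_enum.
by exists Y => //; rewrite setTI.
Qed.

Lemma measurable_fun_rV d1 d2 (T1 : measurableType d1) (T2 : measurableType d2)
    n (f : T1 -> 'rV[T2]_n) :
  (forall i, measurable_fun [set: T1] (fun x => f x ord0 i)) ->
  measurable_fun [set: T1] f.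
Proof.
move=> mf.
suff H : g_sigma_preimage (fun i x => f x ord0 i) `<=` measurable.
  move=> _ A mA; apply: H.
  rewrite -/((fun i => (fun v : 'rV[T2]_n => v ord0 i) \o f)).
  by rewrite (g_sigma_preimage_comp (fun i (v : 'rV[T2]_n) => v ord0 i) f); exists A.
apply: smallest_sub; first exact: sigma_algebra_measurable.
case: n => [|n] in f mf *; first by rewrite big_ord0.
rewrite -bigcup_mkord_ord; apply: bigcup_sub => i Ii.
by move=> A [B mB <-]; exact: mf.
Qed.

Section lebesgue_rV.
Context {R : realType}.

Definition cons_rV n (xv : measurableTypeR R * 'rV[R]_n) : 'rV[R]_n.+1 :=
  \row_i if unlift ord0 i is Some j then xv.2 ord0 j else xv.1.

Lemma cons_rV0 n (xv : measurableTypeR R * 'rV[R]_n) : cons_rV xv ord0 ord0 = xv.1.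
Proof. by rewrite mxE unlift_none. Qed.

Lemma cons_rVS n (xv : measurableTypeR R * 'rV[R]_n) i :
  cons_rV xv ord0 (lift ord0 i) = xv.2 ord0 i.
Proof. by rewrite mxE liftK. Qed.

Lemma measurable_cons_rV n : measurable_fun [set: measurableTypeR R * 'rV[R]_n] (@cons_rV n).
Proof.
apply: measurable_fun_rV => i; have [j ->|->] := unliftP ord0 i.
  under eq_fun do rewrite cons_rVS.
  exact: (measurableT_comp (measurable_coord j) measurable_snd).
by under eq_fun do rewrite cons_rV0; exact: measurable_fst.
Qed.

Section lebesgue_rVS.
Variables (n : nat) (m : {sigma_finite_measure set 'rV[R]_n -> \bar R}).

Definition lebesgue_rVS := pushforward (@lebesgue_measure R \x m)%E (@cons_rV n).

Let lebesgue_rVS_measure : {measure set 'rV[R]_n.+1 -> \bar R} :=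
  measure_function_pushforward__canonical__measure_function_Measure
    (@lebesgue_measure R \x m)%E (@measurable_cons_rV n).

HB.instance Definition _ := isMeasure.Build _ _ _ lebesgue_rVS
  (measure0 lebesgue_rVS_measure) (measure_ge0 lebesgue_rVS_measure)
  (@measure_semi_sigma_additive _ _ _ lebesgue_rVS_measure).

Let lebesgue_rVS_sigma_finite : sigma_finite setT lebesgue_rVS.
Proof.
pose hd (v : 'rV[R]_n.+1) : measurableTypeR R := v ord0 ord0.
pose tl (v : 'rV[R]_n.+1) : 'rV[R]_n := \row_i v ord0 (lift ord0 i).
have mhd : measurable_fun setT hd by exact: measurable_coord.
have mtl : measurable_fun setT tl.
  apply: measurable_fun_rV => i; rewrite /tl; under eq_fun do rewrite mxE.
  exact: measurable_coord.
have mht : measurable_fun setT (fun v => (hd v, tl v)).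
  exact/measurable_fun_pair.
have consK xv : (hd (cons_rV xv), tl (cons_rV xv)) = xv.
  case: xv => x v; rewrite /hd cons_rV0; congr pair.
  by apply/rowP => i; rewrite mxE cons_rVS.
have [F FT Ffin] : sigma_finite setT (@lebesgue_measure R \x m)%E.
  have /sigma_finiteP[A [TA ndA Aoo]] := sigma_finiteT (@lebesgue_measure R).
  have /sigma_finiteP[B [TB ndB Boo]] := sigma_finiteT m.
  exists (fun k => A k `*` B k).
    rewrite -setXTT TA TB predeqE => -[x y]; split.
      move=> [/= [i _ Aix] [k _ Bky]]; exists (maxn i k) => //; split.
      - by move: x Aix; exact/subsetPset/ndA/leq_maxl.
      - by move: y Bky; exact/subsetPset/ndB/leq_maxr.
    by move=> [i _ []/= ? ?]; split; exists i.
  move=> k; have [? ?] := Aoo k; have [? ?] := Boo k.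
  split; first exact: measurableX.
  by rewrite product_measure1E// lte_mul_pinfty// ge0_fin_numE.
exists (fun k => (fun v => (hd v, tl v)) @^-1` F k).
  by rewrite -preimage_bigcup -FT preimage_setT.
move=> k; have [mF Foo] := Ffin k; split.
  by rewrite -[X in measurable X]setTI; exact: mht.
rewrite /lebesgue_rVS /pushforward/=.
rewrite (_ : _ @^-1` _ = F k)//.
by apply/seteqP; split=> xv /=; rewrite consK.
Qed.

HB.instance Definition _ :=
  @Measure_isSigmaFinite.Build _ _ _ lebesgue_rVS lebesgue_rVS_sigma_finite.

End lebesgue_rVS.

(* n-dimensional Lebesgue measure, as the n-fold product of lebesgue_measure *)
Fixpoint lebesgue_rV n : {sigma_finite_measure set 'rV[R]_n -> \bar R} :=
  match n with
  | 0 => @dirac _ 'rV[R]_0 0 R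
  | n'.+1 => lebesgue_rVS (lebesgue_rV n')
  end.

Lemma lebesgue_rV_box n (a b : 'I_n -> R) : (forall i, a i <= b i) ->
  lebesgue_rV n [set v : 'rV[R]_n | forall i, v ord0 i \in `[a i, b i]] =
  (\prod_(i < n) (b i - a i))%:E.
Proof.
elim: n a b => [|n IH] a b ab /=.
  rewrite big_ord0 diracE; congr (_%:E).
  by rewrite mem_set//= => -[].
pose tl (i : 'I_n) := `[a (lift ord0 i), b (lift ord0 i)]%classic.
have boxE : @cons_rV n @^-1` [set v : 'rV[R]_n.+1 | forall i, v ord0 i \in `[a i, b i]] =
    `[a ord0, b ord0]%classic `*` [set v : 'rV[R]_n | forall i, tl i (v ord0 i)].
  apply/seteqP; split=> -[x v]/=.
    move=> H; split; first by have := H ord0; rewrite cons_rV0.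
    by move=> i; have := H (lift ord0 i); rewrite cons_rVS.
  by move=> [xab H] i; have [j ->|->] := unliftP ord0 i;
    rewrite ?cons_rVS ?cons_rV0//; exact: H.
rewrite /lebesgue_rVS /pushforward boxE product_measure1E//.
  rewrite IH//= [in RHS]big_ord_recl EFinM; congr (_ * _)%E.
  rewrite lebesgue_measure_itv/= lte_fin; case: ltP => // ba.
  by rewrite (@le_anti _ _ (a ord0) (b ord0)) ?ab ?ba// subrr.
rewrite (_ : [set v : 'rV[R]_n | _] =
  \bigcap_i ((fun v : 'rV[R]_n => v ord0 i) @^-1` tl i)); last first.
  by apply/seteqP; split=> v /= H i => [_|]; exact: H.
apply: (@fin_bigcap_measurable _ 'rV[R]_n); [exact: finite_finset|move=> i _].
rewrite -[X in measurable X]setTI.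
exact: (measurable_coord i measurableT (measurable_itv _)).
Qed.

End lebesgue_rV.

Section euclidean.
Context {R : realType} {n : nat}.
Implicit Types v w : 'rV[R]_n.

(* The library norm `|v| is the sup norm; it induces the same topology. *)
Definition enorm v : R := Num.sqrt (\sum_i v ord0 i ^+ 2).

Definition dot v w : R := \sum_i v ord0 i * w ord0 i.

Definition partial (phi : 'rV[R]_n -> R) (i : 'I_n) (x : 'rV[R]_n) : R :=
  'D_(delta_mx ord0 i) phi x.

Definition grad (phi : 'rV[R]_n -> R) (x : 'rV[R]_n) : 'rV[R]_n :=
  \row_i partial phi i x.

End euclidean.

(* In finite dimension, C^oo amounts to the existence and continuity of all
   iterated directional derivatives. *)
Definition smooth (R : realType) (V : normedModType R) (phi : V -> R) : Prop :=
  forall s : seq V,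
    let phi_s := foldr (fun v h => 'D_v h) phi s in
    continuous phi_s /\ forall x v, derivable phi_s x v.

Definition test_function (R : realType) (V : normedModType R) (Omega : set V)
    (phi : V -> R) : Prop :=
  let supp := closure [set x | phi x != 0] in
  [/\ smooth phi, compact supp & supp `<=` Omega].

Section function_spaces.
Context {R : realType} {n : nat}.
Implicit Types (w : 'rV[R]_n -> R) (G : 'rV[R]_n -> 'rV[R]_n).
Implicit Types (u : 'rV[R]_n -> R -> R) (Du : 'rV[R]_n -> R -> 'rV[R]_n).
Local Notation leb := (@lebesgue_rV R n).
Local Notation leb_xt := (leb \x @lebesgue_measure R)%E.

Definition Lp_loc (p : R) w : Prop :=
  measurable_fun setT w /\
  forall K : set 'rV[R]_n, compact K ->
    (\int[leb]_(x in K) (`|w x| `^ p)%:E < +oo)%E.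

Definition weak_gradient w G : Prop :=
  forall (phi : 'rV[R]_n -> R) (i : 'I_n), test_function setT phi ->
    \int[leb]_x (w x * partial phi i x) = - (\int[leb]_x (G x ord0 i * phi x)).

Definition W1p_loc (p : R) w G : Prop :=
  [/\ Lp_loc p w, forall i, Lp_loc p (fun x => G x ord0 i) & weak_gradient w G].

(* [0, Ts) and (0, Ts), with Ts possibly +oo *)
Definition time_co (Ts : \bar R) : set R := [set t | 0 <= t /\ (t%:E < Ts)%E].
Definition time_oo (Ts : \bar R) : set R := [set t | 0 < t /\ (t%:E < Ts)%E].

Definition C0_L1_loc (Ts : \bar R) u : Prop :=
  forall K : set 'rV[R]_n, compact K -> forall t0, time_co Ts t0 ->
    (\int[leb]_(x in K) `|u x t - u x t0|%:E)%E
      @[t --> within (time_co Ts) (nbhs t0)] --> 0%E.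

(* Joint measurability selects representatives of the classes u(., t), Du(., t)
   that depend measurably on t. *)
Definition Lp_loc_W1p_loc (Ts : \bar R) (p : R) u Du : Prop :=
  [/\ measurable_fun ([set: 'rV[R]_n] `*` time_co Ts)
        (fun z : 'rV[R]_n * measurableTypeR R => u z.1 z.2),
      measurable_fun ([set: 'rV[R]_n] `*` time_co Ts)
        (fun z : 'rV[R]_n * measurableTypeR R => Du z.1 z.2),
      {ae lebesgue_measure, forall t, time_co Ts t ->
        W1p_loc p (u ^~ t) (Du ^~ t)} &
      forall (T' : R) (K : set 'rV[R]_n), time_oo Ts T' -> compact K ->
        (\int[leb_xt]_(z in K `*` `[0%R, T'])
           (`|u z.1 z.2| `^ p + enorm (Du z.1 z.2) `^ p)%:E < +oo)%E].

Definition Linfty_loc_L1_Linfty (Ts : \bar R) u : Prop :=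
  forall T' : R, time_oo Ts T' -> exists C : R, forall t, 0 <= t <= T' ->
    ('N[leb]_1[EFin \o (u ^~ t)] <= C%:E)%E /\
    ('N[leb]_(+oo)[EFin \o (u ^~ t)] <= C%:E)%E.

(* u_t + div f(x,t,u) + div g(t,u) = mu(t) div(|Du|^(p-2) Du) in
   D'(R^n x (0, Ts)), i.e. tested against every phi in C_c^oo(R^n x (0, Ts)) *)
Definition distributional_equation (p : R) (mu : R -> R)
    (f : 'rV[R]_n -> R -> R -> 'rV[R]_n) (g : R -> R -> 'rV[R]_n)
    (Ts : \bar R) u Du : Prop :=
  let Q := [set: 'rV[R]_n] `*` time_oo Ts in
  forall phi : 'rV[R]_n * R -> R, test_function Q phi ->
    let phi_t (z : 'rV[R]_n * R) := 'D_((0, 1) : 'rV[R]_n * R) phi z in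
    let phi_x (z : 'rV[R]_n * R) := grad (fun x => phi (x, z.2)) z.1 in
    - (\int[leb_xt]_(z in Q) (u z.1 z.2 * phi_t z))
    - (\int[leb_xt]_(z in Q) dot (f z.1 z.2 (u z.1 z.2)) (phi_x z))
    - (\int[leb_xt]_(z in Q) dot (g z.2 (u z.1 z.2)) (phi_x z))
    = - (\int[leb_xt]_(z in Q)
           (mu z.2 *
            dot (enorm (Du z.1 z.2) `^ (p - 2) *: Du z.1 z.2) (phi_x z))).

Definition solution (p : R) (mu : R -> R)
    (f : 'rV[R]_n -> R -> R -> 'rV[R]_n) (g : R -> R -> 'rV[R]_n)
    (Ts : \bar R) (u0 : 'rV[R]_n -> R) u : Prop :=
  C0_L1_loc Ts u /\ Linfty_loc_L1_Linfty Ts u /\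
  (exists Du, Lp_loc_W1p_loc Ts p u Du /\
     distributional_equation p mu f g Ts u Du) /\
  {ae leb, forall x, u x 0 = u0 x}.

End function_spaces.

(* Main.v *)
Require Import Defs.
From HB Require Import structures.
From mathcomp Require Import all_boot all_order all_algebra.
From mathcomp Require Import all_classical all_reals all_analysis.
From mathcomp Require Import ess_sup_inf measurable_realfun measurable_fun_approximation.
From mathcomp Require Import ring lra.

(** Why comparison holds. Write w = u - v. Subtracting the equations gives
w_t = div (Phi_u - Phi_v) with Phi = mu |Du|^(p-2) Du - f - g, and this is
tested with a cutoff times the derivative of a smooth convex approximation of
the positive part of w. Three effects compete.

- Interior. The p-Laplacian flux is uniformly monotone, so it contributes at
least c |Dw|^p (p_laplacian_monotone). The convective difference is Hoelder of
exponent 1 - 1/p in u, and the exponent conjugate to p turns it into a multiple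
of |w|; by Young's inequality it costs a fraction of c |Dw|^p plus C |w|
(regular_dissipative). The remainder C |w| is multiplied by the second
derivative of the approximation of the positive part, and the approximation is
chosen so that |s| times this second derivative is bounded and tends to 0
(cvg_mul_pos_reg''). The interior therefore contributes nothing in the limit.

- Infinity. The gradient of the cutoff leaves the flux through an annulus of
radius L, namely 1/L times the integral of |Phi_u| + |Phi_v|. No bound on the
gradients over the whole space is known, so the vanishing of this term as L
grows has to be extracted from the equation of each solution separately:
testing with an annular cutoff times u (u^2 + eta^2)^(-tau) bounds the integral
of (u^2 + eta^2)^(-tau) |Du|^p over the annulus by the mass of u there
(energy_bound), and this mass tends to 0 because u is integrable. Young's
inequality with weight lambda then trades the flux for lambda times that energy
plus lambda^(-(p-1)) L^(-p) times the integral of (u^2 + eta^2)^(tau (p-1)) over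
the annulus (flux_tail_bound). The last integral is bounded by a multiple of
L^p in both cases of the theorem: if p >= n, take tau = 0, since the annulus has
volume of order L^n; if p < n, take tau = 1/(2(p-1)), so that the integrand is
at most |u| + eta, and eta = L^(-n). Choosing lambda large and then L large
makes the flux small.

- Initial time. The time cutoff vanishes near t = 0; the initial layer which it
creates is small by continuity in time with values in L^1_loc and the ordering
of the initial states.

Together these give u <= v almost everywhere in space-time (comparison_ae), and
continuity in time upgrades this to almost everywhere in space at every time
(ordered_at_all_times).

Functions of a solution are not admissible as test functions directly. The
chain rule weak_chain_rule makes the testing rigorous: for convolutions of the
solution with smooth kernels it is the classical chain rule followed by an
integration by parts, and the limit is taken in L^p and L^q, where continuity of
translations gives convergence of mollifications. All kernels are built from
the functions s^(-j) exp(-1/s), whose smoothness is checked once and for all on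
the algebra that they generate (flat_alg_smooth). *)

Set Implicit Arguments.
Unset Strict Implicit.
Unset Printing Implicit Defensive.

Import Order.TTheory GRing.Theory Num.Theory.
Import numFieldNormedType.Exports.

Local Open Scope classical_set_scope.
Local Open Scope ring_scope.

(** * Integrals of real-valued functions *)

Section integration.
Context {R : realType} {d : measure_display} {T : measurableType d}.
Variable mu : {measure set T -> \bar R}.
Implicit Types f g : T -> R.

(** Integrability over the whole space of a real-valued function: with all
    integrals finite, additivity and monotonicity are statements in a field, free of
    the side conditions of extended real arithmetic. *)
Definition ig f := mu.-integrable setT (EFin \o f).

Lemma ig_meas f : ig f -> measurable_fun setT f.
Proof. by case/integrableP => /measurable_EFinP. Qed.

Lemma ig_dom g f : measurable_fun setT f -> (forall x, `|f x| <= g x) ->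
  ig g -> ig f.
Proof.
move=> mf fg; apply: le_integrable => //; first exact/measurable_EFinP.
by move=> x _ /=; rewrite lee_fin (le_trans (fg x))// ler_norm.
Qed.

Lemma igD f g : ig f -> ig g -> ig (fun x => f x + g x).
Proof. by move=> igf igg; exact: (integrableD measurableT igf igg). Qed.

Lemma igB f g : ig f -> ig g -> ig (fun x => f x - g x).
Proof. by move=> igf igg; exact: (integrableB measurableT igf igg). Qed.

Lemma igN f : ig f -> ig (fun x => - f x).
Proof. by move=> igf; exact: (integrableN igf). Qed.

Lemma igZ c f : ig f -> ig (fun x => c * f x).
Proof. by move=> igf; exact: (integrableZl measurableT c igf). Qed.

Lemma ig_abs f : ig f -> ig (fun x => `|f x|).
Proof. by move=> igf; exact: (integrable_norm igf). Qed.

Lemma ig0 : ig (fun=> 0).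
Proof. exact: (integrable0 mu setT). Qed.

Lemma ig_sum (J : Type) (s : seq J) (F : J -> T -> R) :
  (forall j, ig (F j)) -> ig (fun x => \sum_(j <- s) F j x).
Proof.
move=> igF; elim: s => [|j s IH].
  by under eq_fun do rewrite big_nil; exact: ig0.
by under eq_fun do rewrite big_cons; exact: igD.
Qed.

Lemma I_D f g : ig f -> ig g ->
  \int[mu]_x (f x + g x) = \int[mu]_x f x + \int[mu]_x g x.
Proof. exact: RintegralD. Qed.

Lemma I_B f g : ig f -> ig g ->
  \int[mu]_x (f x - g x) = \int[mu]_x f x - \int[mu]_x g x.
Proof. exact: RintegralB. Qed.

Lemma I_Z c f : ig f -> \int[mu]_x (c * f x) = c * \int[mu]_x f x.
Proof. exact: RintegralZl. Qed.

Lemma I_0 : \int[mu]_x (fun=> 0) x = 0 :> R.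
Proof. by rewrite /Rintegral integral0. Qed.

Lemma I_N f : ig f -> \int[mu]_x (- f x) = - \int[mu]_x f x.
Proof.
move=> igf; rewrite -mulN1r -I_Z//; apply: eq_Rintegral => x _.
by rewrite mulN1r.
Qed.

Lemma I_sum (J : Type) (s : seq J) (F : J -> T -> R) :
  (forall j, ig (F j)) ->
  \int[mu]_x (\sum_(j <- s) F j x) = \sum_(j <- s) \int[mu]_x F j x.
Proof.
move=> igF; elim: s => [|j s IH].
  by rewrite big_nil; under eq_Rintegral do rewrite big_nil; exact: I_0.
rewrite big_cons -IH; under eq_Rintegral do rewrite big_cons.
by rewrite I_D//; exact: ig_sum.
Qed.

Lemma I_le f g : ig f -> ig g -> (forall x, f x <= g x) ->
  \int[mu]_x f x <= \int[mu]_x g x.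
Proof. by move=> igf igg fg; exact: le_Rintegral. Qed.

Lemma I_ge0 f : (forall x, 0 <= f x) -> 0 <= \int[mu]_x f x.
Proof. by move=> f0; apply: Rintegral_ge0 => x _; exact: f0. Qed.

Lemma I_abs f : ig f -> `|\int[mu]_x f x| <= \int[mu]_x `|f x|.
Proof. by move=> igf; exact: le_normr_Rintegral. Qed.

Lemma I_fin f : ig f -> (\int[mu]_x f x)%:E = (\int[mu]_x (f x)%:E)%E.
Proof. by move=> igf; rewrite fineK//; exact: (integrable_fin_num measurableT igf). Qed.

Lemma ig_ge0 f c : measurable_fun setT f -> (forall x, 0 <= f x) ->
  (\int[mu]_x (f x)%:E <= c%:E)%E -> ig f /\ \int[mu]_x f x <= c.
Proof.
move=> mf f0 fc; have igf : ig f.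
  apply/integrableP; split; first exact/measurable_EFinP.
  apply: le_lt_trans (ltry c); apply: le_trans fc; rewrite le_eqVlt.
  by apply/orP; left; apply/eqP/eq_integral => x _ /=; rewrite ger0_norm.
by split => //; rewrite -lee_fin I_fin.
Qed.

Lemma I_ae f g : measurable_fun setT f -> measurable_fun setT g ->
  {ae mu, forall x, f x = g x} -> \int[mu]_x f x = \int[mu]_x g x.
Proof.
move=> mf mg fg; congr fine; apply: ae_eq_integral => //.
- exact/measurable_EFinP.
- exact/measurable_EFinP.
- by apply: filterS fg => x fgx _; rewrite fgx.
Qed.

Lemma ig_ae f g : measurable_fun setT g ->
  {ae mu, forall x, f x = g x} -> ig f -> ig g.
Proof.
move=> mg fg /[dup] /ig_meas mf /integrableP[_ foo]; apply/integrableP.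
split; first exact/measurable_EFinP.
rewrite (_ : integral _ _ _ = (\int[mu]_x `|(f x)%:E|)%E)//.
apply: ae_eq_integral => //.
- by apply/measurable_EFinP; exact: measurableT_comp.
- by apply/measurable_EFinP; exact: measurableT_comp.
- by apply: filterS fg => x fgx _; rewrite /= fgx.
Qed.

Lemma I_le_ae f g : ig f -> ig g -> {ae mu, forall x, f x <= g x} ->
  \int[mu]_x f x <= \int[mu]_x g x.
Proof.
move=> igf igg fg.
have mf := ig_meas igf; have mg := ig_meas igg.
have mM : measurable_fun setT (fun x => Num.max (f x) (g x)).
  exact: measurable_maxr.
have aeM : {ae mu, forall x, g x = Num.max (f x) (g x)}.
  by apply: filterS fg => x /max_idPr ->.
rewrite (I_ae mg mM aeM); apply: I_le => //; first exact: ig_ae aeM igg.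
by move=> x; rewrite le_max lexx.
Qed.

Lemma I_dct (f_ : nat -> T -> R) f g : (forall k, measurable_fun setT (f_ k)) ->
  measurable_fun setT f -> (forall x, f_ k x @[k --> \oo] --> f x) ->
  ig g -> (forall k x, `|f_ k x| <= g x) ->
  ig f /\ \int[mu]_x f_ k x @[k --> \oo] --> \int[mu]_x f x.
Proof.
move=> mf_ mf f_f igg f_g.
have cE x : (EFin \o f_ ^~ x) k @[k --> \oo] --> (f x)%:E.
  by apply: cvg_EFin; [exact: nearW|exact: f_f].
have [|||||igf _ cv] := @dominated_convergence _ _ _ mu setT measurableT
  (fun k => EFin \o f_ k) (EFin \o f) (EFin \o g).
- by move=> k; exact/measurable_EFinP.
- exact/measurable_EFinP.
- by apply: aeW => x _; exact: cE.
- exact: igg.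
- by apply: aeW => x k _ /=; rewrite lee_fin f_g.
split => //; apply: fine_cvg; rewrite I_fin//; exact: cv.
Qed.

Lemma ig_bdd (A : set T) (C : R) f : measurable A -> (mu A < +oo)%E ->
  measurable_fun setT f -> (forall x, A x -> `|f x| <= C) ->
  (forall x, ~ A x -> f x = 0) -> ig f.
Proof.
move=> mA Aoo mf fC f0.
have igA : ig (fun x => C * \1_A x).
  apply: igZ.
  apply/integrableP; split; first exact/measurable_EFinP.
  under eq_integral do rewrite /= ger0_norm//.
  by rewrite integral_indic// setIT.
apply: (ig_dom mf _ igA) => x; rewrite indicE.
have [Ax|nAx] := pselect (A x); first by rewrite mem_set// mulr1 fC.
by rewrite memNset// mulr0 f0// normr0.
Qed.

Lemma I_eq0_ae f : ig f -> (forall x, 0 <= f x) -> \int[mu]_x f x <= 0 ->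
  {ae mu, forall x, f x = 0}.
Proof.
move=> igf f0 If.
have E0 : (\int[mu]_x `|(f x)%:E| = 0)%E.
  under eq_integral do rewrite gee0_abs ?lee_fin//.
  rewrite -I_fin//; congr EFin; apply/eqP; rewrite eq_le If/=; exact: I_ge0.
have mf : measurable_fun setT (EFin \o f) by exact/measurable_EFinP/ig_meas.
have /ae_eq_integral_abs := E0 => /(_ measurableT mf).
by apply: filterS => x /(_ Logic.I) [].
Qed.

End integration.

(** * Translation invariance of Lebesgue measure on space-time *)

Definition preserves d (T : measurableType d) (R : realType)
    (mu : set T -> \bar R) (phi : T -> T) :=
  measurable_fun setT phi /\ forall A, measurable A -> mu (phi @^-1` A) = mu A.

(** A sigma-finite product measure is determined by its values on rectangles,
    and on rectangles the two factors act separately. *)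
Lemma preserves_prod d1 d2 (T1 : measurableType d1) (T2 : measurableType d2)
    (R : realType) (m1 : {sigma_finite_measure set T1 -> \bar R})
    (m2 : {sigma_finite_measure set T2 -> \bar R}) phi1 phi2 :
  preserves m1 phi1 -> preserves m2 phi2 ->
  preserves (m1 \x m2)%E (fun z => (phi1 z.1, phi2 z.2)).
Proof.
move=> [mphi1 H1] [mphi2 H2].
have mphi : measurable_fun setT (fun z : T1 * T2 => (phi1 z.1, phi2 z.2)).
  by apply/measurable_fun_pair => /=; exact: measurableT_comp.
split => // A mA; apply/esym.
pose m' : {measure set (T1 * T2) -> \bar R} :=
  measure_function_pushforward__canonical__measure_function_Measure
    (m1 \x m2)%E mphi.
rewrite (_ : (m1 \x m2)%E (_ @^-1` A) = m' A)//.
apply: product_measure_unique => // B C mB mC /=; rewrite /pushforward/=.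
rewrite (_ : _ @^-1` _ = (phi1 @^-1` B) `*` (phi2 @^-1` C))// product_measure1E.
- by congr (_ * _)%E; [exact: H1|exact: H2].
- by rewrite -[X in measurable X]setTI; exact: mphi1.
- by rewrite -[X in measurable X]setTI; exact: mphi2.
Qed.

Lemma preserves_addR (R : realType) (a : R) :
  preserves (@lebesgue_measure R) (fun x : measurableTypeR R => x + a : measurableTypeR R).
Proof.
have mp : measurable_fun setT (fun x : measurableTypeR R => x + a : measurableTypeR R).
  exact: measurable_funD.
split => // A mA; apply/esym.
pose m' : {measure set (measurableTypeR R) -> \bar R} :=
  measure_function_pushforward__canonical__measure_function_Measure
    (@lebesgue_measure R) mp.
rewrite (_ : lebesgue_measure (_ @^-1` A) = m' A)//.
apply: lebesgue_measure_unique => // _ [[x y] _ <-] /=.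
rewrite /pushforward (_ : _ @^-1` _ = `]x - a, y - a]%classic); last first.
  by apply/seteqP; split => z /=; rewrite !in_itv /= ltrBlDr lerBrDr.
by rewrite !lebesgue_measure_itv/= !lte_fin ltrD2r; case: ifP => // _;
   rewrite -!EFinB; congr EFin; ring.
Qed.

Lemma measurable_addrV (R : realType) n (a : 'rV[R]_n) :
  measurable_fun setT (fun x : 'rV[R]_n => x + a).
Proof.
apply: measurable_fun_rV => i; under eq_fun do rewrite mxE.
by apply: measurable_funD => //; exact: measurable_coord.
Qed.

Lemma preserves_addrV (R : realType) n (a : 'rV[R]_n) :
  preserves (@lebesgue_rV R n) (fun x => x + a).
Proof.
split; first exact: measurable_addrV.
elim: n a => [|n IH] a A mA /=.
  rewrite (_ : _ @^-1` A = A)//; apply/funext => x /=.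
  by rewrite (thinmx0 a) addr0.
rewrite /lebesgue_rVS /pushforward.
pose b : 'rV[R]_n := \row_i a ord0 (lift ord0 i).
have [_ H] := preserves_prod (preserves_addR (a ord0 ord0))
  (conj (measurable_addrV b) (IH b)).
rewrite -[RHS]H; last first.
  by rewrite -[X in measurable X]setTI; exact: measurable_cons_rV.
congr (_ _); apply/seteqP; split => -[x v] /=; congr (A _).
  apply/rowP => i; rewrite !mxE.
  by case: unliftP => [j ->|->]; rewrite ?mxE.
apply/rowP => i; rewrite !mxE.
by case: unliftP => [j ->|->]; rewrite ?mxE.
Qed.

Section lebV.
Context {R : realType} {n : nat}.
Local Notation V := ('rV[R]_n * measurableTypeR R)%type.

(** Lebesgue measure on space-time under a name of its own, so that its
    sigma-finite structure is found by unification. *)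
Definition lebV : set V -> \bar R := (@lebesgue_rV R n \x @lebesgue_measure R)%E.

HB.instance Definition _ := Measure.on lebV.

Let lebV_sigma_finite : sigma_finite setT lebV.
Proof.
have /sigma_finiteP[F [TF ndF Foo]] := sigma_finiteT (@lebesgue_rV R n).
have /sigma_finiteP[G [TG ndG Goo]] := sigma_finiteT (@lebesgue_measure R).
exists (fun k => F k `*` G k).
  rewrite -setXTT TF TG predeqE => -[x y]; split.
    move=> [/= [i _ Fix] [k _ Gky]]; exists (maxn i k) => //; split.
    - by move: x Fix; exact/subsetPset/ndF/leq_maxl.
    - by move: y Gky; exact/subsetPset/ndG/leq_maxr.
  by move=> [k _ []/= ? ?]; split; exists k.
move=> k; have [? ?] := Foo k; have [? ?] := Goo k.
split; first exact: measurableX.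
by rewrite /lebV product_measure1E// lte_mul_pinfty// ge0_fin_numE.
Qed.

HB.instance Definition _ :=
  Measure_isSigmaFinite.Build _ _ _ lebV lebV_sigma_finite.

Lemma preserves_addV (h : V) : preserves lebV (fun z => z + h).
Proof.
have := preserves_prod (preserves_addrV h.1) (preserves_addR h.2).
by congr preserves; apply/funext => -[x t]; case: h.
Qed.

Lemma measurable_addV (h : V) : measurable_fun setT (fun z : V => z + h).
Proof. by case: (preserves_addV h). Qed.

Lemma integral_addV (f : V -> \bar R) h : measurable_fun setT f ->
  (forall z, 0 <= f z)%E ->
  (\int[lebV]_z f (z + h)%R = \int[lebV]_z f z)%E.
Proof.
move=> mf f0; have [mh H] := preserves_addV h.
have E := @ge0_integral_pushforward _ _ _ _ _ _ mh lebV setT f measurableT mf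
  (fun z _ => f0 z).
rewrite preimage_setT in E; rewrite -[LHS]E.
by apply: eq_measure_integral => A mA _; exact: H.
Qed.

Lemma ig_addV (f : V -> R) h : ig lebV f -> ig lebV (fun z => f (z + h)).
Proof.
move=> /[dup] /ig_meas mf /integrableP[_ foo]; apply/integrableP; split.
  by apply/measurable_EFinP; apply: measurableT_comp; [exact: mf|exact: measurable_addV].
rewrite (integral_addV (f := fun z => `|(f z)%:E|%E))//.
by apply: measurableT_comp => //; exact/measurable_EFinP.
Qed.

Lemma I_addV (f : V -> R) h : ig lebV f ->
  \int[lebV]_z f (z + h) = \int[lebV]_z f z.
Proof.
move=> /[dup] /ig_meas mf igf; rewrite /Rintegral; congr fine.
have mfE : measurable_fun setT (EFin \o f) by exact/measurable_EFinP.
rewrite integralE [in RHS]integralE; congr (_ - _)%E.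
  apply: etrans (integral_addV h (measurable_funepos mfE) (fun z => funepos_ge0 _ z)).
  by apply: eq_integral => z _; rewrite !funeposE.
apply: etrans (integral_addV h (measurable_funeneg mfE) (fun z => funeneg_ge0 _ z)).
by apply: eq_integral => z _; rewrite !funenegE.
Qed.

Lemma coord_le_norm (x : 'rV[R]_n) i : `|x ord0 i| <= `|x|.
Proof.
rewrite /Num.norm/= mx_normrE.
exact: (@le_bigmax _ _ _ 0 (fun ij : 'I_1 * 'I_n => `|x ij.1 ij.2|) (ord0, i)).
Qed.

Lemma norm_rV_le (x : 'rV[R]_n) (N : R) : 0 <= N ->
  (`|x| <= N) <-> (forall i, `|x ord0 i| <= N).
Proof.
move=> N0; split=> [xN i|H]; first exact: le_trans (coord_le_norm x i) xN.
rewrite /Num.norm/= mx_normrE; apply: bigmax_le => // -[i j] _ /=.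
by rewrite ord1.
Qed.

Definition ball_rV (N : R) : set 'rV[R]_n := [set x | `|x| <= N].

Lemma ball_rVE N : 0 <= N ->
  ball_rV N = [set v : 'rV[R]_n | forall i, v ord0 i \in `[- N, N]].
Proof.
move=> N0; apply/seteqP; split=> x /=.
  by move=> /norm_rV_le -/(_ N0) H i; rewrite in_itv/= -ler_norml.
by move=> H; apply/norm_rV_le => // i; have := H i; rewrite in_itv/= -ler_norml.
Qed.

Lemma measurable_ball_rV N : measurable (ball_rV N).
Proof.
have [N0|N0] := leP 0 N; last first.
  rewrite (_ : ball_rV N = set0)//; apply/seteqP; split=> // x /= xN.
  by have := le_lt_trans xN N0; rewrite ltNge normr_ge0.
rewrite ball_rVE// (_ : [set v | _] =
  \bigcap_i ((fun v : 'rV[R]_n => v ord0 i) @^-1` `[- N, N]%classic)); last first.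
  by apply/seteqP; split=> v /= H i => [_|]; exact: H.
apply: (@fin_bigcap_measurable _ 'rV[R]_n); [exact: finite_finset|move=> i _].
rewrite -[X in measurable X]setTI.
exact: (measurable_coord i measurableT (measurable_itv _)).
Qed.

Lemma leb_ball_rV N : 0 <= N -> lebesgue_rV n (ball_rV N) = ((2 * N) ^+ n)%:E.
Proof.
move=> N0; rewrite ball_rVE// (@lebesgue_rV_box _ _ (fun=> - N) (fun=> N)).
  by rewrite big_const_ord iter_mulr_1; congr (_ ^+ _)%:E; ring.
by move=> _; rewrite (le_trans _ N0)// oppr_le0.
Qed.

Definition ballV (N : R) : set V := [set z | `|z| <= N].

Lemma normV_le (z : V) N : (`|z| <= N) = (`|z.1| <= N) && (`|z.2| <= N).
Proof. by rewrite [`|z|]prod_normE/= ge_max. Qed.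

Lemma ballVE N : ballV N = ball_rV N `*` `[- N, N]%classic.
Proof.
apply/seteqP; split=> -[x t]; rewrite /ballV/ball_rV/= in_itv/= -ler_norml normV_le/=.
  by move=> /andP[].
by move=> [-> ->].
Qed.

Lemma measurable_ballV N : measurable (ballV N).
Proof.
by rewrite ballVE; apply: measurableX; [exact: measurable_ball_rV|exact: measurable_itv].
Qed.

Lemma lebV_ballV N : (lebV (ballV N) < +oo)%E.
Proof.
rewrite ballVE /lebV product_measure1E//; last exact: measurable_ball_rV.
have [N0|N0] := leP 0 N.
  apply: lte_mul_pinfty => //.
    rewrite ge0_fin_numE//; apply: le_lt_trans (ltry ((2 * N) ^+ n)).
    by rewrite le_eqVlt; apply/orP; left; apply/eqP; exact: leb_ball_rV.
  have foo : (@lebesgue_measure R `[(- N)%R, N]%classic < +oo)%E.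
    by rewrite lebesgue_measure_itv/=; case: ifP => _; rewrite ?ltry// -EFinB ltry.
  exact: foo.
rewrite (_ : `[- N, N]%classic = set0) ?measure0 ?mule0//.
apply/seteqP; split=> // t /=; rewrite in_itv/= -ler_norml => tN.
by have := le_lt_trans tN N0; rewrite ltNge normr_ge0.
Qed.

End lebV.

(** * Measurability of continuous compositions *)

Section discretization.
Context {R : realType}.

Definition disc (k : nat) (r : R) : R := (Num.floor (k.+1%:R * r))%:~R / k.+1%:R.

Lemma disc_le k r : disc k r <= r.
Proof. by rewrite /disc ler_pdivrMr// mulrC; exact: floor_le. Qed.

Lemma disc_ge0 k r : 0 <= r -> 0 <= disc k r.
Proof.
move=> r0; rewrite /disc divr_ge0// ler0z floor_ge0.
by rewrite mulr_ge0.
Qed.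

Lemma disc_dist k r : `|disc k r - r| <= k.+1%:R^-1.
Proof.
rewrite ler0_norm ?subr_le0 ?disc_le// opprB lerBlDr /disc.
rewrite -[X in _ <= X + _]mul1r -mulrDl ler_pdivlMr// mulrC.
by rewrite addrC; apply/ltW; have := floorD1_gt (k.+1%:R * r); rewrite intrD.
Qed.

Lemma measurable_floor_eq d (T : measurableType d) (b : T -> R) (c : R) (m : int) :
  measurable_fun setT b -> measurable [set w | Num.floor (c * b w) = m].
Proof.
move=> mb.
have mcb : measurable_fun setT (fun w => c * b w) by exact: measurable_funM.
rewrite (_ : [set w | _] = (fun w => c * b w) @^-1` `[m%:~R, (m + 1)%:~R[%classic).
  by rewrite -[X in measurable X]setTI; exact: mcb.
apply/seteqP; split => w /=; rewrite in_itv/=.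
  by move=> <-; exact: floor_itv.
by move=> /floor_def.
Qed.

(** Composition of a continuous function with measurable maps: rounding the
    arguments to the grid of mesh 1/(k+1) factors the composition through a
    countable type, and the rounded compositions converge pointwise. *)
Lemma measurable_continuous_comp n d (T : measurableType d)
    (f : 'rV[R]_n * R * R -> R) (a : T -> 'rV[R]_n) (b c : T -> R) :
  {within [set z : 'rV[R]_n * R * R | 0 <= z.1.2], continuous f} ->
  measurable_fun setT a -> measurable_fun setT b -> measurable_fun setT c ->
  (forall w, 0 <= b w) ->
  measurable_fun setT (fun w => f (a w, b w, c w)).
Proof.
move=> cf ma mb mc b0.
pose pt k w := (map_mx (disc k) (a w), disc k (b w), disc k (c w)).
apply: (@measurable_fun_cvg _ _ _ _ (fun k w => f (pt k w))).
- move=> k.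
  pose flr (r : R) := Num.floor (k.+1%:R * r) : int.
  pose q w : 'rV[int]_n * int * int :=
    (map_mx flr (a w), flr (b w), flr (c w)).
  pose h (x : 'rV[int]_n * int * int) : R :=
    f (map_mx (fun m : int => m%:~R / k.+1%:R) x.1.1, x.1.2%:~R / k.+1%:R,
       x.2%:~R / k.+1%:R).
  have fE : (fun w => f (pt k w)) = h \o q.
    apply/funext => w; rewrite /h/q/pt/=; congr (f (_, _, _)).
    by apply/rowP => i; rewrite !mxE.
  rewrite fE => _ Y mY; rewrite setTI.
  have -> : (h \o q) @^-1` Y =
      \bigcup_x (if h x \in Y then q @^-1` [set x] else set0).
    apply/seteqP; split => w /=.
      by move=> Yw; exists (q w) => //; rewrite mem_set.
    by move=> [x _]; case: ifPn => //; rewrite inE => Yx /= ->.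
  apply: countable_bigcupT_measurable; first exact: countableP.
  move=> -[[x1 x2] x3]; case: ifPn => // _.
  have -> : q @^-1` [set (x1, x2, x3)] =
      (\bigcap_i [set w | flr (a w ord0 i) = x1 ord0 i]) `&`
      [set w | flr (b w) = x2] `&` [set w | flr (c w) = x3].
    apply/seteqP; split => w /=.
      by rewrite /q => -[<- <- <-]; split => //; split => // i _ /=; rewrite mxE.
    move=> [[H <-] <-]; rewrite /q; congr (_, _, _).
    by apply/rowP => i; rewrite mxE; exact: H.
  apply: measurableI; last exact: measurable_floor_eq.
  apply: measurableI; last exact: measurable_floor_eq.
  apply: fin_bigcap_measurable; first exact: finite_finset.
  move=> i _; apply: measurable_floor_eq.
  exact: (measurableT_comp (measurable_coord i) ma).
- move=> w _.
  have cfw := (subspace_continuousP _ _).1 cf (a w, b w, c w) (b0 w).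
  apply: (@cvg_comp _ _ _ (pt^~ w) f \oo (within [set z : 'rV[R]_n * R * R | 0 <= z.1.2] (nbhs (a w, b w, c w)))) => //.
  move=> A; rewrite /within/= => /nbhs_ballP[e /= e0 eA].
  near=> k.
  apply: eA; last by rewrite /pt/=; exact: disc_ge0.
  have ke : k.+1%:R^-1 < e.
    by near: k; exact: (near_infty_natSinv_lt (PosNum e0)).
  have de r : `|r - disc k r| < e.
    by rewrite distrC; exact: le_lt_trans (disc_dist k r) ke.
  split => /=; last exact: de.
  split => /=; last exact: de.
  rewrite -ball_normE /ball_/=.
  apply: (@le_lt_trans _ _ k.+1%:R^-1) => //; apply/norm_rV_le => // i.
  by rewrite !mxE distrC; exact: disc_dist.
Unshelve. all: end_near. Qed.

Lemma measurable_continuous_rVR n (f : 'rV[R]_n * R -> R) :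
  continuous f -> measurable_fun setT (f : 'rV[R]_n * measurableTypeR R -> R).
Proof.
move=> cf.
pose g (z : 'rV[R]_n * R * R) := f (z.1.1, z.2).
have cg : continuous g.
  move=> z; apply: (@continuous2_cvg _ _ _ _ _ _ (fun z => z.1.1) snd (fun x t => f (x, t))).
  - by rewrite (_ : (fun x => _) = f); [exact: cf|apply/funext => -[]].
  - by apply: cvg_comp; [exact: cvg_fst|exact: cvg_fst].
  - exact: cvg_snd.
have := @measurable_continuous_comp n _ ('rV[R]_n * measurableTypeR R)%type g fst
  (fun=> 0) snd (continuous_subspaceT cg) measurable_fst (measurable_cst _)
  measurable_snd (fun=> lexx 0).
by congr (measurable_fun _ _); apply/funext => -[].
Qed.

End discretization.

(** * Continuity of translations in the L^q mean *)

Section real_facts.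
Context {R : realType}.

Lemma ler_powR2 (q a b : R) : 0 <= q -> 0 <= a -> a <= b -> a `^ q <= b `^ q.
Proof. by move=> q0 a0 ab; apply: ge0_ler_powR; rewrite ?nnegrE// (le_trans a0). Qed.

Lemma powR_D_le (q a b : R) : 0 <= q ->
  `|a + b| `^ q <= 2 `^ q * (`|a| `^ q + `|b| `^ q).
Proof.
move=> q0.
have H : `|a + b| <= 2 * Num.max `|a| `|b|.
  rewrite (le_trans (ler_normD _ _))// mulr_natl mulr2n lerD// le_max lexx//.
  by rewrite orbT.
apply: (le_trans (ler_powR2 q0 (normr_ge0 _) H)).
rewrite powRM ?le_max ?normr_ge0//.
rewrite ler_wpM2l ?powR_ge0//; case: (leP `|a| `|b|) => _.
  by rewrite lerDr powR_ge0.
by rewrite lerDl powR_ge0.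
Qed.

Lemma powR_small (q e : R) : 0 < q -> 0 < e ->
  exists2 d : R, 0 < d & forall x, 0 <= x <= d -> x `^ q <= e.
Proof.
move=> q0 e0; exists (e `^ q^-1); first exact: powR_gt0.
move=> x /andP[x0 xd]; apply: (le_trans (ler_powR2 (ltW q0) x0 xd)).
by rewrite -powRrM mulVf ?gt_eqF// powRr1// ltW.
Qed.

Lemma cvg_powR0 (q : R) (u : nat -> R) : 0 < q -> u k @[k --> \oo] --> 0 ->
  `|u k| `^ q @[k --> \oo] --> 0.
Proof.
move=> q0 u0; apply/cvgr0Pnorm_le => e e0.
have [d d0 H] := powR_small q0 e0.
near=> k; rewrite ger0_norm ?powR_ge0//; apply: H; rewrite normr_ge0/=.
near: k; move/cvgr0Pnorm_le : u0; exact.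
Unshelve. all: end_near. Qed.

Lemma measurable_powR_norm d (T : measurableType d) (q : R) (F : T -> R) :
  measurable_fun setT F -> measurable_fun setT (fun z => `|F z| `^ q).
Proof.
move=> mF; apply: (measurableT_comp (measurable_powR q)).
exact: measurableT_comp.
Qed.

Lemma three_terms_le (c e : R) : 1 <= c -> 0 < e ->
  let x := e / c / c / 4 in c * (x + c * (x + x)) <= e.
Proof.
move=> c1 e0 /=; set x := e / c / c / 4.
have c0 : 0 < c by rewrite (lt_le_trans ltr01).
have -> : c * (x + c * (x + x)) = e / 4 / c + e / 2.
  by rewrite /x; field; rewrite gt_eqF.
have : e / 4 / c <= e / 4 by rewrite ler_pdivrMr// ler_peMr// divr_ge0// ltW.
by move=> ?; lra.
Qed.

End real_facts.

Section nonneg_integrals.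
Context {R : realType} {d : measure_display} {T : measurableType d}.
Variable mu : {measure set T -> \bar R}.
Implicit Types f g : T -> R.

Lemma nn_le f g : measurable_fun setT f -> measurable_fun setT g ->
  (forall x, 0 <= f x) -> (forall x, f x <= g x) ->
  (\int[mu]_x (f x)%:E <= \int[mu]_x (g x)%:E)%E.
Proof.
move=> mf mg f0 fg; apply: ge0_le_integral => //.
- by move=> x _; rewrite lee_fin.
- exact/measurable_EFinP.
- exact/measurable_EFinP.
- by move=> x _; rewrite lee_fin.
Qed.

Lemma nn_D f g : measurable_fun setT f -> measurable_fun setT g ->
  (forall x, 0 <= f x) -> (forall x, 0 <= g x) ->
  (\int[mu]_x (f x + g x)%:E = \int[mu]_x (f x)%:E + \int[mu]_x (g x)%:E)%E.
Proof.
move=> mf mg f0 g0; rewrite -ge0_integralD//.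
- by move=> x _; rewrite lee_fin.
- exact/measurable_EFinP.
- by move=> x _; rewrite lee_fin.
- exact/measurable_EFinP.
Qed.

Lemma nn_Z c f : measurable_fun setT f -> (forall x, 0 <= f x) -> 0 <= c ->
  (\int[mu]_x (c * f x)%:E = c%:E * \int[mu]_x (f x)%:E)%E.
Proof.
move=> mf f0 c0; rewrite -ge0_integralZl_EFin//.
- by move=> x _; rewrite lee_fin.
- exact/measurable_EFinP.
Qed.

End nonneg_integrals.

Section translation_continuity.
Context {R : realType} {n : nat}.
Local Notation V := ('rV[R]_n * measurableTypeR R)%type.
Variable q : R.
Hypothesis q0 : 0 < q.
Implicit Types F G H : V -> R.

(** The q-th power of the L^q norm; dispensing with the root keeps all
    estimates polynomial in it, at the cost of a constant 2^q in the triangle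
    inequality. *)
Definition Nq F : \bar R := (\int[lebV]_z (`|F z| `^ q)%:E)%E.

Definition tcont F := forall e : R, 0 < e ->
  exists2 d : R, 0 < d & forall h : V, `|h| <= d ->
    (Nq (fun z => F (z + h) - F z)%R <= e%:E)%E.

Lemma Nq_le F G : measurable_fun setT F -> measurable_fun setT G ->
  (forall z, `|F z| <= `|G z|) -> (Nq F <= Nq G)%E.
Proof.
move=> mF mG FG; apply: nn_le.
- exact: measurable_powR_norm.
- exact: measurable_powR_norm.
- by move=> z; exact: powR_ge0.
- by move=> z; apply: ler_powR2 => //; exact: ltW.
Qed.

Lemma Nq_D F G : measurable_fun setT F -> measurable_fun setT G ->
  (Nq (fun z => F z + G z)%R <= (2 `^ q)%:E * (Nq F + Nq G))%E.
Proof.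
move=> mF mG.
have mF' := @measurable_powR_norm _ _ _ q _ mF.
have mG' := @measurable_powR_norm _ _ _ q _ mG.
rewrite /Nq -nn_D//; try by move=> *; exact: powR_ge0.
rewrite -nn_Z; [|exact: measurable_funD| |exact: powR_ge0]; last first.
  by move=> z; rewrite addr_ge0// powR_ge0.
apply: nn_le.
- by apply: measurable_powR_norm; exact: measurable_funD.
- by apply: measurable_funM => //; exact: measurable_funD.
- by move=> z; exact: powR_ge0.
- by move=> z; apply: powR_D_le; exact: ltW.
Qed.

Lemma Nq_translate F h : measurable_fun setT F -> Nq (fun z => F (z + h)) = Nq F.
Proof.
move=> mF; apply: (@integral_addV _ _ (fun z => (`|F z| `^ q)%:E) h).
- by apply/measurable_EFinP; exact: measurable_powR_norm.
- by move=> z; rewrite lee_fin powR_ge0.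
Qed.

Lemma measurable_translate F h : measurable_fun setT F ->
  measurable_fun setT (fun z : V => F (z + h)).
Proof. by move=> mF; apply: measurableT_comp => //; exact: measurable_addV. Qed.

Let measurable_incr F h : measurable_fun setT F ->
  measurable_fun setT (fun z : V => F (z + h) - F z).
Proof. by move=> mF; apply: measurable_funB => //; exact: measurable_translate. Qed.

Lemma tcont_dom F G H : measurable_fun setT F ->
  measurable_fun setT G -> measurable_fun setT H ->
  (forall z (h : V), `|F (z + h) - F z| <=
     `|G (z + h) - G z| + `|H (z + h) - H z|) ->
  tcont G -> tcont H -> tcont F.
Proof.
move=> mF mG mH FGH tG tH e e0.
pose c := 2 `^ q; have c0 : 0 < c by exact: powR_gt0.
have ec0 : 0 < e / c / 2 by rewrite !divr_gt0.
have [d1 d10 H1] := tG _ ec0; have [d2 d20 H2] := tH _ ec0.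
exists (Num.min d1 d2); first by rewrite lt_min d10.
move=> h; rewrite le_min => /andP[hd1 hd2].
have mG' := measurable_incr h mG; have mH' := measurable_incr h mH.
apply: (@le_trans _ _ (Nq (fun z => `|G (z + h) - G z| + `|H (z + h) - H z|)%R)).
  apply: Nq_le.
  - exact: measurable_incr.
  - by apply: measurable_funD; exact: measurableT_comp.
  - by move=> z; rewrite [leRHS]ger0_norm// addr_ge0.
apply: le_trans (Nq_D _ _) _; try exact: measurableT_comp.
have -> : Nq (fun z => `|G (z + h) - G z|) = Nq (fun z => G (z + h) - G z)%R.
  by rewrite /Nq; under eq_integral do rewrite normr_id.
have -> : Nq (fun z => `|H (z + h) - H z|) = Nq (fun z => H (z + h) - H z)%R.
  by rewrite /Nq; under eq_integral do rewrite normr_id.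
rewrite -/c (_ : e%:E = c%:E * ((e / c / 2)%:E + (e / c / 2)%:E))%E; last first.
  by rewrite -EFinD -EFinM; congr EFin; field; rewrite gt_eqF.
by apply: lee_wpmul2l; [rewrite lee_fin ltW|apply: leeD; [exact: H1|exact: H2]].
Qed.

Lemma tcontD F G : measurable_fun setT F -> measurable_fun setT G ->
  tcont F -> tcont G -> tcont (fun z => F z + G z).
Proof.
move=> mF mG; apply: tcont_dom => //; first exact: measurable_funD.
by move=> z h; rewrite opprD addrACA ler_normD.
Qed.

Lemma tcont0 : tcont (fun=> 0).
Proof.
move=> e e0; exists 1 => // h _; rewrite /Nq.
under eq_integral do rewrite subrr normr0 powR0 ?gt_eqF//.
by rewrite integral0 lee_fin ltW.
Qed.

Lemma tcontZ c F : measurable_fun setT F -> tcont F -> tcont (fun z => c * F z).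
Proof.
move=> mF tF e e0.
pose k := `|c| `^ q + 1; have k0 : 0 < k by rewrite ltr_wpDl// powR_ge0.
have ek : 0 < e / k by rewrite divr_gt0.
have [d d0 H] := tF _ ek; exists d => // h /H Hh.
have -> : Nq (fun z => c * F (z + h) - c * F z)%R =
          ((`|c| `^ q)%:E * Nq (fun z => F (z + h) - F z)%R)%E.
  rewrite /Nq -nn_Z ?powR_ge0//; last first.
    exact: measurable_powR_norm (measurable_incr h mF).
  apply: eq_integral => z _; rewrite -mulrBr normrM powRM//.
apply: (@le_trans _ _ ((`|c| `^ q)%:E * (e / k)%:E)%E).
  by rewrite lee_wpmul2l// lee_fin powR_ge0.
rewrite -EFinM lee_fin mulrCA ger_pMr// ler_pdivrMr// mul1r /k lerDl//.
Qed.

Lemma tcontB F G : measurable_fun setT F -> measurable_fun setT G ->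
  tcont F -> tcont G -> tcont (fun z => F z - G z).
Proof.
move=> mF mG tF tG.
have -> : (fun z => F z - G z) = (fun z => F z + (-1) * G z).
  by apply/funext => z; rewrite mulN1r.
by apply: (tcontD mF _ tF (tcontZ (-1) mG tG)); exact: measurable_funM.
Qed.

Lemma tcont_sum (J : Type) (s : seq J) (F : J -> V -> R) :
  (forall j, measurable_fun setT (F j)) -> (forall j, tcont (F j)) ->
  tcont (fun z => \sum_(j <- s) F j z).
Proof.
move=> mF tF; elim: s => [|j s IH].
  by under eq_fun do rewrite big_nil; exact: tcont0.
under eq_fun do rewrite big_cons.
by apply: (tcontD (mF j) _ (tF j) IH); exact: measurable_sum.
Qed.

(** The three terms of an epsilon/3 argument: F(z+h) - G(z+h), G(z+h) - G(z)
    and G(z) - F(z); the first and the last have the same mean by translation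
    invariance. *)
Lemma tcont_lim F : measurable_fun setT F ->
  (forall e : R, 0 < e -> exists G, [/\ measurable_fun setT G, tcont G &
     (Nq (fun z => F z - G z)%R <= e%:E)%E]) -> tcont F.
Proof.
move=> mF FG e e0.
pose c := 2 `^ q; have c0 : 0 < c by exact: powR_gt0.
have ec0 : 0 < e / c / c / 4 by rewrite !divr_gt0.
have [G [mG tG FGe]] := FG _ ec0.
have [d d0 H] := tG _ ec0; exists d => // h /H Hh.
have mD : measurable_fun setT (fun z => F z - G z) by exact: measurable_funB.
have -> : (fun z : V => F (z + h) - F z) =
  (fun z => (F (z + h) - G (z + h)) +
            ((G (z + h) - G z) + (-1) * (F z - G z))).
  by apply/funext => z; ring.
have mN : measurable_fun setT (fun z : V => -1 * (F z - G z)) by exact: measurable_funM.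
apply: le_trans (Nq_D _ _) _.
- exact: (measurable_translate h mD).
- by apply: measurable_funD => //; exact: measurable_incr.
rewrite (Nq_translate h mD).
have E2 : (Nq (fun z => (G (z + h) - G z) + (-1) * (F z - G z))%R <=
    c%:E * ((e / c / c / 4)%:E + (e / c / c / 4)%:E))%E.
  apply: le_trans (Nq_D _ _) _ => //; first exact: measurable_incr.
  apply: lee_wpmul2l; first by rewrite lee_fin ltW.
  apply: leeD; first exact: Hh.
  rewrite /Nq; under eq_integral do rewrite normrM normrN1 mul1r.
  exact: FGe.
apply: (@le_trans _ _ (c%:E * ((e / c / c / 4)%:E +
    c%:E * ((e / c / c / 4)%:E + (e / c / c / 4)%:E)))%E).
  by apply: lee_wpmul2l; [rewrite lee_fin ltW|exact: (leeD FGe E2)].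
have h2 : (1 : R) <= 2 by rewrite (ler1n R 2).
have c1 : 1 <= c by have := ler_powR h2 (ltW q0); rewrite powRr0.
by have := three_terms_le c1 e0; rewrite /= -lee_fin.
Qed.

(** On the support, enlarged by 1, the increment is at most L |h|; outside it
    vanishes for |h| <= 1. *)
Lemma tcont_lip F (L N : R) : measurable_fun setT F -> 0 <= L ->
  (forall z z', `|F z - F z'| <= L * `|z - z'|) ->
  (forall z, N < `|z| -> F z = 0) -> tcont F.
Proof.
move=> mF L0 lF FN e e0.
have /fineK mE : lebV (ballV (N + 1) : set V) \is a fin_num.
  by rewrite ge0_fin_numE//; exact: lebV_ballV.
set m := fine _ in mE.
have m0 : 0 <= m by exact: fine_ge0.
have em : 0 < e / (m + 1) by rewrite divr_gt0// ltr_wpDl.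
have [d d0 H] := powR_small q0 em.
exists (Num.min 1 (d / (L + 1))).
  by rewrite lt_min ltr01 divr_gt0// ltr_wpDl.
move=> h; rewrite le_min => /andP[h1 hd].
have Lh : 0 <= L * `|h| <= d.
  rewrite mulr_ge0//=; move: hd; rewrite ler_pdivlMr ?ltr_wpDl// => hd.
  by apply: le_trans hd; rewrite mulrC ler_wpM2l// lerDl.
apply: (@le_trans _ _ (\int[lebV]_z ((e / (m + 1)) * \1_(ballV (N + 1) : set V) z)%:E)%E).
  apply: nn_le.
  - exact: measurable_powR_norm (measurable_incr h mF).
  - apply: measurable_funM => //; apply: measurable_indic.
    exact: measurable_ballV.
  - by move=> z; exact: powR_ge0.
  move=> z; rewrite indicE; have [zB|zB] := boolP (z \in _).
    rewrite mulr1; apply: H; rewrite normr_ge0/=; apply: le_trans (lF _ _) _.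
    by rewrite addrAC subrr add0r; case/andP: Lh.
  have zN : N + 1 < `|z| by rewrite ltNge; apply/negP => zN; move: zB; rewrite mem_set.
  rewrite mulr0 !FN ?subrr ?normr0 ?powR0 ?gt_eqF//.
    by rewrite (le_lt_trans _ zN)// lerDl.
  have := ler_normB (z + h) h; rewrite addrK => zh.
  rewrite ltNge; apply/negP => zhN; move: zN; rewrite ltNge => /negP; apply.
  by rewrite (le_trans zh)// lerD.
rewrite nn_Z//; last 2 first.
- by apply: measurable_indic; exact: measurable_ballV.
- exact: ltW.
rewrite integral_indic//; last exact: measurable_ballV.
rewrite setIT; set X := (X in (_ * X)%E); rewrite (_ : X = m%:E); last by rewrite mE.
rewrite -EFinM lee_fin mulrAC ler_pdivrMr ?ltr_wpDl//.
by nra.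
Qed.

End translation_continuity.

Section translation_continuity_Lq.
Import HBNNSimple.
Context {R : realType} {n : nat}.
Local Notation V := ('rV[R]_n * measurableTypeR R)%type.
Variable q : R.
Hypothesis q0 : 0 < q.
Implicit Types F G H : V -> R.

Lemma Nq_cvg0 (F_ : nat -> V -> R) F G :
  (forall k, measurable_fun setT (F_ k)) -> measurable_fun setT F ->
  (forall z, F_ k z @[k --> \oo] --> F z) ->
  ig lebV G -> (forall k z, `|F z - F_ k z| `^ q <= G z) ->
  forall e : R, 0 < e -> exists k, (Nq q (fun z => F z - F_ k z)%R <= e%:E)%E.
Proof.
move=> mF_ mF F_F igG FG e e0.
have mD k : measurable_fun setT (fun z => F z - F_ k z) by exact: measurable_funB.
have mq k := @measurable_powR_norm _ _ _ q _ (mD k).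
have igk k : ig lebV (fun z => `|F z - F_ k z| `^ q).
  by apply: (ig_dom (mq k) _ igG) => z; rewrite ger0_norm ?powR_ge0.
have cv z : `|F z - F_ k z| `^ q @[k --> \oo] --> (0 : R).
  apply: cvg_powR0 => //; rewrite -(subrr (F z)).
  by apply: cvgB; [exact: cvg_cst|exact: F_F].
have bd k z : `| `|F z - F_ k z| `^ q | <= G z by rewrite ger0_norm ?powR_ge0.
have [_ ] := @I_dct _ _ _ lebV (fun k z => `|F z - F_ k z| `^ q) (fun=> 0) G mq
  (measurable_cst _) cv igG bd.
rewrite I_0 => /cvgr0Pnorm_le/(_ _ e0)[k _ /(_ k (leqnn k))] /= H.
exists k; rewrite /Nq -I_fin// lee_fin; apply: le_trans H.
exact: ler_norm.
Qed.

Definition ballVo (N : R) : set V := [set z | `|z| < N].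

Lemma measurable_ballVo N : measurable (ballVo N).
Proof.
have mn : measurable_fun setT (fun z : V => `|z|).
  apply: (@measurable_continuous_rVR R n (fun z => `|z|)).
  by move=> z; exact: norm_continuous.
have := mn measurableT `]-oo, N[%classic (measurable_itv _).
by rewrite setTI; congr measurable; apply/seteqP; split => z /=; rewrite in_itv.
Qed.

Let ramp (k : nat) (r : R) : R := Num.min 1 (k%:R * Num.max 0 r).

Let ramp_ge0 k r : 0 <= ramp k r.
Proof. by rewrite /ramp le_min ler01 mulr_ge0// le_max lexx. Qed.

Let ramp_le1 k r : ramp k r <= 1.
Proof. by rewrite /ramp ge_min lexx. Qed.

Let min_lip (a b c : R) : `|Num.min a b - Num.min a c| <= `|b - c|.
Proof.
have [ab|ba] := leP a b; have [ac|ca] := leP a c; rewrite ?subrr ?normr0//.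
  by rewrite !ger0_norm; lra.
by rewrite !ler0_norm; lra.
Qed.

Let max_lip (a b c : R) : `|Num.max a b - Num.max a c| <= `|b - c|.
Proof.
by have := min_lip (- a) (- b) (- c); rewrite -!oppr_max -!opprD !normrN.
Qed.

Let ramp_lip k r s : `|ramp k r - ramp k s| <= k%:R * `|r - s|.
Proof.
apply: le_trans (min_lip _ _ _) _; rewrite -mulrBr normrM ger0_norm//.
by rewrite ler_wpM2l// max_lip.
Qed.

Let ramp_cvg r : ramp k r @[k --> \oo] --> (if 0 < r then 1 else 0 : R).
Proof.
case: ifPn => [r0|]; last first.
  rewrite -leNgt => r0; apply: cvg_near_cst; apply: nearW => k.
  by rewrite /ramp (max_idPl r0) mulr0 (min_idPr ler01).
apply: cvg_near_cst; near=> k.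
rewrite /ramp (max_idPr (ltW r0)); apply/min_idPl.
rewrite -ler_pdivrMr// mul1r.
by near: k; exact: nbhs_infty_ger.
Unshelve. all: end_near. Qed.

(** Sets all of whose bounded parts have a translation-continuous indicator.
    They form a sigma-algebra, so it suffices to recognise generators. *)
Let tset (A : set V) := measurable A /\
  forall N : nat, tcont q (\1_(A `&` ballVo N%:R) : V -> R).

Let measurable_indicI A N : measurable A ->
  measurable_fun setT (\1_(A `&` ballVo N) : V -> R).
Proof.
by move=> mA; apply: measurable_indic; apply: measurableI => //; exact: measurable_ballVo.
Qed.

(** The indicator of {a < c} is the pointwise limit of Lipschitz ramps of
    c - a. *)
Let tset_gt (c : V -> R) a : (forall z z', `|c z - c z'| <= `|z - z'|) ->
  measurable_fun setT c -> tset [set z | a < c z].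
Proof.
move=> cL mc.
have mA : measurable [set z | a < c z].
  have := mc measurableT `]a, +oo[%classic (measurable_itv _).
  by rewrite setTI; congr measurable; apply/seteqP; split => z /=; rewrite in_itv/= andbT.
split => // N.
have mnorm : measurable_fun setT (fun z : V => `|z|).
  apply: (@measurable_continuous_rVR R n (fun z => `|z|)).
  by move=> z; exact: norm_continuous.
have mramp k (f : V -> R) : measurable_fun setT f -> measurable_fun setT (fun z => ramp k (f z)).
  move=> mf; apply: measurable_minr => //; apply: measurable_funM => //.
  by apply: measurable_maxr.
(* The second factor cuts off to the open ball of radius N. *)
pose F_ k z := ramp k (c z - a) * ramp k (N%:R - `|z|).
have mF_ k : measurable_fun setT (F_ k).
  by apply: measurable_funM; apply: mramp; apply: measurable_funB.
have mF : measurable_fun setT (\1_([set z | (a < c z)%R] `&` ballVo N%:R) : V -> R).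
  exact: measurable_indicI.
have F_0 k z : N%:R <= `|z| -> F_ k z = 0.
  move=> Nz; rewrite /F_ {2}/ramp (max_idPl _) ?subr_le0// mulr0 (min_idPr ler01).
  by rewrite mulr0.
apply: tcont_lim => // e e0.
have igB : ig lebV (fun z : V => \1_(ballV N%:R) z : R).
  apply: (@ig_bdd _ _ _ _ (ballV N%:R) 1); [exact: measurable_ballV|exact: lebV_ballV| | |].
  - by apply: measurable_indic; exact: measurable_ballV.
  - by move=> z zB; rewrite indicE mem_set// normr1.
  - by move=> z zB; rewrite indicE memNset.
have [||k Hk] := @Nq_cvg0 F_ _ _ mF_ mF _ igB _ e e0.
- move=> z; rewrite indicE.
  have -> : (z \in [set z | (a < c z)%R] `&` ballVo N%:R)%:R =
    (if 0 < c z - a then 1 else 0) * (if 0 < N%:R - `|z| then 1 else 0) :> R.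
    rewrite !subr_gt0; have [H|] := boolP (z \in _).
      by move: H; rewrite inE => -[/= -> ->]; rewrite mulr1.
    rewrite notin_setE/= => H; case: ifPn => H1; case: ifPn => H2; rewrite ?mulr0 ?mul0r//.
    by exfalso; apply: H.
  by apply: cvgM; exact: ramp_cvg.
- move=> k z; rewrite indicE [X in _ <= X]indicE.
  have [zB|zB] := boolP (z \in ballV N%:R).
    apply: (@le_trans _ _ (1 `^ q)); last by rewrite powR1.
    apply: ler_powR2; [exact: ltW|exact: normr_ge0|].
    have F0 : 0 <= F_ k z by rewrite mulr_ge0.
    have F1 : F_ k z <= 1 by rewrite -[leRHS]mulr1 ler_pM.
    move: F0 F1; move: (F_ k z) => y y0 y1.
    by case: (_ \in _); rewrite ?mulr1n ?mulr0n ler_norml; apply/andP; split; lra.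
  have Nz : N%:R < `|z| by rewrite ltNge; apply/negP => H; move: zB; rewrite mem_set.
  have zN : ~ ([set z | a < c z] `&` ballVo N%:R) z.
    by move=> [_]; rewrite /ballVo/= ltNge ltW.
  rewrite (F_0 _ _ (ltW Nz)) (memNset zN) subrr normr0 powR0 ?gt_eqF//.
exists (F_ k); split => //.
apply: (@tcont_lip _ _ _ q0 _ (2 * k%:R) N%:R) => //; last first.
  by move=> z /ltW; exact: F_0.
move=> z z'; rewrite /F_.
set x := ramp k _; set y := ramp k _; set x' := ramp k _; set y' := ramp k _.
have -> : x * y - x' * y' = x * (y - y') + (x - x') * y' by ring.
apply: le_trans (ler_normD _ _) _; rewrite !normrM.
rewrite (ger0_norm (ramp_ge0 _ _)) [X in _ + _ * X](ger0_norm (ramp_ge0 _ _)).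
have x1 : x <= 1 := ramp_le1 _ _; have y1 : y' <= 1 := ramp_le1 _ _.
have xx : `|x - x'| <= k%:R * `|z - z'|.
  apply: le_trans (ramp_lip _ _ _) _; rewrite ler_wpM2l//.
  by rewrite opprB addrA subrK.
have yy : `|y - y'| <= k%:R * `|z - z'|.
  apply: le_trans (ramp_lip _ _ _) _; rewrite ler_wpM2l//.
  rewrite (_ : _ - _ - _ = `|z'| - `|z|); last by ring.
  by rewrite distrC; exact: ler_dist_dist.
apply: (@le_trans _ _ (`|y - y'| + `|x - x'|)).
  by apply: lerD; [rewrite ler_piMl|rewrite ler_piMr].
by rewrite mulrAC mulr2n mulrDl mul1r mulrDl lerD// mulrC.
Qed.

Let tset_sigma_algebra : sigma_algebra setT tset.
Proof.
have tT : tset setT.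
  have -> : setT = [set z : V | (-1 : R) < 0].
    by apply/seteqP; split => // z _ /=; rewrite ltrN10.
  apply: (@tset_gt (fun=> 0)) => // z z'; rewrite subrr normr0//.
have t0 : tset set0.
  split => // N; rewrite set0I; rewrite indic0; exact: tcont0.
have tC A : tset A -> tset (setT `\` A).
  move=> [mA tA]; split; first exact: measurableD.
  move=> N; have -> : \1_((setT `\` A) `&` ballVo N%:R) =
     (fun z => \1_(setT `&` ballVo N%:R) z - \1_(A `&` ballVo N%:R) z) :> (V -> R).
    apply/funext => z; rewrite setTD setTI !indicE !in_setI in_setC.
    by case: (z \in A); case: (z \in ballVo _); rewrite /= ?subr0 ?subrr.
  apply: tcontB => //; [exact: measurable_indicI|exact: measurable_indicI|exact: tT.2].
have tU A B : tset A -> tset B -> tset (A `|` B).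
  move=> [mA tA] [mB tB]; split; first exact: measurableU.
  move=> N; apply: (tcont_dom q0 _ _ _ _ (tA N) (tB N)); try exact: measurable_indicI.
    by apply: measurable_indicI; exact: measurableU.
  move=> z h; rewrite !indicE !in_setI !in_setU.
  case: (z + h \in A); case: (z + h \in B); case: (z + h \in ballVo _);
  case: (z \in A); case: (z \in B); case: (z \in ballVo _); rewrite /= ?subr0 ?subrr ?sub0r ?normrN ?normr0 ?normr1 ?addr0 ?add0r//; lra.
split; [exact: t0|exact: tC|move=> A tA].
have mA k := (tA k).1.
have mU : measurable (\bigcup_k A k) by exact: bigcupT_measurable.
split; first exact: mU.
move=> N; apply: (tcont_lim q0); first exact: measurable_indicI.
move=> e e0.
have igB : ig lebV (fun z : V => \1_(ballV N%:R) z : R).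
  apply: (@ig_bdd _ _ _ _ (ballV N%:R) 1); [exact: measurable_ballV|exact: lebV_ballV| | |].
  - by apply: measurable_indic; exact: measurable_ballV.
  - by move=> z zB; rewrite indicE mem_set// normr1.
  - by move=> z zB; rewrite indicE memNset.
pose U k := \big[setU/set0]_(i < k) A i.
have tUk k : tset (U k).
  elim: k => [|k IH]; first by rewrite /U big_ord0; exact: t0.
  by rewrite /U big_ord_recr/=; exact: tU IH (tA k).
have [||k Hk] := @Nq_cvg0 (fun k => \1_(U k `&` ballVo N%:R)) (\1_((\bigcup_k A k) `&` ballVo N%:R)) _ (fun k => measurable_indicI _ (tUk k).1) (measurable_indicI _ mU) _ igB _ e e0.
- move=> z; apply: cvg_near_cst.
  have [[k _ Akz]|nU] := pselect ((\bigcup_k A k) z); last first.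
    apply: nearW => k; rewrite !indicE !in_setI (memNset nU) memNset//.
    by rewrite /U -bigcup_mkord => -[i /= _ Aiz]; apply: nU; exists i.
  exists k.+1 => // m /= km; rewrite !indicE !in_setI.
  have -> : z \in \bigcup_k A k by rewrite mem_set//; exists k.
  by have -> : z \in U m by rewrite mem_set// /U -bigcup_mkord; exists k.
- move=> k z; rewrite !indicE !in_setI.
  have [zB|zB] := boolP (z \in ballVo _).
    rewrite (@mem_set _ (ballV N%:R)); last by move: zB; rewrite inE => /ltW.
    apply: (@le_trans _ _ (1 `^ q)); last by rewrite powR1.
    apply: ler_powR2; [exact: ltW|exact: normr_ge0|rewrite !andbT].
    by case: (_ \in _); case: (_ \in _); rewrite ?subrr ?subr0 ?sub0r ?normrN ?normr1 ?normr0.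
  by rewrite !andbF subrr normr0 powR0 ?gt_eqF// ler0n.
exists (\1_(U k `&` ballVo N%:R)); split => //; last exact: (tUk k).2.
exact: measurable_indicI (tUk k).1.
Qed.

(** The coordinates are 1-Lipschitz and generate the product sigma-algebra. *)
Let tset_measurable (A : set V) : measurable A -> tset A.
Proof.
have coordL (c : V -> R) : (forall z z', `|c z - c z'| <= `|z - z'|) ->
    measurable_fun setT c -> forall Y : set (measurableTypeR R), measurable Y -> tset (c @^-1` Y).
  move=> cL mc.
  have SA := sigma_algebra_image c tset_sigma_algebra.
  suff : (measurable : set (set (measurableTypeR R))) `<=` image_set_system setT c tset.
    by move=> + Y mY => /(_ Y mY); rewrite /image_set_system/= setTI.
  apply: smallest_sub => // _ [[a b] _ <-] /=.
  rewrite /image_set_system/= setTI.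
  have -> : c @^-1` `]a, b]%classic = [set z | a < c z] `&` (setT `\` [set z | b < c z]).
    apply/seteqP; split => z /=; rewrite in_itv/=.
      by move=> /andP[-> cb]; split => //; split => //; apply/negP; rewrite -leNgt.
    by move=> [-> [_ /negP]]; rewrite -leNgt => ->.
  have [t0 tC tU] := tset_sigma_algebra.
  have -> : [set z | a < c z] `&` (setT `\` [set z | b < c z]) =
     setT `\` \bigcup_k (if k == 0%N then setT `\` [set z | a < c z] else [set z | b < c z]).
    apply/seteqP; split => z /=.
      move=> [acz [_ nb]]; split => // -[k _]; case: ifPn => _ /=.
        by move=> [_]; exact.
      by move=> bz; exact: nb.
    move=> [_ H]; split.
      by apply: contrapT => nacz; apply: H; exists 0%N.
    by split => // bz; apply: H; exists 1%N.
  apply: (tC); apply: (tU) => k; case: ifPn => _.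
    by apply: (tC); exact: tset_gt.
  exact: tset_gt.
apply: smallest_sub; first exact: tset_sigma_algebra.
move=> B [] [Y mY <-] /=; rewrite setTI; last first.
  apply: (coordL snd) => //.
  move=> z z'; have := normV_le (z - z') `|z - z'|; rewrite lexx.
  by move=> /esym/andP[].
have SA := sigma_algebra_image (fst : V -> 'rV[R]_n) tset_sigma_algebra.
have : (measurable : set (set 'rV[R]_n)) `<=` image_set_system setT (fst : V -> _) tset.
  apply: smallest_sub => //.
  rewrite -bigcup_seq; apply: bigcup_sub => i _ _ [Z mZ <-].
  rewrite /image_set_system/= !setTI.
  apply: (coordL (fun z => z.1 ord0 i)) => //.
    move=> z z'; have := normV_le (z - z') `|z - z'|; rewrite lexx.
    move=> /esym/andP[H _]; apply: le_trans H.
    by have := coord_le_norm (z - z').1 i; rewrite !mxE.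
  exact: (measurableT_comp (measurable_coord i) measurable_fst).
by move=> /(_ Y mY); rewrite /image_set_system/= setTI.
Qed.

Lemma tcont_nnsfun (g : {nnsfun V >-> R}) (N : nat) :
  (forall z, N%:R <= `|z| -> g z = 0) -> tcont q g.
Proof.
move=> gN.
have -> : (g : V -> R) = fun z => \sum_(y <- finmap.enum_fset (fset_set (range g)))
    (y * \1_(g @^-1` [set y] `&` ballVo N%:R) z).
  apply/funext => z; rewrite [LHS]fimfunE fsbig_finite/=; last exact: fimfunP.
  apply: eq_bigr => y _; have [->|y0] := eqVneq y 0; first by rewrite !mul0r.
  congr (y * _); rewrite !indicE in_setI.
  have [zy|//] := boolP (z \in g @^-1` _); rewrite /= mem_set//.
  rewrite /ballVo/= ltNge; apply/negP => /gN gz.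
  by move: zy y0; rewrite inE/= gz => <-; rewrite eqxx.
have mg y : measurable (g @^-1` [set y]) by exact: measurable_sfunP.
apply: tcont_sum => // y.
  by apply: measurable_funM => //; exact: measurable_indicI.
apply: tcontZ => //; first exact: measurable_indicI.
exact: (tset_measurable (mg y)).2.
Qed.

Lemma tcont_ge0 F (N : nat) : measurable_fun setT F -> (forall z, 0 <= F z) ->
  ig lebV (fun z => F z `^ q) -> (forall z, N%:R <= `|z| -> F z = 0) -> tcont q F.
Proof.
move=> mF F0 igF FN; apply: tcont_lim => // e e0.
have mFE : measurable_fun setT (EFin \o F) by exact/measurable_EFinP.
pose g := nnsfun_approx measurableT mFE.
have FE0 (z : V) : setT z -> (0 <= (EFin \o F) z)%E by move=> _; rewrite lee_fin.
have gF k z : g k z <= F z.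
  by rewrite -lee_fin /g nnsfun_approxE; exact: (le_approx k FE0).
have cvg z : g k z @[k --> \oo] --> F z.
  apply: (fine_cvg (f := EFin \o g^~ z)).
  exact: (cvg_nnsfun_approx measurableT mFE FE0).
have bd k z : `|F z - g k z| `^ q <= F z `^ q.
  apply: ler_powR2 => //; first exact: ltW.
  by rewrite ger0_norm ?subr_ge0 ?gF// gerBl fun_ge0.
have mg k : measurable_fun setT (g k : V -> R) by [].
have [k Hk] := Nq_cvg0 mg mF cvg igF bd e0.
exists (g k); split; [exact: mg| |exact: Hk].
apply: (@tcont_nnsfun _ N) => z /FN Fz.
by apply/eqP; rewrite eq_le fun_ge0 andbT -Fz.
Qed.

(** Splitting into positive and negative parts and approximating by simple
    functions reduces the claim to indicators, that is to tset_measurable. *)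
Lemma tcont_Lq F (N : nat) : measurable_fun setT F ->
  ig lebV (fun z => `|F z| `^ q) -> (forall z, N%:R <= `|z| -> F z = 0) ->
  tcont q F.
Proof.
move=> mF igF FN.
pose Fp z := Num.max (F z) 0; pose Fm z := Num.max (- F z) 0.
have mp : measurable_fun setT Fp by exact: measurable_maxr.
have mm : measurable_fun setT Fm by apply: measurable_maxr => //; exact: measurableT_comp.
have -> : F = fun z => Fp z - Fm z.
  apply/funext => z; rewrite /Fp/Fm.
  have [Fz|Fz] := leP 0 (F z).
    by rewrite (max_idPr _) ?oppr_le0// subr0.
  by rewrite (max_idPl _) ?oppr_ge0 ?ltW// sub0r opprK.
have dom (f : V -> R) : measurable_fun setT f -> (forall z, 0 <= f z <= `|F z|) ->
    tcont q f.
  move=> mf fF; apply: (@tcont_ge0 _ N) => //.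
  - by move=> z; case/andP: (fF z).
  - apply: (ig_dom _ _ igF); first exact: (measurableT_comp (measurable_powR q) mf).
    move=> z; rewrite ger0_norm ?powR_ge0//; have /andP[f0 fle] := fF z.
    by apply: ler_powR2 => //; exact: ltW.
  - move=> z /FN Fz; have := fF z; rewrite Fz normr0.
    by move=> /le_anti.
apply: tcontB => //.
  by apply: dom => // z; rewrite /Fp le_max lexx orbT ge_max ler_norm normr_ge0.
by apply: dom => // z; rewrite /Fm le_max lexx orbT ge_max -normrN ler_norm normr_ge0.
Qed.

End translation_continuity_Lq.

(** * Continuous differentiability and flat functions *)

Lemma is_deriveE {R : realType} {V : normedModType R} (f g : V -> R) z v (a b : R) :
  f = g -> a = b -> is_derive z v f a -> is_derive z v g b.
Proof. by move=> -> ->. Qed.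

Lemma is_derive_line {R : realType} {V : normedModType R} (f : V -> R) z v (a : R) :
  is_derive z v f a <-> is_derive (0 : R) 1 (fun h : R => f (h *: v + z)) a.
Proof.
have E : (fun h : R => h^-1 *: ((f \o shift z) (h *: v) - f z)) =
    (fun h : R => h^-1 *: (((fun h : R => f (h *: v + z)) \o shift 0) (h *: 1)
      - (fun h : R => f (h *: v + z)) 0)).
  by apply/funext => h /=; rewrite addr0 scale0r add0r [h *: 1]mulr1.
have E1 : derivable (fun h : R => f (h *: v + z)) 0 1 = derivable f z v.
  by rewrite /derivable -E.
have E2 : 'D_1 (fun h : R => f (h *: v + z)) 0 = 'D_v f z.
  by rewrite /derive -E.
split=> -[H1 H2]; apply: DeriveDef; first by rewrite E1.
- by rewrite E2.
- by rewrite -E1.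
- by rewrite -E2.
Qed.

Lemma continuous_is_derive {R : realType} (g g' : R -> R) : (forall s : R, is_derive s 1 g (g' s)) ->
  continuous g.
Proof.
by move=> Dg s; apply: differentiable_continuous; apply/derivable1_diffP; have [] := Dg s.
Qed.

Section directional_C1.
Context {R : realType} {V : normedModType R}.
Implicit Types (f g : V -> R) (df dg : V -> V -> R) (z v : V).

(** The directional derivatives are carried as a function of the point and the
    direction, so that C1_M and C1_comp compute them explicitly. *)
Definition C1 f df := [/\ continuous f, forall z v, is_derive z v f (df z v) &
  forall v, continuous (fun z => df z v)].

Lemma is_derive_comp1 f (g : R -> R) z v (a b : R) :
  is_derive z v f a -> is_derive (f z) 1 g b ->
  is_derive z v (fun z => g (f z)) (b * a).
Proof.
move=> /is_derive_line fa gb; apply/is_derive_line.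
apply: (@is_derive1_comp _ g (fun h : R => f (h *: v + z))).
  by rewrite scale0r add0r.
Qed.

Lemma is_derive_line_at f z v (h a : R) : is_derive (h *: v + z) v f a ->
  is_derive h 1 (fun h : R => f (h *: v + z)) a.
Proof.
move=> /is_derive_line H; apply/(@is_derive_line R R^o); apply: is_deriveE H => //.
apply/funext => k; congr f.
by rewrite addrA -scalerDl [k *: 1]mulr1.
Qed.

Lemma C1_D f g df dg : C1 f df -> C1 g dg ->
  C1 (fun z => f z + g z) (fun z v => df z v + dg z v).
Proof.
move=> [cf Df cdf] [cg Dg cdg]; split.
- by move=> z; apply: cvgD; [exact: cf|exact: cg].
- by move=> z v; exact: is_deriveD.
- by move=> v z; apply: cvgD; [exact: cdf|exact: cdg].
Qed.

Lemma C1_M f g df dg : C1 f df -> C1 g dg ->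
  C1 (fun z => f z * g z) (fun z v => f z * dg z v + df z v * g z).
Proof.
move=> [cf Df cdf] [cg Dg cdg]; split.
- by move=> z; apply: cvgM; [exact: cf|exact: cg].
- move=> z v; apply: is_deriveE (is_deriveM (Df z v) (Dg z v)) => //.
  by rewrite /GRing.scale/= [g z * _]mulrC.
- move=> v z; apply: cvgD; apply: cvgM; [exact: cf|exact: cdg|exact: cdf|exact: cg].
Qed.

Lemma C1_aff f (c : V -> R) : continuous f ->
  (forall z v (h : R), f (h *: v + z) = h * c v + f z) -> C1 f (fun=> c).
Proof.
move=> cf fE; split => //; last by move=> v z; exact: cvg_cst.
move=> z v; apply/is_derive_line.
rewrite (_ : (fun h => _) = (fun h : R => c v * h) \+ cst (f z)); last first.
  by apply/funext => h /=; rewrite fE mulrC.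
have D1 : is_derive (0 : R) 1 (c v \*: (id : R -> R)) (c v *: 1).
  exact: is_deriveZ (is_derive_id _ _).
have D2 : is_derive (0 : R) 1 (cst (f z) : R -> R) 0 by exact: is_derive_cst.
have D3 := is_deriveD D1 D2.
refine (is_deriveE _ _ D3) => //.
by rewrite addr0 [c v *: 1]mulr1.
Qed.

Lemma C1_cst (c : R) : C1 (fun=> c) (fun _ _ => 0).
Proof.
apply: C1_aff => [z|z v h]; first exact: cvg_cst.
by rewrite mulr0 add0r.
Qed.

Lemma C1_comp f df (g g' : R -> R) : C1 f df ->
  (forall s : R, is_derive s 1 g (g' s)) -> continuous g' ->
  C1 (fun z => g (f z)) (fun z v => g' (f z) * df z v).
Proof.
move=> [cf Df cdf] Dg cg'; split.
- move=> z; apply: continuous_comp; first exact: cf.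
  by apply: differentiable_continuous; apply/derivable1_diffP; exact: ex_derive.
- by move=> z v; exact: is_derive_comp1.
- move=> v z; apply: cvgM; last exact: cdf.
  by apply: continuous_comp; [exact: cf|exact: cg'].
Qed.

Lemma C1_eq f g df dg : f =1 g -> df =2 dg -> C1 f df -> C1 g dg.
Proof.
move=> /funext -> H; suff -> : df = dg by [].
by apply/funext => z; apply/funext => v.
Qed.

Lemma C1_mvt_le f df z v (h M : R) : (forall y v, is_derive y v f (df y v)) ->
  (forall y, `|df y v| <= M) -> `|f (h *: v + z) - f z| <= M * `|h|.
Proof.
move=> Df dM.
pose phi (s : R) := f (s *: v + z).
have Dphi (s : R) : is_derive s 1 phi (df (s *: v + z) v).
  by apply: is_derive_line_at; exact: Df.
have cphi : continuous phi.
  by move=> s; apply: differentiable_continuous; apply/derivable1_diffP; exact: ex_derive.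
have phi0 : phi 0 = f z by rewrite /phi scale0r add0r.
rewrite -phi0 -/(phi h).
have [h0|h0|->] := ltgtP h 0; last by rewrite subrr !normr0 mulr0.
  have [c _ E] := MVT h0 (fun s _ => Dphi s) (continuous_subspaceT cphi).
  rewrite distrC E normrM sub0r normrN; apply: ler_wpM2r => //; exact: dM.
have [c _ E] := MVT h0 (fun s _ => Dphi s) (continuous_subspaceT cphi).
by rewrite E normrM subr0; apply: ler_wpM2r => //; exact: dM.
Qed.

End directional_C1.

Section flat_functions.
Context {R : realType}.

(** The functions s^-j exp(-1/s), extended by 0 to s <= 0: a family of smooth
    functions closed, up to linear combinations, under differentiation. *)
Definition flat (j : nat) (s : R) : R :=
  if 0 < s then s^-1 ^+ j * expR (- s^-1) else 0.

Lemma flat_ge0 j s : 0 <= flat j s.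
Proof.
by rewrite /flat; case: ifPn => // s0; rewrite mulr_ge0 ?expR_ge0// exprn_ge0// invr_ge0 ltW.
Qed.

Lemma flat_gt0 j s : 0 < s -> 0 < flat j s.
Proof. by move=> s0; rewrite /flat s0 mulr_gt0 ?expR_gt0// exprn_gt0// invr_gt0. Qed.

Lemma flat_eq0 j s : s <= 0 -> flat j s = 0.
Proof. by rewrite /flat leNgt => /negbTE ->. Qed.

(** One term of the exponential series, exp x >= x^(j+m) / (j+m)!, at
    x = 1/s. *)
Lemma flat_le j m s : 0 < s -> (0 < j + m)%N ->
  flat j s <= (j + m)`!%:R * s ^+ m.
Proof.
move=> s0 jm; rewrite /flat s0.
set x := s^-1; have x0 : 0 < x by rewrite invr_gt0.
have H : x ^+ (j + m) * expR (- x) <= (j + m)`!%:R.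
  rewrite expRN ler_pdivrMr ?expR_gt0// -ler_pdivrMl ?ltr0n ?fact_gt0//.
  have := expR_ge1Dxn (j + m).-1 (ltW x0); rewrite prednK// => H.
  by rewrite mulrC (le_trans _ H)// lerDr.
have -> : x ^+ j * expR (- x) = x ^+ (j + m) * expR (- x) * s ^+ m.
  have sx : s ^+ m * x ^+ m = 1 by rewrite -exprMn /x divff ?gt_eqF// expr1n.
  have -> : x ^+ (j + m) * expR (- x) * s ^+ m = x ^+ j * expR (- x) * (s ^+ m * x ^+ m).
    by rewrite exprD; ring.
  by rewrite sx mulr1.
by rewrite ler_wpM2r// exprn_ge0// ltW.
Qed.

(** Used at the origin, where the defining formula of a flat function changes. *)
Lemma is_derive_quadratic (g : R -> R) (x C : R) :
  (forall h, `|g (h + x) - g x| <= C * h ^+ 2) -> is_derive x 1 g 0.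
Proof.
move=> H.
have C0 : 0 <= C by have := H 1; rewrite expr1n mulr1; exact: le_trans.
have cv : h^-1 *: ((g \o shift x) (h *: 1) - g x) @[h --> (0 : R)^'] --> (0 : R).
  apply/cvgr0Pnorm_le => e e0; near=> h.
  have h0 : h != 0 by near: h; exact: nbhs_dnbhs_neq.
  rewrite /= [h *: 1]mulr1 normrZ normfV ler_pdivrMl ?normr_gt0//.
  apply: (le_trans (H h)); rewrite -normr_id -real_normK ?num_real// expr2 mulrCA.
  rewrite normr_id ler_wpM2l//.
  have : `|h| <= e / (C + 1).
    near: h; apply: dnbhs0_le; rewrite divr_gt0// ltr_wpDl//.
  rewrite ler_pdivlMr ?ltr_wpDl// => he; apply: le_trans he.
  by rewrite mulrC ler_wpM2l// lerDl.
by split; [apply/cvg_ex; exists 0|exact: cvg_lim].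
Unshelve. all: end_near. Qed.

Lemma is_derive_flat j (s : R) :
  is_derive s 1 (flat j) (- j%:R * flat j.+1 s + flat j.+2 s).
Proof.
have [s0|s0|->] := ltgtP s 0.
- rewrite !flat_eq0 ?ltW// mulr0 addr0.
  have D0 : is_derive s 1 (cst 0 : R -> R) 0 by exact: is_derive_cst.
  apply: near_eq_is_derive D0.
  near=> y; rewrite flat_eq0//; apply/ltW.
  by near: y; exact: lt_nbhsl.
- have := s0; rewrite /flat => ->.
  apply: (@near_eq_is_derive _ _ _ (fun s : R => s^-1 ^+ j * expR (- s^-1))).
    near=> y; have -> // : 0 < y; near: y; exact: lt_nbhsr.
  have Di : is_derive s 1 (fun s : R => s^-1) (- s^-1 ^+ 2).
    apply: is_deriveE (is_deriveV (lt0r_neq0 s0) (is_derive_id s 1)) => //.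
    by rewrite [_ *: 1]mulr1 exprVn.
  have De : is_derive s 1 (fun s : R => expR (- s^-1)) (expR (- s^-1) * s^-1 ^+ 2).
    have Dn : is_derive s 1 (fun s : R => - s^-1) (s^-1 ^+ 2).
      by apply: is_deriveE (is_deriveN Di) => //; rewrite opprK.
    exact: (is_derive_comp1 Dn (is_derive_expR _)).
  have Dx : is_derive s 1 (fun s : R => s^-1 ^+ j) (- j%:R * s^-1 ^+ j.+1).
    apply: is_deriveE (is_deriveX j Di); first by rewrite exprfctE.
    case: j => [|j]; first by rewrite /GRing.scale/= !mul0r oppr0 mul0r.
    by rewrite /GRing.scale/= mulrN mulNr -mulrA -exprD addn2.
  apply: is_deriveE (is_deriveM Dx De) => //.
  by rewrite /GRing.scale/= !exprS; ring.
- rewrite !flat_eq0// mulr0 addr0.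
  apply: (@is_derive_quadratic _ _ (j + 2)`!%:R) => h; rewrite addr0 [X in _ - X]flat_eq0// subr0.
  rewrite ger0_norm ?flat_ge0//; have [h0|h0] := ltP 0 h.
    by apply: flat_le => //; rewrite addn2.
  by rewrite flat_eq0// mulr_ge0// exprn_even_ge0.
Unshelve. all: end_near. Qed.

Lemma continuous_flat j : continuous (flat j).
Proof.
move=> s; apply: differentiable_continuous; apply/derivable1_diffP.
by have [] := is_derive_flat j s.
Qed.

Context {V : normedModType R}.

(** An algebra of smooth functions, presented by the closure properties that
    make its stability under directional derivatives an induction. *)
Inductive flat_alg : (V -> R) -> Prop :=
| flat_alg_aff f c : continuous f ->
    (forall z v (h : R), f (h *: v + z) = h * c v + f z) -> flat_alg f
| flat_alg_D f g : flat_alg f -> flat_alg g -> flat_alg (fun z => f z + g z)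
| flat_alg_M f g : flat_alg f -> flat_alg g -> flat_alg (fun z => f z * g z)
| flat_alg_flat j f : flat_alg f -> flat_alg (fun z => flat j (f z)).

Lemma flat_alg_cst (c : R) : flat_alg (fun=> c).
Proof.
apply: (@flat_alg_aff _ (fun=> 0)) => [z|z v h]; first exact: cvg_cst.
by rewrite mulr0 add0r.
Qed.

(** Induction over the closure properties: the derivative of each construction
    stays in the algebra by the product and chain rules and is_derive_flat. *)
Lemma flat_alg_C1 f : flat_alg f ->
  exists2 df, C1 f df & forall v, flat_alg (fun z => df z v).
Proof.
elim=> {f} [f c cf fE|f g _ [df Cf af] _ [dg Cg ag]|f g af' [df Cf af] ag' [dg Cg ag]|j f af' [df Cf af]].
- by exists (fun=> c); [exact: C1_aff|move=> v; exact: flat_alg_cst].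
- exists (fun z v => df z v + dg z v); first exact: C1_D.
  by move=> v; exact: flat_alg_D.
- exists (fun z v => f z * dg z v + df z v * g z); first exact: C1_M.
  by move=> v; apply: flat_alg_D; exact: flat_alg_M.
- exists (fun z v => (- j%:R * flat j.+1 (f z) + flat j.+2 (f z)) * df z v).
    apply: (C1_comp Cf (is_derive_flat j)).
    move=> s; apply: cvgD; last exact: continuous_flat.
    by apply: cvgM; [exact: cvg_cst|exact: continuous_flat].
  move=> v; apply: flat_alg_M => //; apply: flat_alg_D; last exact: flat_alg_flat.
  by apply: flat_alg_M; [exact: flat_alg_cst|exact: flat_alg_flat].
Qed.

Lemma flat_alg_derive f v : flat_alg f -> flat_alg ('D_v f).
Proof.
move=> /flat_alg_C1[df [_ Df _] adf]; rewrite (_ : 'D_v f = fun z => df z v)//.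
by apply/funext => z; have [_] := Df z v.
Qed.

Lemma flat_alg_smooth f : flat_alg f -> smooth f.
Proof.
move=> af s; have : flat_alg (foldr (fun v h => 'D_v h) f s).
  by elim: s => // v s IH /=; exact: flat_alg_derive.
move=> /flat_alg_C1[df [ch Dh _] _]; split => // x v.
Qed.

End flat_functions.

(** * Mollifying kernels *)

Section kernel.
Context {R : realType} {n : nat}.
Local Notation V := ('rV[R]_n * measurableTypeR R)%type.

Lemma compact_ball_rV (x : 'rV[R]_n) (e : R) : 0 <= e ->
  compact [set y : 'rV[R]_n | `|y - x| <= e].
Proof.
move=> e0; have -> : [set y : 'rV[R]_n | `|y - x| <= e] =
    [set y | forall i, `[x ord0 i - e, x ord0 i + e]%classic (y ord0 i)].
  apply/seteqP; split => y /=.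
    move=> /(norm_rV_le _ e0) H i; have := H i.
    by rewrite !mxE in_itv/= ler_distl.
  move=> H; apply/(norm_rV_le _ e0) => i; have := H i.
  by rewrite !mxE in_itv/= ler_distl.
apply: (@rV_compact _ n (fun i => `[x ord0 i - e, x ord0 i + e]%classic)) => i.
exact: segment_compact.
Qed.

Lemma compact_ball_rVR (z : 'rV[R]_n * R) (e : R) : 0 <= e ->
  compact [set y : 'rV[R]_n * R | `|y - z| <= e].
Proof.
move=> e0; have -> : [set y : 'rV[R]_n * R | `|y - z| <= e] =
    [set x | `|x - z.1| <= e] `*` `[z.2 - e, z.2 + e]%classic.
  apply/seteqP; split => -[x t] /=; rewrite normV_le/= in_itv/= -ler_distl.
    by move=> /andP[].
  by move=> [-> ->].
by apply: compact_setX; [exact: compact_ball_rV|exact: segment_compact].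
Qed.

Lemma bounded_of_support (f : 'rV[R]_n * R -> R) (N : R) : continuous f ->
  (forall z, N < `|z| -> f z = 0) -> exists2 C, 0 <= C & forall z, `|f z| <= C.
Proof.
move=> cf fN; pose N' := Num.max N 0.
have N'0 : 0 <= N' by rewrite le_max lexx orbT.
have /compact_bounded[C [_ HC]] : compact (f @` [set y : 'rV[R]_n * R | `|y - 0| <= N']).
  by apply: continuous_compact; [exact: continuous_subspaceT|exact: compact_ball_rVR].
exists (`|C| + 1) => [|z]; first exact: addr_ge0.
have [zN|zN] := leP `|z| N'.
  apply: (HC (`|C| + 1)); first by rewrite (le_lt_trans (ler_norm _))// ltrDl.
  by exists z => //=; rewrite subr0.
rewrite fN ?normr0 ?addr_ge0//.
by rewrite (le_lt_trans _ zN)// le_max lexx.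
Qed.

Lemma C1_support (f : 'rV[R]_n * R -> R) df (N : R) : C1 f df ->
  (forall z, N < `|z| -> f z = 0) -> forall v z, N < `|z| -> df z v = 0.
Proof.
move=> [_ Df _] fN v z zN.
have D0 : is_derive z v (cst 0 : _ -> R) 0 by exact: is_derive_cst.
have D1 : is_derive z v f 0.
  apply: near_eq_is_derive D0.
  apply/nbhs_ballP; exists (`|z| - N); rewrite /= ?subr_gt0// => y.
  rewrite -ball_normE/= => zy; rewrite fN// -ltrN2 -(ltrD2l `|z|).
  by apply: le_lt_trans zy; exact: lerB_dist.
have [_ <-] := Df z v; have [_ <-] := D1.
by [].
Qed.

Definition sqn (h : 'rV[R]_n * R) : R := \sum_i h.1 ord0 i ^+ 2 + h.2 ^+ 2.

Lemma norm_sqn h : `|h| ^+ 2 <= sqn h.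
Proof.
rewrite -ler_sqrt ?sqrtr_sqr ?normr_id; last first.
  by rewrite addr_ge0 ?sqr_ge0// sumr_ge0// => i _; exact: sqr_ge0.
have s0 : 0 <= Num.sqrt (sqn h) by exact: sqrtr_ge0.
rewrite normV_le; apply/andP; split.
  apply/(norm_rV_le _ s0) => i; rewrite -sqrtr_sqr ler_wsqrtr//.
  rewrite /sqn (bigD1 i)//= -addrA lerDl addr_ge0 ?sqr_ge0//.
  by rewrite sumr_ge0// => j _; exact: sqr_ge0.
rewrite -sqrtr_sqr ler_wsqrtr// /sqn lerDr sumr_ge0// => j _; exact: sqr_ge0.
Qed.

Lemma sqn_le h (r : R) : `|h| <= r -> sqn h <= n.+1%:R * r ^+ 2.
Proof.
move=> hr; have r0 : 0 <= r by exact: le_trans (normr_ge0 _) hr.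
move: hr; rewrite normV_le => /andP[/(norm_rV_le _ r0) h1 h2].
rewrite /sqn -natr1 mulrDl mul1r; apply: lerD.
  rewrite -[X in X%:R * _]card_ord mulr_natl -sumr_const; apply: ler_sum => i _.
  by rewrite -real_normK ?num_real// lerXn2r ?nnegrE.
by rewrite -real_normK ?num_real// lerXn2r ?nnegrE.
Qed.

(** The Euclidean square of h is polynomial, which puts the bump function in the
    algebra of flat functions; the support lies in the sup-norm ball of radius e. *)
Definition raw_ker (e : R) (h : 'rV[R]_n * R) : R := flat 0 (e ^+ 2 - sqn h).

Lemma raw_ker_support e h : 0 <= e -> e < `|h| -> raw_ker e h = 0.
Proof.
move=> e0 eh; apply: flat_eq0; rewrite subr_le0 (le_trans _ (norm_sqn _))//.
by rewrite lerXn2r ?nnegrE ?normr_ge0// ltW.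
Qed.

Lemma flat_alg_sum {V' : normedModType R} (J : Type) (s : seq J) (f : J -> V' -> R) :
  (forall j, flat_alg (f j)) -> flat_alg (fun z => \sum_(j <- s) f j z).
Proof.
move=> af; elim: s => [|j s IH].
  by under eq_fun do rewrite big_nil; exact: flat_alg_cst.
by under eq_fun do rewrite big_cons; exact: flat_alg_D.
Qed.

Lemma continuous_coord i : continuous (fun x : 'rV[R]_n => x ord0 i).
Proof. by move=> x; exact: coord_continuous. Qed.

Lemma flat_alg_raw_ker e (z : 'rV[R]_n * R) :
  flat_alg (fun y : 'rV[R]_n * R => raw_ker e (y - z)).
Proof.
apply: flat_alg_flat; apply: flat_alg_D; first exact: flat_alg_cst.
have sq (l : 'rV[R]_n * R -> R) c : continuous l ->
    (forall z v (h : R), l (h *: v + z) = h * c v + l z) -> flat_alg (fun y => l y ^+ 2).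
  by move=> cl lE; apply: flat_alg_M; apply: flat_alg_aff cl lE.
have aN (f : 'rV[R]_n * R -> R) : flat_alg f -> flat_alg (fun y => - f y).
  move=> af; under eq_fun do rewrite -mulN1r.
  by apply: flat_alg_M => //; exact: flat_alg_cst.
apply: aN; apply: flat_alg_D.
  apply: flat_alg_sum => i.
  apply: (sq (fun y => (y - z).1 ord0 i) (fun v => v.1 ord0 i)).
    move=> y; apply: (@continuous_comp _ _ _ (fun y : 'rV[R]_n * R => y.1 - z.1) (fun x => x ord0 i)).
      by apply: cvgB; [exact: cvg_fst|exact: cvg_cst].
    exact: continuous_coord.
  by move=> y v h; rewrite !mxE addrA.
apply: (sq (fun y => (y - z).2) (fun v => v.2)).
  by move=> y; apply: cvgB; [exact: cvg_snd|exact: cvg_cst].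
by move=> y v h; rewrite /= addrA.
Qed.

Lemma flat_alg_raw_ker_slice e (z : 'rV[R]_n * R) (s : R) :
  flat_alg (fun y : 'rV[R]_n => raw_ker e ((y, s) - z)).
Proof.
apply: flat_alg_flat; apply: flat_alg_D; first exact: flat_alg_cst.
under eq_fun do rewrite -mulN1r.
apply: flat_alg_M; first exact: flat_alg_cst.
apply: flat_alg_D; last exact: (flat_alg_cst ((s - z.2) ^+ 2)).
apply: flat_alg_sum => i.
suff H : flat_alg (fun y : 'rV[R]_n => (y - z.1) ord0 i) by exact: flat_alg_M.
have -> : (fun y : 'rV[R]_n => (y - z.1) ord0 i) = (fun y => y ord0 i - z.1 ord0 i).
  by apply/funext => y; rewrite !mxE.
apply: (@flat_alg_aff R _ (fun y : 'rV[R]_n => y ord0 i - z.1 ord0 i) (fun v : 'rV[R]_n => v ord0 i)).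
  move=> y; apply: (@continuousB R R _ (fun y : 'rV[R]_n => y ord0 i) (fun=> z.1 ord0 i) y).
    exact: continuous_coord.
  exact: cst_continuous.
by move=> y v h; rewrite !mxE addrA.
Qed.

Lemma continuous_raw_ker e : continuous (raw_ker e).
Proof.
have [df [ck _ _] _] := flat_alg_C1 (flat_alg_raw_ker e 0).
by move: ck; under eq_fun do rewrite subr0.
Qed.

Lemma measurable_raw_ker e : measurable_fun setT (raw_ker e : V -> R).
Proof. exact: (measurable_continuous_rVR (@continuous_raw_ker e)). Qed.

Lemma ig_raw_ker e : 0 <= e -> ig lebV (raw_ker e : V -> R).
Proof.
move=> e0.
have [C C0 HC] := bounded_of_support (@continuous_raw_ker e)
  (fun h => @raw_ker_support e h e0).
apply: (@ig_bdd _ _ _ _ (ballV e) C).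
- exact: measurable_ballV.
- exact: lebV_ballV.
- exact: measurable_raw_ker.
- by move=> z _; exact: HC.
- move=> z /negP; rewrite -ltNge; exact: raw_ker_support.
Qed.

Lemma lebV_ball_gt0 (r : R) : 0 < r -> (0 < lebV (ballV r : set V))%E.
Proof.
move=> r0; rewrite ballVE /lebV product_measure1E//; last exact: measurable_ball_rV.
apply: mule_gt0.
  have H : (0 < @lebesgue_rV R n (ball_rV r))%E.
    by rewrite leb_ball_rV ?ltW// lte_fin exprn_gt0// mulr_gt0.
  exact: H.
have H : (0 < @lebesgue_measure R `[(- r)%R, r]%classic)%E.
  rewrite lebesgue_measure_itv/= lte_fin ifT; last by rewrite gtrN.
  by rewrite -EFinB lte_fin opprK addr_gt0.
exact: H.
Qed.

Lemma I_raw_ker_gt0 e : 0 < e -> 0 < \int[lebV]_z (raw_ker e z).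
Proof.
move=> e0; rewrite lt_neqAle I_ge0 ?andbT; last by move=> z; exact: flat_ge0.
apply/negP => /eqP I0.
have := I_eq0_ae (ig_raw_ker (ltW e0)) (fun z => flat_ge0 _ _).
rewrite -I0 lexx => /(_ isT)[A [mA A0 HA]].
pose r := e / n.+2%:R.
have r0 : 0 < r by rewrite divr_gt0.
have : (lebV (ballV r : set V) <= 0)%E.
  rewrite -A0; apply: le_measure; rewrite ?inE//; first exact: measurable_ballV.
  move=> z zr; apply: HA => /= H; have := @flat_gt0 R 0 (e ^+ 2 - sqn z).
  rewrite -/(raw_ker e z) H ltxx subr_gt0 => K; have : ~~ (sqn z < e ^+ 2).
    by apply/negP => /K.
  apply/negP; rewrite negbK; apply: le_lt_trans (sqn_le zr) _.
  rewrite /r expr_div_n mulrCA gtr_pMr ?exprn_gt0// ltr_pdivrMr ?exprn_gt0// mul1r.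
  by rewrite -natrX ltr_nat expnS (@leq_trans n.+2)// leq_pmulr.
by rewrite leNgt lebV_ball_gt0.
Qed.

(** Smooth probability densities concentrated in small balls. *)
Definition ker (e : R) (h : 'rV[R]_n * R) : R :=
  (\int[lebV]_z (raw_ker e z))^-1 * raw_ker e h.

Lemma ker_ge0 e h : 0 < e -> 0 <= ker e h.
Proof. by move=> e0; rewrite mulr_ge0 ?flat_ge0// invr_ge0 ltW// I_raw_ker_gt0. Qed.

Lemma ker_support e h : 0 < e -> e < `|h| -> ker e h = 0.
Proof. by move=> e0 eh; rewrite /ker raw_ker_support ?mulr0// ltW. Qed.

Lemma ig_ker e : 0 < e -> ig lebV (ker e : V -> R).
Proof. by move=> e0; apply: igZ; exact: ig_raw_ker (ltW e0). Qed.

Lemma I_ker e : 0 < e -> \int[lebV]_z (ker e z) = 1.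
Proof.
move=> e0; rewrite I_Z ?mulVf ?gt_eqF ?I_raw_ker_gt0//; exact: ig_raw_ker (ltW e0).
Qed.

Lemma flat_alg_ker e z : flat_alg (fun y : 'rV[R]_n * R => ker e (y - z)).
Proof. by apply: flat_alg_M; [exact: flat_alg_cst|exact: flat_alg_raw_ker]. Qed.

Lemma flat_alg_ker_slice e z s : flat_alg (fun y : 'rV[R]_n => ker e ((y, s) - z)).
Proof. by apply: flat_alg_M; [exact: flat_alg_cst|exact: flat_alg_raw_ker_slice]. Qed.

Lemma ker_C1 e : exists dk, C1 (ker e) dk.
Proof.
have [dk Ck _] := flat_alg_C1 (flat_alg_ker e 0); exists dk.
by apply: C1_eq Ck => // y; rewrite subr0.
Qed.

Lemma closed_support_compact {U : normedModType R} (f : U -> R) (K : set U) :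
  compact K -> (forall x, ~ K x -> f x = 0) ->
  compact (closure [set x | f x != 0]) /\ closure [set x | f x != 0] `<=` K.
Proof.
move=> cK fK.
have sub : closure [set x | f x != 0] `<=` K.
  have clK : closed K by apply: compact_closed => //; exact: norm_hausdorff.
  rewrite [X in _ `<=` X](closure_id K).1//; apply: closure_subset => x /= fx.
  by apply: contrapT => /fK fx0; move: fx; rewrite fx0 eqxx.
split => //; apply: (subclosed_compact _ cK sub); exact: closed_closure.
Qed.

(** Smoothness is a case of flat_alg_smooth, so only the support has to be
    located inside the time interval. *)
Lemma test_function_ker e (z : 'rV[R]_n * R) (Ts : \bar R) : 0 < e ->
  0 < z.2 - e -> ((z.2 + e)%:E < Ts)%E ->
  test_function ([set: 'rV[R]_n] `*` time_oo Ts) (fun y => ker e (y - z)).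
Proof.
move=> e0 ze0 zeT.
have [//|cs sub] := @closed_support_compact _ (fun y => ker e (y - z)) _
  (@compact_ball_rVR z e (ltW e0)) _.
  by move=> y /= /negP; rewrite -ltNge; exact: ker_support.
split => //; first exact: flat_alg_smooth (flat_alg_ker e z).
move=> y /sub /=; rewrite normV_le/= => /andP[_]; rewrite ler_distl => /andP[y1 y2].
split => //; split; first exact: lt_le_trans y1.
by apply: le_lt_trans zeT; rewrite lee_fin.
Qed.

Lemma test_function_ker_slice e (z : 'rV[R]_n * R) s : 0 < e ->
  test_function setT (fun y : 'rV[R]_n => ker e ((y, s) - z)).
Proof.
move=> e0.
have [//|cs sub] := @closed_support_compact _ (fun y => ker e ((y, s) - z)) _
  (@compact_ball_rV z.1 e (ltW e0)) _.
  move=> y /= /negP; rewrite -ltNge => yz; apply: ker_support => //.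
  by rewrite ltNge normV_le/= negb_and -ltNge yz.
by split => //; exact: flat_alg_smooth (flat_alg_ker_slice e z s).
Qed.

End kernel.

(** * Convolution *)

Section sequential_continuity.
Context {R : realType} {U : normedModType R}.

Lemma continuous_seq (f : U -> R) :
  (forall z (u : nat -> U), u k @[k --> \oo] --> z -> f (u k) @[k --> \oo] --> f z) ->
  continuous f.
Proof.
move=> H z; apply/cvgrPdist_lt => e e0; apply: contrapT => nH.
have bad (k : nat) : exists y : U, `|z - y| < k.+1%:R^-1 /\ e <= `|f z - f y|.
  apply: contrapT => nE; apply: nH; apply/nbhs_ballP.
  exists k.+1%:R^-1 => //= y; rewrite -ball_normE/= => zy.
  by rewrite ltNge; apply/negP => ey; apply: nE; exists y.
have [u Hu] := choice bad.
have uz : u k @[k --> \oo] --> z.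
  apply/cvgrPdist_le => d d0; near=> k.
  apply: le_trans (ltW (Hu k).1) _; apply/ltW.
  by near: k; exact: (near_infty_natSinv_lt (PosNum d0)).
have /cvgrPdist_lt/(_ _ e0)[k _ Hk] := H z u uz.
have := Hk k (leqnn k); rewrite /= ltNge => /negP; apply.
exact: (Hu k).2.
Unshelve. all: end_near. Qed.

End sequential_continuity.

Section convolution.
Context {R : realType} {n : nat}.
Local Notation V := ('rV[R]_n * measurableTypeR R)%type.
Implicit Types (F : V -> R) (k : 'rV[R]_n * R -> R).

(** Correlation with k, i.e. convolution with the reflection of k. *)
Definition conv k F (z : 'rV[R]_n * R) : R := \int[lebV]_y (F y * k (y - z)).

Lemma measurable_shift_cts k (z : 'rV[R]_n * R) : continuous k ->
  measurable_fun setT (fun y : V => k (y - z)).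
Proof.
move=> ck; apply: (@measurable_continuous_rVR R n (fun y => k (y - z))).
move=> y; apply: continuous_comp; last exact: ck.
by apply: cvgB; [exact: cvg_id|exact: cvg_cst].
Qed.

Lemma ig_conv k F z C : continuous k -> (forall h, `|k h| <= C) -> ig lebV F ->
  ig lebV (fun y : V => F y * k (y - z)).
Proof.
move=> ck kC igF; apply: (@ig_dom _ _ _ _ (fun y => C * `|F y|)).
- apply: measurable_funM; [exact: ig_meas igF|exact: measurable_shift_cts].
- by move=> y; rewrite normrM mulrC ler_wpM2r.
- by apply: igZ; exact: ig_abs.
Qed.

Lemma continuous_conv k F C : continuous k -> (forall h, `|k h| <= C) ->
  ig lebV F -> continuous (conv k F).
Proof.
move=> ck kC igF; apply: continuous_seq => z u uz.
have m w : measurable_fun setT (fun y : V => F y * k (y - w)).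
  exact: ig_meas (ig_conv w ck kC igF).
apply: (@I_dct _ _ _ lebV (fun j y => F y * k (y - u j)) (fun y => F y * k (y - z))
  (fun y => C * `|F y|) _ _ _ _ _).2.
- by move=> j; exact: m.
- exact: m.
- move=> y; apply: cvgM; first exact: cvg_cst.
  apply: (cvg_comp (fun j => y - u j) k _ (ck (y - z))).
  by apply: cvgB => //; exact: cvg_cst.
- by apply: igZ; exact: ig_abs.
- by move=> j y; rewrite normrM mulrC ler_wpM2r.
Qed.

Lemma measurable_conv k F C : continuous k -> (forall h, `|k h| <= C) ->
  ig lebV F -> measurable_fun setT (conv k F : V -> R).
Proof. by move=> ck kC igF; apply: measurable_continuous_rVR; exact: continuous_conv kC igF. Qed.

(** Differentiation under the integral sign: difference quotients of k are
    dominated by the bound on dk through the mean value inequality. The sign comes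
    from the argument y - z. *)
Lemma is_derive_conv k dk F C z v (D : R) : C1 k dk -> (forall h, `|k h| <= C) ->
  (forall h, `|dk h v| <= D) -> ig lebV F ->
  is_derive z v (conv k F) (- conv (fun h => dk h v) F z).
Proof.
move=> [ck Dk cdk] kC dkD igF.
have D0 : 0 <= D := le_trans (normr_ge0 _) (dkD 0).
have mdk w : measurable_fun setT (fun y : V => F y * dk (y - w) v).
  exact: ig_meas (ig_conv w (cdk v) dkD igF).
have igk w := ig_conv w ck kC igF.
have cv : h^-1 *: ((conv k F \o shift z) (h *: v) - conv k F z) @[h --> 0^']
    --> - conv (fun h => dk h v) F z.
  apply/cvgr_dnbhsP => t [t0 tc].
  pose f_ (j : nat) (y : V) := (t j)^-1 * (F y * k (y - (t j *: v + z)) - F y * k (y - z)).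
  have Ef j : (t j)^-1 *: ((conv k F \o shift z) (t j *: v) - conv k F z) =
      \int[lebV]_y f_ j y.
    by rewrite /conv/= /GRing.scale/= -I_B// /f_ I_Z//; exact: igB.
  under eq_fun do rewrite Ef.
  rewrite /conv -I_N; last exact: ig_conv (cdk v) dkD igF.
  apply: (@I_dct _ _ _ lebV f_ (fun y => - (F y * dk (y - z) v))
    (fun y => D * `|F y|) _ _ _ _ _).2.
  - move=> j; apply: measurable_funM => //; apply: measurable_funB; exact: ig_meas.
  - exact: measurableT_comp.
  - move=> y; rewrite -mulrN.
    have -> : (fun j => f_ j y) = (fun j => F y * ((t j)^-1 * (k (- t j *: v + (y - z)) - k (y - z)))).
      apply/funext => j; rewrite /f_ -mulrBr mulrCA; congr (_ * (_ * (k _ - _))).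
      by rewrite opprD scaleNr addrCA.
    apply: cvgM; first exact: cvg_cst.
    have [Dy dy] := Dk (y - z) v.
    have : h^-1 *: ((k \o shift (y - z)) (h *: v) - k (y - z)) @[h --> 0^'] --> dk (y - z) v.
      by rewrite -dy; exact: Dy.
    move=> /cvgr_dnbhsP /(_ (fun j => - t j)) H.
    have /H H' : (forall j, - t j != 0) /\ - t j @[j --> \oo] --> 0.
      by split; [move=> j; rewrite oppr_eq0|rewrite -oppr0; exact: cvgN].
    have -> : (fun j => (t j)^-1 * (k (- t j *: v + (y - z)) - k (y - z))) =
       (fun j => - ((- t j)^-1 *: ((k \o shift (y - z)) (- t j *: v) - k (y - z)))).
      by apply/funext => j; rewrite [(- t j)^-1]invrN [X in _ = - X]scaleNr opprK.
    exact: cvgN.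
  - by apply: igZ; exact: ig_abs.
  - move=> j y; rewrite /f_ -mulrBr mulrCA normrM mulrC ler_wpM2r// normrM normfV.
    rewrite ler_pdivrMl ?normr_gt0// mulrC.
    rewrite (_ : y - (t j *: v + z) = - t j *: v + (y - z)); last first.
      by rewrite opprD scaleNr addrCA.
    rewrite -[X in _ * X]normrN; apply: C1_mvt_le => // w v'; exact: Dk.
by split; [apply/cvg_ex; exists (- conv (fun h => dk h v) F z)|exact: cvg_lim].
Qed.

Lemma conv_C1 k dk F C : C1 k dk -> (forall h, `|k h| <= C) ->
  (forall v, exists D, forall h, `|dk h v| <= D) -> ig lebV F ->
  C1 (conv k F) (fun z v => - conv (fun h => dk h v) F z).
Proof.
move=> Ck kC dkD igF; have [ck Dk cdk] := Ck; split.
- exact: continuous_conv kC igF.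
- by move=> z v; have [D HD] := dkD v; exact: is_derive_conv Ck kC HD igF.
- move=> v; have [D HD] := dkD v => z; apply: cvgN.
  exact: (continuous_conv (cdk v) HD igF).
Qed.

End convolution.

Section mollification.
Context {R : realType} {n : nat}.
Local Notation V := ('rV[R]_n * measurableTypeR R)%type.
Implicit Types (F : V -> R).

Lemma ker_bounded (e : R) : 0 < e ->
  exists2 C, 0 <= C & forall h : 'rV[R]_n * R, `|ker e h| <= C.
Proof.
move=> e0; apply: (@bounded_of_support _ _ _ e).
  by have [dk [ck _ _]] := @ker_C1 R n e; exact: ck.
by move=> h; exact: ker_support.
Qed.

Lemma ker_C1_bounded (e : R) : 0 < e ->
  exists dk : 'rV[R]_n * R -> _, C1 (ker e) dk /\
    forall v, exists D, forall h, `|dk h v| <= D.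
Proof.
move=> e0; have [dk Ck] := @ker_C1 R n e; exists dk; split => // v.
have [_ _ /(_ v) cdk] := Ck.
have [|C _ HC] := @bounded_of_support _ _ (fun h => dk h v) e cdk.
  by move=> z; apply: (C1_support Ck) => h; exact: ker_support.
by exists C.
Qed.

Lemma measurable_conv_ker e F : 0 < e -> ig lebV F ->
  measurable_fun setT (conv (ker e) F : V -> R).
Proof.
move=> e0 igF; have [C _ HC] := ker_bounded e0; apply: measurable_conv HC igF.
by have [dk [ck _ _]] := @ker_C1 R n e; exact: ck.
Qed.

Lemma conv_kerE e F (z : V) : 0 < e -> ig lebV F ->
  conv (ker e) F z = \int[lebV]_h (F (h + z) * ker e h).
Proof.
move=> e0 igF; have [C _ HC] := ker_bounded e0; have [dk [ck _ _]] := @ker_C1 R n e.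
rewrite /conv -(@I_addV _ _ (fun y => F y * ker e (y - z)) z).
  by apply: eq_Rintegral => h _; rewrite addrK.
exact: ig_conv ck HC igF.
Qed.

Lemma ig_translate_ker e F (z : V) : 0 < e -> ig lebV F ->
  ig lebV (fun h : V => F (h + z) * ker e h).
Proof.
move=> e0 igF; have [C C0 HC] := @ker_bounded e e0.
apply: (@ig_dom _ _ _ _ (fun h : V => C * `|F (h + z)|)).
- apply: measurable_funM; last exact: ig_meas (ig_ker e0).
  exact: measurable_translate (ig_meas igF).
- by move=> h; rewrite normrM mulrC ler_wpM2r.
- by apply: igZ; apply: ig_abs; exact: (ig_addV z igF).
Qed.

Lemma conv_ker_le e F M (z : V) : 0 < e -> ig lebV F -> (forall y, `|F y| <= M) ->
  `|conv (ker e) F z| <= M.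
Proof.
move=> e0 igF FM; have [C _ HC] := ker_bounded e0; have [dk [ck _ _]] := @ker_C1 R n e.
rewrite conv_kerE//.
have igk := @ig_ker R n e e0.
have ig1 := ig_translate_ker z e0 igF.
apply: (le_trans (I_abs ig1)).
rewrite -[leRHS]mulr1 -(@I_ker R n e e0) -(I_Z _ igk).
apply: I_le; [exact: ig_abs|exact: igZ|].
by move=> h; rewrite normrM (ger0_norm (ker_ge0 h e0)) ler_wpM2r ?ker_ge0.
Qed.

(** The tangent line at c of the convex function x^q / q; the coefficients are
    those that integrate well against a probability density. *)
Lemma young_tangent (q x c : R) : 1 < q -> 0 <= x -> 0 <= c ->
  c `^ (q - 1) * x <= (1 - q^-1) * c `^ q + q^-1 * x `^ q.
Proof.
move=> q1 x0 c0; have q0 : 0 < q by rewrite (lt_trans ltr01).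
have q10 : 0 < q - 1 by rewrite subr_gt0.
have := @conjugate_powR _ (c `^ (q - 1)) x (q / (q - 1)) q (powR_ge0 _ _) x0 (divr_gt0 q0 q10) q0.
have -> : (q / (q - 1))^-1 + q^-1 = 1.
  by field; rewrite !gt_eqF.
move=> /(_ erefl) H; apply: le_trans H _.
rewrite -powRrM (_ : (q - 1) * (q / (q - 1)) = q); last by field; rewrite gt_eqF.
rewrite mulrC [x `^ q / q]mulrC (_ : (q / (q - 1))^-1 = 1 - q^-1)//.
by field; rewrite !gt_eqF.
Qed.

(** Jensen's inequality for powers and a probability density, obtained by
    integrating the tangent form of Young's inequality. *)
Lemma jensen_powR d (T : measurableType d) (mu : {measure set T -> \bar R})
    (q : R) (G k : T -> R) : 1 < q -> (forall x, 0 <= k x) -> ig mu k ->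
  \int[mu]_x k x = 1 -> measurable_fun setT G ->
  ig mu (fun x => `|G x| `^ q * k x) ->
  ig mu (fun x => G x * k x) /\
  `|\int[mu]_x (G x * k x)| `^ q <= \int[mu]_x (`|G x| `^ q * k x).
Proof.
move=> q1 k0 igk Ik mG igG; have q0 : 0 < q by rewrite (lt_trans ltr01).
have igGk : ig mu (fun x => G x * k x).
  apply: (@ig_dom _ _ _ _ (fun x => (1 - q^-1) * k x + q^-1 * (`|G x| `^ q * k x))).
  - by apply: measurable_funM => //; exact: ig_meas igk.
  - move=> x; have := young_tangent q1 (normr_ge0 (G x)) ler01.
    rewrite !powR1 mul1r mulr1 => H.
    rewrite normrM (ger0_norm (k0 x)) mulrA -mulrDl ler_wpM2r//.
  - by apply: igD; exact: igZ.
split => //.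
set I := \int[mu]_x (G x * k x).
have igaGk : ig mu (fun x => `|G x| * k x).
  have := ig_abs igGk; congr ig; apply/funext => x.
  by rewrite normrM (ger0_norm (k0 x)).
have I1 : `|I| <= \int[mu]_x (`|G x| * k x).
  apply: (le_trans (I_abs igGk)); apply: I_le => // [|x]; first exact: ig_abs.
  by rewrite normrM (ger0_norm (k0 x)).
have I2 : `|I| `^ (q - 1) * \int[mu]_x (`|G x| * k x) <=
    (1 - q^-1) * `|I| `^ q + q^-1 * \int[mu]_x (`|G x| `^ q * k x).
  rewrite -(I_Z _ igaGk).
  apply: (@le_trans _ _ (\int[mu]_x ((1 - q^-1) * `|I| `^ q * k x + q^-1 * (`|G x| `^ q * k x)))).
    apply: I_le; [exact: igZ|by apply: igD; exact: igZ|].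
    move=> x; rewrite !mulrA -mulrDl ler_wpM2r//.
    exact: young_tangent.
  by rewrite I_D; [rewrite (I_Z _ igk) (I_Z _ igG) Ik mulr1|exact: igZ|exact: igZ].
have I3 : `|I| `^ q <= `|I| `^ (q - 1) * \int[mu]_x (`|G x| * k x).
  have [->|I0] := eqVneq `|I| 0; first by rewrite !powR0 ?mul0r// gt_eqF// subr_gt0.
  have -> : `|I| `^ q = `|I| `^ (q - 1) * `|I|.
    by rewrite -[X in _ = _ * X]powRr1// -powRD ?subrK// I0 implybT.
  by rewrite ler_wpM2l// powR_ge0.
have := le_trans I3 I2; rewrite mulrBl mul1r -subr_ge0 => H.
rewrite -(@ler_pM2l _ q^-1) ?invr_gt0// -subr_ge0; move: H.
by congr (0 <= _); ring.
Qed.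

(** Mollification averages the increments F(z+h) - F(z) over |h| <= e; Jensen
    and Tonelli bound its distance to F by the largest mean increment. *)
Lemma Nq_conv_ker q F (N : nat) : 1 < q -> measurable_fun setT F -> ig lebV F ->
  ig lebV (fun z => `|F z| `^ q) -> (forall z, N%:R <= `|z| -> F z = 0) ->
  forall d : R, 0 < d -> exists2 e0 : R, 0 < e0 &
    forall e, 0 < e <= e0 -> (Nq q (fun z => conv (ker e) F z - F z)%R <= d%:E)%E.
Proof.
move=> q1 mF igF igFq FN d d0; have q0 : 0 < q by rewrite (lt_trans ltr01).
have [e0 e00 He] := tcont_Lq q0 mF igFq FN d0.
exists e0 => // e /andP[ep ee0].
have igk := @ig_ker R n e ep; have mk := ig_meas igk.
have [C C0 HC] := @ker_bounded e ep.
have mC := measurable_conv_ker ep igF.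
have mFh (z : V) : measurable_fun setT (fun h : V => F (h + z)) by exact: measurable_translate.
have E (z : V) : conv (ker e) F z - F z = \int[lebV]_h ((F (h + z) - F z) * ker e h).
  have igT := ig_translate_ker z ep igF.
  rewrite conv_kerE//.
  have -> : \int[lebV]_h ((F (h + z) - F z) * ker e h) =
      \int[lebV]_h (F (h + z) * ker e h - F z * ker e h).
    by apply: eq_Rintegral => h _; rewrite mulrBl.
  by rewrite (I_B igT (igZ (F z) igk)) (I_Z (F z) igk) I_ker// mulr1.
have ig2 (z : V) : ig lebV (fun h : V => `|F (h + z) - F z| `^ q * ker e h).
  apply: (@ig_dom _ _ _ _ (fun h : V => 2 `^ q * C * `|F (h + z)| `^ q +
     2 `^ q * `|F z| `^ q * ker e h)).
  - apply: measurable_funM => //; apply: measurable_powR_norm.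
    by apply: measurable_funB.
  - move=> h; rewrite normrM (ger0_norm (powR_ge0 _ _)) (ger0_norm (ker_ge0 h ep)).
    have k0 := ker_ge0 h ep; have kC : ker e h <= C := le_trans (ler_norm _) (HC h).
    apply: (@le_trans _ _ (2 `^ q * (`|F (h + z)| `^ q + `|F z| `^ q) * ker e h)).
      rewrite ler_wpM2r//; apply: le_trans (powR_D_le _ _ (ltW q0)) _.
      by rewrite normrN.
    rewrite mulrDr mulrDl lerD2r -!mulrA ler_wpM2l ?powR_ge0//.
    by rewrite mulrC ler_wpM2r ?powR_ge0.
  - by apply: igD; apply: igZ => //; exact: (ig_addV z igFq).
have mG (z : V) : measurable_fun setT (fun h : V => F (h + z) - F z) by apply: measurable_funB.
pose f (x : V * V) := (`|F (x.2 + x.1) - F x.1| `^ q * ker e x.2)%:E.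
have mf : measurable_fun setT f.
  apply/measurable_EFinP; apply: measurable_funM; last exact: (measurableT_comp mk measurable_snd).
  apply: measurable_powR_norm; apply: measurable_funB; last exact: (measurableT_comp mF measurable_fst).
  apply: (measurableT_comp mF).
  have -> : (fun x : V * V => x.2 + x.1) = (fun x => (x.2.1 + x.1.1, x.2.2 + x.1.2)).
    by apply/funext => -[[? ?] [? ?]].
  apply/measurable_fun_pair.
    apply: measurable_fun_rV => i; under eq_fun do rewrite mxE.
    apply: measurable_funD.
      apply: (measurableT_comp (measurable_coord i)).
      exact: (measurableT_comp measurable_fst measurable_snd).
    apply: (measurableT_comp (measurable_coord i)).
    exact: (measurableT_comp measurable_fst measurable_fst).
  apply: measurable_funD.
    exact: (measurableT_comp measurable_snd measurable_snd).
  exact: (measurableT_comp measurable_snd measurable_fst).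
have f0 x : (0 <= f x)%E by rewrite lee_fin mulr_ge0 ?powR_ge0 ?ker_ge0.
apply: (@le_trans _ _ (\int[lebV]_z \int[lebV]_h f (z, h))%E).
  apply: ge0_le_integral => //.
  - by apply/measurable_EFinP; apply: measurable_powR_norm; apply: measurable_funB.
  - exact: (measurable_fun_fubini_tonelli_F (m2 := lebV)).
  - move=> z _; rewrite E /f /= -I_fin// lee_fin.
    have k0 (h : V) : 0 <= ker e h := ker_ge0 h ep.
    exact: (jensen_powR q1 k0 igk (I_ker ep) (mG z) (ig2 z)).2.
rewrite (fubini_tonelli (m1 := lebV) (m2 := lebV) f mf f0).
have k0 (h : V) : 0 <= ker e h := ker_ge0 h ep.
apply: (@le_trans _ _ (\int[lebV]_h (d * ker e h)%:E)%E); last first.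
  rewrite [leLHS](nn_Z lebV mk k0 (ltW d0)) -I_fin// I_ker// mule1.
  exact: lexx.
apply: ge0_le_integral => //.
- by move=> h _; apply: integral_ge0 => z _; exact: f0.
- exact: (measurable_fun_fubini_tonelli_G (m1 := lebV)).
- by apply/measurable_EFinP; exact: measurable_funM.
- move=> h _; rewrite /f/=.
  have mD : measurable_fun setT (fun z : V => F (z + h) - F z).
    by apply: measurable_funB => //; exact: measurable_translate.
  have -> : (\int[lebV]_z (`|F (h + z) - F z| `^ q * ker e h)%:E =
             \int[lebV]_z (ker e h * `|F (z + h) - F z| `^ q)%:E)%E.
    by apply: eq_integral => z _; rewrite mulrC [h + z]addrC.
  rewrite [leLHS](nn_Z lebV (measurable_powR_norm q mD) (fun z => powR_ge0 _ _) (k0 h)).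
  rewrite [leRHS]EFinM [leRHS]muleC.
  have [he|eh] := leP `|h| e; last by rewrite ker_support// !mul0e.
  apply: lee_wpmul2l; first by rewrite lee_fin k0.
  exact: He h (le_trans he ee0).
Qed.

End mollification.

(** * Integration by parts and limits in the mean *)

Section uniform_modulus.
Context {R : realType}.

Lemma uniform_modulus (phi : R -> R) (M : R) : continuous phi ->
  forall eta : R, 0 < eta -> exists2 d : R, 0 < d &
    forall a b, `|a| <= M -> `|b| <= M -> `|a - b| < d -> `|phi a - phi b| < eta.
Proof.
move=> cphi eta eta0.
pose D := [set x : R * R | (`|x.1| <= M /\ `|x.2| <= M) /\ eta <= `|phi x.1 - phi x.2|].
have cf1 : continuous (fun x : R * R => `|phi x.1 - phi x.2|).
  move=> x; apply: cvg_norm; apply: cvgB.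
    by apply: (cvg_comp _ phi _ (cphi x.1)); exact: cvg_fst.
  by apply: (cvg_comp _ phi _ (cphi x.2)); exact: cvg_snd.
have cf2 : continuous (fun x : R * R => `|x.1 - x.2|).
  by move=> x; apply: cvg_norm; apply: cvgB; [exact: cvg_fst|exact: cvg_snd].
have cD : compact D.
  have -> : D = (`[- M, M]%classic `*` `[- M, M]%classic) `&`
      (fun x => `|phi x.1 - phi x.2|) @^-1` `[eta, +oo[%classic.
    apply/seteqP; split => -[a b]; rewrite /D/= !in_itv/= -!ler_norml andbT.
      by move=> [[-> ->] ->].
    by move=> [[-> ->] ->].
  apply: (@subclosed_compact _ _ (`[- M, M]%classic `*` `[- M, M]%classic)).
  - apply: closedI.
      apply: compact_closed; first exact: norm_hausdorff.
      by apply: compact_setX; exact: segment_compact.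
    apply: closed_comp; last exact: interval_closed.
    by move=> x _; exact: cf1.
  - by apply: compact_setX; exact: segment_compact.
  - exact: subIsetl.
have cI : closed ((fun x : R * R => `|x.1 - x.2|) @` D).
  apply: compact_closed; first exact: Rhausdorff.
  by apply: continuous_compact => //; exact: continuous_subspaceT.
have n0 : ~ ((fun x : R * R => `|x.1 - x.2|) @` D) 0.
  move=> [[a b] [/= _ H] /eqP]; rewrite normr_eq0 subr_eq0 => /eqP ab.
  by move: H; rewrite ab subrr normr0 leNgt eta0.
have := open_nbhs_nbhs (conj (closed_openC cI) n0) => /nbhs_ballP[d /= d0 Hd].
exists d => // a b aM bM abd; rewrite ltNge; apply/negP => H.
apply: (Hd `|a - b|); last by exists (a, b).
by rewrite -ball_normE/= sub0r normrN normr_id.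
Qed.

(** Uniform continuity handles small |a - b|; for the others the bounded
    difference is absorbed, since |a - b|^q is bounded below. *)
Lemma power_modulus (phi : R -> R) (M q : R) : continuous phi -> 0 < q ->
  forall eta : R, 0 < eta -> exists2 K : R, 0 <= K &
    forall a b, `|a| <= M -> `|b| <= M ->
      `|phi a - phi b| <= eta + K * `|a - b| `^ q.
Proof.
move=> cphi q0 eta eta0.
have [d d0 Hd] := uniform_modulus M cphi eta0.
have /compact_bounded[C0 [_ HC0]] : compact (phi @` `[- M, M]%classic).
  by apply: continuous_compact; [exact: continuous_subspaceT|exact: segment_compact].
pose C := `|C0| + 1.
have HC a : `|a| <= M -> `|phi a| <= C.
  move=> aM; apply: (HC0 C); first by rewrite /C (le_lt_trans (ler_norm _))// ltrDl.
  by exists a => //=; rewrite in_itv/= -ler_norml.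
have dq0 : 0 < d `^ q by exact: powR_gt0.
have C_0 : 0 <= C by exact: addr_ge0.
exists (2 * C / d `^ q); first by rewrite divr_ge0 ?mulr_ge0// ltW.
move=> a b aM bM; have [abd|dab] := ltP `|a - b| d.
  by rewrite (le_trans (ltW (Hd _ _ aM bM abd)))// lerDl mulr_ge0 ?powR_ge0// divr_ge0 ?mulr_ge0// ltW.
apply: (@le_trans _ _ (2 * C)).
  apply: le_trans (ler_normB _ _) _; rewrite mulr_natl mulr2n lerD//; exact: HC.
apply: (@le_trans _ _ (2 * C / d `^ q * `|a - b| `^ q)); last by rewrite lerDr ltW.
rewrite mulrAC ler_pdivlMr// ler_wpM2l ?mulr_ge0//.
by apply: ler_powR2 => //; exact: ltW.
Qed.

End uniform_modulus.

Section integration_by_parts.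
Context {R : realType} {n : nat}.
Local Notation V := ('rV[R]_n * measurableTypeR R)%type.

Lemma ig_support (P : 'rV[R]_n * R -> R) N : continuous P ->
  (forall z, N < `|z| -> P z = 0) -> ig lebV (P : V -> R).
Proof.
move=> cP PN; have [C C0 HC] := bounded_of_support cP PN.
apply: (@ig_bdd _ _ _ _ (ballV N) C).
- exact: measurable_ballV.
- exact: lebV_ballV.
- exact: measurable_continuous_rVR.
- by move=> z _; exact: HC.
- by move=> z /negP; rewrite -ltNge; exact: PN.
Qed.

(** Translation invariance, differentiated: the difference quotients of P
    integrate to 0 and converge boundedly to the derivative. *)
Lemma I_derive_eq0 (P : 'rV[R]_n * R -> R) dP N v : C1 P dP ->
  (forall z, N < `|z| -> P z = 0) -> \int[lebV]_(z in [set: V]) dP z v = 0.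
Proof.
move=> CP PN; have [cP DP cdP] := CP.
have dPN := C1_support CP PN.
have [D D0 HD] := bounded_of_support (cdP v) (dPN v).
pose t (j : nat) : R := j.+1%:R^-1.
have t0 j : t j != 0 by rewrite gt_eqF// invr_gt0.
have tc : t j @[j --> \oo] --> 0.
  apply/cvgr0Pnorm_le => e e0; near=> j; rewrite ger0_norm ?invr_ge0//; apply/ltW.
  by near: j; exact: (near_infty_natSinv_lt (PosNum e0)).
pose f_ j (z : V) := (t j)^-1 * (P (t j *: v + z) - P z).
have igP := ig_support cP PN.
have igPt j : ig lebV (fun z : V => P (t j *: v + z)).
  have := ig_addV (t j *: v : V) igP; congr ig.
  by apply/funext => z; rewrite addrC.
have I0 j : \int[lebV]_z f_ j z = 0.
  rewrite /f_ I_Z; last exact: igB.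
  rewrite (I_B (igPt j) igP) -[X in _ - X](I_addV (t j *: v : V) igP).
  have -> : \int[lebV]_z P (t j *: v + z) = \int[lebV]_z P (z + t j *: v).
    by apply: eq_Rintegral => z _; rewrite addrC.
  by rewrite subrr mulr0.
have [|||_] := @I_dct _ _ _ lebV f_ (fun z => dP z v)
  (fun z => D * \1_(ballV (N + `|v|) : set V) z)
  (fun j => ig_meas (igZ _ (igB (igPt j) igP)))
  (measurable_continuous_rVR (cdP v)) _ _ _.
- move=> z; have [Dz dz] := DP z v.
  have : h^-1 *: ((P \o shift z) (h *: v) - P z) @[h --> 0^'] --> dP z v.
    by rewrite -dz; exact: Dz.
  by move=> /cvgr_dnbhsP /(_ t (conj t0 tc)).
- apply: igZ; apply: (@ig_bdd _ _ _ _ (ballV (N + `|v|)) 1).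
  + exact: measurable_ballV.
  + exact: lebV_ballV.
  + by apply: measurable_indic; exact: measurable_ballV.
  + by move=> z zB; rewrite indicE mem_set// normr1.
  + by move=> z zB; rewrite indicE memNset.
- move=> j z; rewrite indicE; have [zB|zB] := boolP (z \in _).
    rewrite mulr1 normrM normfV ler_pdivrMl ?normr_gt0// mulrC.
    by apply: C1_mvt_le => // y; exact: DP.
  have zN : N + `|v| < `|z| by rewrite ltNge; apply/negP => zN; move: zB; rewrite mem_set.
  rewrite mulr0 /f_ !PN ?subrr ?mulr0 ?normr0//.
    by rewrite (le_lt_trans _ zN)// lerDl.
  have t1 : `|t j| <= 1 by rewrite ger0_norm ?invr_ge0// invf_le1// ler1n.
  have : `|t j *: v| <= `|v| by rewrite normrZ ler_piMl.
  have := ler_normB (t j *: v + z) (t j *: v); rewrite addrAC subrr add0r.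
  move=> H1 H2; rewrite ltNge; apply/negP => H3; move: zN; rewrite ltNge => /negP; apply.
  by rewrite (le_trans H1)// lerD.
- under eq_fun do rewrite I0; move=> /cvg_lim <- //; exact: lim_cst.
Unshelve. all: end_near. Qed.

End integration_by_parts.

Section L1null.
Context {R : realType} {n : nat}.
Local Notation V := ('rV[R]_n * measurableTypeR R)%type.
Implicit Types (A B : R -> V -> R).

(** Convergence to 0 with the size of the mollifying kernel; the threshold lets
    measurability and integrability fail for large kernels. *)
Definition L1null A := forall d : R, 0 < d -> exists2 e0 : R, 0 < e0 &
  forall e, 0 < e <= e0 -> ig lebV (A e) /\ \int[lebV]_z `|A e z| <= d.

Definition Lqnull q A := forall d : R, 0 < d -> exists2 e0 : R, 0 < e0 &
  forall e, 0 < e <= e0 -> measurable_fun setT (A e) /\ (Nq q (A e) <= d%:E)%E.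

Definition Lqbounded q A := exists2 C : R, 0 <= C & exists2 e0 : R, 0 < e0 &
  forall e, 0 < e <= e0 -> measurable_fun setT (A e) /\ (Nq q (A e) <= C%:E)%E.

Lemma Nq_ig q (F : V -> R) C : measurable_fun setT F -> (Nq q F <= C%:E)%E ->
  ig lebV (fun z => `|F z| `^ q) /\ \int[lebV]_z (`|F z| `^ q) <= C.
Proof.
by move=> mF NF; apply: ig_ge0 => //; exact: measurable_powR_norm.
Qed.

Lemma L1null_D A B : L1null A -> L1null B -> L1null (fun e z => A e z + B e z).
Proof.
move=> nA nB d d0; have d20 : 0 < d / 2 by rewrite divr_gt0.
have [e1 e10 H1] := nA _ d20; have [e2 e20 H2] := nB _ d20.
exists (Num.min e1 e2); first by rewrite lt_min e10.
move=> e; rewrite le_min => /and3P[ep ee1 ee2].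
have [|iA IA] := H1 e; first by rewrite ep.
have [|iB IB] := H2 e; first by rewrite ep.
split; first exact: igD.
rewrite [leRHS]splitr; apply: le_trans (lerD IA IB).
rewrite -I_D; [|exact: ig_abs|exact: ig_abs].
apply: I_le; [by apply: ig_abs; exact: igD|by apply: igD; exact: ig_abs|].
by move=> z; exact: ler_normD.
Qed.

Lemma L1null_sum (J : Type) (s : seq J) (A : J -> R -> V -> R) :
  (forall j, L1null (A j)) -> L1null (fun e z => \sum_(j <- s) A j e z).
Proof.
move=> nA; elim: s => [|j s IH].
  move=> d d0; exists 1 => // e _; under eq_fun do rewrite big_nil.
  split; first exact: ig0.
  under eq_Rintegral do rewrite big_nil normr0.
  by rewrite I_0 ltW.
have := L1null_D (nA j) IH; congr L1null.
by apply/funext => e; apply/funext => z; rewrite big_cons.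
Qed.

Lemma L1null_I (a_ : R -> V -> R) (a : V -> R) : ig lebV a ->
  L1null (fun e z => a_ e z - a z) ->
  forall d : R, 0 < d -> exists2 e0 : R, 0 < e0 & forall e, 0 < e <= e0 ->
    `|\int[lebV]_z a_ e z - \int[lebV]_z a z| <= d.
Proof.
move=> iga na d d0; have [e0 e00 H] := na d d0; exists e0 => // e /H[igd Id].
have igae : ig lebV (a_ e).
  have := igD igd iga; congr ig; apply/funext => z; by rewrite subrK.
by rewrite -(I_B igae iga); apply: le_trans (I_abs igd) Id.
Qed.

Lemma young_scaled (p q s x y : R) : 0 < p -> 0 < q -> p^-1 + q^-1 = 1 -> 0 < s ->
  `|x * y| <= s^-1 `^ p * `|x| `^ p + s `^ q * `|y| `^ q.
Proof.
move=> p0 q0 pq s0.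
have si0 : 0 < s^-1 by rewrite invr_gt0.
have := conjugate_powR (mulr_ge0 (ltW si0) (normr_ge0 x)) (mulr_ge0 (ltW s0) (normr_ge0 y)) p0 q0 pq.
have -> : s^-1 * `|x| * (s * `|y|) = `|x * y|.
  by rewrite normrM mulrACA mulVf ?gt_eqF// mul1r.
rewrite !powRM ?(ltW si0) ?(ltW s0)// => H; apply: le_trans H _.
have p1 : p^-1 <= 1 by rewrite -pq lerDl invr_ge0 ltW.
have q1 : q^-1 <= 1 by rewrite -pq lerDr invr_ge0 ltW.
by apply: lerD; rewrite ler_piMr// mulr_ge0// powR_ge0.
Qed.

(** A product of an L^p-null and an L^q-bounded family is L^1-null, for
    conjugate exponents: Young's inequality with a small weight. *)
Lemma L1null_M (p q : R) A B : 0 < p -> 0 < q -> p^-1 + q^-1 = 1 ->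
  Lqnull p A -> Lqbounded q B -> L1null (fun e z => A e z * B e z).
Proof.
move=> p0 q0 pq nA [C C0 [e1 e10 HB]] d d0.
have d20 : 0 < d / 2 by rewrite divr_gt0.
have dC : 0 < d / 2 / (C + 1) by rewrite divr_gt0// ltr_wpDl.
have [s s0 Hs] := powR_small q0 dC.
have sp0 : 0 < s^-1 `^ p by rewrite powR_gt0// invr_gt0.
have ds0 : 0 < d / 2 / s^-1 `^ p by rewrite divr_gt0.
have [e2 e20 HA] := nA _ ds0.
exists (Num.min e1 e2); first by rewrite lt_min e10.
move=> e; rewrite le_min => /and3P[ep ee1 ee2].
have [|mB NB] := HB e; first by rewrite ep.
have [|mA NA] := HA e; first by rewrite ep.
have [iB IB] := Nq_ig mB NB; have [iA IA] := Nq_ig mA NA.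
have dom z : `|A e z * B e z| <= s^-1 `^ p * `|A e z| `^ p + s `^ q * `|B e z| `^ q.
  exact: young_scaled.
have igdom := igD (igZ (s^-1 `^ p) iA) (igZ (s `^ q) iB).
have igAB : ig lebV (fun z => A e z * B e z).
  by apply: (ig_dom _ dom igdom); exact: measurable_funM.
split => //; apply: (le_trans (I_le (ig_abs igAB) igdom dom)).
rewrite I_D; [|exact: igZ|exact: igZ]; rewrite (I_Z _ iA) (I_Z _ iB).
rewrite [leRHS]splitr; apply: lerD.
  apply: (@le_trans _ _ (s^-1 `^ p * (d / 2 / s^-1 `^ p))).
    by rewrite ler_wpM2l// ltW.
  by rewrite mulrC divfK// gt_eqF.
have Hs' : s `^ q <= d / 2 / (C + 1) by apply: Hs; rewrite ltW/=.
apply: (@le_trans _ _ (d / 2 / (C + 1) * C)).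
  by apply: ler_pM => //; [exact: powR_ge0|apply: I_ge0 => z; exact: powR_ge0].
rewrite mulrAC ler_pdivrMr ?ltr_wpDl//.
by apply: ler_wpM2l; [exact: ltW|rewrite lerDl].
Qed.

Lemma I_tail (H : V -> R) : ig lebV H -> forall d : R, 0 < d ->
  exists k : nat, ig lebV (fun z => \1_[set z | k%:R < `|H z|] z * `|H z|) /\
    \int[lebV]_z (\1_[set z | k%:R < `|H z|] z * `|H z|) <= d.
Proof.
move=> igH d d0; have igaH := ig_abs igH; have mH := ig_meas igaH.
have mS (k : nat) : measurable [set z : V | k%:R < `|H z|].
  have := mH measurableT `]k%:R, +oo[%classic (measurable_itv _).
  by rewrite setTI; congr measurable; apply/seteqP; split => z /=; rewrite in_itv/= andbT.
have mf (k : nat) : measurable_fun setT (fun z => \1_[set z | k%:R < `|H z|] z * `|H z|).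
  by apply: measurable_funM => //; exact: measurable_indic.
have f0 (k : nat) z : 0 <= \1_[set z | k%:R < `|H z|] z * `|H z|.
  by apply: mulr_ge0.
have fH (k : nat) z : `|\1_[set z | k%:R < `|H z|] z * `|H z| | <= `|H z|.
  by rewrite ger0_norm// ler_piMl// indicE lern1 leq_b1.
have [|_] := @I_dct _ _ _ lebV (fun (k : nat) z => \1_[set z | k%:R < `|H z|] z * `|H z|)
  (fun=> 0) (fun z => `|H z|) mf (measurable_cst _) _ igaH fH.
  move=> z; apply: cvg_near_cst; near=> k; rewrite indicE memNset ?mul0r//=.
  apply/negP; rewrite -leNgt; near: k; exact: nbhs_infty_ger.
rewrite I_0 => /cvgr0Pnorm_le/(_ _ d0)[k _ /(_ k (leqnn k))] /= Hk.
exists k; split; last exact: le_trans (ler_norm _) Hk.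
exact: ig_dom (mf k) (fH k) igaH.
Unshelve. all: end_near. Qed.

(** Dominated convergence for compositions with a continuous function, when
    only mean convergence of the arguments is known: where H is at most k, the
    modulus of continuity of phi is compared with a power of the increment
    (power_modulus); the rest of H has small integral (I_tail). *)
Lemma L1null_modulus (q M : R) (phi : R -> R) (H w : V -> R) (W : R -> V -> R) :
  0 < q -> continuous phi -> ig lebV H -> measurable_fun setT w ->
  (forall z, `|w z| <= M) -> (forall e z, 0 < e -> `|W e z| <= M) ->
  Lqnull q (fun e z => W e z - w z) ->
  (forall e, 0 < e -> measurable_fun setT (W e)) ->
  L1null (fun e z => H z * (phi (W e z) - phi (w z))).
Proof.
move=> q0 cphi igH mw wM WM nW mW d d0.
have d30 : 0 < d / 3 by rewrite divr_gt0.
have /compact_bounded[C0 [_ HC0]] : compact (phi @` `[- M, M]%classic).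
  by apply: continuous_compact; [exact: continuous_subspaceT|exact: segment_compact].
pose C := `|C0| + 1; have C_0 : 0 < C by rewrite ltr_wpDl.
have HC a : `|a| <= M -> `|phi a| <= C.
  move=> aM; apply: (HC0 C); first by rewrite /C (le_lt_trans (ler_norm _))// ltrDl.
  by exists a => //=; rewrite in_itv/= -ler_norml.
have igaH := ig_abs igH.
pose IH := \int[lebV]_z `|H z|; have IH0 : 0 <= IH by exact: I_ge0.
have eta0 : 0 < d / 3 / (IH + 1) by rewrite divr_gt0// ltr_wpDl.
have [K K0 HK] := power_modulus M cphi q0 eta0; set eta := d / 3 / _ in eta0 HK.
have dC : 0 < d / 3 / (2 * C) by rewrite divr_gt0// mulr_gt0.
have [k [igk Ik]] := I_tail igH dC.
have dk : 0 < d / 3 / (k%:R * K + 1) by rewrite divr_gt0// ltr_wpDl// mulr_ge0.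
have [e0 e00 He] := nW _ dk; exists e0 => // e /[dup] /He[mWw NWw] /andP[ep _].
have [igW IW] := Nq_ig mWw NWw.
pose g z := (eta * `|H z| + k%:R * K * `|W e z - w z| `^ q) +
   2 * C * (\1_[set z | k%:R < `|H z|] z * `|H z|).
have ig1 := igZ eta igaH; have ig2 := igZ (k%:R * K) igW; have ig3 := igZ (2 * C) igk.
have igg : ig lebV g := igD (igD ig1 ig2) ig3.
have mphi : measurable_fun setT phi by exact: continuous_measurable_fun.
have mA : measurable_fun setT (fun z => H z * (phi (W e z) - phi (w z))).
  apply: measurable_funM; first exact: ig_meas igH.
  by apply: measurable_funB; apply: (measurableT_comp mphi) => //; exact: mW.
have dom z : `|H z * (phi (W e z) - phi (w z))| <= g z.
  rewrite normrM /g indicE; have [Hk|Hk] := boolP (z \in _).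
    rewrite mul1r; apply: (@le_trans _ _ (2 * C * `|H z|)).
      rewrite mulrC ler_wpM2r//; apply: le_trans (ler_normB _ _) _.
      by rewrite mulr_natl mulr2n lerD// HC// WM.
    rewrite lerDr; apply: addr_ge0; first by apply: mulr_ge0; [exact: ltW|].
    by apply: mulr_ge0; [exact: mulr_ge0|exact: powR_ge0].
  have Hk' : `|H z| <= k%:R by rewrite leNgt; apply/negP => ?; move: Hk; rewrite mem_set.
  rewrite mul0r mulr0 addr0; apply: (@le_trans _ _ (`|H z| * (eta + K * `|W e z - w z| `^ q))).
    by rewrite ler_wpM2l// HK// WM.
  rewrite mulrDr [`|H z| * eta]mulrC lerD2l mulrA.
  by rewrite ler_wpM2r ?powR_ge0// ler_wpM2r.
have igA := ig_dom mA dom igg; split => //.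
apply: (le_trans (I_le (ig_abs igA) igg dom)).
rewrite (I_D (igD ig1 ig2) ig3) (I_D ig1 ig2) (I_Z _ igaH) (I_Z _ igW) (I_Z _ igk).
have -> : d = d / 3 + d / 3 + d / 3 by field.
apply: lerD; first apply: lerD.
- rewrite -/IH /eta mulrAC ler_pdivrMr ?ltr_wpDl//.
  by apply: ler_wpM2l; [exact: ltW|rewrite lerDl].
- apply: (@le_trans _ _ (k%:R * K * (d / 3 / (k%:R * K + 1)))).
    by rewrite ler_wpM2l// mulr_ge0.
  rewrite mulrC mulrAC ler_pdivrMr ?ltr_wpDl ?mulr_ge0//.
  by apply: ler_wpM2l; [exact: ltW|rewrite lerDl].
- apply: (@le_trans _ _ (2 * C * (d / 3 / (2 * C)))).
    by rewrite ler_wpM2l// ltW// mulr_gt0.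
  by rewrite mulrC divfK// gt_eqF// mulr_gt0.
Qed.

End L1null.

(** * The chain rule for weak solutions *)

Section Lq_families.
Context {R : realType} {n : nat}.
Local Notation V := ('rV[R]_n * measurableTypeR R)%type.
Implicit Types (A B : R -> V -> R) (F : V -> R).

Lemma ig_of_power (r : R) F N : 1 <= r -> measurable_fun setT F ->
  ig lebV (fun z => `|F z| `^ r) -> (forall z, N <= `|z| -> F z = 0) -> ig lebV F.
Proof.
move=> r1 mF igF FN.
apply: (@ig_dom _ _ _ _ (fun z : V => \1_(ballV N : set V) z + `|F z| `^ r)) => //.
  move=> z; rewrite indicE; have [zB|zB] := boolP (z \in _); last first.
    rewrite FN ?normr0 ?addr_ge0 ?powR_ge0// ltW// ltNge.
    by apply/negP => ?; move: zB; rewrite mem_set.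
  have [F1|F1] := leP `|F z| 1; first by rewrite (le_trans F1)// lerDl powR_ge0.
  rewrite (@le_trans _ _ (`|F z| `^ r))// ?lerDr//.
  have := ler_powR (ltW F1) r1; rewrite powRr1//.
apply: igD => //; apply: (@ig_bdd _ _ _ _ (ballV N) 1).
+ exact: measurable_ballV.
+ exact: lebV_ballV.
+ by apply: measurable_indic; exact: measurable_ballV.
+ by move=> z zB; rewrite indicE mem_set// normr1.
+ by move=> z zB; rewrite indicE memNset.
Qed.

Lemma Lqbounded_cst q F : measurable_fun setT F -> ig lebV (fun z => `|F z| `^ q) ->
  Lqbounded q (fun=> F).
Proof.
move=> mF igF; exists (\int[lebV]_z (`|F z| `^ q)).
  by apply: I_ge0 => z; exact: powR_ge0.
by exists 1 => // e _; split => //; rewrite /Nq -I_fin.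
Qed.

Lemma Lqbounded_dom q A B (c e1 : R) : 0 < q -> 0 < e1 ->
  (forall e, 0 < e <= e1 -> measurable_fun setT (A e)) ->
  (forall e z, 0 < e <= e1 -> `|A e z| <= c * `|B e z|) ->
  Lqbounded q B -> Lqbounded q A.
Proof.
move=> q0 e10 mA AB [C C0 [e2 e20 H]].
exists (`|c| `^ q * C); first by rewrite mulr_ge0 ?powR_ge0.
exists (Num.min e1 e2); first by rewrite lt_min e10.
move=> e; rewrite le_min => /and3P[ep ee1 ee2].
have ep1 : 0 < e <= e1 by rewrite ep.
have [|mB NB] := H e; first by rewrite ep.
split; first exact: mA.
apply: (@le_trans _ _ (Nq q (fun z => `|c| * B e z)%R)).
  apply: Nq_le => //; [exact: mA|exact: measurable_funM|].
  move=> z; rewrite normrM normr_id; apply: le_trans (AB e z ep1) _.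
  by rewrite ler_wpM2r// ler_norm.
rewrite /Nq.
have -> : (\int[lebV]_z (`| `|c| * B e z| `^ q)%:E =
           \int[lebV]_z (`|c| `^ q * `|B e z| `^ q)%:E)%E.
  by apply: eq_integral => z _; rewrite normrM normr_id powRM.
rewrite [leLHS](nn_Z lebV (measurable_powR_norm q mB) (fun z => powR_ge0 _ _) (powR_ge0 _ _)).
rewrite [leRHS]EFinM; exact: lee_wpmul2l.
Qed.

Lemma Lqbounded_null q A F : 0 < q -> measurable_fun setT F ->
  ig lebV (fun z => `|F z| `^ q) ->
  (forall e, 0 < e -> measurable_fun setT (A e)) ->
  Lqnull q (fun e z => A e z - F z) -> Lqbounded q A.
Proof.
move=> q0 mF igF mA nA.
have [e0 e00 He] := nA 1 ltr01.
pose C := \int[lebV]_z (`|F z| `^ q).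
have C0 : 0 <= C by apply: I_ge0 => z; exact: powR_ge0.
exists (2 `^ q * (1 + C)); first by rewrite mulr_ge0 ?powR_ge0// addr_ge0.
exists e0 => // e /[dup] /He[mAF NAF] /andP[ep _]; split; first exact: mA.
have -> : A e = fun z => (A e z - F z) + F z by apply/funext => z; rewrite subrK.
apply: le_trans (Nq_D q0 mAF mF) _; rewrite [leRHS]EFinM.
apply: lee_wpmul2l; first by rewrite lee_fin powR_ge0.
by rewrite [leRHS]EFinD; apply: leeD => //; rewrite /Nq -I_fin.
Qed.

Lemma Lqnull_conv q F (N : nat) : 1 < q -> measurable_fun setT F -> ig lebV F ->
  ig lebV (fun z => `|F z| `^ q) -> (forall z, N%:R <= `|z| -> F z = 0) ->
  Lqnull q (fun e z => conv (ker e) F z - F z).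
Proof.
move=> q1 mF igF igFq FN d d0.
have [e0 e00 He] := Nq_conv_ker q1 mF igF igFq FN d0.
exists e0 => // e /[dup] /andP[ep _] /He ?; split => //.
by apply: measurable_funB => //; exact: measurable_conv_ker.
Qed.

End Lq_families.

Section weak_chain_rule.
Context {R : realType} {n : nat}.
Local Notation V := ('rV[R]_n * measurableTypeR R)%type.

Definition dir_x (i : 'I_n) : 'rV[R]_n * R := (delta_mx ord0 i, 0).
Definition dir_t : 'rV[R]_n * R := (0, 1).

Variables (p q : R) (w : V -> R) (G Phi : 'I_n -> V -> R) (N : nat) (M e1 : R).
Variable S : set ('rV[R]_n * R).
Hypotheses (p1 : 1 < p) (q1 : 1 < q) (pq : p^-1 + q^-1 = 1) (e10 : 0 < e1).
Hypotheses (mw : measurable_fun setT w) (wM : forall z, `|w z| <= M).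
Hypothesis wN : forall z, N%:R <= `|z| -> w z = 0.
Hypothesis mG : forall i, measurable_fun setT (G i).
Hypothesis igGp : forall i, ig lebV (fun z => `|G i z| `^ p).
Hypothesis GN : forall i z, N%:R <= `|z| -> G i z = 0.
Hypothesis mPhi : forall i, measurable_fun setT (Phi i).
Hypothesis igPhiq : forall i, ig lebV (fun z => `|Phi i z| `^ q).
Hypothesis PhiN : forall i z, N%:R <= `|z| -> Phi i z = 0.
Hypothesis weak_grad : forall e dk i z, 0 < e <= e1 -> C1 (ker e) dk -> S z ->
  conv (fun h => dk h (dir_x i)) w z = - conv (ker e) (G i) z.
Hypothesis weak_eq : forall e dk z, 0 < e <= e1 -> C1 (ker e) dk -> S z ->
  conv (fun h => dk h dir_t) w z = \sum_i conv (fun h => dk h (dir_x i)) (Phi i) z.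

Variables (xi : 'rV[R]_n * R -> R) (dxi : 'rV[R]_n * R -> 'rV[R]_n * R -> R) (N2 : R).
Hypothesis Cxi : C1 xi dxi.
Hypothesis xiN : forall z, N2 < `|z| -> xi z = 0.
Hypothesis xiS : forall z, ~ S z -> xi z = 0.

Variables (B b b' : R -> R).
Hypothesis DB : forall s : R, is_derive s 1 B (b s).
Hypothesis Db : forall s : R, is_derive s 1 b (b' s).
Hypothesis cb' : continuous b'.

Let p0 : 0 < p. Proof. exact: lt_trans p1. Qed.
Let q0 : 0 < q. Proof. exact: lt_trans q1. Qed.

Let cB : continuous B. Proof. exact: continuous_is_derive DB. Qed.
Let cb : continuous b. Proof. exact: continuous_is_derive Db. Qed.

Let igw : ig lebV w.
Proof.
apply: (@ig_bdd _ _ _ _ (ballV N%:R) M) => //.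
- exact: measurable_ballV.
- exact: lebV_ballV.
- by move=> z nz; apply: wN; rewrite leNgt; apply/negP => /ltW.
Qed.

Let igG i : ig lebV (G i).
Proof. exact: ig_of_power (ltW p1) (mG i) (igGp i) (GN i). Qed.

Let igPhi i : ig lebV (Phi i).
Proof. exact: ig_of_power (ltW q1) (mPhi i) (igPhiq i) (PhiN i). Qed.

Let W e := conv (ker e) w.
Let Ge e i := conv (ker e) (G i).
Let Pe e i := conv (ker e) (Phi i).
Let Qe e (z : V) := \sum_i Pe e i z * (xi z * (b' (W e z) * Ge e i z) + dxi z (dir_x i) * b (W e z)).
Let Q (z : V) := \sum_i Phi i z * (xi z * (b' (w z) * G i z) + dxi z (dir_x i) * b (w z)).

Let dxiN v z : N2 < `|z| -> dxi z v = 0.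
Proof. exact: (C1_support Cxi xiN). Qed.

(** The classical chain rule for the mollification W e, integrated. It rests on
    two exact derivatives with zero integral: the time derivative of xi B(W) and the
    space derivatives of xi b(W) (Phi * kernel). *)
Let mollified e : 0 < e <= e1 ->
  \int[lebV]_(z in [set: V]) (dxi z dir_t * B (W e z)) = \int[lebV]_z Qe e z.
Proof.
move=> ee1; have /andP[ep _] := ee1.
have [dk [Ck dkD]] := @ker_C1_bounded R n e ep.
have [C C0 HC] := @ker_bounded R n e ep.
have CW := conv_C1 Ck HC dkD igw.
have CP i := conv_C1 Ck HC dkD (igPhi i).
have C1P := C1_M Cxi (C1_comp CW DB cb).
have C2P i := C1_M (C1_M Cxi (C1_comp CW Db cb')) (CP i).
have z1 z : N2 < `|z| -> xi z * B (W e z) = 0 by move=> /xiN ->; rewrite mul0r.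
have z2 i z : N2 < `|z| -> xi z * b (W e z) * Pe e i z = 0.
  by move=> /xiN ->; rewrite !mul0r.
have I1 := I_derive_eq0 dir_t C1P z1.
have I2 i := I_derive_eq0 (dir_x i) (C2P i) (z2 i).
have ig1 : ig lebV _ := let: And3 _ _ c := C1P in ig_support (c dir_t) (C1_support C1P z1 dir_t).
have ig2 i : ig lebV _ := let: And3 _ _ c := C2P i in
  ig_support (c (dir_x i)) (C1_support (C2P i) (z2 i) (dir_x i)).
have ig0 : ig lebV (fun z : V => dxi z dir_t * B (W e z)).
  apply: (@ig_support _ _ _ N2).
    have [_ _ cdxi] := Cxi; have [cW _ _] := CW.
    move=> z; apply: cvgM; first exact: cdxi.
    by apply: continuous_comp; [exact: cW|exact: cB].
  by move=> z zN; rewrite dxiN// mul0r.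
have E (z : V) : Qe e z = dxi z dir_t * B (W e z)
  - (xi z * (b (W e z) * - conv (fun h => dk h dir_t) w z) + dxi z dir_t * B (W e z))
  + \sum_i (xi z * b (W e z) * - conv (fun h => dk h (dir_x i)) (Phi i) z
     + (xi z * (b' (W e z) * - conv (fun h => dk h (dir_x i)) w z)
        + dxi z (dir_x i) * b (W e z)) * Pe e i z).
  rewrite big_split/=.
  have -> : \sum_i xi z * b (W e z) * - conv (fun h => dk h (dir_x i)) (Phi i) z =
      xi z * b (W e z) * - conv (fun h => dk h dir_t) w z.
    have [Sz|/xiS ->] := pselect (S z); last first.
      by rewrite !mul0r big1// => i _; rewrite !mul0r.
    by rewrite (weak_eq ee1 Ck Sz) -mulr_sumr sumrN.
  have -> : \sum_i (xi z * (b' (W e z) * - conv (fun h => dk h (dir_x i)) w z)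
      + dxi z (dir_x i) * b (W e z)) * Pe e i z = Qe e z.
    apply: eq_bigr => i _; rewrite mulrC; congr (_ * (_ + _)).
    have [Sz|/xiS ->] := pselect (S z); last by rewrite !mul0r.
    by rewrite (weak_grad i ee1 Ck Sz) opprK.
  by set x := dxi z dir_t * _; set y := - conv _ w z; set t := Qe e z; ring.
under [RHS]eq_Rintegral do rewrite E.
rewrite I_D; [|exact: igB ig0 ig1|exact: ig_sum].
by rewrite I_B// I1 subr0 I_sum// big1 ?addr0.
Qed.

Let WM e z : 0 < e -> `|W e z| <= M.
Proof. by move=> ep; exact: conv_ker_le. Qed.

Let mW e : 0 < e -> measurable_fun setT (W e : V -> R).
Proof. by move=> ep; exact: measurable_conv_ker. Qed.
Let mGe e i : 0 < e -> measurable_fun setT (Ge e i : V -> R).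
Proof. by move=> ep; exact: measurable_conv_ker. Qed.
Let mxi : measurable_fun setT (xi : V -> R).
Proof. by apply: measurable_continuous_rVR; case: Cxi. Qed.
Let mdxi v : measurable_fun setT ((fun z => dxi z v) : V -> R).
Proof. by apply: measurable_continuous_rVR; case: Cxi => _ _; exact. Qed.
Let mcomp (f : R -> R) (g : V -> R) : continuous f -> measurable_fun setT g ->
  measurable_fun setT (fun z => f (g z)).
Proof.
move=> cf mg; apply: measurableT_comp => //; exact: continuous_measurable_fun.
Qed.

Let wq : ig lebV (fun z => `|w z| `^ q).
Proof.
apply: (@ig_bdd _ _ _ _ (ballV N%:R) (M `^ q)) => //.
- exact: measurable_ballV.
- exact: lebV_ballV.
- exact: measurable_powR_norm.
- move=> z _; rewrite ger0_norm ?powR_ge0//; apply: ler_powR2 => //; exact: ltW.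
- move=> z nz; rewrite wN ?normr0 ?powR0 ?gt_eqF// leNgt; apply/negP => /ltW.
  exact: nz.
Qed.

Let nW : Lqnull q (fun e z => W e z - w z).
Proof. exact: (Lqnull_conv q1 mw igw wq wN). Qed.

Let nG i : Lqnull p (fun e z => Ge e i z - G i z).
Proof. exact: Lqnull_conv (GN i). Qed.

Let nP i : Lqnull q (fun e z => Pe e i z - Phi i z).
Proof. exact: Lqnull_conv (PhiN i). Qed.

Let bound (f : R -> R) : continuous f -> exists2 C, 0 <= C & forall a, `|a| <= M -> `|f a| <= C.
Proof.
move=> cf.
have /compact_bounded[C0 [_ HC0]] : compact (f @` `[- M, M]%classic).
  by apply: continuous_compact; [exact: continuous_subspaceT|exact: segment_compact].
exists (`|C0| + 1); first exact: addr_ge0.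
move=> a aM; apply: (HC0 (`|C0| + 1)); first by rewrite (le_lt_trans (ler_norm _))// ltrDl.
by exists a => //=; rewrite in_itv/= -ler_norml.
Qed.

(** The difference of products is telescoped so that each term carries exactly
    one factor tending to 0 in L^p or L^q, or one composition treated by
    L1null_modulus. *)
Let limit : L1null (fun e z => Qe e z - Q z).
Proof.
have [Cb Cb0 HCb] := bound cb; have [Cb' Cb'0 HCb'] := bound cb'.
have [cxi _ cdxi] := Cxi.
have [X X0 HX] := bounded_of_support cxi xiN.
(* Each line has one factor that tends to 0; the products of limits are only
   integrable by Young's inequality. *)
pose T i (e : R) (z : V) :=
    ((Pe e i z - Phi i z) * (xi z * (b' (W e z) * Ge e i z))
     + (Ge e i z - G i z) * (xi z * b' (W e z) * Phi i z))
   + (xi z * G i z * Phi i z) * (b' (W e z) - b' (w z))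
   + (Pe e i z - Phi i z) * (dxi z (dir_x i) * b (W e z))
   + (Phi i z * dxi z (dir_x i)) * (b (W e z) - b (w z)).
have -> : (fun e z => Qe e z - Q z) = (fun e z => \sum_i T i e z).
  apply/funext => e; apply/funext => z; rewrite /Qe /Q -sumrB.
  by apply: eq_bigr => i _; rewrite /T; ring.
apply: L1null_sum => i.
have qp : q^-1 + p^-1 = 1 by rewrite addrC.
have igxi r : 0 < r -> ig lebV (fun z : V => `|dxi z (dir_x i)| `^ r).
  move=> r0; have [D D0 HD] := bounded_of_support (cdxi (dir_x i)) (dxiN (dir_x i)).
  apply: (@ig_bdd _ _ _ _ (ballV N2) (D `^ r)).
  - exact: measurable_ballV.
  - exact: lebV_ballV.
  - exact: measurable_powR_norm.
  - move=> z _; rewrite ger0_norm ?powR_ge0//; apply: ler_powR2 => //; exact: ltW.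
  - by move=> z /negP; rewrite -ltNge => zN; rewrite dxiN// normr0 powR0// gt_eqF.
have bdG : Lqbounded p (fun e z => Ge e i z).
  by apply: (Lqbounded_null p0 (mG i) (igGp i) _ (nG i)) => e ep; exact: mGe.
apply: L1null_D; first apply: L1null_D; first apply: L1null_D; first apply: L1null_D.
- apply: (L1null_M q0 p0 qp (nP i)).
  apply: (Lqbounded_dom (c := X * Cb') (e1 := 1) p0 ltr01 _ _ bdG).
    move=> e /andP[ep _]; apply: measurable_funM => //; apply: measurable_funM; last exact: mGe.
    by apply: mcomp => //; exact: mW.
  move=> e z /andP[ep _]; rewrite mulrA normrM ler_wpM2r// normrM ler_pM//.
  by apply: HCb'; exact: WM.
- apply: (L1null_M p0 q0 pq (nG i)).
  apply: (Lqbounded_dom (c := X * Cb') (e1 := 1) q0 ltr01 _ _ (Lqbounded_cst (mPhi i) (igPhiq i))).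
    move=> e /andP[ep _]; apply: measurable_funM => //; apply: measurable_funM => //.
    by apply: mcomp => //; exact: mW.
  move=> e z /andP[ep _]; rewrite normrM ler_wpM2r// normrM ler_pM//.
  by apply: HCb'; exact: WM.
- apply: (L1null_modulus q0 cb' _ mw wM (fun e z ep => WM z ep) nW mW).
  apply: (@ig_dom _ _ _ _ (fun z => X * (`|G i z| `^ p + `|Phi i z| `^ q))).
  + by apply: measurable_funM => //; exact: measurable_funM.
  + move=> z; rewrite -mulrA normrM ler_pM//.
    have := young_scaled (G i z) (Phi i z) p0 q0 pq ltr01.
    by rewrite invr1 !powR1 !mul1r.
  + by apply: igZ; exact: igD.
- apply: (L1null_M q0 p0 qp (nP i)).
  apply: (Lqbounded_dom (c := Cb) (e1 := 1) p0 ltr01 _ _ (Lqbounded_cst (mdxi (dir_x i)) (igxi p p0))).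
    move=> e /andP[ep _]; apply: measurable_funM => //.
    by apply: mcomp => //; exact: mW.
  move=> e z /andP[ep _]; rewrite normrM mulrC ler_wpM2r//.
  by apply: HCb; exact: WM.
- apply: (L1null_modulus q0 cb _ mw wM (fun e z ep => WM z ep) nW mW).
  apply: (@ig_dom _ _ _ _ (fun z : V => `|dxi z (dir_x i)| `^ p + `|Phi i z| `^ q)).
  + exact: measurable_funM.
  + move=> z; rewrite mulrC.
    have := young_scaled (dxi z (dir_x i)) (Phi i z) p0 q0 pq ltr01.
    by rewrite invr1 !powR1 !mul1r.
  + by apply: igD => //; exact: igxi.
Qed.

Let igQ : ig lebV Q.
Proof.
have [d0 _ H] := limit ltr01.
have [cxi _ cdxi] := Cxi.
have [X X0 HX] := bounded_of_support cxi xiN.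
have [Cb Cb0 HCb] := bound cb; have [Cb' Cb'0 HCb'] := bound cb'.
apply: ig_sum => i.
have [D D0 HD] := bounded_of_support (cdxi (dir_x i)) (dxiN (dir_x i)).
apply: (@ig_dom _ _ _ _ (fun z => X * Cb' * (`|G i z| `^ p + `|Phi i z| `^ q) + D * Cb * `|Phi i z|)).
- apply: measurable_funM => //; apply: measurable_funD; apply: measurable_funM => //.
    by apply: measurable_funM => //; exact: mcomp.
  exact: mcomp.
- move=> z; rewrite mulrDr; apply: (le_trans (ler_normD _ _)); apply: lerD.
    have -> : Phi i z * (xi z * (b' (w z) * G i z)) = xi z * b' (w z) * (G i z * Phi i z) by ring.
    rewrite normrM; apply: ler_pM => //; first by rewrite normrM ler_pM// HCb'.
    have := young_scaled (G i z) (Phi i z) p0 q0 pq ltr01.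
    by rewrite invr1 !powR1 !mul1r.
  by rewrite mulrC normrM ler_wpM2r// normrM ler_pM// HCb.
- apply: igD; apply: igZ; first exact: igD.
  by apply: ig_abs; exact: igPhi.
Qed.

(** Chain rule for a weak solution of w_t = div Phi, by passing to the limit in
    mollified. The equations are required only at the points of S, away from which
    xi vanishes: a solution on a time interval cannot be mollified at the ends. *)
Lemma weak_chain_rule : ig lebV Q /\
  \int[lebV]_(z in [set: V]) (dxi z dir_t * B (w z)) = \int[lebV]_z Q z.
Proof.
split => //; apply/eqP; rewrite -subr_eq0 -normr_le0; apply/ler_addgt0Pr => d d0.
rewrite add0r.
have [cxi _ cdxi] := Cxi.
have d20 : 0 < d / 2 by rewrite divr_gt0.
have igdxi : ig lebV (fun z : V => dxi z dir_t) by apply: ig_support (cdxi dir_t) (dxiN dir_t).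
have [CB CB0 HCB] := bound cB.
have igA : ig lebV (fun z : V => dxi z dir_t * B (w z)).
  apply: (@ig_dom _ _ _ _ (fun z : V => CB * `|dxi z dir_t|)).
  - by apply: measurable_funM => //; exact: mcomp.
  - by move=> z; rewrite normrM mulrC ler_wpM2r// HCB.
  - by apply: igZ; exact: ig_abs.
have nA : L1null (fun e z => dxi z dir_t * B (W e z) - dxi z dir_t * B (w z)).
  have := L1null_modulus q0 cB igdxi mw wM (fun e z ep => WM z ep) nW mW.
  by congr L1null; apply/funext => e; apply/funext => z; rewrite mulrBr.
have [ea ea0 Ha] := L1null_I igA nA d20.
have [eb eb0 Hb] := L1null_I igQ limit d20.
pose e := Num.min e1 (Num.min ea eb).
have ep : 0 < e by rewrite !lt_min e10 ea0.
have ee1 : 0 < e <= e1 by rewrite ep ge_min lexx.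
have eea : 0 < e <= ea by rewrite ep !ge_min lexx orbT.
have eeb : 0 < e <= eb by rewrite ep !ge_min lexx !orbT.
have := Ha e eea; have := Hb e eeb; rewrite -(mollified ee1).
set x := \int[lebV]_z (dxi z dir_t * B (W e z)).
set y := \int[lebV]_z (dxi z dir_t * B (w z)); set y' := \int[lebV]_z Q z.
move=> h1 h2; rewrite (_ : y - y' = (x - y') - (x - y)); last by ring.
by rewrite [leRHS]splitr (le_trans (ler_normB _ _))// lerD.
Qed.

End weak_chain_rule.

(** * Bounded weak solutions *)

Section weak_sol.

Context {R : realType} {n : nat}.
Local Notation V := ('rV[R]_n * measurableTypeR R)%type.
Implicit Types (F H : V -> R).

Definition locally_Lp (r : R) (F : V -> R) := measurable_fun setT F /\
  forall N : R, ig lebV (fun z => \1_(ballVo N : set V) z * `|F z| `^ r).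

(** Bounded weak solutions of w_t = div Phi with spatial gradient G on ]0, T[,
    tested against the mollifying kernels only: these are the test functions that the
    chain rule needs. *)
Record weak_sol (p q T M : R) (w : V -> R) (G Phi : 'I_n -> V -> R) : Prop := {
  ws_meas : measurable_fun setT w;
  ws_bound : forall z, `|w z| <= M;
  ws_grad_Lp : forall i, locally_Lp p (G i);
  ws_flux_Lq : forall i, locally_Lp q (Phi i);
  ws_grad : forall e dk i (z : 'rV[R]_n * R), 0 < e -> C1 (ker e) dk ->
    0 < z.2 - e -> z.2 + e < T ->
    conv (fun h => dk h (dir_x i)) w z = - conv (ker e) (G i) z;
  ws_eq : forall e dk (z : 'rV[R]_n * R), 0 < e -> C1 (ker e) dk ->
    0 < z.2 - e -> z.2 + e < T ->
    conv (fun h => dk h dir_t) w z = \sum_i conv (fun h => dk h (dir_x i)) (Phi i) z }.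

Lemma indic_ballVo_in (N : R) (z : V) : `|z| < N -> \1_(ballVo N : set V) z = 1 :> R.
Proof. by move=> zN; rewrite indicE mem_set. Qed.

Lemma indic_ballVo_out (N : R) (z : V) : N <= `|z| -> \1_(ballVo N : set V) z = 0 :> R.
Proof. by move=> zN; rewrite indicE memNset// /ballVo/= ltNge zN. Qed.

Lemma measurable_indic_ballVo (N : R) : measurable_fun setT (\1_(ballVo N : set V) : V -> R).
Proof. by apply: measurable_indic; exact: measurable_ballVo. Qed.

Lemma ig_indic_ballVo (N : R) : ig lebV (\1_(ballVo N : set V) : V -> R).
Proof.
apply: (@ig_bdd _ _ _ _ (ballV N) 1).
- exact: measurable_ballV.
- exact: lebV_ballV.
- exact: measurable_indic_ballVo.
- by move=> z _; rewrite ger0_norm ?indicE ?lern1 ?leq_b1.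
- move=> z /negP; rewrite -ltNge => /ltW; exact: indic_ballVo_out.
Qed.

Lemma locally_Lp_ig (r : R) F N : 1 <= r -> locally_Lp r F ->
  ig lebV (fun z => \1_(ballVo N : set V) z * F z).
Proof.
move=> r1 [mF igF].
apply: (@ig_dom _ _ _ _ (fun z => \1_(ballVo N : set V) z + \1_(ballVo N : set V) z * `|F z| `^ r)).
- by apply: measurable_funM => //; exact: measurable_indic_ballVo.
- move=> z; have [zN|zN] := ltP `|z| N; last first.
    by rewrite indic_ballVo_out// !mul0r normr0 addr0.
  rewrite indic_ballVo_in// !mul1r.
  have [F1|F1] := leP `|F z| 1; first by rewrite (le_trans F1)// lerDl powR_ge0.
  rewrite (@le_trans _ _ (`|F z| `^ r))// ?lerDr//.
  by have := ler_powR (ltW F1) r1; rewrite powRr1.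
- by apply: igD => //; exact: ig_indic_ballVo.
Qed.

Lemma locally_Lp_bounded (r M : R) F : 0 <= r -> measurable_fun setT F ->
  (forall z, `|F z| <= M) -> locally_Lp r F.
Proof.
move=> r0 mF FM; split => // N.
apply: (@ig_dom _ _ _ _ (fun z => M `^ r * \1_(ballVo N : set V) z)).
- apply: measurable_funM; first exact: measurable_indic_ballVo.
  exact: measurable_powR_norm.
- move=> z; rewrite normrM mulrC (ger0_norm (powR_ge0 _ _)) ger0_norm ?indicE//.
  by rewrite ler_wpM2r//; apply: ler_powR2.
- by apply: igZ; exact: ig_indic_ballVo.
Qed.

Lemma locally_Lp_D (r : R) F H : 0 <= r -> locally_Lp r F -> locally_Lp r H ->
  locally_Lp r (fun z => F z + H z).
Proof.
move=> r0 [mF igF] [mH igH]; split; first exact: measurable_funD.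
move=> N; apply: (@ig_dom _ _ _ _ (fun z => 2 `^ r *
  (\1_(ballVo N : set V) z * `|F z| `^ r + \1_(ballVo N : set V) z * `|H z| `^ r))).
- apply: measurable_funM; first exact: measurable_indic_ballVo.
  by apply: measurable_powR_norm; exact: measurable_funD.
- move=> z; rewrite normrM (ger0_norm (powR_ge0 _ _)) ger0_norm ?indicE//.
  by rewrite -mulrDr mulrCA ler_wpM2l// powR_D_le.
- by apply: igZ; exact: igD.
Qed.

Lemma locally_Lp_N (r : R) F : locally_Lp r F -> locally_Lp r (fun z => - F z).
Proof.
move=> [mF igF]; split; first exact: measurableT_comp.
by move=> N; under eq_fun do rewrite normrN.
Qed.

Lemma locally_Lp_B (r : R) F H : 0 <= r -> locally_Lp r F -> locally_Lp r H ->
  locally_Lp r (fun z => F z - H z).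
Proof. by move=> r0 lF lH; apply: locally_Lp_D => //; exact: locally_Lp_N. Qed.

Lemma ig_conv_loc r F k e (z : 'rV[R]_n * R) : 1 <= r -> locally_Lp r F -> continuous k ->
  (forall h, e < `|h| -> k h = 0) -> ig lebV (fun y : V => F y * k (y - z)).
Proof.
move=> r1 lF ck ke; have [C C0 HC] := bounded_of_support ck ke.
pose N := `|z| + `|e| + 1.
apply: (@ig_dom _ _ _ _ (fun y => C * `|\1_(ballVo N : set V) y * F y|)).
- by apply: measurable_funM; [case: lF|exact: measurable_shift_cts].
- move=> y; have [yN|yN] := ltP `|y| N.
    by rewrite indic_ballVo_in// mul1r normrM mulrC ler_wpM2r.
  rewrite ke ?mulr0 ?normr0 ?mulr_ge0//.
  have := ler_distD z y 0; rewrite !subr0 => H.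
  apply: (le_lt_trans (ler_norm _)); rewrite -(ltrD2r `|z|); apply: lt_le_trans H.
  by apply: lt_le_trans yN; rewrite /N addrC ltrDl.
- by apply: igZ; apply: ig_abs; exact: locally_Lp_ig lF.
Qed.

Lemma conv_B r F H k e (z : 'rV[R]_n * R) : 1 <= r -> locally_Lp r F -> locally_Lp r H ->
  continuous k -> (forall h, e < `|h| -> k h = 0) ->
  conv k (fun y => F y - H y) z = conv k F z - conv k H z.
Proof.
move=> r1 lF lH ck ke.
rewrite /conv -(I_B (ig_conv_loc z r1 lF ck ke) (ig_conv_loc z r1 lH ck ke)).
by apply: eq_Rintegral => y _; rewrite mulrBl.
Qed.

(** The point of formulating the notion with an arbitrary flux Phi: it is
    linear in (w, G, Phi), although the flux of a solution depends nonlinearly on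
    the gradient. *)
Lemma weak_sol_B p q T M M' w w' G G' Phi Phi' : 1 <= p -> 1 <= q ->
  weak_sol p q T M w G Phi -> weak_sol p q T M' w' G' Phi' ->
  weak_sol p q T (M + M') (fun z => w z - w' z) (fun i z => G i z - G' i z)
    (fun i z => Phi i z - Phi' i z).
Proof.
move=> p1 q1 [mw wM lG lP gr eq] [mw' wM' lG' lP' gr' eq'].
have p0 : 0 <= p := le_trans ler01 p1; have q0 : 0 <= q := le_trans ler01 q1.
have lw := locally_Lp_bounded p0 mw wM; have lw' := locally_Lp_bounded p0 mw' wM'.
split.
- exact: measurable_funB.
- by move=> z; apply: (le_trans (ler_normB _ _)); exact: lerD.
- by move=> i; exact: locally_Lp_B.
- by move=> i; exact: locally_Lp_B.
- move=> e dk i z e0 Ck z1 z2; have [ck _ cdk] := Ck.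
  have ks (h : 'rV[R]_n * R) : e < `|h| -> ker e h = 0 by exact: ker_support.
  have ds v h := C1_support Ck ks v (z := h).
  rewrite (conv_B z p1 lw lw' (cdk _) (ds _)) (conv_B z p1 (lG i) (lG' i) ck ks).
  by rewrite (gr e dk)// (gr' e dk)// opprB addrC opprK.
- move=> e dk z e0 Ck z1 z2; have [ck _ cdk] := Ck.
  have ks (h : 'rV[R]_n * R) : e < `|h| -> ker e h = 0 by exact: ker_support.
  have ds v h := C1_support Ck ks v (z := h).
  rewrite (conv_B z p1 lw lw' (cdk _) (ds _)) (eq e dk)// (eq' e dk)// -sumrB.
  by apply: eq_bigr => i _; rewrite (conv_B z q1 (lP i) (lP' i) (cdk _) (ds _)).
Qed.

Lemma conv_cut k e F N (z : 'rV[R]_n * R) : (forall h, e < `|h| -> k h = 0) ->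
  `|z| + e < N -> conv k (fun y => \1_(ballVo N : set V) y * F y) z = conv k F z.
Proof.
move=> ke zN; apply: eq_Rintegral => y _.
have [yN|yN] := ltP `|y| N; first by rewrite indic_ballVo_in// mul1r.
rewrite ke ?mulr0//.
have := ler_distD z y 0; rewrite !subr0 => H.
rewrite -(ltrD2r `|z|); apply: lt_le_trans H.
by apply: lt_le_trans yN; rewrite addrC.
Qed.

Lemma exists_small_pos (a : R) : 0 < a -> exists e : R, [/\ 0 < e, e < a & e <= 1].
Proof.
move=> a0; have m0 : 0 < Num.min a 1 by rewrite lt_min a0 ltr01.
have m2 : Num.min a 1 / 2 < Num.min a 1 by rewrite gtr_pMr// invf_lt1 ?ltr1n.
exists (Num.min a 1 / 2); split; first by rewrite divr_gt0.
  by apply: lt_le_trans m2 _; rewrite ge_min lexx.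
by apply: ltW; apply: lt_le_trans m2 _; rewrite ge_min lexx orbT.
Qed.

(** The global integrability required by weak_chain_rule is obtained by
    truncating all functions to a ball which contains the support of xi and its
    neighbourhood of size e1; the kernels of smaller size do not see the truncation. *)
Lemma weak_sol_chain_rule p q T M w G Phi xi dxi N2 a (B b b' : R -> R) :
  1 < p -> 1 < q -> p^-1 + q^-1 = 1 -> weak_sol p q T M w G Phi ->
  C1 xi dxi -> (forall z : 'rV[R]_n * R, N2 < `|z| -> xi z = 0) -> 0 < a ->
  (forall z : 'rV[R]_n * R, z.2 <= a \/ T - a <= z.2 -> xi z = 0) ->
  (forall s : R, is_derive s 1 B (b s)) -> (forall s : R, is_derive s 1 b (b' s)) ->
  continuous b' ->
  let Q z := \sum_i Phi i z * (xi z * (b' (w z) * G i z) + dxi z (dir_x i) * b (w z)) in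
  ig lebV Q /\ \int[lebV]_(z in [set: V]) (dxi z dir_t * B (w z)) = \int[lebV]_z Q z.
Proof.
move=> p1 q1 pq [mw wM lG lP gr eq] Cxi xiN a0 xia DB Db cb' Q.
have p0 : 0 < p := lt_trans ltr01 p1; have q0 : 0 < q := lt_trans ltr01 q1.
have [e1 [e10 e1a e11]] := exists_small_pos a0.
have [N NN2] : exists N : nat, `|N2| + 3 <= N%:R :> R.
  exists (Num.truncn (`|N2| + 3)).+1; apply/ltW; exact: truncnS_gt.
(* Points at which kernels of size e1 stay inside the ball and the time interval. *)
pose S := [set z : 'rV[R]_n * R | `|z| + e1 < N%:R /\ (e1 < z.2 /\ z.2 < T - e1)].
pose cut (F : V -> R) z := \1_(ballVo N%:R : set V) z * F z.
have cutN F z : N%:R <= `|z| -> cut F z = 0.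
  by move=> zN; rewrite /cut indic_ballVo_out// mul0r.
have mcut F : measurable_fun setT F -> measurable_fun setT (cut F).
  by move=> mF; apply: measurable_funM => //; exact: measurable_indic_ballVo.
have igcut r F : 0 < r -> locally_Lp r F -> ig lebV (fun z => `|cut F z| `^ r).
  move=> r0 [_ /(_ N%:R)]; congr ig; apply/funext => z; rewrite /cut.
  have [zN|zN] := ltP `|z| N%:R; first by rewrite indic_ballVo_in// !mul1r.
  by rewrite indic_ballVo_out// !mul0r normr0 powR0 ?gt_eqF.
have cutM z : `|cut w z| <= M.
  rewrite /cut normrM (@le_trans _ _ `|w z|)// ler_piMl// ger0_norm ?indicE ?lern1 ?leq_b1//.
have gradS e dk i z : 0 < e <= e1 -> C1 (ker e) dk -> S z ->
    conv (fun h => dk h (dir_x i)) (cut w) z = - conv (ker e) (cut (G i)) z.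
  move=> /andP[e0 ee1] Ck [zN [z1 z2]].
  have ks (h : 'rV[R]_n * R) : e < `|h| -> ker e h = 0 by exact: ker_support.
  have ds v h := C1_support Ck ks v (z := h).
  have zeN : `|z| + e < N%:R by apply: le_lt_trans zN; rewrite lerD2l.
  rewrite (conv_cut _ (ds _) zeN) (conv_cut _ ks zeN); apply: gr => //.
    by rewrite subr_gt0; exact: le_lt_trans z1.
  by rewrite -ltrBrDr; apply: lt_le_trans z2 _; rewrite lerB.
have eqS e dk z : 0 < e <= e1 -> C1 (ker e) dk -> S z ->
    conv (fun h => dk h dir_t) (cut w) z = \sum_i conv (fun h => dk h (dir_x i)) (cut (Phi i)) z.
  move=> /andP[e0 ee1] Ck [zN [z1 z2]].
  have ks (h : 'rV[R]_n * R) : e < `|h| -> ker e h = 0 by exact: ker_support.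
  have ds v h := C1_support Ck ks v (z := h).
  have zeN : `|z| + e < N%:R by apply: le_lt_trans zN; rewrite lerD2l.
  rewrite (conv_cut _ (ds _) zeN) (eq e dk)//.
  - by apply: eq_bigr => i _; rewrite (conv_cut _ (ds _) zeN).
  - by rewrite subr_gt0; exact: le_lt_trans z1.
  - by rewrite -ltrBrDr; apply: lt_le_trans z2 _; rewrite lerB.
have N2N (z : 'rV[R]_n * R) : `|z| <= N2 -> `|z| + e1 < N%:R.
  move=> zN2; apply: lt_le_trans NN2.
  apply: ler_ltD; first by rewrite (le_trans zN2)// ler_norm.
  by rewrite (le_lt_trans e11)// ltr1n.
have xiS z : ~ S z -> xi z = 0.
  move=> nS; have [zN2|] := leP `|z| N2; last exact: xiN.
  apply: xia; have [z1|z1] := leP z.2 a; [by left|right].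
  rewrite leNgt; apply/negP => z2; apply: nS; split; first exact: N2N.
  by split; [exact: lt_trans z1|apply: lt_trans z2 _; rewrite ltrD2l ltrN2].
have dxiN := C1_support Cxi xiN.
have := @weak_chain_rule R n p q (cut w) (fun i => cut (G i)) (fun i => cut (Phi i)) N M e1 S
  p1 q1 pq e10 (mcut _ mw) cutM (cutN w) (fun i => mcut _ (lG i).1)
  (fun i => igcut p _ p0 (lG i)) (fun i => cutN (G i)) (fun i => mcut _ (lP i).1)
  (fun i => igcut q _ q0 (lP i)) (fun i => cutN (Phi i)) gradS eqS xi dxi N2 Cxi xiN xiS
  B b b' DB Db cb'.
have cutE F z : `|z| <= N2 -> cut F z = F z.
  move=> zN2; rewrite /cut indic_ballVo_in ?mul1r//.
  have zN := N2N z zN2; rewrite (@lt_trans _ _ (`|z| + e1))// ltrDl//.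
have -> : (fun z : V => \sum_i cut (Phi i) z *
    (xi z * (b' (cut w z) * cut (G i) z) + dxi z (dir_x i) * b (cut w z))) = Q.
  apply/funext => z; apply: eq_bigr => i _.
  have [zN2|zN2] := leP `|z| N2; first by rewrite !cutE.
  by rewrite xiN// dxiN// !mul0r addr0 !mulr0.
have -> // : \int[lebV]_(z in [set: V]) (dxi z dir_t * B (cut w z)) =
    \int[lebV]_(z in [set: V]) (dxi z dir_t * B (w z)).
apply: eq_Rintegral => z _.
have [zN2|zN2] := leP `|z| N2; first by rewrite cutE.
by rewrite dxiN// !mul0r.
Qed.

End weak_sol.

(** * Slices of space-time functions *)

Section slices.
Context {R : realType} {n : nat}.
Local Notation V := ('rV[R]_n * measurableTypeR R)%type.
Local Notation leb := (@lebesgue_rV R n).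
Local Notation leb1 := (@lebesgue_measure R).
Implicit Types f g : V -> R.

Lemma measurable_slice f t : measurable_fun setT f ->
  measurable_fun setT (fun x : 'rV[R]_n => f (x, t)).
Proof. by move=> mf; exact: measurableT_comp (mf) (measurable_pair2 t). Qed.

Lemma ae_slice_ig f : ig lebV f ->
  {ae leb1, forall t, ig leb (fun x => f (x, t))}.
Proof. exact: (@ae_integrable2 _ _ _ _ R leb leb1 (EFin \o f)). Qed.

Lemma I_eq0_slices f : ig lebV f ->
  {ae leb1, forall t, \int[leb]_x f (x, t) = 0} -> \int[lebV]_z f z = 0.
Proof.
move=> igf f0; rewrite /Rintegral.
have <- := @integral21_prod_meas1 _ _ _ _ R leb leb1 (EFin \o f) igf.
have -> : (\int[leb1]_t fubini_G leb (EFin \o f) t = \int[leb1]_t (cst 0 t))%E; last by rewrite integral0.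
apply: ae_eq_integral => //.
- exact: (@measurable_fubini_G _ _ _ _ R leb leb1 (EFin \o f) igf).
- near=> t => _.
  have igt : ig leb (fun x => f (x, t)) by near: t; exact: ae_slice_ig.
  rewrite /fubini_G/= -I_fin//; congr EFin.
  by near: t.
Unshelve. all: by end_near. Qed.

Lemma nn_slices_le f (a b C : R) : a <= b -> 0 <= C -> measurable_fun setT f ->
  (forall z, 0 <= f z) -> (forall z, ~ (a <= z.2 <= b) -> f z = 0) ->
  (forall t, a <= t <= b -> (\int[leb]_x (f (x, t))%:E <= C%:E)%E) ->
  (\int[lebV]_z (f z)%:E <= (C * (b - a))%:E)%E.
Proof.
move=> ab C0 mf f0 fab fC.
have mEf : measurable_fun setT (EFin \o f) by exact/measurable_EFinP.
have Ef0 z : (0 <= (EFin \o f) z)%E by rewrite lee_fin.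
rewrite (@fubini_tonelli2 _ _ _ _ R leb leb1 (EFin \o f))//.
have -> : (C * (b - a))%:E = (\int[leb1]_t (C * \1_(`[a, b]%classic) t)%:E)%E.
  have E : leb1 `[a, b]%classic = (b - a)%:E.
    by rewrite lebesgue_measure_itv/= lte_fin; case: ltgtP ab => // -> _; rewrite subrr.
  have EI : (\int[leb1]_t (\1_(`[a, b]%classic) t)%:E = (b - a)%:E)%E.
    by rewrite -E; exact: etrans (integral_indic _ _ _) (congr1 _ (setIT _)).
  by rewrite nn_Z// EI EFinM.
apply: ge0_le_integral => //.
- by move=> t _; apply: integral_ge0 => x _; rewrite lee_fin.
- by apply: measurable_fun_fubini_tonelli_G => // z; rewrite lee_fin.
- by apply/measurable_EFinP; apply: measurable_funM.
- move=> t _; rewrite /fubini_G/= indicE.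
  have [tab|tab] := pselect (a <= t <= b).
    by rewrite mem_set ?mulr1 ?fC//= in_itv/=.
  rewrite memNset ?mulr0; last by rewrite /= in_itv/=.
  by under eq_integral do rewrite fab//; rewrite integral0.
Qed.

(** Tonelli, applied to the indicator of the set where f and g differ. *)
Lemma ae_slices f g : measurable_fun setT f -> measurable_fun setT g ->
  (forall t, {ae leb, forall x, f (x, t) = g (x, t)}) ->
  {ae lebV, forall z, f z = g z}.
Proof.
move=> mf mg fg.
have mA : measurable [set z : V | f z - g z != 0].
  rewrite (_ : [set _ | _] = (fun z => f z - g z) @^-1` (~` [set 0])).
    by rewrite -[X in measurable X]setTI; apply: measurable_funB => //; exact: measurableC.
  by apply/seteqP; split=> z /= /eqP.
exists [set z : V | f z - g z != 0]; split => //; last first.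
  by move=> z /= fgz; rewrite subr_eq0; apply/eqP.
set A := [set z | _].
have mEA : measurable_fun setT (EFin \o (\1_A : V -> R)) by exact/measurable_EFinP.
have EA0 z : (0 <= (EFin \o (\1_A : V -> R)) z)%E by rewrite lee_fin.
have := @fubini_tonelli2 _ _ _ _ R leb leb1 _ mEA EA0.
rewrite [X in X = _](_ : _ = lebV A); last exact: etrans (integral_indic _ _ _) (congr1 _ (setIT A)).
move=> ->; apply: integral0_eq => t _; rewrite /fubini_G/=.
have mAt : measurable_fun setT (fun x : 'rV[R]_n => (\1_A (x, t))%:E : \bar R).
  by apply/measurable_EFinP; apply: (measurable_slice t); exact: measurable_indic.
have -> : (\int[leb]_x (\1_A (x, t))%:E = \int[leb]_x (cst 0 x))%E; last by rewrite integral0.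
apply: ae_eq_integral => //.
apply: filterS (fg t) => x fgx _; rewrite indicE memNset// /A/= fgx subrr.
by rewrite eqxx.
Qed.
End slices.

(** * Euclidean norm and clamping *)

Section continuity_within.

Lemma within_continuous_comp (X Y Z : topologicalType) (A : set X) (B : set Y)
    (g : X -> Y) (f : Y -> Z) : continuous g -> (forall x, A x -> B (g x)) ->
  {within B, continuous f} -> {within A, continuous (fun x => f (g x))}.
Proof.
move=> cg AB /subspace_continuousP cf; apply/subspace_continuousP => x Ax.
apply: (cvg_comp _ _ _ (cf (g x) (AB x Ax))).
move=> W BW; have gW : nbhs x (fun y => B (g y) -> W (g y)) by exact: (cg x _ BW).
by apply: filterS gW => y /= Wy Ay; exact/Wy/AB.
Qed.

Lemma within_continuous_post (X Y Z : topologicalType) (A : set X)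
    (f : X -> Y) (k : Y -> Z) : continuous k ->
  {within A, continuous f} -> {within A, continuous (fun x => k (f x))}.
Proof.
move=> ck /subspace_continuousP cf; apply/subspace_continuousP => x Ax.
exact: (cvg_comp _ _ (cf x Ax) (ck _)).
Qed.

End continuity_within.

Section euclidean_norm.
Context {R : realType} {n : nat}.
Implicit Types v w : 'rV[R]_n.

Lemma enorm_ge0 v : 0 <= enorm v.
Proof. exact: sqrtr_ge0. Qed.

Lemma enorm_sqr v : enorm v ^+ 2 = \sum_i v ord0 i ^+ 2.
Proof. by rewrite sqr_sqrtr// sumr_ge0// => i _; exact: sqr_ge0. Qed.

Lemma coord_le_enorm v i : `|v ord0 i| <= enorm v.
Proof.
rewrite -(@ler_pXn2r _ 2)// ?nnegrE ?enorm_ge0// enorm_sqr real_normK ?num_real//.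
rewrite (bigD1 i)//= lerDl; apply: sumr_ge0 => j _; exact: sqr_ge0.
Qed.

Lemma enorm0 : enorm (0 : 'rV[R]_n) = 0.
Proof.
rewrite /enorm big1 ?sqrtr0// => i _.
by rewrite mxE expr0n.
Qed.

Lemma measurable_enorm d (T : measurableType d) (G : T -> 'rV[R]_n) :
  (forall i, measurable_fun setT (fun z => G z ord0 i)) ->
  measurable_fun setT (fun z => enorm (G z)).
Proof.
move=> mG; apply: (measurableT_comp (f := @Num.sqrt R)).
  by apply: continuous_measurable_fun; exact: sqrt_continuous.
by apply: measurable_sum => i; exact: measurable_funX.
Qed.

Lemma enorm_flux_le v i (p : R) : 2 < p ->
  `|enorm v `^ (p - 2) * v ord0 i| <= enorm v `^ (p - 1).
Proof.
move=> p2; have e0 := enorm_ge0 v.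
rewrite normrM (ger0_norm (powR_ge0 _ _)).
apply: (@le_trans _ _ (enorm v `^ (p - 2) * enorm v `^ 1)).
  by rewrite powRr1// ler_wpM2l ?powR_ge0// coord_le_enorm.
rewrite -powRD; last by apply/implyP => /eqP h; exfalso; lra.
by rewrite (_ : p - 2 + 1 = p - 1)//; ring.
Qed.

End euclidean_norm.

Section clamp.
Context {R : realType}.

(** Projection onto [-M, M], turning an essential bound into a pointwise one. *)
Definition clamp (M s : R) : R := Num.max (- M) (Num.min s M).

Lemma clamp_le M s : 0 <= M -> `|clamp M s| <= M.
Proof.
move=> M0; rewrite /clamp ler_norml le_max lexx/= ge_max ge_min lexx orbT andbT.
by rewrite (le_trans _ M0)// oppr_le0.
Qed.

Lemma clamp_id M s : `|s| <= M -> clamp M s = s.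
Proof.
by rewrite ler_norml => /andP[sM Ms]; rewrite /clamp min_l// max_r.
Qed.

Lemma clamp0 M : 0 <= M -> clamp M 0 = 0.
Proof. by move=> M0; rewrite clamp_id// normr0. Qed.

Lemma clamp_norm M s : 0 <= M -> `|clamp M s| <= `|s|.
Proof.
move=> M0; have [sM|sM] := leP `|s| M; first by rewrite clamp_id.
by rewrite (le_trans (clamp_le _ M0))// ltW.
Qed.

Lemma measurable_clamp d (T : measurableType d) M (f : T -> R) :
  measurable_fun setT f -> measurable_fun setT (fun z => clamp M (f z)).
Proof.
move=> mf; apply: measurable_maxr; first exact: measurable_cst.
by apply: measurable_minr => //; exact: measurable_cst.
Qed.

(** Projection onto [0, T], extending to all times fields that are continuous for
    nonnegative times only. *)
Definition tclamp (T t : R) : R := Num.max 0 (Num.min t T).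

Lemma tclamp_itv T t : 0 <= T -> 0 <= tclamp T t <= T.
Proof. by move=> T0; rewrite /tclamp le_max lexx/= ge_max T0 ge_min lexx orbT. Qed.

Lemma tclamp_id T t : 0 <= t <= T -> tclamp T t = t.
Proof. by move=> /andP[t0 tT]; rewrite /tclamp min_l// max_r. Qed.

Lemma continuous_tclamp T : continuous (tclamp T).
Proof.
move=> t; apply: (@continuous_max _ _ (fun=> 0) (fun t => Num.min t T)); first exact: cvg_cst.
by apply: (@continuous_min _ _ id (fun=> T)); [exact: cvg_id|exact: cvg_cst].
Qed.

End clamp.

Section bounds_on_compact.
Context {R : realType}.

Lemma conjugate_exponent (p : R) : 1 < p -> let q := p / (p - 1) in
  [/\ 1 < q, p^-1 + q^-1 = 1 & (p - 1) * q = p].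
Proof.
move=> p1 q; have d0 : 0 < p - 1 by rewrite subr_gt0.
have p0 : p != 0 by rewrite gt_eqF// (lt_trans ltr01).
split; rewrite /q.
- by rewrite ltr_pdivlMr// mul1r gtrBl.
- by rewrite invf_div -{1}(mul1r p^-1) -mulrDl addrC subrK divff.
- by rewrite mulrCA divff ?mulr1// gt_eqF.
Qed.

Lemma tclamp_bounds (mu : R -> R) (T : R) : 0 < T ->
  {within [set t : R | 0 <= t], continuous mu} -> (forall t, 0 <= t -> 0 < mu t) ->
  exists m0 m1, 0 < m0 /\ forall t, m0 <= mu (tclamp T t) <= m1.
Proof.
move=> T0 cmu mu0.
have cT : {within `[0, T], continuous mu}.
  by apply: continuous_subspaceW cmu => t /=; rewrite in_itv/= => /andP[].
have [c cI cM] := EVT_max (ltW T0) cT; have [d dI dm] := EVT_min (ltW T0) cT.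
exists (mu d), (mu c); split.
  by apply: mu0; move: dI; rewrite in_itv/= => /andP[].
move=> t; have tI : tclamp T t \in `[0, T] by rewrite in_itv/= tclamp_itv// ltW.
by rewrite dm// cM.
Qed.

Lemma continuous_tclamp_comp (mu : R -> R) (T : R) : 0 <= T ->
  {within [set t : R | 0 <= t], continuous mu} -> continuous (fun t => mu (tclamp T t)).
Proof.
move=> T0 cmu; apply/continuous_subspace_setT.
apply: (within_continuous_comp (B := [set t : R | 0 <= t]) _ _ cmu).
  exact: continuous_tclamp.
by move=> t _ /=; case/andP: (tclamp_itv t T0).
Qed.

End bounds_on_compact.

Section ker_slices.
Context {R : realType} {n : nat}.
Local Notation V := ('rV[R]_n * measurableTypeR R)%type.

Lemma partial_ker_slice e dk i (z : 'rV[R]_n * R) s x : C1 (@ker R n e) dk ->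
  partial (fun y : 'rV[R]_n => ker e ((y, s) - z)) i x = dk ((x, s) - z) (dir_x i).
Proof.
move=> [_ Dk _]; rewrite /partial; apply: derive_val.
have /is_derive_line := Dk ((x, s) - z) (dir_x i).
move=> D; apply/is_derive_line; apply: is_deriveE D => //.
apply/funext => h /=; congr ker.
case: z => a b; rewrite /dir_x; congr pair => /=.
  by rewrite addrA.
by rewrite scaler0 add0r.
Qed.

Lemma derive_ker_time e dk (z y : 'rV[R]_n * R) : C1 (@ker R n e) dk ->
  'D_((0, 1) : 'rV[R]_n * R) (fun y => ker e (y - z)) y = dk (y - z) dir_t.
Proof.
move=> [_ Dk _]; apply: derive_val.
have /is_derive_line := Dk (y - z) dir_t.
move=> D; apply/is_derive_line; apply: is_deriveE D => //.
by apply/funext => h /=; rewrite addrA.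
Qed.

End ker_slices.

(** * Representatives of a solution on space-time *)

Lemma continuous_proj23 (X Y Z : topologicalType) :
  continuous (fun y : X * Y * Z => (y.1.2, y.2)).
Proof.
move=> [[a b] c] W [[/= A B] [nA nB] AB].
exists ((setT `*` A), B) => /=.
  by split => //; exists (setT, A) => //=; split => //; exact: filterT.
by move=> [[x y] z] /= [[_ Ay] Bz]; apply: AB.
Qed.

Lemma compact_ball_rV0 (R : realType) n (N : R) : compact (ball_rV N : set 'rV[R]_n).
Proof.
have [N0|N0] := leP 0 N; last first.
  rewrite (_ : ball_rV N = set0); first exact: compact0.
  by apply/seteqP; split => // x /(le_trans (normr_ge0 _)); rewrite leNgt N0.
rewrite (_ : ball_rV N = [set y : 'rV[R]_n | `|y - 0| <= N]); first exact: compact_ball_rV.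
by apply/seteqP; split => x; rewrite /ball_rV/= subr0.
Qed.

Section regular.
Context {R : realType} {n : nat}.
Local Notation V := ('rV[R]_n * measurableTypeR R)%type.
Local Notation leb := (@lebesgue_rV R n).
Variables (p : R) (mu : R -> R) (f : 'rV[R]_n -> R -> R -> 'rV[R]_n)
  (g : R -> R -> 'rV[R]_n) (T : R).

(** Time is projected onto [0, T], so that the field is defined and continuous on
    all of space-time. *)
Definition convection (i : 'I_n) (z : V) (s : R) : R :=
  f z.1 (tclamp T z.2) s ord0 i + g (tclamp T z.2) s ord0 i.

Definition flux (U : V -> R) (G : V -> 'rV[R]_n) (i : 'I_n) (z : V) : R :=
  mu (tclamp T z.2) * (enorm (G z) `^ (p - 2) * G z ord0 i) - convection i z (U z).

(** Functions U and G on space-time that represent u and its gradient on [0, T].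
    Passing to them turns the essential bound into a pointwise one, while every
    slice stays controlled, since the initial and the final comparison happen at
    fixed times. *)
Record regular (M : R) (u : 'rV[R]_n -> R -> R) (U : V -> R) (G : V -> 'rV[R]_n) : Prop := {
  reg_weak : weak_sol p (p / (p - 1)) T M U (fun i z => G z ord0 i) (flux U G);
  reg_ig : ig lebV U;
  reg_slice : forall t, ig leb (fun x => U (x, t));
  reg_ae : forall t, 0 <= t <= T -> {ae leb, forall x, U (x, t) = u x t};
  reg_cont : forall N e t0, 0 < e -> 0 <= t0 <= T ->
    exists2 d, 0 < d & forall t, 0 <= t <= T -> `|t - t0| < d ->
      \int[leb]_x (\1_(ball_rV N : set 'rV[R]_n) x * `|U (x, t) - U (x, t0)|) <= e }.

Hypothesis p2 : 2 < p.
Hypothesis T0 : 0 < T.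
Hypothesis cmu : {within [set t : R | 0 <= t], continuous mu}.
Hypothesis mu0 : forall t, 0 <= t -> 0 < mu t.
Hypothesis cf : {within [set z : 'rV[R]_n * R * R | 0 <= z.1.2],
    continuous (fun z => f z.1.1 z.1.2 z.2)}.
Hypothesis cg : {within [set z : R * R | 0 <= z.1], continuous (fun z => g z.1 z.2)}.
Hypothesis hbd : forall M, 0 < M -> exists H0, forall x t s i, `|s| <= M ->
  `|f x (tclamp T t) s ord0 i| <= H0 /\ `|g (tclamp T t) s ord0 i| <= H0.

Lemma measurable_mu : measurable_fun setT (fun z : V => mu (tclamp T z.2)).
Proof.
apply: (measurableT_comp (f := fun t : measurableTypeR R => mu (tclamp T t))) => //.
by apply: continuous_measurable_fun; apply: continuous_tclamp_comp => //; exact: ltW.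
Qed.

Lemma measurable_f i (U : V -> R) : measurable_fun setT U ->
  measurable_fun setT (fun z : V => f z.1 (tclamp T z.2) (U z) ord0 i).
Proof.
move=> mU.
apply: (@measurable_continuous_comp R n _ V
  (fun y => f y.1.1 y.1.2 y.2 ord0 i) fst (fun z => tclamp T z.2) U) => //.
- apply: (within_continuous_post (k := fun x : 'rV[R]_n => x ord0 i)) cf.
  exact: continuous_coord.
- apply: (measurableT_comp (f := tclamp T : measurableTypeR R -> _)) => //.
  by apply: continuous_measurable_fun; exact: continuous_tclamp.
- by move=> z; case/andP: (tclamp_itv z.2 (ltW T0)).
Qed.

Lemma measurable_g i (U : V -> R) : measurable_fun setT U ->
  measurable_fun setT (fun z : V => g (tclamp T z.2) (U z) ord0 i).
Proof.
move=> mU.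
apply: (@measurable_continuous_comp R n _ V
  (fun y => g y.1.2 y.2 ord0 i) fst (fun z => tclamp T z.2) U) => //.
- apply: (within_continuous_comp (B := [set z : R * R | 0 <= z.1])
    (g := fun y : 'rV[R]_n * R * R => (y.1.2, y.2)) (f := fun y => g y.1 y.2 ord0 i)) => //.
    exact: continuous_proj23.
  apply: (within_continuous_post (k := fun x : 'rV[R]_n => x ord0 i)) cg.
  exact: continuous_coord.
- apply: (measurableT_comp (f := tclamp T : measurableTypeR R -> _)) => //.
  by apply: continuous_measurable_fun; exact: continuous_tclamp.
- by move=> z; case/andP: (tclamp_itv z.2 (ltW T0)).
Qed.

Variables (Ts : \bar R) (u : 'rV[R]_n -> R -> R) (Du : 'rV[R]_n -> R -> 'rV[R]_n).
Hypothesis TTs : (T%:E < Ts)%E.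
Hypothesis uC0 : C0_L1_loc Ts u.
Hypothesis uLW : Lp_loc_W1p_loc Ts p u Du.
Hypothesis uDE : distributional_equation p mu f g Ts u Du.
Variable M : R.
Hypothesis M0 : 0 < M.
Hypothesis uM : forall t, 0 <= t <= T ->
    ('N[leb]_1[EFin \o (u ^~ t)] <= M%:E)%E /\
    ('N[leb]_(+oo)[EFin \o (u ^~ t)] <= M%:E)%E.

Let inT (z : V) := 0 <= z.2 <= T.
Let U0 z := if inT z then u z.1 z.2 else 0.
Let U z := clamp M (U0 z).
Let G z := if inT z then Du z.1 z.2 else 0.

Let T_co t : 0 <= t <= T -> time_co Ts t.
Proof. by case/andP=> t0 tT; split => //; apply: le_lt_trans TTs; rewrite lee_fin. Qed.

Let measurable_time_co : measurable (time_co Ts : set (measurableTypeR R)).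
Proof.
case: Ts => [r| |].
- rewrite (_ : time_co _ = `[0, r[%classic) //.
  apply/seteqP; split=> [t [t0 tr]|t /=]; first by rewrite /= in_itv/= t0 -lte_fin.
  by rewrite in_itv/= => /andP[t0 tr]; split; rewrite ?lte_fin.
- rewrite (_ : time_co _ = `[0, +oo[%classic) //.
  apply/seteqP; split=> [t [t0 _]|t /=]; first by rewrite /= in_itv/= andbT.
  by rewrite in_itv/= andbT => t0; split; rewrite ?ltry.
- rewrite (_ : time_co _ = set0) //.
  by apply/seteqP; split=> t; rewrite /time_co//= => -[_]; rewrite ltNge leNye.
Qed.

Let measurable_inT : measurable [set z : V | inT z].
Proof.
rewrite (_ : [set z | _] = [set: 'rV[R]_n] `*` `[0, T]%classic).
  exact: measurableX.
by apply/seteqP; split=> [z zT|z [_]]; rewrite /= ?in_itv.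
Qed.

Let measurable_cut d (Y : measurableType d) (a : V -> Y) (c : Y) :
  measurable_fun ([set: 'rV[R]_n] `*` time_co Ts) a ->
  measurable_fun setT (fun z => if inT z then a z else c).
Proof.
move=> ma; apply: measurable_fun_if => //.
- by apply: (@measurable_fun_bool _ _ _ _ true); rewrite setTI.
- rewrite setTI; apply: measurable_funS ma; first exact: measurableX.
  by move=> z /= zT; split => //; exact: T_co.
Qed.

Let mU0 : measurable_fun setT U0.
Proof. by apply: measurable_cut; case: uLW. Qed.

Let mU : measurable_fun setT U. Proof. exact: measurable_clamp. Qed.

Let mG i : measurable_fun setT (fun z => G z ord0 i).
Proof.
apply: (measurableT_comp (measurable_coord i)).
by apply: measurable_cut; case: uLW.
Qed.

Let leb_gt0 : (0 < leb setT)%E.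
Proof.
apply: (@lt_le_trans _ _ (leb (ball_rV 1))).
  by rewrite leb_ball_rV ?lte_fin ?mulr1 ?exprn_gt0.
by apply: le_measure => //; rewrite inE; [exact: measurable_ball_rV|exact: measurableT].
Qed.

(** The essential bound holds at every time, so truncation changes no slice by
    more than a null set. *)
Let U_ae t : 0 <= t <= T -> {ae leb, forall x, U (x, t) = u x t}.
Proof.
move=> tT; have [_] := uM tT; rewrite unlock leb_gt0 => /ess_supP.
by apply: filterS => x /=; rewrite lee_fin => uxM; rewrite /U /U0 /inT/= tT clamp_id.
Qed.

Let U_U0 : {ae lebV, forall z, U z = U0 z}.
Proof.
apply: ae_slices => // t; have [tT|tT] := boolP (0 <= t <= T).
  by apply: filterS (U_ae tT) => x ->; rewrite /U0 /inT/= tT.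
by apply: aeW => x; rewrite /U /U0 /inT/= (negbTE tT) clamp0// ltW.
Qed.

Let U0_slice t : (\int[leb]_x `|U0 (x, t)|%:E <= M%:E)%E.
Proof.
have [tT|tT] := boolP (0 <= t <= T); last first.
  under eq_integral do rewrite /U0 /inT/= (negbTE tT) normr0.
  by rewrite integral0 lee_fin ltW.
have [+ _] := uM tT; rewrite Lnorm1.
by under [in X in _ -> X]eq_integral do rewrite /U0 /inT/= tT.
Qed.

Let U_le z : `|U z| <= `|U0 z|. Proof. by apply: clamp_norm; exact: ltW. Qed.

Let ig_slice t : ig leb (fun x => U (x, t)).
Proof.
have mU0t : measurable_fun setT (fun x : 'rV[R]_n => `|U0 (x, t)|).
  by apply: measurableT_comp => //; exact: measurable_slice.
have [igU0 _] := ig_ge0 mU0t (fun=> normr_ge0 _) (U0_slice t).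
by apply: ig_dom igU0 => //; exact: measurable_slice.
Qed.

Let igU : ig lebV U.
Proof.
have mU0' : measurable_fun setT (fun z : V => `|U0 z|) by exact: measurableT_comp.
have U0T (z : V) : ~ (0 <= z.2 <= T) -> `|U0 z| = 0.
  by move=> /negP zT; rewrite /U0 /inT (negbTE zT) normr0.
have le := nn_slices_le (ltW T0) (ltW M0) mU0' (fun=> normr_ge0 _) U0T (fun t _ => U0_slice t).
have [igU0 _] := ig_ge0 mU0' (fun=> normr_ge0 _) le.
by apply: ig_dom igU0.
Qed.

Let ig_enorm (N : R) : ig lebV (fun z => \1_(ballVo N : set V) z * enorm (G z) `^ p).
Proof.
have [_ _ _ /(_ T (ball_rV N))] := uLW.
have TooT : time_oo Ts T by split.
move=> /(_ TooT (@compact_ball_rV0 R n N)) fin.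
have mE : measurable_fun setT (fun z => \1_(ballVo N : set V) z * enorm (G z) `^ p).
  apply: measurable_funM; first exact: measurable_indic_ballVo.
  under eq_fun do rewrite -(ger0_norm (enorm_ge0 _)).
  by apply: measurable_powR_norm; exact: measurable_enorm.
apply/integrableP; split; first exact/measurable_EFinP.
apply: le_lt_trans fin; rewrite [leRHS]integral_mkcond.
set D := _ `*` _.
have mD : measurable D by apply: measurableX => //; exact: measurable_ball_rV.
have -> : (fun z : V => (`|u z.1 z.2| `^ p + enorm (Du z.1 z.2) `^ p)%:E) \_ D =
    (fun z : V => (\1_D z * (`|U0 z| `^ p + enorm (G z) `^ p))%:E).
  apply/funext => z; rewrite patchE indicE; case: ifPn => zD; last by rewrite mul0r.
  have zT : inT z by move: zD; rewrite inE => -[_ /=]; rewrite in_itv.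
  by rewrite mul1r /U0 /G zT.
apply: ge0_le_integral => //.
- by apply/measurable_EFinP; exact: measurableT_comp.
- apply/measurable_EFinP; apply: measurable_funM => //.
  apply: measurable_funD; first exact: measurable_powR_norm.
  under eq_fun do rewrite -(ger0_norm (enorm_ge0 _)).
  by apply: measurable_powR_norm; exact: measurable_enorm.
- move=> z _ /=; rewrite lee_fin ger0_norm; last by rewrite mulr_ge0 ?powR_ge0// indicE.
  have [zT|zT] := boolP (inT z); last first.
    rewrite /G (negbTE zT) enorm0 powR0 ?mulr0.
      by rewrite mulr_ge0 ?indicE ?addr_ge0 ?powR_ge0.
    by rewrite gt_eqF// (lt_trans _ p2).
  have [zN|zN] := ltP `|z| N; last first.
    by rewrite indic_ballVo_out// mul0r mulr_ge0 ?indicE ?addr_ge0 ?powR_ge0.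
  rewrite indic_ballVo_in// mul1r indicE mem_set ?mul1r ?lerDr ?powR_ge0//.
  split; last by rewrite /= in_itv.
  by move: (ltW zN); rewrite normV_le => /andP[].
Qed.

Let q := p / (p - 1).
Let p1 : 1 < p. Proof. by apply: lt_trans p2; rewrite ltr1n. Qed.
Let q1 : 1 < q. Proof. by have [] := conjugate_exponent p1. Qed.
Let pq : (p - 1) * q = p. Proof. by have [] := conjugate_exponent p1. Qed.

Let A i (z : V) := mu (tclamp T z.2) * (enorm (G z) `^ (p - 2) * G z ord0 i).

Let mE : measurable_fun setT (fun z => enorm (G z)). Proof. exact: measurable_enorm. Qed.

Let mA i : measurable_fun setT (A i).
Proof.
apply: measurable_funM; first exact: measurable_mu.
apply: measurable_funM => //.
under eq_fun do rewrite -(ger0_norm (enorm_ge0 _)).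
exact: measurable_powR_norm.
Qed.

Let locally_A i : locally_Lp q (A i).
Proof.
split => // N; have [m0 [m1 [m00 mb]]] := tclamp_bounds T0 cmu mu0.
apply: (@ig_dom _ _ _ _ (fun z => m1 `^ q * (\1_(ballVo N : set V) z * enorm (G z) `^ p))).
- apply: measurable_funM; first exact: measurable_indic_ballVo.
  exact: measurable_powR_norm.
- move=> z; rewrite normrM ger0_norm ?indicE// mulrCA ler_wpM2l//.
  rewrite (ger0_norm (powR_ge0 _ _)) -pq powRrM -powRM ?powR_ge0//; last first.
    by case/andP: (mb 0) => m0m mm1; rewrite (le_trans (ltW m00))// (le_trans m0m).
  apply: ler_powR2 => //; first by rewrite ltW// (lt_trans _ q1).
  rewrite /A normrM; apply: ler_pM => //; last exact: enorm_flux_le.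
  case/andP: (mb z.2) => m0m mm1.
  by rewrite ger0_norm// (le_trans (ltW m00)).
- by apply: igZ; exact: ig_enorm.
Qed.

Let locally_G i : locally_Lp p (fun z => G z ord0 i).
Proof.
split => // N.
apply: ig_dom (ig_enorm N) => [|z].
  by apply: measurable_funM; [exact: measurable_indic_ballVo|exact: measurable_powR_norm].
rewrite normrM ger0_norm ?indicE// ler_wpM2l// (ger0_norm (powR_ge0 _ _)).
apply: ler_powR2 => //; first by rewrite ltW// (lt_trans _ p1).
exact: coord_le_enorm.
Qed.

Let UM z : `|U z| <= M. Proof. by apply: clamp_le; exact: ltW. Qed.

Let locally_f i : locally_Lp q (fun z => f z.1 (tclamp T z.2) (U z) ord0 i).
Proof.
have [H0 H] := hbd M0; apply: (@locally_Lp_bounded _ _ _ H0).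
- by rewrite ltW// (lt_trans _ q1).
- exact: measurable_f.
- by move=> z; have [] := H z.1 z.2 (U z) i (UM z).
Qed.

Let locally_g i : locally_Lp q (fun z => g (tclamp T z.2) (U z) ord0 i).
Proof.
have [H0 H] := hbd M0; apply: (@locally_Lp_bounded _ _ _ H0).
- by rewrite ltW// (lt_trans _ q1).
- exact: measurable_g.
- by move=> z; have [] := H z.1 z.2 (U z) i (UM z).
Qed.

(** The weak gradient is given slicewise; Fubini integrates the slices of the
    kernel, which are test functions in space. *)
Let weak_grad e dk i (z : 'rV[R]_n * R) : 0 < e -> C1 (ker e) dk ->
    0 < z.2 - e -> z.2 + e < T ->
  conv (fun h => dk h (dir_x i)) U z = - conv (ker e) (fun z => G z ord0 i) z.
Proof.
move=> e0 Ck z1 z2; have [ck _ cdk] := Ck.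
have ks (h : 'rV[R]_n * R) : e < `|h| -> ker e h = 0 by exact: ker_support.
have ds (v h : 'rV[R]_n * R) : e < `|h| -> dk h v = 0 := C1_support Ck ks v (z := h).
have lU := locally_Lp_bounded (ltW (lt_trans ltr01 p1)) mU UM.
have ig1 := ig_conv_loc z (ltW p1) lU (cdk (dir_x i)) (ds _).
have ig2 := ig_conv_loc z (ltW p1) (locally_G i) ck ks.
apply/eqP; rewrite -addr_eq0 /conv -I_D//; apply/eqP.
apply: I_eq0_slices; first exact: igD.
have [_ _ W _] := uLW.
near=> t.
have igt1 : ig leb (fun x => U (x, t) * dk ((x, t) - z) (dir_x i)).
  by near: t; exact: ae_slice_ig ig1.
have igt2 : ig leb (fun x => G (x, t) ord0 i * ker e ((x, t) - z)).
  by near: t; exact: ae_slice_ig ig2.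
have Wt : time_co Ts t -> W1p_loc p (u ^~ t) (Du ^~ t) by near: t; exact: W.
rewrite I_D//.
have [tT|tT] := boolP (0 <= t <= T); last first.
  rewrite [X in X + _](_ : _ = 0) ?add0r; last first.
    rewrite -[RHS](I_0 leb); apply: eq_Rintegral => x _.
    by rewrite /U /U0 /inT/= (negbTE tT) clamp0 ?mul0r// ltW.
  rewrite -[RHS](I_0 leb); apply: eq_Rintegral => x _.
  by rewrite /G /inT/= (negbTE tT) mxE mul0r.
have [_ _ /(_ _ i (test_function_ker_slice z t e0)) wg] := Wt (T_co tT).
rewrite [X in X + _](_ : _ = \int[leb]_x (u x t * partial (fun y => ker e ((y, t) - z)) i x)).
  rewrite wg addrC; apply/eqP; rewrite subr_eq0; apply/eqP.
  by apply: eq_Rintegral => x _; rewrite /G /inT/= tT.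
apply: I_ae.
- exact: ig_meas igt1.
- under eq_fun do rewrite (partial_ker_slice _ _ _ _ Ck).
  apply: measurable_funM.
    have := measurable_slice t mU0.
    by rewrite /U0 /inT/= tT.
  exact: (measurable_slice t (measurable_shift_cts z (cdk (dir_x i)))).
- by apply: filterS (U_ae tT) => x ->; rewrite (partial_ker_slice _ _ _ _ Ck).
Unshelve. all: by end_near. Qed.

(** Integrands supported near z do not distinguish the solution's time interval
    from the whole line. *)
Let Q_eq e (z : 'rV[R]_n * R) (a b : V -> R) : 0 < z.2 - e -> z.2 + e < T ->
  (forall y, 0 <= y.2 <= T -> a y = b y) ->
  (forall y, e < `|y - z| -> a y = 0) -> (forall y, e < `|y - z| -> b y = 0) ->
  \int[(leb \x @lebesgue_measure R)%E]_(y in [set: 'rV[R]_n] `*` time_oo Ts) a y =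
  \int[lebV]_y b y.
Proof.
move=> z1 z2 ab a0 b0; rewrite Rintegral_mkcond;
rewrite [LHS](_ : _ = \int[lebV]_y (a \_ ([set: 'rV[R]_n] `*` time_oo Ts)) y)//; apply: eq_Rintegral => y _.
rewrite patchE; have [yz|yz] := leP `|y - z| e; last by rewrite a0// b0// if_same.
have : `|y.2 - z.2| <= e by move: yz; rewrite normV_le => /andP[].
rewrite ler_distl => /andP[y1 y2].
have y0 : 0 < y.2 := lt_le_trans z1 y1; have yT : y.2 < T := le_lt_trans y2 z2.
rewrite mem_set; first by rewrite ab// !ltW.
by split => //; split => //; apply: lt_trans TTs; rewrite lte_fin.
Qed.

(** The kernel centred at z is an admissible test function in space-time. *)
Let weak_eq e dk (z : 'rV[R]_n * R) : 0 < e -> C1 (ker e) dk ->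
    0 < z.2 - e -> z.2 + e < T ->
  conv (fun h => dk h dir_t) U z = \sum_i conv (fun h => dk h (dir_x i)) (flux U G i) z.
Proof.
move=> e0 Ck z1 z2; have [ck _ cdk] := Ck.
have ks (h : 'rV[R]_n * R) : e < `|h| -> ker e h = 0 by exact: ker_support.
have ds (v h : 'rV[R]_n * R) : e < `|h| -> dk h v = 0 := C1_support Ck ks v (z := h).
have zTs : ((z.2 + e)%:E < Ts)%E by apply: lt_trans TTs; rewrite lte_fin.
have igc v F : locally_Lp q F -> ig lebV (fun y : V => F y * dk (y - z) v).
  by move=> lF; exact: (ig_conv_loc z (ltW q1) lF (cdk v) (ds v)).
have parE i (y : V) : grad (fun x => ker e ((x, y.2) - z)) y.1 ord0 i = dk (y - z) (dir_x i).
  by rewrite mxE (partial_ker_slice _ _ _ _ Ck); case: y.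
pose fi i (y : V) := f y.1 (tclamp T y.2) (U0 y) ord0 i.
pose gi i (y : V) := g (tclamp T y.2) (U0 y) ord0 i.
have Efg (b : 'I_n -> V -> R) (b0 : 'I_n -> V -> R) :
    (forall i, measurable_fun setT (b0 i)) -> (forall i, locally_Lp q (b i)) ->
    (forall i, {ae lebV, forall y, b0 i y = b i y}) ->
    \int[lebV]_y (\sum_i b0 i y * dk (y - z) (dir_x i)) =
    \sum_i conv (fun h => dk h (dir_x i)) (b i) z.
  move=> mb0 lb b0b.
  have mb i : measurable_fun setT (fun y : V => b0 i y * dk (y - z) (dir_x i)).
    by apply: measurable_funM => //; exact: (measurable_shift_cts z (cdk (dir_x i))).
  have Eb i : {ae lebV, forall y, b i y * dk (y - z) (dir_x i) = b0 i y * dk (y - z) (dir_x i)}.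
    by apply: filterS (b0b i) => y ->.
  rewrite I_sum; last by move=> i; apply: ig_ae (igc _ _ (lb i)).
  apply: eq_bigr => i _; apply/esym/I_ae => //.
  exact: ig_meas (igc _ _ (lb i)).
have := uDE (test_function_ker e0 z1 zTs); cbv zeta.
rewrite (Q_eq (e := e) (b := fun y => U0 y * dk (y - z) dir_t) z1 z2); first last.
- by move=> y yz; rewrite ds// mulr0.
- by move=> y yz; rewrite (derive_ker_time _ _ Ck) ds// mulr0.
- by move=> y yT; rewrite (derive_ker_time _ _ Ck) /U0 /inT yT.
rewrite (Q_eq (e := e) (b := fun y => \sum_i fi i y * dk (y - z) (dir_x i)) z1 z2); first last.
- by move=> y yz; rewrite big1// => i _; rewrite ds// mulr0.
- by move=> y yz; rewrite /dot big1// => i _; rewrite parE ds// mulr0.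
- move=> y yT; apply: eq_bigr => i _.
  by rewrite parE /fi tclamp_id// /U0 /inT yT.
rewrite (Q_eq (e := e) (b := fun y => \sum_i gi i y * dk (y - z) (dir_x i)) z1 z2); first last.
- by move=> y yz; rewrite big1// => i _; rewrite ds// mulr0.
- by move=> y yz; rewrite /dot big1// => i _; rewrite parE ds// mulr0.
- move=> y yT; apply: eq_bigr => i _.
  by rewrite parE /gi tclamp_id// /U0 /inT yT.
rewrite (Q_eq (e := e) (b := fun y => \sum_i A i y * dk (y - z) (dir_x i)) z1 z2); first last.
- by move=> y yz; rewrite big1// => i _; rewrite ds// mulr0.
- by move=> y yz; rewrite /dot big1 ?mulr0// => i _; rewrite parE ds// mulr0.
- move=> y yT; rewrite /dot mulr_sumr; apply: eq_bigr => i _.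
  by rewrite parE mxE /A tclamp_id// /G /inT yT mulrA.
rewrite (Efg (fun i y => f y.1 (tclamp T y.2) (U y) ord0 i) fi)//; last 2 first.
- by move=> i; exact: measurable_f.
- by move=> i; apply: filterS U_U0 => y Uy; rewrite /fi Uy.
rewrite (Efg (fun i y => g (tclamp T y.2) (U y) ord0 i) gi)//; last 2 first.
- by move=> i; exact: measurable_g.
- by move=> i; apply: filterS U_U0 => y Uy; rewrite /gi Uy.
rewrite (Efg A A)//; last by move=> i; exact: aeW.
rewrite (@I_ae _ _ _ _ _ (fun y => U y * dk (y - z) dir_t)); first last.
- by apply: filterS U_U0 => y ->.
- by apply: measurable_funM => //; exact: (measurable_shift_cts z (cdk dir_t)).
- by apply: measurable_funM => //; exact: (measurable_shift_cts z (cdk dir_t)).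
have fluxE i : conv (fun h => dk h (dir_x i)) (flux U G i) z =
    conv (fun h => dk h (dir_x i)) (A i) z -
    (conv (fun h => dk h (dir_x i)) (fun y => f y.1 (tclamp T y.2) (U y) ord0 i) z +
     conv (fun h => dk h (dir_x i)) (fun y => g (tclamp T y.2) (U y) ord0 i) z).
  rewrite /conv -I_D; [|exact: igc|exact: igc].
  rewrite -I_B; [|exact: igc|by apply: igD; exact: igc].
  by apply: eq_Rintegral => y _; rewrite /flux /convection -/(A i y) mulrBl mulrDl.
rewrite (eq_bigr _ (fun i _ => fluxE i)) sumrB big_split/=.
move=> E; rewrite -[RHS]opprK -[LHS]opprK; congr (- _).
by rewrite opprB addrC -E /conv; ring.
Qed.

(** The representatives are u, truncated at its essential bound, and Du, both
    extended by 0 in time. *)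
Lemma solution_regular : exists U G, regular M u U G.
Proof.
exists U, G; split => //.
- split => //.
  + move=> i; have -> : flux U G i = fun z => A i z -
        (f z.1 (tclamp T z.2) (U z) ord0 i + g (tclamp T z.2) (U z) ord0 i) by [].
    have q0 : 0 <= q by rewrite ltW// (lt_trans _ q1).
    by apply: locally_Lp_B => //; exact: locally_Lp_D.
- move=> N e t0 e0 t0T.
  have H := uC0 (@compact_ball_rV0 R n N) (T_co t0T).
  have : nbhs (0%E : \bar R) [set x | (x < e%:E)%E].
    by apply: open_nbhs_nbhs; split; [exact: open_ereal_lt_ereal|rewrite /= lte_fin].
  move=> /H; rewrite /nbhs/= => -[d d0 dH]; exists d => // t tT td.
  have {}dH := dH t; rewrite /ball_/= distrC in dH.
  have {dH} := dH td (T_co tT).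
  have mut t' : 0 <= t' <= T -> measurable_fun setT (u ^~ t').
    move=> t'T; have := measurable_slice t' mU0.
    by rewrite /U0 /inT/= t'T.
  have mU' t' : measurable_fun setT (fun x => U (x, t')) by exact: measurable_slice.
  have mB : measurable_fun setT (\1_(ball_rV N : set 'rV[R]_n) : _ -> R).
    by apply: measurable_indic; exact: measurable_ball_rV.
  have igB : ig leb (fun x => \1_(ball_rV N : set 'rV[R]_n) x * `|U (x, t) - U (x, t0)|).
    apply: ig_dom (ig_abs (igB (ig_slice t) (ig_slice t0))) => [|x].
      apply: measurable_funM => //; apply: measurableT_comp => //.
      exact: measurable_funB.
    by rewrite normrM normr_id ler_piMl// ger0_norm ?indicE// lern1 leq_b1.
  rewrite -lee_fin I_fin// => /ltW; apply: le_trans; rewrite [leRHS]integral_mkcond.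
  rewrite (@ae_eq_integral _ _ _ leb setT ((fun x => `|u x t - u x t0|%:E) \_ (ball_rV N)))//.
  + by apply/measurable_EFinP; exact: ig_meas igB.
  + apply/(measurable_restrictT _ _).1; first exact: measurable_ball_rV.
    apply: measurable_funTS; apply/measurable_EFinP; apply: measurableT_comp => //.
    by apply: measurable_funB; exact: mut.
  + apply: filterS2 (U_ae tT) (U_ae t0T) => x Ux Ux0 _.
    by rewrite patchE Ux Ux0 indicE; case: ifP => _; rewrite ?mul1r ?mul0r.
Qed.

End regular.

(** * Functions of one variable used for testing *)

Section derivative_rules.
Context {R : realType}.
Implicit Types (f g : R -> R) (s a b c : R).

Lemma is_derive_mulc c f s a : is_derive s 1 f a -> is_derive s 1 (fun y => c * f y) (c * a).
Proof. by move=> Df; refine (is_deriveE _ _ (is_deriveZ c Df)). Qed.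

Lemma is_derive_add f g s a b : is_derive s 1 f a -> is_derive s 1 g b ->
  is_derive s 1 (fun y => f y + g y) (a + b).
Proof. by move=> Df Dg; refine (is_deriveE _ _ (is_deriveD Df Dg)). Qed.

Lemma is_derive_mul f g s a b : is_derive s 1 f a -> is_derive s 1 g b ->
  is_derive s 1 (fun y => f y * g y) (f s * b + a * g s).
Proof.
move=> Df Dg; refine (is_deriveE _ _ (is_deriveM Df Dg)) => //.
by rewrite /GRing.scale/= (mulrC (g s)).
Qed.

Lemma is_derive_affine g (c d s b : R) : is_derive (c * s + d) 1 g b ->
  is_derive s 1 (fun s => g (c * s + d)) (c * b).
Proof.
move=> Dg; rewrite mulrC.
apply: (is_derive_comp1 (f := fun s : R => c * s + d)) Dg.
rewrite -[X in is_derive _ _ _ X](addr0 c) -[X in X + 0](mulr1 c).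
have D0 : is_derive s 1 (cst d : R -> R) 0 by exact: is_derive_cst.
exact: is_derive_add (is_derive_mulc c (is_derive_id s (1 : R))) D0.
Qed.

End derivative_rules.

Section step_functions.
Context {R : realType}.
Implicit Types s r : R.

Definition pos s : R := Num.max s 0.

Lemma pos_ge0 s : 0 <= pos s. Proof. by rewrite le_max lexx orbT. Qed.

Lemma pos_id s : 0 <= s -> pos s = s. Proof. by move=> s0; rewrite /pos max_l. Qed.

Lemma pos_eq0 s : s <= 0 -> pos s = 0. Proof. by move=> s0; rewrite /pos max_r. Qed.

Lemma continuous_pos : continuous (pos : R -> R).
Proof.
by move=> s; apply: (@continuous_max _ _ id (fun=> 0)); [exact: cvg_id|exact: cvg_cst].
Qed.

Lemma sqpos_taylor s (h : R) :
  `|pos (h + s) ^+ 2 - pos s ^+ 2 - 2 * pos s * h| <= h ^+ 2.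
Proof.
rewrite ler_norml /pos; apply/andP.
have [s0|s0] := leP s 0; have [h0|h0] := leP (h + s) 0; split; nra.
Qed.

Lemma is_derive_sqpos s : is_derive s 1 (fun s => pos s ^+ 2) (2 * pos s).
Proof.
have D : is_derive s (1 : R) (fun y : R => pos y ^+ 2 - 2 * pos s * y) 0.
  apply: (@is_derive_quadratic _ _ _ 1) => h; rewrite mul1r.
  apply: le_trans (sqpos_taylor s h); rewrite le_eqVlt; apply/orP; left; apply/eqP.
  by congr `| _ |; ring.
have L := is_derive_mulc (2 * pos s) (is_derive_id s (1 : R)).
refine (is_deriveE _ _ (is_derive_add D L)); last by rewrite add0r mulr1.
by apply/funext => y /=; rewrite subrK.
Qed.

(** A C^1 step with piecewise linear derivative, as a combination of squares of
    positive parts. *)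
Definition step r : R := 2 * (pos r ^+ 2 - 2 * pos (r - 2^-1) ^+ 2 + pos (r - 1) ^+ 2).
Definition step' r : R := 4 * (pos r - 2 * pos (r - 2^-1) + pos (r - 1)).

Lemma step_le0 r : r <= 0 -> step r = 0.
Proof. by move=> r0; rewrite /step !pos_eq0 ?expr0n/=; lra. Qed.

Lemma step_ge1 r : 1 <= r -> step r = 1.
Proof. by move=> r1; rewrite /step !pos_id; lra || (rewrite /=; field). Qed.

Lemma step_itv r : 0 <= step r <= 1.
Proof.
rewrite /step /pos; have [h1|h1] := leP r 0; have [h2|h2] := leP (r - 2^-1) 0;
  have [h3|h3] := leP (r - 1) 0; apply/andP; split; try lra; nra.
Qed.

Lemma step'_itv r : 0 <= step' r <= 2.
Proof.
rewrite /step' /pos; have [h1|h1] := leP r 0; have [h2|h2] := leP (r - 2^-1) 0;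
  have [h3|h3] := leP (r - 1) 0; apply/andP; split; lra.
Qed.

Lemma step'_eq0 r : r <= 0 \/ 1 <= r -> step' r = 0.
Proof.
by case=> r0; rewrite /step'; [rewrite !pos_eq0; lra|rewrite !pos_id; lra].
Qed.

Lemma is_derive_step r : is_derive r 1 step (step' r).
Proof.
have D c := is_derive_affine (c := 1) (d := - c) (is_derive_sqpos (1 * r - c)).
refine (is_deriveE _ _ (is_derive_mulc 2 (is_derive_add (is_derive_add (D 0)
  (is_derive_mulc (-2) (D 2^-1))) (D 1)))).
- by apply/funext => y; rewrite /step !mul1r subr0 mulNr.
- by rewrite /step' !mul1r subr0; ring.
Qed.

Lemma continuous_affine (a b : R) : continuous (fun s : R => a * s + b).
Proof.
move=> s; apply: cvgD; last exact: cvg_cst.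
by apply: cvgM; [exact: cvg_cst|exact: cvg_id].
Qed.

Lemma continuous_step' : continuous step'.
Proof.
have c (b : R) : continuous (fun s => pos (s - b)).
  move=> s; apply: (@continuous_comp _ _ _ (fun s => s - b) pos); last exact: continuous_pos.
  by apply: cvgB; [exact: cvg_id|exact: cvg_cst].
move=> s; apply: cvgM; first exact: cvg_cst.
apply: cvgD; last exact: c.
apply: cvgB; first exact: continuous_pos.
by apply: cvgM; [exact: cvg_cst|exact: c].
Qed.

End step_functions.

Section positive_part_regularisation.
Context {R : realType}.
Implicit Types (s : R) (k : nat).

(** s exp(-1/((k+1)s)) for s > 0, a smooth convex approximation from below of the
    positive part; its successive derivatives are combinations of flat functions. *)
Definition pos_reg k s : R := s * flat 0 (k.+1%:R * s).
Definition pos_reg' k s : R := flat 0 (k.+1%:R * s) + flat 1 (k.+1%:R * s).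
Definition pos_reg'' k s : R := k.+1%:R * flat 3 (k.+1%:R * s).

Lemma mul_flat j s : s * flat j.+1 s = flat j s.
Proof.
rewrite /flat; case: ifP => s0; last by rewrite mulr0.
by rewrite exprS !mulrA divff ?mul1r// gt_eqF.
Qed.

Lemma is_derive_pos_reg k s : is_derive s 1 (pos_reg k) (pos_reg' k s).
Proof.
have D0 := @is_derive_affine _ _ k.+1%:R 0 s _ (is_derive_flat 0 _).
refine (is_deriveE _ _ (is_derive_mul (is_derive_id s (1 : R)) D0)).
- by apply/funext => y; rewrite /pos_reg /= addr0.
- rewrite /= addr0 oppr0 mul0r add0r mul1r addrC /pos_reg'; congr (_ + _).
  by rewrite mulrA (mulrC s) mul_flat.
Qed.

Lemma is_derive_pos_reg' k s : is_derive s 1 (pos_reg' k) (pos_reg'' k s).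
Proof.
have D j := @is_derive_affine _ _ k.+1%:R 0 s _ (is_derive_flat j _).
refine (is_deriveE _ _ (is_derive_add (D 0%N) (D 1%N))).
- by apply/funext => y; rewrite /pos_reg' addr0.
- by rewrite /pos_reg'' addr0; ring.
Qed.

Lemma continuous_pos_reg'' k : continuous (pos_reg'' k).
Proof.
move=> s; apply: cvgM; first exact: cvg_cst.
apply: (@continuous_comp _ _ _ (fun s : R => k.+1%:R * s) (flat 3)); last exact: continuous_flat.
by apply: cvgM; [exact: cvg_cst|exact: cvg_id].
Qed.

Lemma flat_le_fact j s : (0 < j)%N -> flat j s <= j`!%:R.
Proof.
move=> j0; have [s0|s0] := leP s 0; first by rewrite flat_eq0.
have H : (0 < j + 0)%N by rewrite addn0.
by have := flat_le s0 H; rewrite addn0 expr0 mulr1.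
Qed.

Lemma flat0_le1 s : flat 0 s <= 1.
Proof.
rewrite /flat; case: ifP => // s0; rewrite expr0 mul1r.
by rewrite -expR0 ler_expR oppr_le0 invr_ge0 ltW.
Qed.

Lemma flat0_ge s : 0 < s -> 1 - s^-1 <= flat 0 s.
Proof.
move=> s0; rewrite /flat s0 expr0 mul1r.
exact: expR_ge1Dx.
Qed.

Lemma pos_reg_itv k s : 0 <= pos_reg k s <= pos s.
Proof.
rewrite /pos_reg; have [s0|s0] := leP s 0.
  by rewrite flat_eq0 ?mulr0 ?lexx ?pos_ge0// pmulr_rle0.
by have s0' := ltW s0; rewrite pos_id// ger_pMr// flat0_le1 andbT mulr_ge0 ?flat_ge0.
Qed.

Lemma pos_reg'_itv k s : 0 <= pos_reg' k s <= 2.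
Proof.
by rewrite /pos_reg' addr_ge0 ?flat_ge0//= lerD ?flat0_le1// (@flat_le_fact 1).
Qed.

Lemma pos_reg''_ge0 k s : 0 <= pos_reg'' k s.
Proof. by rewrite mulr_ge0 ?flat_ge0. Qed.

(** Scale invariance: |s| pos_reg'' is one fixed bounded profile at (k+1)s. *)
Lemma mul_pos_reg'' k s : `|s| * pos_reg'' k s = flat 2 (k.+1%:R * s).
Proof.
have [s0|s0] := leP s 0.
  by rewrite /pos_reg'' !flat_eq0 ?mulr0// pmulr_rle0.
by rewrite ger0_norm ?ltW// /pos_reg'' mulrCA mulrA (mul_flat 2).
Qed.

Lemma mul_pos_reg''_itv k s : 0 <= `|s| * pos_reg'' k s <= 2.
Proof. by rewrite mul_pos_reg'' flat_ge0/= (@flat_le_fact 2). Qed.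

Lemma cvg_harmonic_mul (c : R) : c * k.+1%:R^-1 @[k --> \oo] --> 0.
Proof. by rewrite -[X in _ --> X](mulr0 c); apply: cvgMr; exact: cvg_harmonic. Qed.

(** The profile r^(-2) exp(-1/r) vanishes as r tends to infinity. This is what
    annihilates a Lipschitz remainder C |w| in the comparison. *)
Lemma cvg_mul_pos_reg'' s : `|s| * pos_reg'' k s @[k --> \oo] --> 0.
Proof.
have [s0|s0] := leP s 0.
  rewrite (_ : (fun k => _) = fun=> 0); first exact: cvg_cst.
  by apply/funext => k; rewrite mul_pos_reg'' flat_eq0// pmulr_rle0.
apply: (@squeeze_cvgr _ _ _ _ (fun=> 0) (fun k => s^-1 * k.+1%:R^-1)); last 2 first.
- exact: cvg_cst.
- exact: cvg_harmonic_mul.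
near=> k; have k0 : 0 < k.+1%:R * s by rewrite mulr_gt0.
rewrite mul_pos_reg'' flat_ge0/= -invfM (mulrC s) -[leRHS]mulr1 ler_pdivlMl// mul_flat.
exact: (@flat_le_fact 1).
Unshelve. all: by end_near. Qed.

Lemma cvg_pos_reg s : pos_reg k s @[k --> \oo] --> pos s.
Proof.
have [s0|s0] := leP s 0.
  rewrite (_ : (fun k => _) = fun=> 0) ?pos_eq0//; first exact: cvg_cst.
  by apply/funext => k; rewrite /pos_reg flat_eq0 ?mulr0// pmulr_rle0.
apply: (@squeeze_cvgr _ _ _ _ (fun k => s - 1 * k.+1%:R^-1) (fun=> s)); last 2 first.
- rewrite pos_id ?ltW// -[X in _ --> X]subr0.
  exact: cvgB (cvg_cst s) (cvg_harmonic_mul 1).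
- by rewrite pos_id ?ltW//; exact: cvg_cst.
near=> k; have k0 : 0 < k.+1%:R * s by rewrite mulr_gt0.
rewrite /pos_reg ger_pMr// flat0_le1 andbT.
have := flat0_ge k0; rewrite -(ler_pM2l s0); apply: le_trans.
by rewrite mulrBr mulr1 invfM mulrCA divff ?mulr1 ?mul1r ?gt_eqF.
Unshelve. all: by end_near. Qed.

End positive_part_regularisation.

(** * The energy and its weight *)

Section energy_functions.
Context {R : realType}.
Variables (tau eta : R).
Hypothesis tau_itv : 0 <= tau < 2^-1.
Hypothesis eta0 : 0 < eta.
Implicit Types s : R.

Definition rho s : R := s ^+ 2 + eta ^+ 2.
(** The weight of the energy: energy' s = s omega(s) behaves like
    s |s|^(-2 tau) for |s| large compared with eta, which removes the singularity
    at 0. *)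
Definition omega s : R := rho s `^ (- tau).
Definition energy s : R := (2 * (1 - tau))^-1 * (rho s `^ (1 - tau) - (eta ^+ 2) `^ (1 - tau)).
Definition energy' s : R := s * omega s.
Definition energy'' s : R := omega s - 2 * tau * s ^+ 2 * rho s `^ (- tau - 1).

Lemma rho_gt0 s : 0 < rho s.
Proof. by rewrite /rho ltr_wpDl ?sqr_ge0 ?exprn_gt0. Qed.

Lemma omega_gt0 s : 0 < omega s. Proof. by rewrite powR_gt0// rho_gt0. Qed.

Lemma is_derive_rho s : is_derive s 1 rho (2 * s).
Proof.
have D0 : is_derive s 1 (cst (eta ^+ 2) : R -> R) 0 by exact: is_derive_cst.
have Did := is_derive_id s (1 : R).
refine (is_deriveE _ _ (is_derive_add (is_derive_mul Did Did) D0)).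
- by apply/funext => y; rewrite /rho expr2.
- by rewrite /=; ring.
Qed.

Lemma is_derive_rho_powR r s :
  is_derive s 1 (fun s => rho s `^ r) (r * rho s `^ (r - 1) * (2 * s)).
Proof. exact: is_derive_comp1 (is_derive_rho s) (is_derive1_powR r (rho_gt0 s)). Qed.

Lemma continuous_rho_powR r : continuous (fun s => rho s `^ r).
Proof.
move=> s; apply: differentiable_continuous; apply/derivable1_diffP.
by have [] := is_derive_rho_powR r s.
Qed.

Lemma is_derive_energy s : is_derive s 1 energy (energy' s).
Proof.
have D0 : is_derive s 1 (cst (- (eta ^+ 2) `^ (1 - tau)) : R -> R) 0 by exact: is_derive_cst.
refine (is_deriveE _ _ (is_derive_mulc (2 * (1 - tau))^-1
  (is_derive_add (is_derive_rho_powR (1 - tau) s) D0))) => //.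
rewrite addr0 /energy' /omega (_ : 1 - tau - 1 = - tau); last by ring.
have t1 : 1 - tau != 0 by case/andP: tau_itv => _ t; lra.
by field; rewrite t1.
Qed.

Lemma is_derive_energy' s : is_derive s 1 energy' (energy'' s).
Proof.
refine (is_deriveE _ _ (is_derive_mul (is_derive_id s (1 : R)) (is_derive_rho_powR (- tau) s))) => //.
by rewrite /energy'' /omega; ring.
Qed.

Lemma continuous_energy'' : continuous energy''.
Proof.
move=> s; apply: cvgB; first exact: continuous_rho_powR.
apply: cvgM; last exact: continuous_rho_powR.
apply: cvgM; first exact: cvg_cst.
rewrite expr2 (_ : (fun x => x ^+ 2) = fun x => x * x) //.
by apply: cvgM; exact: cvg_id.
Qed.

(** The subtracted term of energy'' is at most 2 tau omega, because
    s^2 <= rho. *)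
Lemma energy''_itv s : (1 - 2 * tau) * omega s <= energy'' s <= omega s.
Proof.
have [t0 t1] := andP tau_itv; have r0 := rho_gt0 s.
have E : rho s `^ (- tau) = rho s * rho s `^ (- tau - 1).
  rewrite -[X in X * _]powRr1 ?(ltW r0)// -powRD ?(gt_eqF r0) ?implybT//.
  by congr (_ `^ _); ring.
have P0 : 0 <= rho s `^ (- tau - 1) := powR_ge0 _ _.
have sr : s ^+ 2 <= rho s by rewrite lerDl sqr_ge0.
have H : 0 <= 2 * tau * (s ^+ 2 * rho s `^ (- tau - 1)).
  by apply: mulr_ge0; [rewrite mulr_ge0|rewrite mulr_ge0// sqr_ge0].
have H2 : 2 * tau * (s ^+ 2 * rho s `^ (- tau - 1)) <= 2 * tau * omega s.
  by rewrite ler_wpM2l ?mulr_ge0// /omega E ler_wpM2r.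
by rewrite /energy'' -(mulrA (2 * tau)); apply/andP; split; lra.
Qed.

(** omega s <= |s|^(-2 tau), as rho >= s^2 and tau >= 0. *)
Lemma omega_powR s : omega s * `|s| `^ (1 + 2 * tau) <= `|s|.
Proof.
have [t0 t1] := andP tau_itv.
have [->|s0] := eqVneq s 0; first by rewrite normr0 powR0 ?mulr0//; apply/eqP; lra.
have ns : 0 < `|s| by rewrite normr_gt0.
rewrite powRD ?(gt_eqF ns) ?implybT// powRr1 ?normr_ge0// mulrCA ger_pMr//.
rewrite /omega powRN ler_pdivrMl ?powR_gt0 ?rho_gt0// mulr1.
rewrite powRrM; apply: ler_powR2 => //.
by rewrite powR_mulrn// real_normK ?num_real// /rho lerDl sqr_ge0.
Qed.

Lemma omega_powR_le M r s : `|s| <= M -> 1 + 2 * tau <= r ->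
  omega s * `|s| `^ r <= M `^ (r - 1 - 2 * tau) * `|s|.
Proof.
move=> sM r1; have [t0 t1] := andP tau_itv.
have -> : `|s| `^ r = `|s| `^ (r - 1 - 2 * tau) * `|s| `^ (1 + 2 * tau).
  rewrite -powRD; first by congr (_ `^ _); ring.
  by apply/implyP => /eqP h; exfalso; lra.
rewrite mulrCA; apply: ler_pM; rewrite ?powR_ge0 ?mulr_ge0 ?powR_ge0//.
- by apply: ler_powR2 => //; lra.
- exact: omega_powR.
Qed.

Lemma energy_itv s : 0 <= energy s <= omega s * s ^+ 2.
Proof.
have [t0 t1] := andP tau_itv; have r0 := rho_gt0 s.
have e20 : 0 < eta ^+ 2 by rewrite exprn_gt0.
have er : eta ^+ 2 <= rho s by rewrite lerDr sqr_ge0.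
have c0 : 0 < 2 * (1 - tau) by lra.
apply/andP; split.
  rewrite /energy mulr_ge0 ?invr_ge0 ?(ltW c0)// subr_ge0.
  by apply: ler_powR2 => //; [lra|exact: ltW].
rewrite /energy ler_pdivrMl//.
have E x : 0 < x -> x `^ (1 - tau) = x * x `^ (- tau).
  by move=> x0; rewrite -(mulr_powRB1 (ltW x0))//; [congr (_ * _ `^ _); ring|lra].
rewrite !E// /omega.
have H : rho s `^ (- tau) <= (eta ^+ 2) `^ (- tau).
  by rewrite !powRN lef_pV2 ?posrE ?powR_gt0//; apply: ler_powR2 => //; exact: ltW.
have P0 : 0 <= rho s `^ (- tau) := powR_ge0 _ _.
have -> : s ^+ 2 = rho s - eta ^+ 2 by rewrite /rho addrK.
have H2 := ler_wpM2l (ltW e20) H.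
have H3 : 0 <= (1 - 2 * tau) * (rho s `^ (- tau) * (rho s - eta ^+ 2)).
  by rewrite mulr_ge0 ?mulr_ge0 ?subr_ge0//; lra.
nra.
Qed.

End energy_functions.

(** * Cutoffs in space and time *)

Section one_dimensional_cutoffs.
Context {R : realType}.
Implicit Types (r t a T : R) (m : nat).

Definition ball_cut r : R := step (2 - r).
Definition ball_cut' r : R := - step' (2 - r).

Definition ann r : R := step (3 - r) * step (2 * r - 1).
Definition ann' r : R := - step' (3 - r) * step (2 * r - 1) + step (3 - r) * (2 * step' (2 * r - 1)).
(** A power of the annular cutoff: its gradient is then controlled by a lower
    power of the cutoff itself, which Young's inequality can absorb (see
    ann_powR). *)
Definition ann_cut m r : R := ann r ^+ m.+1.
Definition ann_cut' m r : R := m.+1%:R * ann r ^+ m * ann' r.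

(** Zero for t <= a and for t >= T1, and equal to (T1 - t)^2 in between, after
    the layer ]a, 2a[: minus its derivative is a positive weight there. *)
Definition time_cut a T1 t : R := step (a^-1 * t - 1) * pos (T1 - t) ^+ 2.
Definition time_cut' a T1 t : R :=
  a^-1 * step' (a^-1 * t - 1) * pos (T1 - t) ^+ 2 - 2 * step (a^-1 * t - 1) * pos (T1 - t).

Lemma continuous_affine_comp (g : R -> R) (c d : R) : continuous g ->
  continuous (fun s => g (c * s + d)).
Proof.
move=> cg s; apply: (@continuous_comp _ _ _ (fun s => c * s + d) g); last exact: cg.
exact: continuous_affine.
Qed.

Lemma continuous_step : continuous (step : R -> R).
Proof.
move=> s; apply: differentiable_continuous; apply/derivable1_diffP.
by have [] := is_derive_step s.
Qed.

Lemma is_derive_ball_cut r : is_derive r 1 ball_cut (ball_cut' r).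
Proof.
have D := is_derive_affine (c := -1) (d := 2) (is_derive_step (-1 * r + 2)).
have E y : -1 * y + 2 = 2 - y :> R by ring.
refine (is_deriveE _ _ D); last by rewrite E mulN1r.
by apply/funext => y; rewrite E.
Qed.

Lemma continuous_ball_cut' : continuous ball_cut'.
Proof.
have E y : -1 * y + 2 = 2 - y :> R by ring.
have -> : ball_cut' = fun y => - step' (-1 * y + 2) by apply/funext => y; rewrite E.
by move=> s; apply: cvgN; exact: continuous_affine_comp continuous_step' s.
Qed.

Lemma ball_cut_itv r : 0 <= ball_cut r <= 1. Proof. exact: step_itv. Qed.

Lemma ball_cut_eq1 r : r <= 1 -> ball_cut r = 1.
Proof. by move=> r1; apply: step_ge1; lra. Qed.

Lemma ball_cut_eq0 r : 2 <= r -> ball_cut r = 0.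
Proof. by move=> r1; apply: step_le0; lra. Qed.

Lemma ball_cut'_le r : `|ball_cut' r| <= 2.
Proof.
by rewrite /ball_cut' normrN; have /andP[h0 h2] := step'_itv (2 - r); rewrite ger0_norm.
Qed.

Lemma ball_cut'_eq0 r : r <= 1 \/ 2 <= r -> ball_cut' r = 0.
Proof. by move=> h; rewrite /ball_cut' step'_eq0 ?oppr0//; case: h => h; [right|left]; lra. Qed.

Lemma ann_itv r : 0 <= ann r <= 1.
Proof.
have /andP[a0 a1] := step_itv (3 - r); have /andP[b0 b1] := step_itv (2 * r - 1).
by rewrite /ann mulr_ge0// mulr_ile1.
Qed.

Lemma ann_eq1 r : 1 <= r <= 2 -> ann r = 1.
Proof. by move=> /andP[r1 r2]; rewrite /ann !step_ge1 ?mulr1//; lra. Qed.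

Lemma ann_eq0 r : r <= 2^-1 \/ 3 <= r -> ann r = 0.
Proof.
case=> h; first by rewrite /ann (@step_le0 _ (2 * r - 1)) ?mulr0//; lra.
by rewrite /ann step_le0 ?mul0r//; lra.
Qed.

Lemma is_derive_ann r : is_derive r 1 ann (ann' r).
Proof.
have D3 := is_derive_affine (c := -1) (d := 3) (is_derive_step (-1 * r + 3)).
have D2 := is_derive_affine (c := 2) (d := -1) (is_derive_step (2 * r - 1)).
have E y : -1 * y + 3 = 3 - y :> R by ring.
refine (is_deriveE _ _ (is_derive_mul D3 D2)).
- by apply/funext => y; rewrite E.
- by rewrite E /ann'; ring.
Qed.

Lemma continuous_ann' : continuous ann'.
Proof.
have E y : -1 * y + 3 = 3 - y :> R by ring.
have -> : ann' = fun y => - step' (-1 * y + 3) * step (2 * y - 1) +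
    step (-1 * y + 3) * (2 * step' (2 * y - 1)) by apply/funext => y; rewrite E.
move=> s; apply: cvgD; apply: cvgM.
- by apply: cvgN; exact: continuous_affine_comp continuous_step' s.
- exact: continuous_affine_comp continuous_step s.
- exact: continuous_affine_comp continuous_step s.
- apply: cvgM; first exact: cvg_cst.
  exact: continuous_affine_comp continuous_step' s.
Qed.

Lemma ann'_le r : `|ann' r| <= 6.
Proof.
have /andP[a0 a1] := step_itv (3 - r); have /andP[b0 b1] := step_itv (2 * r - 1).
have /andP[c0 c1] := step'_itv (3 - r); have /andP[d0 d1] := step'_itv (2 * r - 1).
rewrite /ann'; move: (step (3 - r)) (step (2 * r - 1)) (step' (3 - r)) (step' (2 * r - 1)) a0 a1 b0 b1 c0 c1 d0 d1.
move=> a b c d a0 a1 b0 b1 c0 c1 d0 d1.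
have H1 : c * b <= 2 * 1 by apply: ler_pM.
have H2 : a * (2 * d) <= 1 * (2 * 2).
  by apply: ler_pM => //; [rewrite mulr_ge0|rewrite ler_pM2l].
have H3 : 0 <= c * b by rewrite mulr_ge0.
have H4 : 0 <= a * (2 * d) by rewrite !mulr_ge0.
by rewrite ler_norml; apply/andP; split; lra.
Qed.

Lemma is_derive_ann_cut m r : is_derive r 1 (ann_cut m) (ann_cut' m r).
Proof.
elim: m => [|m IH].
  refine (is_deriveE _ _ (is_derive_ann r)) => //.
  by rewrite /ann_cut' expr0 !mul1r.
refine (is_deriveE _ _ (is_derive_mul (is_derive_ann r) IH)).
- by apply/funext => y; rewrite /ann_cut [RHS]exprS.
- by rewrite /ann_cut' /ann_cut !exprS (_ : m.+2%:R = m.+1%:R + 1 :> R); [ring|rewrite -natr1].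
Qed.

Lemma continuous_ann_cut' m : continuous (ann_cut' m).
Proof.
move=> s; apply: cvgM; last exact: continuous_ann'.
apply: cvgM; first exact: cvg_cst.
apply: (@continuous_comp _ _ _ ann (fun y => y ^+ m)); last exact: exprn_continuous.
apply: differentiable_continuous; apply/derivable1_diffP.
by have [] := is_derive_ann s.
Qed.

Lemma ann_cut_itv m r : 0 <= ann_cut m r <= 1.
Proof.
have /andP[a0 a1] := ann_itv r.
by rewrite /ann_cut exprn_ge0// exprn_ile1.
Qed.

Lemma ann_cut_eq1 m r : 1 <= r <= 2 -> ann_cut m r = 1.
Proof. by move=> h; rewrite /ann_cut ann_eq1// expr1n. Qed.

Lemma ann_cut_eq0 m r : r <= 2^-1 \/ 3 <= r -> ann_cut m r = 0.
Proof. by move=> h; rewrite /ann_cut ann_eq0// expr0n. Qed.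

Lemma ann_cut'_le m r : `|ann_cut' m r| <= 6 * m.+1%:R * ann r ^+ m.
Proof.
have /andP[a0 a1] := ann_itv r.
rewrite /ann_cut' !normrM (ger0_norm (ler0n _ _)) (ger0_norm (exprn_ge0 _ a0)).
by rewrite mulrC mulrA ler_wpM2r ?exprn_ge0// ler_wpM2r// ann'_le.
Qed.

Lemma ann_cut'_eq0 m r : r <= 2^-1 \/ 3 <= r -> ann_cut' m.+1 r = 0.
Proof. by move=> h; rewrite /ann_cut' ann_eq0// expr0n mulr0 mul0r. Qed.

Lemma is_derive_time_cut a T1 t : is_derive t 1 (time_cut a T1) (time_cut' a T1 t).
Proof.
have D1 := is_derive_affine (c := a^-1) (d := -1) (is_derive_step (a^-1 * t - 1)).
have D2 := is_derive_affine (c := -1) (d := T1) (is_derive_sqpos (-1 * t + T1)).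
have E y : -1 * y + T1 = T1 - y :> R by ring.
refine (is_deriveE _ _ (is_derive_mul D1 D2)).
- by apply/funext => y; rewrite E.
- by rewrite E /time_cut'; ring.
Qed.

Lemma continuous_time_cut' a T1 : continuous (time_cut' a T1).
Proof.
have E y : -1 * y + T1 = T1 - y :> R by ring.
have -> : time_cut' a T1 = fun t => a^-1 * step' (a^-1 * t - 1) * (pos (-1 * t + T1) * pos (-1 * t + T1)) -
    2 * step (a^-1 * t - 1) * pos (-1 * t + T1).
  by apply/funext => t; rewrite E /time_cut' expr2.
have cp s := @continuous_affine_comp _ (-1) T1 continuous_pos s.
move=> s; apply: cvgB; apply: cvgM; last exact: cp.
- apply: cvgM; first exact: cvg_cst.
  exact: continuous_affine_comp continuous_step' s.
- by apply: cvgM; exact: cp.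
- apply: cvgM; first exact: cvg_cst.
  exact: continuous_affine_comp continuous_step s.
Qed.

Lemma time_cut_le0 a T1 t : 0 < a -> t <= a -> time_cut a T1 t = 0 /\ time_cut' a T1 t = 0.
Proof.
move=> a0 ta; have h : a^-1 * t - 1 <= 0 by rewrite subr_le0 ler_pdivrMl// mulr1.
by rewrite /time_cut /time_cut' step_le0// step'_eq0; [split; ring|left].
Qed.

Lemma time_cut_ge a T1 t : T1 <= t -> time_cut a T1 t = 0 /\ time_cut' a T1 t = 0.
Proof.
by move=> tT; rewrite /time_cut /time_cut' pos_eq0; [split; ring|rewrite subr_le0].
Qed.

Lemma time_cut_itv a T1 t : 0 < a -> 0 <= T1 -> 0 <= time_cut a T1 t <= T1 ^+ 2.
Proof.
move=> a0 T10; have /andP[s0 s1] := step_itv (a^-1 * t - 1).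
rewrite /time_cut mulr_ge0 ?sqr_ge0//=.
have [ta|ta] := leP t a; first by have [h _] := time_cut_le0 T1 a0 ta; rewrite -/(time_cut a T1 t) h sqr_ge0.
rewrite (@le_trans _ _ (pos (T1 - t) ^+ 2))//; first by rewrite ler_piMl// sqr_ge0.
by rewrite ler_sqr ?nnegrE ?pos_ge0// /pos ge_max T10 andbT; lra.
Qed.

(** The step is constant there, so only the factor (T1 - t)^2 varies. *)
Lemma time_cut'_late a T1 t : 0 < a -> 2 * a <= t -> time_cut' a T1 t = - 2 * pos (T1 - t).
Proof.
move=> a0 ta; have h : 1 <= a^-1 * t - 1.
  by rewrite lerBrDr ler_pdivlMl// mulrC; lra.
by rewrite /time_cut' step_ge1// step'_eq0; [ring|right].
Qed.

Lemma time_cut'_le a T1 t : 0 < a -> 0 <= T1 -> 0 <= t ->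
  - 2 * T1 <= time_cut' a T1 t <= a^-1 * (2 * T1 ^+ 2).
Proof.
move=> a0 T10 t0; have /andP[s0 s1] := step_itv (a^-1 * t - 1).
have /andP[d0 d1] := step'_itv (a^-1 * t - 1).
have p0 := pos_ge0 (T1 - t).
have pT : pos (T1 - t) <= T1 by rewrite /pos ge_max T10 andbT; lra.
have pT2 : pos (T1 - t) ^+ 2 <= T1 ^+ 2 by rewrite ler_sqr ?nnegrE.
have i0 : 0 <= a^-1 by rewrite invr_ge0 ltW.
rewrite /time_cut'; move: (a^-1) (step (a^-1 * t - 1)) (step' (a^-1 * t - 1)) (pos (T1 - t)) s0 s1 d0 d1 p0 pT pT2 i0.
move=> i s d p s0 s1 d0 d1 p0 pT pT2 i0.
have H1 : 0 <= i * d * p ^+ 2 by rewrite !mulr_ge0 ?sqr_ge0.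
have H2 : i * d * p ^+ 2 <= i * (2 * T1 ^+ 2).
  by rewrite -mulrA ler_wpM2l//; apply: ler_pM => //; exact: sqr_ge0.
have H3 : 0 <= 2 * s * p by rewrite !mulr_ge0.
have H4 : 2 * s * p <= 2 * 1 * T1.
  by apply: ler_pM; rewrite ?mulr_ge0// ler_pM2l.
by apply/andP; split; lra.
Qed.

End one_dimensional_cutoffs.

Section cutoffs.
Context {R : realType} {n : nat}.
Local Notation W := ('rV[R]_n * R)%type.

(** |x|^2 / L^2 with the Euclidean norm, which unlike the norm is smooth at 0. *)
Definition rad2 (L : R) (z : W) : R := L ^- 2 * \sum_i z.1 ord0 i ^+ 2.

Lemma C1_sum (I : Type) (s : seq I) (f : I -> W -> R) df :
  (forall i, C1 (f i) (df i)) ->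
  C1 (fun z => \sum_(i <- s) f i z) (fun z v => \sum_(i <- s) df i z v).
Proof.
move=> Cf; elim: s => [|i s IH].
  by apply: C1_eq (C1_cst 0) => [z|z v]; rewrite big_nil.
by apply: C1_eq (C1_D (Cf i) IH) => [z|z v]; rewrite big_cons.
Qed.

Lemma C1_coord i : C1 (fun z : W => z.1 ord0 i) (fun _ v => v.1 ord0 i).
Proof.
apply: C1_aff.
  by move=> z; apply: (@continuous_comp _ _ _ fst (fun x : 'rV[R]_n => x ord0 i)); [exact: cvg_fst|exact: continuous_coord].
by move=> z v h /=; rewrite !mxE.
Qed.

Lemma C1_time : C1 (fun z : W => z.2) (fun _ v => v.2).
Proof. by apply: C1_aff => // z; exact: cvg_snd. Qed.

Lemma C1_rad2 L : C1 (rad2 L) (fun z v => L ^- 2 * \sum_i (2 * z.1 ord0 i * v.1 ord0 i)).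
Proof.
have CS := C1_sum (index_enum 'I_n) (fun i => C1_M (C1_coord i) (C1_coord i)).
apply: C1_eq (C1_M (C1_cst (L ^- 2)) CS) => [z|z v].
  by congr (_ * _); apply: eq_bigr => i _; rewrite expr2.
rewrite mul0r addr0; congr (_ * _); apply: eq_bigr => i _; ring.
Qed.

(** Cutoffs are products of a function of t and a function of |x|^2 / L^2. *)
Lemma cutoff_C1 (th th' k k' : R -> R) L :
  (forall s : R, is_derive s 1 th (th' s)) -> continuous th' ->
  (forall s : R, is_derive s 1 k (k' s)) -> continuous k' ->
  exists dxi, [/\ C1 (fun z : W => th z.2 * k (rad2 L z)) dxi,
    forall z, dxi z dir_t = th' z.2 * k (rad2 L z) &
    forall z i, dxi z (dir_x i) = th z.2 * (k' (rad2 L z) * (L ^- 2 * (2 * z.1 ord0 i)))].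
Proof.
move=> Dth cth Dk ck.
have C := C1_M (C1_comp C1_time Dth cth) (C1_comp (C1_rad2 L) Dk ck).
eexists; split; first exact: C.
  move=> z; rewrite /dir_t/= mulr1 [X in _ * (_ * (_ * X))]big1 ?mulr0 ?add0r//.
  by move=> i _; rewrite mxE mulr0.
move=> z i; rewrite /dir_x/= mulr0 mul0r addr0; congr (_ * (_ * (_ * _))).
rewrite (bigD1 i)//= big1 ?addr0; first by rewrite mxE !eqxx mulr1.
by move=> j ji; rewrite mxE (negbTE ji) andbF mulr0.
Qed.

Lemma rad2_coord L z i : 0 < L -> rad2 L z <= 4 -> `|z.1 ord0 i| <= 2 * L.
Proof.
move=> L0; rewrite /rad2 ler_pdivrMl ?exprn_gt0// => H.
rewrite -(@ler_pXn2r _ 2)// ?nnegrE ?mulr_ge0 ?(ltW L0)//.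
rewrite real_normK ?num_real// exprMn (_ : 2 ^+ 2 = 4 :> R); last by ring.
rewrite mulrC; apply: le_trans H.
by rewrite (bigD1 i)//= lerDl sumr_ge0// => j _; exact: sqr_ge0.
Qed.

Lemma rad2_norm L z : 0 < L -> rad2 L z <= 4 -> `|z.1| <= 2 * L.
Proof.
move=> L0 H; apply/norm_rV_le; first by rewrite mulr_ge0// ltW.
by move=> i; exact: rad2_coord.
Qed.

Lemma rad2_le L z N : 0 < L -> `|z.1| <= N -> rad2 L z <= L ^- 2 * (n%:R * N ^+ 2).
Proof.
move=> L0 zN; rewrite /rad2 ler_wpM2l ?invr_ge0 ?exprn_even_ge0//.
rewrite mulr_natl -[X in _ *+ X](card_ord n) -sumr_const; apply: ler_sum => i _.
have N0 : 0 <= N by exact: le_trans zN.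
rewrite -real_normK ?num_real// ler_sqr ?nnegrE//.
exact: le_trans (coord_le_norm _ _) zN.
Qed.

Lemma measurable_rad2 L : measurable_fun setT (rad2 L : 'rV[R]_n * measurableTypeR R -> R).
Proof. by apply: measurable_continuous_rVR; case: (C1_rad2 L). Qed.

Lemma grad_rad2_le L z i : 0 < L -> rad2 L z <= 4 ->
  `|L ^- 2 * (2 * z.1 ord0 i)| <= L^-1 * 4.
Proof.
move=> L0 H; rewrite !normrM ger0_norm ?invr_ge0 ?exprn_even_ge0//.
rewrite (ger0_norm (ler0n _ 2)) expr2 invfM -mulrA ler_wpM2l ?invr_ge0 ?(ltW L0)//.
rewrite ler_pdivrMl//; have := rad2_coord i L0 H; lra.
Qed.

End cutoffs.

(** * Local energy estimate and the flux through annuli *)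

Section pointwise_energy.
Context {R : realType}.

(** The exponent q = p/(p-1) of the flux satisfies m q >= m + 1 once
    m >= p - 1. *)
Lemma ann_powR (m : nat) (p : R) (r : R) : 1 < p -> p - 1 <= m%:R ->
  (ann r ^+ m) `^ (p / (p - 1)) <= ann_cut m r.
Proof.
move=> p1 pm; have d0 : 0 < p - 1 by rewrite subr_gt0.
have /andP[a0 a1] := ann_itv r.
have q0 : p / (p - 1) != 0 by rewrite gt_eqF// divr_gt0//; lra.
have m0 : (0 < m)%N by rewrite -(ltr0n R); lra.
have [->|an0] := eqVneq (ann r) 0.
  by rewrite expr0n eqn0Ngt m0 powR0//; case/andP: (ann_cut_itv m r).
have ap : 0 < ann r by rewrite lt_neqAle eq_sym an0.
rewrite /ann_cut -!powR_mulrn// -powRrM; apply: ger_powR; first by rewrite ap.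
rewrite mulrA ler_pdivlMr// -natr1; lra.
Qed.

(** Young's inequality with weight s for the product of u and the flux: the flux
    comes with the small factor s^q and, because Y^q <= chi, with the cutoff chi of
    the energy; the cutoff is lost only in the term with |u|^p. *)
Lemma cross_term_le (p q s K th om chi chi' Y ph u g C E Ur : R) :
  0 < p -> 0 < q -> p^-1 + q^-1 = 1 -> 0 < s -> 0 <= th -> 0 <= om -> 0 <= Y ->
  `|chi' * g| <= K * Y -> Y `^ q <= chi -> 0 <= K ->
  `|ph| `^ q <= C * (E + Ur) ->
  - (ph * (th * (chi' * g) * (u * om))) <=
  K * s^-1 `^ p * (th * (om * `|u| `^ p)) + K * s `^ q * C * (th * chi * (om * E) + th * chi * (om * Ur)).
Proof.
move=> p0 q0 pq s0 th0 om0 Y0 cg Yq K0 phq.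
apply: (le_trans (ler_norm _)); rewrite normrN.
have -> : ph * (th * (chi' * g) * (u * om)) = (th * om) * ((chi' * g) * (u * ph)) by ring.
rewrite normrM ger0_norm ?mulr_ge0// normrM.
have H1 : `|chi' * g| * `|u * ph| <= K * (Y * `|u * ph|).
  by rewrite mulrA ler_wpM2r.
have H2 : Y * `|u * ph| <= s^-1 `^ p * `|u| `^ p + s `^ q * (chi * (C * (E + Ur))).
  rewrite -{1}(ger0_norm Y0) -normrM (_ : Y * (u * ph) = u * (Y * ph)); last by ring.
  apply: (le_trans (young_scaled u (Y * ph) p0 q0 pq s0)).
  rewrite lerD2l ler_wpM2l ?powR_ge0// normrM (ger0_norm Y0) powRM//.
  by apply: ler_pM; rewrite ?powR_ge0.
have H3 : `|chi' * g| * `|u * ph| <= K * (s^-1 `^ p * `|u| `^ p + s `^ q * (chi * (C * (E + Ur)))).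
  by apply: (le_trans H1); rewrite ler_wpM2l.
apply: (le_trans (ler_wpM2l _ H3)); first exact: mulr_ge0.
by rewrite le_eqVlt; apply/orP; left; apply/eqP; ring.
Qed.

Lemma main_term_ge (c C tau th om om' chi S E Ur : R) : 0 <= th -> 0 <= chi -> 0 <= c -> 0 <= C ->
  0 <= E -> 0 <= Ur -> 0 <= om' ->
  (1 - 2 * tau) * om <= om' <= om -> c * E - C * Ur <= S ->
  (1 - 2 * tau) * c * (th * chi * (om * E)) - C * (th * chi * (om * Ur)) <= th * chi * om' * S.
Proof.
move=> th0 chi0 c0 C0 E0 Ur0 om0 /andP[h1 h2] HS.
have H1 : (1 - 2 * tau) * om * (c * E) <= om' * (c * E) by rewrite ler_wpM2r// mulr_ge0.
have H2 : om' * (C * Ur) <= om * (C * Ur) by rewrite ler_wpM2r// mulr_ge0.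
have H3 : om' * (c * E - C * Ur) <= om' * S by rewrite ler_wpM2l.
have H : (1 - 2 * tau) * om * (c * E) - om * (C * Ur) <= om' * S.
  by apply: le_trans H3; rewrite mulrBr; lra.
have tc0 : 0 <= th * chi by rewrite mulr_ge0.
have := ler_wpM2l tc0 H; lra.
Qed.

Lemma exists_small_power (q b c : R) : 0 < q -> 0 <= b -> 0 < c ->
  exists2 s : R, 0 < s & b * s `^ q <= c.
Proof.
move=> q0 b0 c0; have b1 : 0 < b + 1 by lra.
have [s s0 Hs] := powR_small q0 (divr_gt0 c0 b1).
exists s => //; have /Hs : 0 <= s <= s by rewrite lexx ltW.
rewrite ler_pdivlMr//; have := powR_ge0 s q; nra.
Qed.

(** The absorption argument of energy_pointwise between real numbers: half of
    the coercive term 2 c2 e pays for the cross term. *)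
Lemma energy_arith (N K0 sp sq C c2 Mp TT e A1 A2 P Q u : R) :
  0 <= N -> 0 <= K0 -> 0 <= sp -> 0 <= TT -> 0 <= C -> 0 <= c2 -> 0 <= e -> 0 <= A1 ->
  N * (K0 * C) * sq <= c2 -> 2 * c2 * e - C * A1 <= P ->
  - Q <= N * (K0 * sp * A2 + K0 * sq * C * (e + A1)) ->
  A2 <= TT * (Mp * u) -> A1 <= TT * u ->
  c2 * e <= P + Q + TT * (C + N * (K0 * sp * Mp) + c2) * u.
Proof.
move=> N0 K00 sp0 TT0 C0 c20 e0 A10 Hs HP HQ HA2 HA1.
have H1 : N * (K0 * sp) * A2 <= N * (K0 * sp) * (TT * (Mp * u)).
  by rewrite ler_wpM2l// !mulr_ge0.
have H2 : N * (K0 * C) * sq * (e + A1) <= c2 * (e + A1) by rewrite ler_wpM2r// addr_ge0.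
have H3 : (C + c2) * A1 <= (C + c2) * (TT * u) by rewrite ler_wpM2l// addr_ge0.
have -> : TT * (C + N * (K0 * sp * Mp) + c2) * u =
  (C + c2) * (TT * u) + N * (K0 * sp) * (TT * (Mp * u)) by ring.
have E : N * (K0 * sp * A2 + K0 * sq * C * (e + A1)) =
  N * (K0 * sp) * A2 + N * (K0 * C) * sq * (e + A1) by ring.
rewrite E in HQ; lra.
Qed.

Lemma energy_final (c2 K K1 a e X D J IT : R) : 0 < c2 -> 0 <= K -> 0 <= K1 -> 0 < a ->
  0 <= e -> 0 <= D -> c2 * X <= IT + K * D -> IT <= a^-1 * K1 * J -> J <= e * a ->
  X <= c2^-1 * (K1 + K) * (e + D).
Proof.
move=> c0 K0 K10 a0 e0 D0 h1 h2 h3.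
have i0 : 0 <= a^-1 * K1 by rewrite mulr_ge0// invr_ge0 ltW.
have h4 : a^-1 * K1 * J <= K1 * e.
  apply: (le_trans (ler_wpM2l i0 h3)).
  by rewrite (_ : a^-1 * K1 * (e * a) = K1 * e)//; field; rewrite gt_eqF.
rewrite -mulrA ler_pdivlMl//.
have : 0 <= K1 * D by rewrite mulr_ge0.
have : 0 <= K * e by rewrite mulr_ge0.
lra.
Qed.

Lemma flux_arith (th TT lam om C lp Lp u eta F Fq E Ur op : R) :
  0 <= th -> th <= TT -> 0 <= lam -> 0 <= om -> 0 <= C -> 0 <= lp -> 0 <= Lp ->
  0 <= u -> 0 <= eta ->
  F <= lp * op * Lp + lam * om * Fq -> Fq <= C * (E + Ur) -> om * Ur <= u -> op <= u + eta ->
  th * F <= lam * C * (th * (om * E) + TT * u) + lp * Lp * TT * (u + eta).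
Proof.
move=> th0 thT lam0 om0 C0 lp0 Lp0 u0 eta0 HF HFq HU Hop.
have lo0 : 0 <= lam * om by rewrite mulr_ge0.
have H1 : lam * om * Fq <= lam * om * (C * (E + Ur)) by rewrite ler_wpM2l.
have H2 : lp * op * Lp <= lp * (u + eta) * Lp by rewrite ler_wpM2r// ler_wpM2l.
have H3 : th * F <= th * (lp * (u + eta) * Lp + lam * om * (C * (E + Ur))).
  by rewrite ler_wpM2l//; lra.
have H4 : th * (om * Ur) <= TT * u.
  by apply: (@le_trans _ _ (th * u)); [rewrite ler_wpM2l|rewrite ler_wpM2r].
have H5 : lam * C * (th * (om * Ur)) <= lam * C * (TT * u) by rewrite ler_wpM2l// mulr_ge0.
have H6 : lp * Lp * (u + eta) * th <= lp * Lp * (u + eta) * TT.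
  by rewrite ler_wpM2l// !mulr_ge0// addr_ge0.
lra.
Qed.

(** The powers of L cancel here: Lm Lp = 1, and eta L^n <= L^p bounds the
    contribution of the volume B. *)
Lemma flux_final (lam C Ke TT f lp Lm Lp Ln e D eta X B F : R) :
  0 <= lam -> 0 <= C -> 0 <= Ke -> 0 <= TT -> 0 <= f -> 0 <= lp -> 0 <= Lm ->
  Lp * Lm = 1 -> 1 <= Lp -> 0 <= e -> 0 <= D -> 0 <= eta ->
  X <= Ke * (e + D) -> B <= f * Ln -> eta * Ln <= Lp ->
  F <= lam * C * (X + TT * D) + lp * Lm * TT * (D + eta * B) ->
  F <= (C * (Ke + TT) + TT * (1 + f)) * (lam * (e + D) + lp * (D + 1)).
Proof.
move=> lam0 C0 Ke0 TT0 f0 lp0 Lm0 LE L1 e0 D0 eta0 HX HB He HF.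
have lc0 : 0 <= lam * C by rewrite mulr_ge0.
have Lm1 : Lm <= 1 by rewrite -LE ler_peMl.
have H1 : lam * C * (X + TT * D) <= lam * C * (Ke * (e + D) + TT * (e + D)).
  rewrite ler_wpM2l//; have : 0 <= TT * e by rewrite mulr_ge0.
  lra.
have H2 : Lm * (D + eta * B) <= D + f.
  have h1 : eta * B <= f * Lp.
    apply: (@le_trans _ _ (eta * (f * Ln))); first by rewrite ler_wpM2l.
    by rewrite mulrCA ler_wpM2l.
  have h2 : Lm * (D + eta * B) <= Lm * (D + f * Lp) by rewrite ler_wpM2l// lerD2l.
  have h3 : Lm * D <= D by rewrite ler_piMl.
  have h4 : Lm * (f * Lp) = f by rewrite mulrCA (mulrC Lm) LE mulr1.
  by apply: (le_trans h2); rewrite mulrDr h4 lerD2r.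
have H3 : lp * TT * (Lm * (D + eta * B)) <= lp * TT * (D + f).
  by rewrite ler_wpM2l// mulr_ge0.
have H4 : 0 <= lp * TT * (f * D + 1) by rewrite !mulr_ge0// addr_ge0// mulr_ge0.
have H5 : 0 <= C * (Ke + TT) * (lp * (D + 1)) by rewrite !mulr_ge0// addr_ge0.
have H6 : 0 <= TT * (1 + f) * (lam * (e + D)) by rewrite !mulr_ge0// addr_ge0.
lra.
Qed.

End pointwise_energy.

Section cutoff_tools.
Context {R : realType} {n : nat}.
Local Notation V := ('rV[R]_n * measurableTypeR R)%type.
Local Notation leb := (@lebesgue_rV R n).

Lemma measurable_comp_continuous (g : R -> R) (w : V -> R) : continuous g ->
  measurable_fun setT w -> measurable_fun setT (fun z => g (w z)).
Proof.
move=> cg mw; apply: (measurableT_comp (f := g)) => //.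
exact: continuous_measurable_fun.
Qed.

Lemma measurable_time (g : R -> R) : continuous g ->
  measurable_fun setT (fun z : V => g z.2).
Proof.
move=> cg; apply: (measurableT_comp (f := g : measurableTypeR R -> R)) => //.
exact: continuous_measurable_fun.
Qed.

(** The layer has thickness a, which compensates the factor 1/a of the derivative
    of the time cutoff. *)
Lemma initial_layer (H : V -> R) (a e : R) : 0 < a -> 0 <= e -> ig lebV H ->
  (forall z, 0 <= H z) ->
  (forall t, a <= t <= 2 * a -> (\int[leb]_x (H (x, t))%:E <= e%:E)%E) ->
  ig lebV (fun z => \1_[set z : V | a <= z.2 <= 2 * a] z * H z) /\
  \int[lebV]_z (\1_[set z : V | a <= z.2 <= 2 * a] z * H z) <= e * a.
Proof.
move=> a0 e0 igH H0 He; set A := [set z | _].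
have mA : measurable A.
  rewrite (_ : A = [set: 'rV[R]_n] `*` `[a, 2 * a]%classic); first exact: measurableX.
  by apply/seteqP; split=> [z zT|z [_]]; rewrite /A /= ?in_itv.
have mf : measurable_fun setT (fun z => \1_A z * H z).
  by apply: measurable_funM; [exact: measurable_indic|exact: ig_meas igH].
apply: ig_ge0 => // [z|]; first by rewrite mulr_ge0// indicE.
have a2 : a <= 2 * a by rewrite ler_peMl ?(ltW a0)// ler1n.
have -> : e * a = e * (2 * a - a) by congr (_ * _); ring.
apply: nn_slices_le => //.
- by move=> z; rewrite mulr_ge0// indicE.
- by move=> z zA; rewrite indicE memNset ?mul0r.
- move=> t tA; under eq_integral do rewrite indicE mem_set ?mul1r//.
  exact: He.
Qed.

Lemma cutoff_support (k : R -> R) T T1 L a (z : 'rV[R]_n * R) : T1 < T -> 0 < a -> 0 < L -> (forall r, 3 <= r -> k r = 0) ->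
  Num.max (2 * L) T < `|z| -> time_cut a T1 z.2 * k (rad2 L z) = 0.
Proof.
move=> T1T a0 L0 k0 zN.
have [tT|tT] := leP T1 z.2; first by have [-> _] := time_cut_ge a tT; rewrite mul0r.
have [ta|ta] := leP z.2 a; first by have [-> _] := time_cut_le0 T1 a0 ta; rewrite mul0r.
have [r3|r3] := leP 3 (rad2 L z); first by rewrite k0// mulr0.
have z1 : `|z.1| <= 2 * L by apply: rad2_norm => //; apply: ltW; apply: lt_trans r3 _; rewrite ltr_nat.
exfalso; move: zN; apply/negP; rewrite -leNgt normV_le.
rewrite (le_trans z1) ?le_max ?lexx//= ger0_norm ?(ltW (lt_trans a0 ta))//.
by rewrite (ltW (lt_trans tT T1T)) orbT.
Qed.

End cutoff_tools.

Section dissipative.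
Context {R : realType} {n : nat}.
Local Notation V := ('rV[R]_n * measurableTypeR R)%type.

(** All that the local estimates use of a solution: a coercive flux, with
    growth conjugate to the energy density E = |Du|^p. The lower order terms have
    size |u|^(1 + 2 tau), exactly what the weight omega reduces to |u|. *)
Record dissipative (p T M c C tau : R) (U E : V -> R) (G Phi : 'I_n -> V -> R) : Prop := {
  dis_weak : weak_sol p (p / (p - 1)) T M U G Phi;
  dis_ig : ig lebV U;
  dis_meas : measurable_fun setT E;
  dis_ge0 : forall z, 0 <= E z;
  dis_coercive : forall z,
    c * E z - C * `|U z| `^ (1 + 2 * tau) <= \sum_i Phi i z * G i z;
  dis_growth : forall i z,
    `|Phi i z| `^ (p / (p - 1)) <= C * (E z + `|U z| `^ (1 + 2 * tau)) }.

End dissipative.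

Section energy_estimate.
Context {R : realType} {n : nat}.
Local Notation V := ('rV[R]_n * measurableTypeR R)%type.
Local Notation leb := (@lebesgue_rV R n).
Variables (p T T1 M c C tau : R) (U E : V -> R) (G Phi : 'I_n -> V -> R).
Hypothesis p2 : 2 < p.
Hypothesis T10 : 0 < T1.
Hypothesis T1T : T1 < T.
Hypothesis c0 : 0 < c.
Hypothesis C0 : 0 <= C.
Hypothesis tau_itv : 0 <= tau < 2^-1.
Hypothesis dis : dissipative p T M c C tau U E G Phi.

Let weakU := dis_weak dis.
Let igU := dis_ig dis.
Let mE := dis_meas dis.
Let E0 := dis_ge0 dis.
Let coercive := dis_coercive dis.
Let growth := dis_growth dis.

Definition annulus (L : R) : set V := [set z | 2^-1 <= rad2 L z <= 3].

Lemma measurable_rad2_itv (L a b : R) : measurable [set z : V | a <= rad2 L z <= b].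
Proof.
rewrite (_ : [set _ | _] = (rad2 L : V -> R) @^-1` `[a, b]%classic).
  by rewrite -[X in measurable X]setTI; exact: measurable_rad2.
by apply/seteqP; split => z /=; rewrite in_itv.
Qed.

Lemma measurable_indic_annulus (L : R) : measurable_fun setT (\1_(annulus L) : V -> R).
Proof. by apply: measurable_indic; exact: measurable_rad2_itv. Qed.

Lemma ig_annulus (L : R) : ig lebV (fun z => \1_(annulus L) z * `|U z|).
Proof.
apply: ig_dom (ig_abs igU) => [|z].
  apply: measurable_funM; first exact: measurable_indic_annulus.
  by apply: measurableT_comp => //; exact: ig_meas igU.
by rewrite normrM normr_id ler_piMl// ger0_norm ?indicE// lern1 leq_b1.
Qed.

(** The weighted local energy in an annulus; the cutoff vanishes for t <= a and
    t >= T1. *)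
Definition energy_density (m : nat) (eta L a : R) (z : V) : R :=
  time_cut a T1 z.2 * ann_cut m (rad2 L z) * (omega tau eta (U z) * E z).

(** The integrand of the tested equation dominates half of the coercive term, up
    to a multiple of |u| in the annulus: the derivative of the cutoff is paid for by
    cross_term_le, and every term without gradient is at most |u| by omega_powR and
    the bound M. *)
Lemma energy_pointwise (m : nat) : p - 1 <= m%:R ->
  exists2 K, 0 <= K & forall eta L a z dxi, 0 < eta -> 1 <= L -> 0 < a ->
   (forall i, dxi i = time_cut a T1 z.2 * (ann_cut' m (rad2 L z) * (L ^- 2 * (2 * z.1 ord0 i)))) ->
   (1 - 2 * tau) * c / 2 * energy_density m eta L a z <=
    \sum_i Phi i z * (time_cut a T1 z.2 * ann_cut m (rad2 L z) * (energy'' tau eta (U z) * G i z) +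
      dxi i * energy' tau eta (U z)) + K * (\1_(annulus L) z * `|U z|).
Proof.
move=> pm; have p1 : 1 < p by move: p2 => h; lra.
have [q1 pq pqp] := conjugate_exponent p1.
have p0 : 0 < p by lra. have q0 : 0 < p / (p - 1) by lra.
have [t0 t1] := andP tau_itv; have c1 := c0; have h2 := p2.
have cc : 0 < (1 - 2 * tau) * c / 2 by rewrite divr_gt0// mulr_gt0//; lra.
pose K0 : R := 24 * m.+1%:R.
have K00 : 0 <= K0 by rewrite mulr_ge0.
have b0 : 0 <= n%:R * (K0 * C) by rewrite !mulr_ge0.
(* s is chosen so that n cross terms take at most half of the coercive term;
   K0 collects 6 (m + 1) from the cutoff and 4 from the gradient of rad2. *)
have [s s0 Hs] := exists_small_power q0 b0 cc.
pose K := T1 ^+ 2 * (C + n%:R * (K0 * s^-1 `^ p * M `^ (p - 1 - 2 * tau)) + (1 - 2 * tau) * c / 2).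
have Kge0 : 0 <= K.
  rewrite /K mulr_ge0 ?sqr_ge0// !addr_ge0//; last exact: ltW.
  by rewrite !mulr_ge0 ?powR_ge0.
exists K => //.
move=> eta L a z dxi eta0 L1 a0 Hdxi.
have /andP[th0 thT] := time_cut_itv z.2 a0 (ltW T10).
have /andP[ch0 ch1] := ann_cut_itv m (rad2 L z).
have om0 := omega_gt0 tau eta0 (U z).
have UM := ws_bound weakU z.
have om1 := omega_powR tau_itv eta0 (U z).
have omp : omega tau eta (U z) * `|U z| `^ p <= M `^ (p - 1 - 2 * tau) * `|U z|.
  by apply: omega_powR_le => //; lra.
have oi := energy''_itv tau_itv eta0 (U z).
have o''0 : 0 <= energy'' tau eta (U z).
  by case/andP: oi => h _; apply: le_trans h; rewrite mulr_ge0 ?(ltW om0)//; lra.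
have Ur0 : 0 <= `|U z| `^ (1 + 2 * tau) := powR_ge0 _ _.
have L0 : 0 < L by lra.
have [rz|rz] := boolP (2^-1 <= rad2 L z <= 3); last first.
  have h : rad2 L z <= 2^-1 \/ 3 <= rad2 L z.
    by move: rz; rewrite negb_and -!ltNge => /orP[/ltW|/ltW]; [left|right].
  have m0 : (0 < m)%N by rewrite -(ltr0n R); lra.
  rewrite /energy_density ann_cut_eq0// mulr0 !mul0r mulr0 big1 ?add0r.
    by apply: mulr_ge0 => //; apply: mulr_ge0 => //; rewrite indicE.
  move=> i _; rewrite Hdxi -(prednK m0) ann_cut'_eq0//; ring.
rewrite indicE mem_set ?mul1r//.
have main := main_term_ge th0 ch0 (ltW c0) C0 (E0 z) Ur0 o''0 oi (coercive z).
pose Zi := K0 * s^-1 `^ p * (time_cut a T1 z.2 * (omega tau eta (U z) * `|U z| `^ p)) +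
  K0 * s `^ (p / (p - 1)) * C * (energy_density m eta L a z +
   time_cut a T1 z.2 * ann_cut m (rad2 L z) * (omega tau eta (U z) * `|U z| `^ (1 + 2 * tau))).
have cross i : - (Phi i z * (dxi i * energy' tau eta (U z))) <= Zi.
  rewrite Hdxi /energy'; apply: (@cross_term_le _ p _ s K0 _ _ _ _ (ann (rad2 L z) ^+ m)) => //.
  - exact: ltW.
  - by apply: exprn_ge0; case/andP: (ann_itv (rad2 L z)).
  - have H1 := ann_cut'_le m (rad2 L z).
    have r4 : rad2 L z <= 4 by case/andP: rz => _; lra.
    have H2 := grad_rad2_le i L0 r4.
    have H3 : L^-1 * 4 <= 4 by rewrite ger_pMl// invf_le1.
    rewrite normrM (_ : K0 = 6 * m.+1%:R * 4); last by rewrite /K0; ring.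
    rewrite mulrAC; apply: ler_pM => //; exact: le_trans H2 H3.
  - exact: ann_powR.
have sumE : \sum_i Phi i z * (time_cut a T1 z.2 * ann_cut m (rad2 L z) * (energy'' tau eta (U z) * G i z) +
      dxi i * energy' tau eta (U z)) =
    time_cut a T1 z.2 * ann_cut m (rad2 L z) * energy'' tau eta (U z) * (\sum_i Phi i z * G i z) +
    \sum_i Phi i z * (dxi i * energy' tau eta (U z)).
  rewrite mulr_sumr -big_split/=; apply: eq_bigr => i _; ring.
have crossS : - (\sum_i Phi i z * (dxi i * energy' tau eta (U z))) <= n%:R * Zi.
  rewrite -sumrN mulr_natl -[X in _ *+ X](card_ord n) -sumr_const.
  by apply: ler_sum => i _; exact: cross.
have tU : time_cut a T1 z.2 * ann_cut m (rad2 L z) * (omega tau eta (U z) * `|U z| `^ (1 + 2 * tau)) <= T1 ^+ 2 * `|U z|.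
  have tc : time_cut a T1 z.2 * ann_cut m (rad2 L z) <= T1 ^+ 2.
    by apply: le_trans thT; rewrite ler_piMr.
  have tc0 : 0 <= time_cut a T1 z.2 * ann_cut m (rad2 L z) by rewrite mulr_ge0.
  by apply: ler_pM => //; apply: mulr_ge0 => //; exact: ltW.
have tp : time_cut a T1 z.2 * (omega tau eta (U z) * `|U z| `^ p) <= T1 ^+ 2 * (M `^ (p - 1 - 2 * tau) * `|U z|).
  by apply: ler_pM => //; apply: mulr_ge0; [exact: ltW|exact: powR_ge0].
have e0 : 0 <= energy_density m eta L a z.
  by apply: mulr_ge0; [exact: mulr_ge0|apply: mulr_ge0 => //; exact: ltW].
have A10 : 0 <= time_cut a T1 z.2 * ann_cut m (rad2 L z) *
    (omega tau eta (U z) * `|U z| `^ (1 + 2 * tau)).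
  by apply: mulr_ge0; [exact: mulr_ge0|apply: mulr_ge0 => //; exact: ltW].
have c2E : 2 * ((1 - 2 * tau) * c / 2) = (1 - 2 * tau) * c by rewrite mulrC divfK.
rewrite -c2E in main; rewrite sumE.
exact: (energy_arith (ler0n _ n) K00 (powR_ge0 _ _) (sqr_ge0 T1) C0 (ltW cc) e0 A10 Hs main crossS tp tU).
Qed.

Lemma energy_U_le eta z : 0 < eta ->
  0 <= energy tau eta (U z) <= M `^ (1 - 2 * tau) * `|U z|.
Proof.
move=> eta0; have [t0 t1] := andP tau_itv.
have /andP[e0 e1] := energy_itv tau_itv eta0 (U z).
rewrite e0/=; apply: (le_trans e1).
have r2 : 1 + 2 * tau <= 2 by lra.
have := omega_powR_le tau_itv eta0 (ws_bound weakU z) r2.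
rewrite (_ : 2 - 1 - 2 * tau = 1 - 2 * tau); last by ring.
by rewrite powR_mulrn// real_normK ?num_real.
Qed.

Lemma continuous_energy eta : 0 < eta -> continuous (energy tau eta).
Proof.
move=> eta0 s; apply: differentiable_continuous; apply/derivable1_diffP.
by have [] := is_derive_energy tau_itv eta0 s.
Qed.

Lemma measurable_energy_density m eta L a : 0 < eta ->
  measurable_fun setT (energy_density m eta L a).
Proof.
move=> eta0; apply: measurable_funM.
  apply: measurable_funM.
    by apply: measurable_time; apply: continuous_is_derive => s; exact: is_derive_time_cut.
  apply: measurable_comp_continuous; last exact: measurable_rad2.
  by apply: continuous_is_derive => s; exact: is_derive_ann_cut.
apply: measurable_funM => //; apply: measurable_comp_continuous; last exact: ig_meas igU.
exact: continuous_rho_powR.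
Qed.

(** The tested equation, integrated. After the initial layer the time derivative
    of the cutoff has the good sign; in the layer it is at most a multiple of 1/a,
    against a mass at most e a. *)
Lemma energy_bound (m : nat) : p - 1 <= m%:R ->
  exists2 K, 0 <= K & forall eta L a e, 0 < eta -> 1 <= L -> 0 < a -> a <= T - T1 -> 0 <= e ->
    (forall t, a <= t <= 2 * a ->
       (\int[leb]_x (\1_(annulus L) (x, t) * `|U (x, t)|)%:E <= e%:E)%E) ->
    ig lebV (energy_density m eta L a) /\
    \int[lebV]_z energy_density m eta L a z <=
      K * (e + \int[lebV]_z (\1_(annulus L) z * `|U z|)).
Proof.
move=> pm; have [K K0 HK] := energy_pointwise pm.
have p1 : 1 < p by move: p2 => h; lra.
have [q1 pq pqp] := conjugate_exponent p1.
have [t0 t1] := andP tau_itv; have c0' := c0.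
set c2 := (1 - 2 * tau) * c / 2.
have cc : 0 < c2 by rewrite divr_gt0// mulr_gt0//; lra.
pose K1 := 2 * T1 ^+ 2 * M `^ (1 - 2 * tau).
have K10 : 0 <= K1 by rewrite mulr_ge0 ?powR_ge0// mulr_ge0 ?sqr_ge0.
exists (c2^-1 * (K1 + K)); first by rewrite mulr_ge0 ?invr_ge0 ?addr_ge0// ltW.
move=> eta L a e eta0 L1 a0 aT e0 He.
have L0 : 0 < L := lt_le_trans ltr01 L1.
have [dxi [Cxi dxit dxix]] := @cutoff_C1 R n _ _ _ _ L (is_derive_time_cut a T1) (@continuous_time_cut' _ a T1)
  (is_derive_ann_cut m) (@continuous_ann_cut' _ m).
have k3 (r : R) : 3 <= r -> ann_cut m r = 0 by move=> h; apply: ann_cut_eq0; right.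
have xiN (z : 'rV[R]_n * R) := cutoff_support (z := z) T1T a0 L0 k3.
have xia (z : 'rV[R]_n * R) : z.2 <= a \/ T - a <= z.2 ->
    time_cut a T1 z.2 * ann_cut m (rad2 L z) = 0.
  case=> h; first by have [-> _] := time_cut_le0 T1 a0 h; rewrite mul0r.
  have h1 : T1 <= z.2 by apply: le_trans h; rewrite lerBrDl -lerBrDr.
  by have [-> _] := time_cut_ge a h1; rewrite mul0r.
have [igQ IQ] := weak_sol_chain_rule p1 q1 pq weakU Cxi xiN a0 xia
  (is_derive_energy tau_itv eta0) (is_derive_energy' tau eta0) (@continuous_energy'' _ tau _ eta0).
set Q := (fun z => _) in igQ IQ.
have igAn := ig_annulus L.
have mD := measurable_energy_density m L a eta0.
have D0 z : 0 <= energy_density m eta L a z.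
  have /andP[th0 _] := time_cut_itv z.2 a0 (ltW T10).
  have /andP[ch0 _] := ann_cut_itv m (rad2 L z).
  apply: mulr_ge0; [exact: mulr_ge0|apply: mulr_ge0 => //; exact: powR_ge0].
have DQ z : c2 * energy_density m eta L a z <= Q z + K * (\1_(annulus L) z * `|U z|).
  by apply: HK => // i; exact: dxix.
have igR : ig lebV (fun z => Q z + K * (\1_(annulus L) z * `|U z|)).
  by apply: igD => //; exact: igZ.
have igc : ig lebV (fun z => c2 * energy_density m eta L a z).
  apply: ig_dom igR => [|z]; first exact: measurable_funM.
  by rewrite ger0_norm// mulr_ge0// ltW.
have igE : ig lebV (energy_density m eta L a).
  have := igZ c2^-1 igc; congr ig; apply/funext => z.
  by rewrite mulrA mulVf ?mul1r// gt_eqF.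
split => //.
have [_ _ cdxi] := Cxi; have [Kd Kd0 HKd] := bounded_of_support (cdxi dir_t) (C1_support Cxi xiN dir_t).
have mU := ig_meas igU.
have igT : ig lebV (fun z => dxi z dir_t * energy tau eta (U z)).
  apply: (@ig_dom _ _ _ _ (fun z => Kd * (M `^ (1 - 2 * tau) * `|U z|))).
  - apply: measurable_funM; first exact: measurable_continuous_rVR.
    exact: measurable_comp_continuous (continuous_energy eta0) mU.
  - move=> z; have /andP[h0 h1] := energy_U_le z eta0.
    by rewrite normrM (ger0_norm h0); apply: ler_pM.
  - by apply: igZ; apply: igZ; exact: ig_abs.
have H0 z : 0 <= \1_(annulus L) z * `|U z| by rewrite mulr_ge0// indicE.
have [igJ IJ] := initial_layer a0 e0 igAn H0 He.
have TJ z : dxi z dir_t * energy tau eta (U z) <=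
    a^-1 * K1 * (\1_[set z : V | a <= z.2 <= 2 * a] z * (\1_(annulus L) z * `|U z|)).
  have /andP[h0 h1] := energy_U_le z eta0.
  have /andP[ch0 ch1] := ann_cut_itv m (rad2 L z).
  have J0 : 0 <= a^-1 * K1 * (\1_[set z : V | a <= z.2 <= 2 * a] z * (\1_(annulus L) z * `|U z|)).
    apply: mulr_ge0; first by rewrite mulr_ge0// invr_ge0 ltW.
    by rewrite mulr_ge0// indicE.
  rewrite dxit.
  have [za|za] := leP z.2 a; first by have [_ ->] := time_cut_le0 T1 a0 za; rewrite !mul0r.
  have [za2|za2] := leP (2 * a) z.2.
    apply: le_trans J0; rewrite (time_cut'_late _ a0 za2) !mulNr oppr_le0.
    by apply: mulr_ge0 => //; apply: mulr_ge0 => //; rewrite mulr_ge0 ?pos_ge0.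
  have [zD|zD] := boolP (2^-1 <= rad2 L z <= 3); last first.
    apply: le_trans J0; rewrite ann_cut_eq0 ?mulr0 ?mul0r//.
    by move: zD; rewrite negb_and -!ltNge => /orP[/ltW|/ltW]; [left|right].
  rewrite indicE mem_set ?mul1r; last by rewrite /= !ltW.
  rewrite indicE mem_set ?mul1r//.
  have z0 : 0 <= z.2 by rewrite ltW// (lt_trans a0).
  have /andP[_ th1] := time_cut'_le a0 (ltW T10) z0.
  have -> : a^-1 * K1 * `|U z| = a^-1 * (2 * T1 ^+ 2) * 1 * (M `^ (1 - 2 * tau) * `|U z|).
    by rewrite /K1; ring.
  apply: (@le_trans _ _ (a^-1 * (2 * T1 ^+ 2) * 1 * energy tau eta (U z))).
    apply: ler_wpM2r => //.
    apply: (@le_trans _ _ (a^-1 * (2 * T1 ^+ 2) * ann_cut m (rad2 L z))).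
      exact: ler_wpM2r.
    apply: ler_wpM2l => //.
    by rewrite mulr_ge0 ?invr_ge0 ?(ltW a0)// mulr_ge0 ?sqr_ge0.
  apply: ler_wpM2l => //; rewrite mulr1 mulr_ge0 ?invr_ge0 ?(ltW a0)//.
  by rewrite mulr_ge0 ?sqr_ge0.
have h1 := I_le igc igR DQ.
have h2 := I_le igT (igZ (a^-1 * K1) igJ) TJ.
rewrite (I_Z c2 igE) (I_D igQ (igZ K igAn)) (I_Z K igAn) -IQ in h1.
rewrite (I_Z (a^-1 * K1) igJ) in h2.
exact: energy_final cc K0 K10 a0 e0 (I_ge0 _ H0) h1 h2 IJ.
Qed.

Variable eta : R -> R.
Hypothesis eta_scale : forall L, 1 <= L -> [/\ 0 < eta L, eta L * L ^+ n <= L `^ p &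
  forall s, omega tau (eta L) s `^ (- (p - 1)) <= `|s| + eta L].

(** It contains the annuli on which flux_tail lives; its volume is of order L^n. *)
Definition box (L : R) : set V := [set z | `|z.1| <= 2 * L /\ 0 <= z.2 <= T].

Lemma box_bound L : 0 < L -> ig lebV (\1_(box L) : V -> R) /\
  \int[lebV]_z (\1_(box L) z) <= (4 * L) ^+ n * T.
Proof.
move=> L0; have T0 : 0 <= T by rewrite ltW// (lt_trans T10).
have mB : measurable (box L).
  rewrite (_ : box L = ball_rV (2 * L) `*` `[0, T]%classic).
    by apply: measurableX => //; exact: measurable_ball_rV.
  by apply/seteqP; split=> [z [z1 z2]|z [z1]]; split => //=; rewrite ?in_itv// in_itv.
apply: ig_ge0 => //.
rewrite -[X in _ * X]subr0; apply: nn_slices_le => //.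
- by rewrite exprn_ge0// mulr_ge0// ltW.
- by move=> z zT; rewrite indicE memNset// => -[].
- move=> t tT; under eq_integral => x _.
    rewrite (_ : \1_(box L) (x, t) = \1_(ball_rV (2 * L) : set 'rV[R]_n) x :> R); last first.
      by rewrite !indicE; congr (_ _)%:R; apply/idP/idP; rewrite !inE => // -[].
    over.
  have L20 : 0 <= 2 * L by rewrite mulr_ge0// ltW.
  rewrite integral_indic ?setIT; [|exact: measurableT|exact: measurable_ball_rV].
  have BE : leb (ball_rV (2 * L)) = ((4 * L) ^+ n)%:E.
    by rewrite (leb_ball_rV L20) mulrA; congr ((_ * _) ^+ _)%:E; ring.
  by rewrite [X in (X <= _)%E]BE.
Qed.

(** What the gradient of ball_cut, of size 1/L and supported in
    1 <= |x|^2 / L^2 <= 2, leaves of the flux. *)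
Definition flux_tail (L a : R) (i : 'I_n) (z : V) : R :=
  time_cut a T1 z.2 * \1_[set z : V | 1 <= rad2 L z <= 2] z * (L^-1 * `|Phi i z|).

(** Young's inequality for 1/L and the flux with weight lambda omega: this
    produces omega |Phi|^q, controlled by the energy, and omega^(-(p-1)), controlled
    by the hypothesis on eta. *)
Lemma flux_tail_pointwise m lam L a i z : 0 < lam -> 1 <= L -> 0 < a ->
  0 <= flux_tail L a i z <=
    lam * C * (energy_density m (eta L) L a z + T1 ^+ 2 * (\1_(annulus L) z * `|U z|)) +
    lam `^ (- (p - 1)) * L `^ (- p) * T1 ^+ 2 *
      (\1_(annulus L) z * `|U z| + eta L * \1_(box L) z).
Proof.
move=> lam0 L1 a0; have [eta0 _ om_eta] := eta_scale L1.
have p1 : 1 < p by move: p2 => h; lra.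
have [q1 pq pqp] := conjugate_exponent p1.
have p0 : 0 < p := lt_trans ltr01 p1; have q0 : 0 < p / (p - 1) := lt_trans ltr01 q1.
have L0 : 0 < L := lt_le_trans ltr01 L1.
have /andP[th0 thT] := time_cut_itv z.2 a0 (ltW T10).
have om0 := omega_gt0 tau eta0 (U z).
have Ph0 : 0 <= L^-1 * `|Phi i z| by rewrite mulr_ge0// invr_ge0 ltW.
have e0 : 0 <= energy_density m (eta L) L a z.
  have /andP[ch0 _] := ann_cut_itv m (rad2 L z).
  apply: mulr_ge0; [exact: mulr_ge0|apply: mulr_ge0; [exact: ltW|exact: E0]].
have B0 : 0 <= eta L * \1_(box L) z by rewrite mulr_ge0 ?indicE// ltW.
have D0 : 0 <= \1_(annulus L) z * `|U z| by rewrite mulr_ge0// indicE.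
have l0 : 0 <= lam `^ (- (p - 1)) * L `^ (- p) by rewrite mulr_ge0 ?powR_ge0.
have C0' := C0.
have R0 : 0 <= lam * C * (energy_density m (eta L) L a z + T1 ^+ 2 * (\1_(annulus L) z * `|U z|)) +
    lam `^ (- (p - 1)) * L `^ (- p) * T1 ^+ 2 *
      (\1_(annulus L) z * `|U z| + eta L * \1_(box L) z).
  apply: addr_ge0; apply: mulr_ge0.
  - by rewrite mulr_ge0// ltW.
  - by apply: addr_ge0 => //; apply: mulr_ge0 => //; exact: sqr_ge0.
  - by apply: mulr_ge0 => //; exact: sqr_ge0.
  - exact: addr_ge0.
apply/andP; split.
  by rewrite /flux_tail mulr_ge0//= mulr_ge0// indicE.
rewrite /flux_tail; have [rz|rz] := boolP (1 <= rad2 L z <= 2); last first.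
  by rewrite indicE memNset ?mulr0 ?mul0r//; exact/negP.
rewrite indicE mem_set// mulr1.
have [z0|z0] := leP z.2 a; first by have [-> _] := time_cut_le0 T1 a0 z0; rewrite mul0r.
have [zT|zT] := leP T1 z.2; first by have [-> _] := time_cut_ge a zT; rewrite mul0r.
move=> {R0}.
have /andP[r1 r2] := rz.
have iA : \1_(annulus L) z = 1 :> R.
  rewrite indicE mem_set// /annulus/=; apply/andP; split.
    by apply: le_trans r1; rewrite invf_le1 ?ler1n.
  by apply: (le_trans r2); rewrite ler_nat.
have iB : \1_(box L) z = 1 :> R.
  rewrite indicE mem_set//; split; first by apply: rad2_norm => //; rewrite (le_trans r2)// ler_nat.
  by rewrite (ltW (lt_trans a0 z0)) (ltW (lt_trans zT T1T)).
rewrite /energy_density iA iB !mul1r mulr1 ann_cut_eq1// mulr1.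
have lo0 : 0 < lam * omega tau (eta L) (U z) by rewrite mulr_gt0.
have y := @young_scaled _ p _ ((lam * omega tau (eta L) (U z)) `^ (p / (p - 1))^-1) L^-1 `|Phi i z| p0 q0 pq (powR_gt0 _ lo0).
rewrite -powRrM mulVf ?(gt_eqF q0)// powRr1 ?(ltW lo0)// normr_id in y.
have iL : `|L^-1| = L^-1 by rewrite ger0_norm// invr_ge0 ltW.
rewrite (ger0_norm Ph0) iL in y.
have E1 : (((lam * omega tau (eta L) (U z)) `^ (p / (p - 1))^-1)^-1) `^ p =
    lam `^ (- (p - 1)) * omega tau (eta L) (U z) `^ (- (p - 1)).
  rewrite -powRN -powRrM -powRM ?(ltW lam0) ?(ltW om0)//; congr (_ `^ _).
  by rewrite invf_div mulNr divfK// gt_eqF.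
have E2 : L^-1 `^ p = L `^ (- p) by rewrite -(powR_inv1 (ltW L0)) -powRrM mulN1r.
rewrite E1 E2 in y.
have gr := growth i z.
have om1 := omega_powR tau_itv eta0 (U z).
have ome := om_eta (U z).
exact: (flux_arith th0 thT (ltW lam0) (ltW om0) C0 (powR_ge0 _ _) (powR_ge0 _ _) (normr_ge0 _) (ltW eta0) y gr om1 ome).
Qed.

Lemma measurable_flux_tail L a i : measurable_fun setT (flux_tail L a i).
Proof.
apply: measurable_funM.
  apply: measurable_funM; last by apply: measurable_indic; exact: measurable_rad2_itv.
  by apply: measurable_time; apply: continuous_is_derive => s; exact: is_derive_time_cut.
apply: measurable_funM => //; apply: measurableT_comp => //.
by have [] := ws_flux_Lq weakU i.
Qed.

(** For fixed lambda the first term tends to 0 with the masses of U in the annulus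
    and in its initial layer; the second is small for large lambda. *)
Lemma flux_tail_bound : exists2 K, 0 <= K & forall lam L a e i, 0 < lam -> 1 <= L ->
    0 < a -> a <= T - T1 -> 0 <= e ->
    (forall t, a <= t <= 2 * a ->
       (\int[leb]_x (\1_(annulus L) (x, t) * `|U (x, t)|)%:E <= e%:E)%E) ->
    ig lebV (flux_tail L a i) /\
    \int[lebV]_z flux_tail L a i z <=
      K * (lam * (e + \int[lebV]_z (\1_(annulus L) z * `|U z|)) +
           lam `^ (- (p - 1)) * (\int[lebV]_z (\1_(annulus L) z * `|U z|) + 1)).
Proof.
(* The power of the annular cutoff required by ann_powR. *)
have [m pm] : exists m : nat, p - 1 <= m%:R.
  by exists (Num.truncn (p - 1)).+1; apply/ltW; exact: truncnS_gt.
have [Ke Ke0 HKe] := energy_bound pm.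
have T0 : 0 < T := lt_trans T10 T1T.
have K0 : 0 <= C * (Ke + T1 ^+ 2) + T1 ^+ 2 * (1 + 4 ^+ n * T).
  have := sqr_ge0 T1; move: C0 Ke0 (ltW T0) => c0' k0 t0 s0.
  by rewrite addr_ge0// mulr_ge0// addr_ge0// mulr_ge0// exprn_ge0.
exists (C * (Ke + T1 ^+ 2) + T1 ^+ 2 * (1 + 4 ^+ n * T)) => //.
move=> lam L a e i lam0 L1 a0 aT e0 He.
have [eta0 eta_L _] := eta_scale L1.
have L0 : 0 < L := lt_le_trans ltr01 L1.
have [igE IE] := HKe _ _ _ _ eta0 L1 a0 aT e0 He.
have [igB IB] := box_bound L0.
have igA := ig_annulus L.
have pw z := flux_tail_pointwise m i z lam0 L1 a0.
have igS := igD igE (igZ (T1 ^+ 2) igA).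
have igS2 := igD igA (igZ (eta L) igB).
have igR := igD (igZ (lam * C) igS) (igZ (lam `^ (- (p - 1)) * L `^ (- p) * T1 ^+ 2) igS2).
have igF : ig lebV (flux_tail L a i).
  apply: ig_dom igR => [|z]; first exact: measurable_flux_tail.
  by have /andP[h0 h1] := pw z; rewrite ger0_norm.
split => //.
have := I_le igF igR (fun z => (andP (pw z)).2).
rewrite (I_D (igZ (lam * C) igS) (igZ (lam `^ (- (p - 1)) * L `^ (- p) * T1 ^+ 2) igS2)).
rewrite (I_Z (lam * C) igS) (I_Z (lam `^ (- (p - 1)) * L `^ (- p) * T1 ^+ 2) igS2).
rewrite (I_D igE (igZ (T1 ^+ 2) igA)) (I_D igA (igZ (eta L) igB)).
rewrite (I_Z (T1 ^+ 2) igA) (I_Z (eta L) igB).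
have D0 : 0 <= \int[lebV]_z (\1_(annulus L) z * `|U z|).
  by apply: I_ge0 => z; rewrite mulr_ge0// indicE.
have p0 : 0 <= p by rewrite ltW// (lt_trans _ p2)// ltr0n.
have LpE : L `^ p * L `^ (- p) = 1 by rewrite powRN divff// gt_eqF// powR_gt0.
have Lp1 : 1 <= L `^ p by have := ler_powR L1 p0; rewrite powRr0.
have IB' : \int[lebV]_z (\1_(box L) z) <= 4 ^+ n * T * L ^+ n.
  by rewrite -mulrA (mulrC T) mulrA -exprMn.
have f0 : 0 <= 4 ^+ n * T by rewrite mulr_ge0 ?exprn_ge0// ltW.
exact: (flux_final (ltW lam0) C0 Ke0 (sqr_ge0 T1) f0 (powR_ge0 _ _) (powR_ge0 _ _) LpE Lp1 e0 D0 (ltW eta0) IE IB' eta_L).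
Qed.

End energy_estimate.

(** * Tails of integrable functions *)

Section tails.
Context {R : realType} {n : nat}.
Local Notation V := ('rV[R]_n * measurableTypeR R)%type.
Local Notation leb := (@lebesgue_rV R n).

Lemma near_rad2_le (z : 'rV[R]_n * R) (c : R) : 0 < c ->
  \forall k \near \oo, rad2 k.+1%:R z <= c.
Proof.
move=> c0; set s := \sum_i z.1 ord0 i ^+ 2.
have s0 : 0 <= s by apply: sumr_ge0 => i _; exact: sqr_ge0.
near=> k.
have k1 : s / c <= k.+1%:R.
  near: k; exists (Num.truncn (s / c)) => //= k kN.
  by apply: (le_trans (ltW (truncnS_gt _))); rewrite ler_nat.
rewrite /rad2 -/s ler_pdivrMl ?exprn_gt0// mulrC -ler_pdivrMl// mulrC.
apply: (le_trans k1); rewrite expr2 ler_peMl// ler1n.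
Unshelve. all: by end_near. Qed.

(** A fixed point leaves all large annuli; dominated convergence. *)
Lemma annulus_tail_ge0 d (X : measurableType d) (nu : {measure set X -> \bar R})
    (phi : X -> V) (H : X -> R) (dl : R) :
  (forall L, measurable_fun setT (fun x => \1_(annulus L : set V) (phi x) : R)) ->
  ig nu H -> 0 < dl ->
  \forall k \near \oo,
    \int[nu]_x (\1_(annulus k.+1%:R : set V) (phi x) * `|H x|) <= dl.
Proof.
move=> mphi igH dl0.
have mH := ig_meas igH.
have [|||||ig0 cv] := @I_dct R _ X nu
  (fun k x => \1_(annulus k.+1%:R : set V) (phi x) * `|H x|) (fun=> 0) (fun x => `|H x|).
- by move=> k; apply: measurable_funM => //; exact: measurableT_comp.
- exact: measurable_cst.
- move=> x; apply: cvg_near_cst.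
  have h4 : 0 < 4^-1 :> R by rewrite invr_gt0.
  near=> k.
  have rk : rad2 k.+1%:R (phi x) <= 4^-1 by near: k; exact: near_rad2_le.
  rewrite indicE memNset ?mul0r// /annulus/= => /andP[h _].
  by move: (le_trans h rk); apply/negP; rewrite -ltNge ltf_pV2 ?posrE// ltr_nat.
- exact: ig_abs.
- move=> k x; rewrite normrM normr_id ler_piMl// ger0_norm ?indicE//.
  by rewrite lern1 leq_b1.
rewrite I_0 in cv; have /cvgr_dist_le/(_ dl dl0) := cv.
apply: filterS => k; rewrite sub0r normrN; apply: le_trans; exact: ler_norm.
Unshelve. all: by end_near. Qed.

Lemma annulus_tail (H : V -> R) dl : ig lebV H -> 0 < dl ->
  \forall k \near \oo, \int[lebV]_z (\1_(annulus k.+1%:R : set V) z * `|H z|) <= dl.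
Proof.
move=> igH dl0; apply: (annulus_tail_ge0 (phi := id)) => // L.
exact: measurable_indic_annulus.
Qed.

Lemma annulus_tail_slice (H : V -> R) t dl : ig leb (fun x => H (x, t)) -> 0 < dl ->
  \forall k \near \oo, \int[leb]_x (\1_(annulus k.+1%:R : set V) (x, t) * `|H (x, t)|) <= dl.
Proof.
move=> igH dl0; apply: (annulus_tail_ge0 (phi := fun x => (x, t))) => // L.
exact: (measurable_slice t (measurable_indic_annulus L)).
Qed.

Lemma exists_small (A e : R) : 0 <= A -> 0 < e -> exists2 d : R, 0 < d <= 1 & A * d <= e.
Proof.
move=> A0 e0; have A1 : 0 < A + 1 by rewrite ltr_wpDl.
have m0 : 0 < Num.min 1 (e / (A + 1)) by rewrite lt_min ltr01 divr_gt0.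
exists (Num.min 1 (e / (A + 1))); first by rewrite m0 ge_min lexx.
apply: (@le_trans _ _ ((A + 1) * (e / (A + 1)))); last by rewrite mulrC divfK// gt_eqF.
apply: ler_pM => //; [exact: ltW|by rewrite lerDl|by rewrite ge_min lexx orbT].
Qed.

Lemma slice_le (A : 'rV[R]_n -> R) c : ig leb A -> (forall x, 0 <= A x) ->
  \int[leb]_x A x <= c -> (\int[leb]_x (A x)%:E <= c%:E)%E.
Proof. by move=> igA A0 Ac; rewrite -I_fin// lee_fin. Qed.

End tails.

(** * Comparison almost everywhere in space-time *)

Section comparison_arith.
Context {R : realType}.

Lemma pos_le_norm (s : R) : pos s <= `|s|.
Proof. by rewrite /pos ge_max normr_ge0 ler_norm. Qed.

Lemma pos_lip (a b a' b' : R) : a' <= b' -> pos (a - b) <= `|a - a'| + `|b - b'|.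
Proof.
move=> ab; rewrite /pos ge_max addr_ge0// andbT.
have h1 := ler_norm (a - a'); have h2 := ler_norm (b' - b).
rewrite distrC in h2; lra.
Qed.

Lemma cross_diff_le (th bc g L ph ph' c' I : R) : 0 <= th -> 0 < L -> 0 <= I ->
  `|bc| <= 2 * I -> (I != 0 -> `|g| <= L^-1 * 4) -> 0 <= c' <= 2 ->
  - ((ph - ph') * (th * (bc * g) * c')) <= 16 * (th * I * (L^-1 * `|ph|) + th * I * (L^-1 * `|ph'|)).
Proof.
move=> th0 L0 I0 bI gL /andP[c0 c2].
apply: (le_trans (ler_norm _)); rewrite normrN !normrM (ger0_norm th0) (ger0_norm c0).
have bg : `|bc| * `|g| <= 2 * I * (L^-1 * 4).
  have [I00|I00] := eqVneq I 0.
    have : `|bc| <= 0 by rewrite (le_trans bI)// I00 mulr0.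
    by rewrite normr_le0 => /eqP ->; rewrite I00 normr0 !mul0r mulr0 mul0r.
  by apply: ler_pM => //; exact: gL.
have iL : 0 <= L^-1 by rewrite invr_ge0 ltW.
have bg0 : 0 <= 2 * I * (L^-1 * 4) by rewrite !mulr_ge0.
have pp : `|ph - ph'| <= `|ph| + `|ph'| := ler_normB _ _.
have h1 : th * (`|bc| * `|g|) * c' <= th * (2 * I * (L^-1 * 4)) * 2.
  by apply: ler_pM => //; [rewrite !mulr_ge0|rewrite ler_wpM2l].
have h2 : `|ph - ph'| * (th * (`|bc| * `|g|) * c') <=
    (`|ph| + `|ph'|) * (th * (2 * I * (L^-1 * 4)) * 2).
  by apply: ler_pM => //; rewrite !mulr_ge0.
apply: (le_trans h2); rewrite le_eqVlt; apply/orP; left; apply/eqP; ring.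
Qed.

Lemma combine_le (a b c d : R) : - a <= b -> - c <= d -> - (b + c) - a <= d.
Proof. by move=> h1 h2; lra. Qed.

Lemma tail_le (K lam lp dl D F : R) : 0 <= K -> 0 <= lam -> 0 <= lp -> dl <= 1 -> D <= dl ->
  F <= K * (lam * (2 * dl + D) + lp * (D + 1)) -> F <= K * (lam * (3 * dl) + lp * 2).
Proof.
move=> K0 lam0 lp0 dl1 Dd HF; apply: (le_trans HF); rewrite ler_wpM2l//.
by apply: lerD; rewrite ler_wpM2l//; lra.
Qed.

(** The two hypotheses on lp = lam^(-(p-1)) and dl are the choices of lambda and dl
    in late_excess_small. *)
Lemma late_final (N KU lam lp dl a TT eps S J X : R) : 0 < a -> 0 <= TT ->
  2 * (16 * (N * KU)) * lp <= eps / 2 ->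
  (3 * (16 * (N * KU)) * lam + 4 * TT) * dl <= eps / 2 ->
  S <= N * (KU * (lam * (3 * dl) + lp * 2)) -> J <= 2 * dl * a ->
  X <= 16 * S + a^-1 * (2 * TT) * J -> X <= eps.
Proof.
move=> a0 TT0 h1 h2 h3 h4 h5.
have i0 : 0 <= a^-1 * (2 * TT) by rewrite !mulr_ge0// invr_ge0 ltW.
have h6 : a^-1 * (2 * TT) * J <= 4 * TT * dl.
  apply: (le_trans (ler_wpM2l i0 h4)); rewrite le_eqVlt; apply/orP; left; apply/eqP.
  by field; rewrite gt_eqF.
lra.
Qed.

End comparison_arith.

Section layers.
Context {R : realType} {n : nat}.
Local Notation V := ('rV[R]_n * measurableTypeR R)%type.
Local Notation leb := (@lebesgue_rV R n).
Variables (U W : V -> R).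
Hypothesis sliceU : forall t, ig leb (fun x => U (x, t)).
Hypothesis sliceW : forall t, ig leb (fun x => W (x, t)).

Lemma ig_indicM (A : set 'rV[R]_n) (H : 'rV[R]_n -> R) : measurable A -> ig leb H ->
  ig leb (fun x => \1_A x * H x).
Proof.
move=> mA igH; apply: ig_dom (ig_abs igH) => [|x].
  by apply: measurable_funM; [exact: measurable_indic|exact: ig_meas igH].
by rewrite normrM ler_piMl// ger0_norm ?indicE// lern1 leq_b1.
Qed.

(** At time t the mass in the annulus is at most that at time 0 plus the distance
    of the two slices on a ball. *)
Lemma layer_annulus (L t dl : R) : 0 < L ->
  \int[leb]_x (\1_(annulus L : set V) (x, 0) * `|U (x, 0)|) <= dl ->
  \int[leb]_x (\1_(ball_rV (2 * L) : set 'rV[R]_n) x * `|U (x, t) - U (x, 0)|) <= dl ->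
  (\int[leb]_x (\1_(annulus L : set V) (x, t) * `|U (x, t)|)%:E <= (2 * dl)%:E)%E.
Proof.
move=> L0 h1 h2.
have mA t' : measurable_fun setT (fun x : 'rV[R]_n => \1_(annulus L : set V) (x, t') : R).
  exact: (measurable_slice t' (measurable_indic_annulus L)).
have igA t' : ig leb (fun x => \1_(annulus L : set V) (x, t') * `|U (x, t')|).
  apply: ig_dom (ig_abs (sliceU t')) => [|x].
    by apply: measurable_funM => //; apply: measurableT_comp => //; exact: ig_meas (sliceU t').
  by rewrite normrM normr_id ler_piMl// ger0_norm ?indicE// lern1 leq_b1.
have igB2 : ig leb (fun x => \1_(ball_rV (2 * L) : set 'rV[R]_n) x * `|U (x, t) - U (x, 0)|).
  by apply: ig_indicM; [exact: measurable_ball_rV|apply: ig_abs; exact: igB].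
have n0 x : 0 <= \1_(annulus L : set V) (x, t) * `|U (x, t)| by rewrite mulr_ge0// indicE.
apply: (slice_le (igA t) n0).
apply: (@le_trans _ _ (dl + dl)); last by rewrite mulr2n mulrDl mul1r.
apply: le_trans (lerD h1 h2); rewrite -(I_D (igA 0) igB2).
apply: (I_le (igA t) (igD (igA 0) igB2)) => x.
have -> : \1_(annulus L : set V) (x, t) = \1_(annulus L : set V) (x, 0) :> R by rewrite !indicE.
have [xA|xA] := pselect ((annulus L : set V) (x, 0)); last first.
  by rewrite !indicE memNset// !mul0r add0r mulr_ge0.
have xL : ball_rV (2 * L) x.
  case/andP: xA => _ r3; apply: (rad2_norm (z := (x, 0))) => //.
  by apply: (le_trans r3); rewrite ler_nat.
rewrite !indicE !mem_set// !mul1r addrC -lerBlDr.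
by have := lerB_dist (U (x, t)) (U (x, 0)).
Qed.

(** The positive part of U - W is 1-Lipschitz in both entries and vanishes at
    time s. *)
Lemma layer_excess (L s t dl : R) : 0 < L -> {ae leb, forall x, U (x, s) <= W (x, s)} ->
  \int[leb]_x (\1_(ball_rV (2 * L) : set 'rV[R]_n) x * `|U (x, t) - U (x, s)|) <= dl ->
  \int[leb]_x (\1_(ball_rV (2 * L) : set 'rV[R]_n) x * `|W (x, t) - W (x, s)|) <= dl ->
  (\int[leb]_x (ball_cut (rad2 L (x, t)) * pos (U (x, t) - W (x, t)))%:E <= (2 * dl)%:E)%E.
Proof.
move=> L0 init h1 h2.
have b0 x := ball_cut_itv (rad2 L ((x, t) : V)).
have igw := igB (sliceU t) (sliceW t).
have igL : ig leb (fun x => ball_cut (rad2 L (x, t)) * pos (U (x, t) - W (x, t))).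
  apply: ig_dom (ig_abs igw) => [|x].
    apply: measurable_funM.
      apply: (measurable_slice (f := fun z => ball_cut (rad2 L z))).
      apply: measurable_comp_continuous; last exact: measurable_rad2.
      by apply: continuous_is_derive => r; exact: is_derive_ball_cut.
    apply: (measurableT_comp (f := pos)); last exact: ig_meas igw.
    by apply: continuous_measurable_fun; exact: continuous_pos.
  have /andP[c0 c1] := b0 x.
  rewrite normrM (ger0_norm c0) (ger0_norm (pos_ge0 _)).
  by apply: le_trans (pos_le_norm _); rewrite ler_piMl ?pos_ge0.
have igBu := ig_indicM (measurable_ball_rV (2 * L)) (ig_abs (igB (sliceU t) (sliceU s))).
have igBw := ig_indicM (measurable_ball_rV (2 * L)) (ig_abs (igB (sliceW t) (sliceW s))).
apply: slice_le => // [x|]; first by have /andP[c0 _] := b0 x; rewrite mulr_ge0 ?pos_ge0.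
apply: (@le_trans _ _ (dl + dl)); last by rewrite mulr2n mulrDl mul1r.
apply: le_trans (lerD h1 h2); rewrite -(I_D igBu igBw).
apply: (I_le_ae igL (igD igBu igBw)).
apply: filterS init => x x0; have /andP[c0 c1] := b0 x.
have [xL|xL] := pselect (ball_rV (2 * L) x).
  rewrite !indicE mem_set// !mul1r; apply: le_trans (pos_lip _ _ x0).
  by rewrite ler_piMl ?pos_ge0.
rewrite ball_cut_eq0 ?mul0r; first by rewrite addr_ge0// mulr_ge0// indicE.
rewrite leNgt; apply/negP => r2; apply: xL; apply: (rad2_norm (z := (x, t))) => //.
by apply: (le_trans (ltW r2)); rewrite ler_nat.
Qed.

End layers.

Section comparison.
Context {R : realType} {n : nat}.
Local Notation V := ('rV[R]_n * measurableTypeR R)%type.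
Local Notation leb := (@lebesgue_rV R n).
Variables (p T T1 M c C tau : R) (U E W E' : V -> R) (G Phi G' Phi' : 'I_n -> V -> R).
Hypothesis p2 : 2 < p.
Hypothesis T10 : 0 < T1.
Hypothesis T1T : T1 < T.
Hypothesis c0 : 0 < c.
Hypothesis C0 : 0 <= C.
Hypothesis tau_itv : 0 <= tau < 2^-1.
Hypothesis disU : dissipative p T M c C tau U E G Phi.
Hypothesis disW : dissipative p T M c C tau W E' G' Phi'.
Variable eta : R -> R.
Hypothesis eta_scale : forall L, 1 <= L -> [/\ 0 < eta L, eta L * L ^+ n <= L `^ p &
  forall s, omega tau (eta L) s `^ (- (p - 1)) <= `|s| + eta L].
Hypothesis monotone : forall z,
  - (C * `|U z - W z|) <= \sum_i (Phi i z - Phi' i z) * (G i z - G' i z).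

Let w z := U z - W z.
Let igw : ig lebV w. Proof. by apply: igB; [exact: dis_ig disU|exact: dis_ig disW]. Qed.
Let mw : measurable_fun setT w. Proof. exact: ig_meas igw. Qed.

Let tailU := flux_tail T1 Phi.
Let tailW := flux_tail T1 Phi'.

Let measurable_late (t0 : R) : measurable [set z : V | t0 <= z.2].
Proof.
rewrite (_ : [set _ | _] = [set: 'rV[R]_n] `*` `[t0, +oo[%classic); first exact: measurableX.
by apply/seteqP; split=> [z zT|z [_]]; rewrite /= in_itv/= andbT.
Qed.

Let bc_meas L : measurable_fun setT (fun z : V => ball_cut (rad2 L z)).
Proof.
apply: measurable_comp_continuous; last exact: measurable_rad2.
by apply: continuous_is_derive => s; exact: is_derive_ball_cut.
Qed.

Let mpos : measurable_fun setT (fun z => pos (w z)).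
Proof. exact: measurable_comp_continuous continuous_pos mw. Qed.

Let ig_bc L : ig lebV (fun z => ball_cut (rad2 L z) * pos (w z)).
Proof.
apply: ig_dom (ig_abs igw) => [|z]; first exact: measurable_funM.
have /andP[b0 b1] := ball_cut_itv (rad2 L z).
rewrite normrM (ger0_norm b0) (ger0_norm (pos_ge0 _)).
by apply: le_trans (pos_le_norm _); rewrite ler_piMl ?pos_ge0.
Qed.

Let ig_init (L a : R) : ig lebV (fun z => \1_[set z : V | a <= z.2 <= 2 * a] z *
    (ball_cut (rad2 L z) * pos (w z))).
Proof.
have mA : measurable [set z : V | a <= z.2 <= 2 * a].
  rewrite (_ : [set _ | _] = [set: 'rV[R]_n] `*` `[a, 2 * a]%classic); first exact: measurableX.
  by apply/seteqP; split=> [z zT|z [_]]; rewrite /= ?in_itv.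
apply: ig_dom (ig_abs (ig_bc L)) => [|z].
  by apply: measurable_funM; [exact: measurable_indic|exact: ig_meas (ig_bc L)].
by rewrite normrM ler_piMl// ger0_norm ?indicE// lern1 leq_b1.
Qed.

(** The part of the tested equation with the good sign: minus the time derivative
    of the cutoff, times the positive part of w, after the initial layer. *)
Definition late_excess (L a : R) (z : V) : R :=
  \1_[set z : V | 2 * a <= z.2] z * (2 * pos (T1 - z.2)) * (ball_cut (rad2 L z) * pos (w z)).

Lemma late_excess_ge0 L a z : 0 <= late_excess L a z.
Proof.
have /andP[b0 _] := ball_cut_itv (rad2 L z).
have i0 : 0 <= \1_[set z : V | 2 * a <= z.2] z :> R by rewrite indicE.
have p0 := pos_ge0 (w z); have p0' := pos_ge0 (T1 - z.2).
by apply: mulr_ge0; [apply: mulr_ge0 => //; exact: mulr_ge0|exact: mulr_ge0].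
Qed.

Lemma ig_late_excess (L a : R) : 0 < a -> ig lebV (late_excess L a).
Proof.
move=> a0; apply: (@ig_dom _ _ _ _ (fun z : V => 2 * T1 * (ball_cut (rad2 L z) * pos (w z)))).
- apply: measurable_funM; last exact: ig_meas (ig_bc L).
  apply: measurable_funM; first exact: measurable_indic.
  apply: measurable_funM => //.
  apply: (measurable_time (g := fun t => pos (T1 - t))) => t.
  apply: (@continuous_comp _ _ _ (fun t => T1 - t) pos); last exact: continuous_pos.
  by apply: cvgB; [exact: cvg_cst|exact: cvg_id].
- move=> z; rewrite ger0_norm ?late_excess_ge0//.
  have /andP[b0 _] := ball_cut_itv (rad2 L z).
  apply: ler_wpM2r; first by rewrite mulr_ge0 ?pos_ge0.
  rewrite indicE; have [za|za] := leP (2 * a) z.2; last first.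
    by rewrite memNset ?mul0r ?mulr_ge0 ?(ltW T10)//= leNgt za.
  rewrite mem_set// mul1r ler_wpM2l// /pos ge_max (ltW T10) andbT gerBl.
  by apply: le_trans za; rewrite mulr_ge0// ltW.
- by apply: igZ; exact: ig_bc.
Qed.

(** Test the equation of w with the regularised positive part, bound the interior
    term from below by monotonicity and the annular term by cross_diff_le, and let
    the regularisation tend to the positive part: the Lipschitz remainder
    disappears by cvg_mul_pos_reg''. The bound S is uniform in the regularisation. *)
Lemma comparison_inequality L a : 1 <= L -> 0 < a -> a <= T - T1 ->
  (forall i, ig lebV (tailU L a i)) -> (forall i, ig lebV (tailW L a i)) ->
  \int[lebV]_z late_excess L a z <=
    16 * (\sum_i (\int[lebV]_z tailU L a i z + \int[lebV]_z tailW L a i z)) +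
    a^-1 * (2 * T1 ^+ 2) * \int[lebV]_z (\1_[set z : V | a <= z.2 <= 2 * a] z *
      (ball_cut (rad2 L z) * pos (w z))).
Proof.
move=> L1 a0 aT igFU igFW.
have p1 : 1 < p by move: p2 => h; lra.
have [q1 pq pqp] := conjugate_exponent p1.
have L0 : 0 < L := lt_le_trans ltr01 L1.
have weakw := weak_sol_B (ltW p1) (ltW q1) (dis_weak disU) (dis_weak disW).
have [dxi [Cxi dxit dxix]] := @cutoff_C1 R n _ _ _ _ L (is_derive_time_cut a T1)
  (@continuous_time_cut' _ a T1) is_derive_ball_cut continuous_ball_cut'.
have k3 (r : R) : 3 <= r -> ball_cut r = 0.
  by move=> h; apply: ball_cut_eq0; apply: le_trans h; rewrite ler_nat.
have xiN (z : 'rV[R]_n * R) := cutoff_support (z := z) T1T a0 L0 k3.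
have xia (z : 'rV[R]_n * R) : z.2 <= a \/ T - a <= z.2 ->
    time_cut a T1 z.2 * ball_cut (rad2 L z) = 0.
  case=> h; first by have [-> _] := time_cut_le0 T1 a0 h; rewrite mul0r.
  have h1 : T1 <= z.2 by apply: le_trans h; rewrite lerBrDl -lerBrDr.
  by have [-> _] := time_cut_ge a h1; rewrite mul0r.
have xi0 (z : V) : 0 <= time_cut a T1 z.2 * ball_cut (rad2 L z).
  have /andP[th0 _] := time_cut_itv z.2 a0 (ltW T10).
  by have /andP[ch0 _] := ball_cut_itv (rad2 L z); exact: mulr_ge0.
have [cxi _ cdxi] := Cxi.
have [Kd Kd0 HKd] := bounded_of_support (cdxi dir_t) (C1_support Cxi xiN dir_t).
have igxi := ig_support cxi xiN.
pose S := 16 * (\sum_i (\int[lebV]_z tailU L a i z + \int[lebV]_z tailW L a i z)).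
pose h k z := - (dxi z dir_t * pos_reg k (w z)) -
  C * (time_cut a T1 z.2 * ball_cut (rad2 L z) * (`|w z| * pos_reg'' k (w z))).
have mxi : measurable_fun setT (fun z : V => time_cut a T1 z.2 * ball_cut (rad2 L z)).
  exact: ig_meas igxi.
have mdxi : measurable_fun setT (fun z : V => dxi z dir_t) by exact: measurable_continuous_rVR.
have creg k : continuous (@pos_reg R k) := continuous_is_derive (is_derive_pos_reg k).
have mh1 k : measurable_fun setT (fun z => dxi z dir_t * pos_reg k (w z)).
  by apply: measurable_funM => //; exact: measurable_comp_continuous (creg k) mw.
have mh2 k : measurable_fun setT (fun z => time_cut a T1 z.2 * ball_cut (rad2 L z) * (`|w z| * pos_reg'' k (w z))).
  apply: measurable_funM => //; apply: measurable_funM; first exact: measurableT_comp.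
  exact: measurable_comp_continuous (@continuous_pos_reg'' R k) mw.
have b1 k z : `|dxi z dir_t * pos_reg k (w z)| <= Kd * `|w z|.
  have /andP[h0 h1] := pos_reg_itv k (w z).
  rewrite normrM (ger0_norm h0); apply: ler_pM => //.
  exact: le_trans h1 (pos_le_norm _).
have b2 k z : `|time_cut a T1 z.2 * ball_cut (rad2 L z) * (`|w z| * pos_reg'' k (w z))| <=
    time_cut a T1 z.2 * ball_cut (rad2 L z) * 2.
  have /andP[h0 h1] := mul_pos_reg''_itv k (w z).
  by rewrite (ger0_norm (mulr_ge0 (xi0 z) h0)); apply: ler_wpM2l.
have igh1 k : ig lebV (fun z => dxi z dir_t * pos_reg k (w z)).
  by apply: ig_dom (igZ Kd (ig_abs igw)) => [|z]; [exact: mh1|exact: b1].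
have igh2 k : ig lebV (fun z => time_cut a T1 z.2 * ball_cut (rad2 L z) * (`|w z| * pos_reg'' k (w z))).
  by apply: ig_dom (igZ 2 igxi) => [|z]; [exact: mh2|rewrite (mulrC 2); exact: b2].
have hS k : \int[lebV]_z h k z <= S.
  have [igQ IQ] := weak_sol_chain_rule p1 q1 pq weakw Cxi xiN a0 xia
    (is_derive_pos_reg k) (is_derive_pos_reg' k) (@continuous_pos_reg'' R k).
  have igS : ig lebV (fun z => 16 * \sum_i (tailU L a i z + tailW L a i z)).
    by apply: igZ; apply: ig_sum => i; exact: igD.
  have IS : \int[lebV]_z (16 * \sum_i (tailU L a i z + tailW L a i z)) = S.
    rewrite (@I_Z _ _ _ _ 16 (fun z => \sum_i (tailU L a i z + tailW L a i z))); last first.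
      by apply: ig_sum => i; exact: igD.
    rewrite I_sum => [|i]; last exact: igD.
    by rewrite /S; congr (16 * _); apply: eq_bigr => i _; rewrite (I_D (igFU i) (igFW i)).
  rewrite /h (I_B (igN (igh1 k)) (igZ C (igh2 k))) (I_N (igh1 k)) IQ -(I_N igQ) -(I_B (igN igQ) (igZ C (igh2 k))) -IS.
  apply: (I_le (igB (igN igQ) (igZ C (igh2 k))) igS) => z.
  have /andP[th0 _] := time_cut_itv z.2 a0 (ltW T10).
  set Q1 := time_cut a T1 z.2 * ball_cut (rad2 L z) * pos_reg'' k (w z) *
    (\sum_i (Phi i z - Phi' i z) * (G i z - G' i z)).
  set Q2 := \sum_i (Phi i z - Phi' i z) * (dxi z (dir_x i) * pos_reg' k (w z)).
  rewrite (_ : \sum_i _ = Q1 + Q2); last first.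
    by rewrite /Q1 /Q2 mulr_sumr -big_split/=; apply: eq_bigr => i _; ring.
  have H1 : - (C * (time_cut a T1 z.2 * ball_cut (rad2 L z) * (`|w z| * pos_reg'' k (w z)))) <= Q1.
    have xc : 0 <= time_cut a T1 z.2 * ball_cut (rad2 L z) * pos_reg'' k (w z).
      by rewrite mulr_ge0// pos_reg''_ge0.
    have := ler_wpM2l xc (monotone z); apply: le_trans.
    by rewrite le_eqVlt; apply/orP; left; apply/eqP; rewrite -/(w z); ring.
  have H2 : - Q2 <= 16 * \sum_i (tailU L a i z + tailW L a i z).
    rewrite /Q2 -sumrN mulr_sumr; apply: ler_sum => i _; rewrite dxix.
    have i0 : 0 <= \1_[set z : V | 1 <= rad2 L z <= 2] z :> R by rewrite indicE.
    apply: cross_diff_le => //; last exact: pos_reg'_itv.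
      have [rz|rz] := boolP (1 <= rad2 L z <= 2).
        by rewrite indicE mem_set// mulr1 ball_cut'_le.
      rewrite indicE memNset; last exact/negP.
      rewrite mulr0 ball_cut'_eq0 ?normr0//.
      by move: rz; rewrite negb_and -!ltNge => /orP[/ltW|/ltW]; [left|right].
    rewrite indicE; have [rz|rz] := boolP (1 <= rad2 L z <= 2); last first.
      by rewrite memNset ?eqxx//; exact/negP.
    move=> _; apply: grad_rad2_le => //; case/andP: rz => _ h2.
    by apply: le_trans h2 _; rewrite ler_nat.
  exact: combine_le H1 H2.
have [|||||igl cvl] := @I_dct R _ V lebV h (fun z => - (dxi z dir_t * pos (w z)))
  (fun z => Kd * `|w z| + C * (time_cut a T1 z.2 * ball_cut (rad2 L z) * 2)).
- by move=> k; exact: ig_meas (igB (igN (igh1 k)) (igZ C (igh2 k))).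
- by apply: measurableT_comp => //; exact: measurable_funM.
- move=> z; rewrite -[X in _ --> X]subr0 -(mulr0 C) -(mulr0 (time_cut a T1 z.2 * ball_cut (rad2 L z))).
  apply: cvgB.
    by apply: cvgN; apply: cvgMr; exact: cvg_pos_reg.
  by apply: cvgMr; apply: cvgMr; exact: cvg_mul_pos_reg''.
- by apply: igD; [apply: igZ; exact: ig_abs|apply: igZ; under eq_fun do rewrite mulrC; exact: igZ].
- move=> k z; apply: (le_trans (ler_normB _ _)); apply: lerD; first by rewrite normrN.
  by rewrite normrM (ger0_norm C0); apply: ler_wpM2l.
have lS : \int[lebV]_z (- (dxi z dir_t * pos (w z))) <= S.
  by apply: (cvgr_to_le cvl); exact: nearW hS.
have ai0 : 0 <= a^-1 * (2 * T1 ^+ 2).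
  by apply: mulr_ge0; [rewrite invr_ge0 ltW|rewrite mulr_ge0// sqr_ge0].
have igR := igD igl (igZ (a^-1 * (2 * T1 ^+ 2)) (ig_init L a)).
have pw z : late_excess L a z <= - (dxi z dir_t * pos (w z)) +
    a^-1 * (2 * T1 ^+ 2) * (\1_[set z : V | a <= z.2 <= 2 * a] z * (ball_cut (rad2 L z) * pos (w z))).
  have /andP[bc0 bc1] := ball_cut_itv (rad2 L z).
  have bp0 : 0 <= ball_cut (rad2 L z) * pos (w z) by rewrite mulr_ge0 ?pos_ge0.
  have J0 : 0 <= a^-1 * (2 * T1 ^+ 2) * (\1_[set z : V | a <= z.2 <= 2 * a] z * (ball_cut (rad2 L z) * pos (w z))).
    by apply: mulr_ge0 => //; apply: mulr_ge0 => //; rewrite indicE.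
  rewrite dxit /late_excess -[X in X <= _]mulrA.
  have [za2|za2] := leP (2 * a) z.2.
    rewrite indicE mem_set// mul1r (time_cut'_late _ a0 za2) !mulNr opprK.
    by rewrite mulrA lerDl.
  rewrite indicE memNset ?mul0r; last by rewrite /= leNgt za2.
  have [za|za] := leP z.2 a.
    by have [_ ->] := time_cut_le0 T1 a0 za; rewrite !mul0r oppr0 add0r.
  rewrite indicE mem_set ?mul1r; last by rewrite /= !ltW.
  have z0 : 0 <= z.2 by rewrite ltW// (lt_trans a0).
  have /andP[_ th1] := time_cut'_le a0 (ltW T10) z0.
  by rewrite addrC subr_ge0 -[X in X <= _]mulrA; apply: ler_wpM2r.
have := I_le (ig_late_excess L a0) igR pw.
rewrite (I_D igl (igZ (a^-1 * (2 * T1 ^+ 2)) (ig_init L a))) (I_Z (a^-1 * (2 * T1 ^+ 2)) (ig_init L a)).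
by move=> h1; apply: (le_trans h1); rewrite lerD2r.
Qed.

Hypothesis sliceU : forall t, ig leb (fun x => U (x, t)).
Hypothesis sliceW : forall t, ig leb (fun x => W (x, t)).
Hypothesis contU : forall N e, 0 < e -> exists2 d, 0 < d & forall t, 0 <= t <= T -> `|t - 0| < d ->
  \int[leb]_x (\1_(ball_rV N : set 'rV[R]_n) x * `|U (x, t) - U (x, 0)|) <= e.
Hypothesis contW : forall N e, 0 < e -> exists2 d, 0 < d & forall t, 0 <= t <= T -> `|t - 0| < d ->
  \int[leb]_x (\1_(ball_rV N : set 'rV[R]_n) x * `|W (x, t) - W (x, 0)|) <= e.
Hypothesis init : {ae leb, forall x, U (x, 0) <= W (x, 0)}.

Lemma exists_layer_time (t0 d d' : R) : 0 < t0 -> 0 < d -> 0 < d' -> exists a : R,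
  [/\ 0 < a, a <= T - T1, 2 * a <= t0 & forall t, a <= t <= 2 * a ->
    [/\ 0 <= t <= T, `|t - 0| < d & `|t - 0| < d']].
Proof.
move=> t00 d0 d'0; have TT : 0 < T - T1 by rewrite subr_gt0.
pose b := Num.min (Num.min t0 (T - T1)) (Num.min d d').
have b0 : 0 < b by rewrite !lt_min t00 TT d0.
have bt : b <= t0 by rewrite !ge_min lexx.
have bT : b <= T - T1 by rewrite !ge_min lexx orbT.
have bd : b <= d by rewrite !ge_min lexx !orbT.
have bd' : b <= d' by rewrite !ge_min lexx !orbT.
have T1' := T10; move: b b0 bt bT bd bd' => b b0 bt bT bd bd'.
exists (b / 4); split; [by rewrite divr_gt0|lra|lra|].
move=> t /andP[h1 h2]; have t0' : 0 <= t by lra.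
rewrite subr0 ger0_norm// t0'; split; lra.
Qed.

(** The parameters are chosen in the order lambda, mass dl, radius L, thickness
    a. *)
Lemma late_excess_small (N : nat) (t0 eps : R) : 0 < t0 -> 0 < eps ->
  exists L a, [/\ 0 < L, 0 < a, 2 * a <= t0,
    (forall z : V, `|z.1| <= N%:R -> rad2 L z <= 1) &
    \int[lebV]_z late_excess L a z <= eps].
Proof.
move=> t00 eps0.
have [KU KU0 HU] := flux_tail_bound p2 T10 T1T c0 C0 tau_itv disU eta_scale.
have [KW KW0 HW] := flux_tail_bound p2 T10 T1T c0 C0 tau_itv disW eta_scale.
pose K := 16 * (n%:R * (KU + KW)).
have K0 : 0 <= K by rewrite !mulr_ge0// addr_ge0.
have q0 : 0 < p - 1 by rewrite subr_gt0 (lt_trans _ p2)// ltr1n.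
have K20 : 0 <= 2 * K by rewrite mulr_ge0.
have e20 : 0 < eps / 2 by rewrite divr_gt0.
(* lambda = 1/s is large enough for the second term of flux_tail_bound, which does
   not improve with L. *)
have [s s0 Hs] := exists_small_power q0 K20 e20.
have l0 : 0 < s^-1 by rewrite invr_gt0.
have A0 : 0 <= 3 * K * s^-1 + 4 * T1 ^+ 2.
  apply: addr_ge0; last by rewrite mulr_ge0 ?sqr_ge0.
  by apply: mulr_ge0; [rewrite mulr_ge0|exact: ltW].
(* With lambda fixed, dl bounds the masses that tend to 0 with L and a. *)
have [dl /andP[dl0 dl1] Hdl] := exists_small A0 e20.
near \oo => k.
have kU : \int[lebV]_z (\1_(annulus k.+1%:R : set V) z * `|U z|) <= dl.
  by near: k; apply: annulus_tail => //; exact: dis_ig disU.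
have kW : \int[lebV]_z (\1_(annulus k.+1%:R : set V) z * `|W z|) <= dl.
  by near: k; apply: annulus_tail => //; exact: dis_ig disW.
have kU0 : \int[leb]_x (\1_(annulus k.+1%:R : set V) (x, 0) * `|U (x, 0)|) <= dl.
  by near: k; exact: annulus_tail_slice.
have kW0 : \int[leb]_x (\1_(annulus k.+1%:R : set V) (x, 0) * `|W (x, 0)|) <= dl.
  by near: k; exact: annulus_tail_slice.
have kN : n%:R * N%:R ^+ 2 <= k.+1%:R :> R.
  near: k; exists (Num.truncn (n%:R * N%:R ^+ 2 : R)) => //= k kN.
  by apply: (le_trans (ltW (truncnS_gt _))); rewrite ler_nat.
have L1 : 1 <= k.+1%:R :> R by rewrite ler1n.
set L := k.+1%:R in kU kW kU0 kW0 kN L1.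
have L0 : 0 < L := lt_le_trans ltr01 L1.
(* Only after L is fixed can the layer be made thin: continuity in time is local
   in space. *)
have [dU dU0 HdU] := contU (2 * L) dl0; have [dW dW0 HdW] := contW (2 * L) dl0.
have [a [a0 aT at0 Ha]] := exists_layer_time t00 dU0 dW0.
exists L, a; split => //.
  move=> z zN; apply: (le_trans (rad2_le L0 zN)).
  rewrite ler_pdivrMl ?exprn_gt0// mulr1; apply: (le_trans kN).
  by rewrite expr2 ler_peMl// ltW.
have d20 : 0 <= 2 * dl by rewrite mulr_ge0// ltW.
have lU t : a <= t <= 2 * a ->
    (\int[leb]_x (\1_(annulus L : set V) (x, t) * `|U (x, t)|)%:E <= (2 * dl)%:E)%E.
  move=> /Ha[tT td td']; apply: layer_annulus => //; exact: HdU.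
have lW t : a <= t <= 2 * a ->
    (\int[leb]_x (\1_(annulus L : set V) (x, t) * `|W (x, t)|)%:E <= (2 * dl)%:E)%E.
  move=> /Ha[tT td td']; apply: layer_annulus => //; exact: HdW.
have lw t : a <= t <= 2 * a ->
    (\int[leb]_x (ball_cut (rad2 L (x, t)) * pos (w (x, t)))%:E <= (2 * dl)%:E)%E.
  by move=> /Ha[tT td td']; apply: (layer_excess sliceU sliceW L0 init); [exact: HdU|exact: HdW].
have FU i := HU _ _ _ _ i l0 L1 a0 aT d20 lU.
have FW i := HW _ _ _ _ i l0 L1 a0 aT d20 lW.
have b0 (z : V) : 0 <= ball_cut (rad2 L z) * pos (w z).
  by have /andP[c0' _] := ball_cut_itv (rad2 L z); rewrite mulr_ge0 ?pos_ge0.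
have [_ IJ] := initial_layer a0 d20 (ig_bc L) b0 lw.
have := comparison_inequality L1 a0 aT (fun i => (FU i).1) (fun i => (FW i).1).
have lamE : s^-1 `^ (- (p - 1)) = s `^ (p - 1).
  by rewrite -(powR_inv1 (ltW s0)) -powRrM mulN1r opprK.
have sumle : \sum_i (\int[lebV]_z tailU L a i z + \int[lebV]_z tailW L a i z) <=
    n%:R * ((KU + KW) * (s^-1 * (3 * dl) + s `^ (p - 1) * 2)).
  rewrite mulr_natl -[X in _ *+ X](card_ord n) -sumr_const; apply: ler_sum => i _.
  have [_ hU] := FU i; have [_ hW] := FW i.
  rewrite lamE in hU hW; rewrite mulrDl; apply: lerD.
    exact: tail_le KU0 (ltW l0) (powR_ge0 _ _) dl1 kU hU.
  exact: tail_le KW0 (ltW l0) (powR_ge0 _ _) dl1 kW hW.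
exact: (late_final a0 (sqr_ge0 T1) Hs Hdl sumle IJ).
Unshelve. all: by end_near. Qed.

(** On bounded sets away from the initial time, (T1 - t) times the positive part of
    w is dominated by late_excess for every admissible L and a, hence has integral
    0. *)
Lemma comparison_ae : {ae lebV, forall z : V, 0 < z.2 < T1 -> U z <= W z}.
Proof.
pose g (k : nat) (z : V) : R := \1_[set z : V | k.+1%:R^-1 <= z.2] z *
  (\1_[set z : V | `|z.1| <= k%:R] z * (2 * pos (T1 - z.2) * pos (w z))).
have g0 k z : 0 <= g k z.
  have i0 (A : set V) : 0 <= \1_A z :> R by rewrite indicE.
  have p0 := pos_ge0 (w z); have p0' := pos_ge0 (T1 - z.2).
  by apply: mulr_ge0 => //; apply: mulr_ge0 => //; apply: mulr_ge0 => //; exact: mulr_ge0.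
have mg k : measurable_fun setT (g k).
  apply: measurable_funM; first exact: measurable_indic.
  apply: measurable_funM.
    apply: measurable_indic.
    rewrite (_ : [set _ | _] = ball_rV k%:R `*` setT); last by apply/seteqP; split=> [z zN|z []].
    by apply: measurableX => //; exact: measurable_ball_rV.
  apply: measurable_funM => //; apply: measurable_funM => //.
  apply: (measurable_time (g := fun t => pos (T1 - t))) => t.
  apply: (@continuous_comp _ _ _ (fun t => T1 - t) pos); last exact: continuous_pos.
  by apply: cvgB; [exact: cvg_cst|exact: cvg_id].
have gl k L a : 0 < a -> 2 * a <= k.+1%:R^-1 -> (forall z : V, `|z.1| <= k%:R -> rad2 L z <= 1) ->
    forall z, g k z <= late_excess L a z.
  move=> a0 ak kL z; rewrite /g indicE.
  have [zk|zk] := leP k.+1%:R^-1 z.2; last first.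
    by rewrite memNset ?mul0r ?late_excess_ge0//= leNgt zk.
  rewrite mem_set// mul1r indicE; have [zN|zN] := leP `|z.1| k%:R; last first.
    by rewrite memNset ?mul0r ?late_excess_ge0//= leNgt zN.
  rewrite mem_set// mul1r /late_excess indicE mem_set ?mul1r; last exact: le_trans zk.
  by rewrite ball_cut_eq1 ?mul1r// kL.
have gae k : {ae lebV, forall z, g k z = 0}.
  have k0 : 0 < k.+1%:R^-1 :> R by rewrite invr_gt0.
  have igg : ig lebV (g k).
    have [L [a [L0 a0 ak kL _]]] := late_excess_small k k0 (@ltr01 R).
    apply: ig_dom (ig_late_excess L a0) => // z; rewrite ger0_norm//; exact: gl.
  apply: I_eq0_ae => //; apply/ler_addgt0Pr => eps eps0; rewrite add0r.
  have [L [a [L0 a0 ak kL He]]] := late_excess_small k k0 eps0.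
  by apply: le_trans He; apply: (I_le igg (ig_late_excess L a0)); exact: gl.
have : {ae lebV, forall z k, g k z = 0} by apply/ae_foralln.
apply: filterS => z gz /andP[z0 zT].
near \oo => k.
have kz : `|z.1| <= k%:R.
  near: k; exists (Num.truncn `|z.1|).+1 => //= k kN.
  by apply: (le_trans (ltW (truncnS_gt _))); rewrite ler_nat.
have kt : k.+1%:R^-1 <= z.2.
  near: k; exists (Num.truncn z.2^-1) => //= k kN.
  rewrite -[z.2]invrK lef_pV2 ?posrE ?invr_gt0//.
  by apply: (le_trans (ltW (truncnS_gt _))); rewrite ler_nat.
have := gz k; rewrite /g !indicE !mem_set// !mul1r => /eqP.
rewrite mulf_eq0 mulf_eq0 pnatr_eq0/= => /orP[/eqP h|/eqP h].
  exfalso; move: h; rewrite pos_id ?subr_ge0 ?(ltW zT)// => /eqP.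
  by rewrite subr_eq0 gt_eqF.
rewrite leNgt; apply/negP => wz; move: h; rewrite pos_id; last by rewrite subr_ge0 ltW.
by move/eqP; rewrite subr_eq0 gt_eqF.
Unshelve. all: by end_near. Qed.

End comparison.

(** * The structure conditions *)

Section p_laplacian.
Context {R : realType} {n : nat}.
Implicit Types a b : 'rV[R]_n.

Lemma enorm_flux_dot (p : R) a : 2 < p ->
  \sum_i (enorm a `^ (p - 2) * a ord0 i) * a ord0 i = enorm a `^ p.
Proof.
move=> p2; under eq_bigr do rewrite -mulrA -expr2.
rewrite -mulr_sumr -enorm_sqr -powR_mulrn ?enorm_ge0// -powRD; last first.
  by apply/implyP => /eqP h; exfalso; lra.
by congr (_ `^ _); lra.
Qed.

Lemma enorm_sub_sqr a b : enorm (a - b) ^+ 2 <= 2 * (enorm a ^+ 2 + enorm b ^+ 2).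
Proof.
rewrite !enorm_sqr -big_split/= mulr_sumr; apply: ler_sum => i _.
by rewrite !mxE; have := sqr_ge0 (a ord0 i + b ord0 i); nra.
Qed.

Lemma powR_sub_mono (r x y : R) : 0 <= r -> 0 <= x -> 0 <= y ->
  0 <= (x `^ r - y `^ r) * (x ^+ 2 - y ^+ 2).
Proof.
move=> r0; have le (a b : R) : 0 <= a -> a <= b -> 0 <= (b `^ r - a `^ r) * (b ^+ 2 - a ^+ 2).
  move=> a0 ab; apply: mulr_ge0; rewrite subr_ge0; first exact: ler_powR2.
  by rewrite ler_sqr ?nnegrE// (le_trans a0).
move=> x0 y0; have [xy|/ltW yx] := leP y x; first exact: le.
by rewrite -mulrNN !opprB; exact: le.
Qed.

(** With A = |a|^(p-2) and B = |b|^(p-2), the sum is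
    (A + B)/2 |a - b|^2 + (A - B)/2 (|a|^2 - |b|^2). The second term is nonnegative,
    and |a - b| <= 2 max(|a|, |b|) bounds A + B from below. *)
Lemma p_laplacian_monotone (p : R) a b : 2 < p ->
  2 `^ (1 - p) * enorm (a - b) `^ p <=
  \sum_i (enorm a `^ (p - 2) * a ord0 i - enorm b `^ (p - 2) * b ord0 i) * (a ord0 i - b ord0 i).
Proof.
move=> p2.
set A := enorm a `^ (p - 2); set B := enorm b `^ (p - 2).
have A0 : 0 <= A := powR_ge0 _ _; have B0 : 0 <= B := powR_ge0 _ _.
have -> : \sum_i (A * a ord0 i - B * b ord0 i) * (a ord0 i - b ord0 i) =
    2^-1 * (A + B) * enorm (a - b) ^+ 2 + 2^-1 * ((A - B) * (enorm a ^+ 2 - enorm b ^+ 2)).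
  rewrite !enorm_sqr -sumrB !mulr_sumr -big_split/=; apply: eq_bigr => i _.
  by rewrite !mxE; field.
have r0 : 0 <= p - 2 by lra.
have mono := powR_sub_mono r0 (enorm_ge0 a) (enorm_ge0 b).
have e0 := enorm_ge0 (a - b).
have key : 2 `^ (2 - p) * enorm (a - b) `^ (p - 2) <= A + B.
  have M0 : 0 <= Num.max (enorm a) (enorm b) by rewrite le_max enorm_ge0.
  have eM : enorm (a - b) <= 2 * Num.max (enorm a) (enorm b).
    rewrite -(@ler_pXn2r _ 2)// ?nnegrE ?mulr_ge0//.
    apply: (le_trans (enorm_sub_sqr a b)).
    have ha : enorm a ^+ 2 <= Num.max (enorm a) (enorm b) ^+ 2.
      by rewrite ler_sqr ?nnegrE ?enorm_ge0// le_max lexx.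
    have hb : enorm b ^+ 2 <= Num.max (enorm a) (enorm b) ^+ 2.
      by rewrite ler_sqr ?nnegrE ?enorm_ge0// le_max lexx orbT.
    by rewrite exprMn; lra.
  apply: (@le_trans _ _ (Num.max (enorm a) (enorm b) `^ (p - 2))).
    apply: (@le_trans _ _ (2 `^ (2 - p) * (2 * Num.max (enorm a) (enorm b)) `^ (p - 2))).
      by rewrite ler_wpM2l ?powR_ge0//; apply: ler_powR2.
    rewrite powRM// mulrA -powRD; last by apply/implyP => _; rewrite pnatr_eq0.
    by rewrite (_ : 2 - p + (p - 2) = 0) ?powRr0 ?mul1r//; ring.
  by rewrite /Num.max; case: ifP => _; rewrite ?lerDl ?lerDr.
have -> : 2 `^ (1 - p) * enorm (a - b) `^ p =
    2^-1 * (2 `^ (2 - p) * enorm (a - b) `^ (p - 2)) * enorm (a - b) ^+ 2.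
  rewrite -powR_mulrn// -!mulrA -powRD; last by apply/implyP => /eqP h; exfalso; lra.
  rewrite mulrA -[2^-1]powR_inv1// -powRD; last by apply/implyP => _; rewrite pnatr_eq0.
  by congr (_ `^ _ * _ `^ _); lra.
have h1 : 2^-1 * (2 `^ (2 - p) * enorm (a - b) `^ (p - 2)) * enorm (a - b) ^+ 2 <=
    2^-1 * (A + B) * enorm (a - b) ^+ 2.
  by rewrite ler_wpM2r ?sqr_ge0// ler_wpM2l.
by apply: (le_trans h1); rewrite lerDl mulr_ge0.
Qed.

End p_laplacian.

Section lipschitz_from_derivative.
Context {R : realType} {n : nat}.

Lemma derivable_coord (v : R -> 'rV[R]_n) (a : R) i : derivable v a 1 ->
  is_derive a 1 (fun s => v s ord0 i) (('D_1 v a) ord0 i).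
Proof.
move=> dv; have dvi := (derivable_mxP v a 1).1 dv ord0 i.
by apply: DeriveDef => //; rewrite derive_mx// mxE.
Qed.

(** The mean value theorem applies to each component of a vector-valued
    function, though not to the function itself. *)
Lemma coord_lipschitz (v : R -> 'rV[R]_n) (M C : R) i :
  (forall a, `|a| <= M -> derivable v a 1 /\ enorm ('D_1 v a) <= C) ->
  forall a b, `|a| <= M -> `|b| <= M -> `|v a ord0 i - v b ord0 i| <= C * `|a - b|.
Proof.
move=> Hv.
have le a b : a <= b -> `|a| <= M -> `|b| <= M -> `|v b ord0 i - v a ord0 i| <= C * `|b - a|.
  move=> ab aM bM; move: (aM) (bM); rewrite (ler_norml a) (ler_norml b) => /andP[a1 a2] /andP[b1 b2].
  have inM x : a <= x <= b -> `|x| <= M.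
    by move=> /andP[ax xb]; rewrite ler_norml (le_trans a1)// (le_trans xb).
  have D x : a <= x <= b -> is_derive x 1 (fun s => v s ord0 i) (('D_1 v x) ord0 i).
    by move=> /inM/Hv[dv _]; exact: derivable_coord.
  have [x xab ->] : exists2 x, x \in `[a, b]%R &
      v b ord0 i - v a ord0 i = ('D_1 v x) ord0 i * (b - a).
    apply: (@MVT_segment _ (fun s => v s ord0 i) (fun x => ('D_1 v x) ord0 i)) => //.
      by move=> x; rewrite in_itv/= => /andP[ax xb]; apply: D; rewrite !ltW.
    apply: continuous_in_subspaceT => x; rewrite inE/= in_itv/= => /D[dx _].
    by apply: differentiable_continuous; exact/derivable1_diffP.
  rewrite normrM ler_wpM2r//; move: xab; rewrite in_itv/= => /inM/Hv[_]; apply: le_trans.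
  exact: coord_le_enorm.
move=> a b aM bM; have [ab|/ltW ba] := leP b a; first exact: le.
by rewrite distrC (distrC a); exact: le.
Qed.

Lemma coercive_arith (m mt c E Y B S : R) : Y <= m / 2 * E + B -> m * E <= mt * E -> B <= S ->
  m / 2 * E - S <= mt * E - Y.
Proof. by move=> h1 h2 h3; lra. Qed.

Lemma growth_arith (t m K E Ur a b C : R) : 0 <= t -> 0 <= m -> 0 <= K -> 0 <= E -> 0 <= Ur ->
  a <= m * E -> b <= K * Ur -> t * (m + K) <= C -> t * (a + b) <= C * (E + Ur).
Proof.
move=> t0 m0 K0 E0 Ur0 ha hb hC.
apply: (@le_trans _ _ (t * (m + K) * (E + Ur))); last by rewrite ler_wpM2r// addr_ge0.
rewrite -mulrA ler_wpM2l//; have : 0 <= m * Ur by rewrite mulr_ge0.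
have : 0 <= K * E by rewrite mulr_ge0.
lra.
Qed.

Lemma monotone_arith (m mt D2 P S1 S2 B CW : R) : 0 <= m -> m <= mt -> 0 <= D2 * P ->
  D2 * P <= S1 -> S2 <= m * D2 * P + B -> B <= CW -> - CW <= mt * S1 - S2.
Proof.
move=> m0 mm P0 h1 h2 h3.
have h4 : m * (D2 * P) <= mt * S1 by apply: ler_pM.
rewrite -mulrA in h2; lra.
Qed.

End lipschitz_from_derivative.

Section structure.
Context {R : realType} {n : nat}.
Implicit Types (k : R -> 'rV[R]_n) (p tau M K : R).

(** Both structural alternatives give such a field, with tau = 0 and with
    tau = 1 / (2 (p - 1)) respectively. The exponents are those whose multiples by
    q = p/(p-1) are 1 and 1 + 2 tau. *)
Definition sub_power p tau M K k := forall a b i, `|a| <= M -> `|b| <= M ->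
  `|k a ord0 i - k b ord0 i| <= K * `|a - b| `^ (1 - p^-1) /\
  `|k a ord0 i| <= K * `|a| `^ ((1 + 2 * tau) * (1 - p^-1)).

Lemma sub_power_holder p M K k : 0 <= M -> (forall i, k 0 ord0 i = 0) ->
  (forall a b, `|a| <= M -> `|b| <= M -> enorm (k a - k b) <= K * `|a - b| `^ (1 - p^-1)) ->
  sub_power p 0 M `|K| k.
Proof.
move=> M0 k0 Hk.
have H a b i : `|a| <= M -> `|b| <= M ->
    `|k a ord0 i - k b ord0 i| <= `|K| * `|a - b| `^ (1 - p^-1).
  move=> aM bM; have := coord_le_enorm (k a - k b) i; rewrite !mxE => h.
  apply: (le_trans h); apply: (le_trans (Hk _ _ aM bM)).
  by rewrite ler_wpM2r ?powR_ge0// ler_norm.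
move=> a b i aM bM; split; first exact: H.
by have := H a 0 i aM; rewrite normr0 k0 !subr0 mulr0 addr0 mul1r => ->.
Qed.

(** With this tau the exponent (1 + 2 tau)(1 - 1/p) is 1, so the size condition is
    the Lipschitz condition at 0; Hoelder continuity follows because
    |a - b|^(1/p) <= (2M)^(1/p). *)
Lemma sub_power_lipschitz p M C k : 2 < p -> 0 <= M -> 0 <= C -> (forall i, k 0 ord0 i = 0) ->
  (forall a, `|a| <= M -> derivable k a 1 /\ enorm ('D_1 k a) <= C) ->
  sub_power p (2 * (p - 1))^-1 M (C * (1 + (2 * M) `^ p^-1)) k.
Proof.
move=> p2 M0 C0 k0 Hk a b i aM bM.
have pM := powR_ge0 (2 * M) p^-1.
have L := coord_lipschitz i Hk; split.
  apply: (le_trans (L a b aM bM)); rewrite -mulrA ler_wpM2l//.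
  have E : `|a - b| = `|a - b| `^ p^-1 * `|a - b| `^ (1 - p^-1).
    rewrite -powRD; last by apply/implyP => /eqP h; exfalso; lra.
    by rewrite (_ : p^-1 + (1 - p^-1) = 1) ?powRr1//; ring.
  rewrite {1}E ler_wpM2r ?powR_ge0//.
  apply: (@le_trans _ _ ((2 * M) `^ p^-1)); last by rewrite lerDr.
  apply: ler_powR2 => //; first by rewrite invr_ge0; lra.
  by apply: (le_trans (ler_normB _ _)); lra.
have -> : (1 + 2 * (2 * (p - 1))^-1) * (1 - p^-1) = 1 :> R.
  by field; apply/andP; split; apply/eqP; lra.
rewrite powRr1//; have := L a 0 aM; rewrite normr0 k0 !subr0 => h.
apply: (le_trans (h M0)); rewrite ler_wpM2r// ler_peMr//; lra.
Qed.

(** Young's inequality, component by component, with n times the weight of the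
    gradient at most c. *)
Lemma young_small (p c : R) : 1 < p -> 0 < c -> exists2 s : R, 0 < s &
  forall (H : 'I_n -> R) (a : 'rV[R]_n) B, (forall i, `|H i| `^ (p / (p - 1)) <= B) ->
    \sum_i H i * a ord0 i <= c * enorm a `^ p + n%:R * s * B.
Proof.
move=> p1 c0; have [q1 pq pqp] := conjugate_exponent p1.
have p0 : 0 < p := lt_trans ltr01 p1; have q0 : 0 < p / (p - 1) := lt_trans ltr01 q1.
have [d d0 Hd] := exists_small_power p0 (ler0n R n) c0.
exists (d^-1 `^ (p / (p - 1))); first by rewrite powR_gt0 ?invr_gt0.
move=> H a B HB.
have id0 : 0 < d^-1 by rewrite invr_gt0.
have each i : H i * a ord0 i <= d `^ p * enorm a `^ p + d^-1 `^ (p / (p - 1)) * B.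
  apply: (le_trans (ler_norm _)); rewrite mulrC.
  apply: (le_trans (young_scaled (a ord0 i) (H i) p0 q0 pq id0)).
  rewrite invrK; apply: lerD; rewrite ler_wpM2l ?powR_ge0//.
  by apply: ler_powR2 => //; [exact: ltW|exact: coord_le_enorm].
apply: (@le_trans _ _ (\sum_(i < n) (d `^ p * enorm a `^ p + d^-1 `^ (p / (p - 1)) * B))).
  by apply: ler_sum => i _; exact: each.
have -> x : \sum_(i < n) x = n%:R * x :> R by rewrite sumr_const card_ord mulr_natl.
by rewrite mulrDr !mulrA lerD2r ler_wpM2r ?powR_ge0.
Qed.

End structure.

Section dissipative_solutions.
Context {R : realType} {n : nat}.
Local Notation V := ('rV[R]_n * measurableTypeR R)%type.
Variables (p tau : R) (mu : R -> R) (f : 'rV[R]_n -> R -> R -> 'rV[R]_n)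
  (g : R -> R -> 'rV[R]_n) (T M K : R).
Hypothesis p2 : 2 < p.
Hypothesis T0 : 0 < T.
Hypothesis cmu : {within [set t : R | 0 <= t], continuous mu}.
Hypothesis mu0 : forall t, 0 <= t -> 0 < mu t.
Hypothesis K0 : 0 <= K.
Hypothesis Hf : forall x t, 0 <= t <= T -> sub_power p tau M K (f x t).
Hypothesis Hg : forall t, 0 <= t <= T -> sub_power p tau M K (g t).

(** The exponent q = p/(p-1) is inverse to 1 - 1/p. *)
Lemma convection_sub_power i z a b : `|a| <= M -> `|b| <= M ->
  `|convection f g T i z a - convection f g T i z b| `^ (p / (p - 1)) <=
    (2 * K) `^ (p / (p - 1)) * `|a - b| /\
  `|convection f g T i z a| `^ (p / (p - 1)) <=
    (2 * K) `^ (p / (p - 1)) * `|a| `^ (1 + 2 * tau).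
Proof.
move=> aM bM; have p1 : 1 < p by move: p2 => h; lra.
have [q1 pq pqp] := conjugate_exponent p1.
have q0 : 0 <= p / (p - 1) := ltW (lt_trans ltr01 q1).
have e1 : (1 - p^-1) * (p / (p - 1)) = 1.
  by move: p1 => h; field; apply/andP; split; apply/eqP; lra.
have tT := tclamp_itv z.2 (ltW T0).
have [f1 f2] := Hf z.1 tT i aM bM; have [g1 g2] := Hg tT i aM bM.
have K20 : 0 <= 2 * K by rewrite mulr_ge0.
have PM (x r : R) : (2 * K * x `^ (r * (1 - p^-1))) `^ (p / (p - 1)) =
    (2 * K) `^ (p / (p - 1)) * x `^ r.
  by rewrite powRM ?powR_ge0// -powRrM -mulrA e1 mulr1.
split.
  rewrite -[in leRHS](powRr1 (normr_ge0 (a - b))) -PM mul1r.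
  apply: ler_powR2 => //; rewrite /convection.
  rewrite (_ : forall x y z w : R, x + y - (z + w) = (x - z) + (y - w)); last by move=> *; ring.
  apply: (le_trans (ler_normD _ _)); move: (lerD f1 g1); rewrite -mulrDl.
  by rewrite (_ : K + K = 2 * K)//; ring.
rewrite -PM; apply: ler_powR2 => //; rewrite /convection.
apply: (le_trans (ler_normD _ _)); move: (lerD f2 g2); rewrite -mulrDl.
by rewrite (_ : K + K = 2 * K)//; ring.
Qed.

(** Coercivity and monotonicity are both Young's inequality against the
    convective term, whose conjugate power is bounded by convection_sub_power. *)
Lemma regular_dissipative : exists c C, [/\ 0 < c, 0 <= C,
  (forall u U G, regular p mu f g T M u U G ->
    dissipative p T M c C tau U (fun z => enorm (G z) `^ p) (fun i z => G z ord0 i)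
      (flux p mu f g T U G)) &
  (forall u U G v W G', regular p mu f g T M u U G -> regular p mu f g T M v W G' ->
    forall z, - (C * `|U z - W z|) <=
      \sum_i (flux p mu f g T U G i z - flux p mu f g T W G' i z) * (G z ord0 i - G' z ord0 i))].
Proof.
have p1 : 1 < p by move: p2 => h; lra.
have [q1 pq pqp] := conjugate_exponent p1.
have q0 : 0 <= p / (p - 1) := ltW (lt_trans ltr01 q1).
have p0 : 0 < p := lt_trans ltr01 p1.
have [m0 [m1 [m00 mb]]] := tclamp_bounds T0 cmu mu0.
have m10 : 0 <= m1 by have /andP[h1 h2] := mb 0; rewrite (le_trans (ltW m00))// (le_trans h1).
have c20 : 0 < m0 / 2 by rewrite divr_gt0.
have c30 : 0 < m0 * 2 `^ (1 - p) by rewrite mulr_gt0 ?powR_gt0.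
have [s s0 Hs] := @young_small R n p _ p1 c20.
have [r r0 Hr] := @young_small R n p _ p1 c30.
set Kq := (2 * K) `^ (p / (p - 1)); have Kq0 : 0 <= Kq := powR_ge0 _ _.
pose C := n%:R * s * Kq + n%:R * r * Kq + 2 `^ (p / (p - 1)) * (m1 `^ (p / (p - 1)) + Kq).
have C1 : 0 <= n%:R * s * Kq by rewrite !mulr_ge0// ltW.
have C2 : 0 <= n%:R * r * Kq by rewrite !mulr_ge0// ltW.
have C3 : 0 <= 2 `^ (p / (p - 1)) * (m1 `^ (p / (p - 1)) + Kq).
  by rewrite mulr_ge0 ?addr_ge0 ?powR_ge0.
exists (m0 / 2), C; split => //; first by rewrite !addr_ge0.
- move=> u U G reg; have UM := ws_bound (reg_weak reg).
  have cz i z := (convection_sub_power i z (UM z) (UM z)).2.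
  have Ur0 z : 0 <= `|U z| `^ (1 + 2 * tau) := powR_ge0 _ _.
  have mG i : measurable_fun setT (fun z => G z ord0 i).
    by have [] := ws_grad_Lp (reg_weak reg) i.
  split.
  + exact: reg_weak reg.
  + exact: reg_ig reg.
  + under eq_fun do rewrite -(ger0_norm (enorm_ge0 _)).
    by apply: measurable_powR_norm; exact: measurable_enorm.
  + by move=> z; exact: powR_ge0.
  + move=> z; have /andP[h1 h2] := mb z.2.
    have Y := Hs (fun i => convection f g T i z (U z)) (G z) _ (fun i => cz i z).
    rewrite /flux; under eq_bigr do rewrite mulrBl -mulrA.
    rewrite sumrB -mulr_sumr enorm_flux_dot//.
    have E0 : 0 <= enorm (G z) `^ p := powR_ge0 _ _.
    have H1 : m0 * enorm (G z) `^ p <= mu (tclamp T z.2) * enorm (G z) `^ p by rewrite ler_wpM2r.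
    have H2 : n%:R * s * Kq * `|U z| `^ (1 + 2 * tau) <= C * `|U z| `^ (1 + 2 * tau).
      by rewrite ler_wpM2r// /C -addrA lerDl addr_ge0.
    rewrite mulrA in Y; exact: coercive_arith Y H1 H2.
  + move=> i z; have /andP[h1 h2] := mb z.2.
    have E0 : 0 <= enorm (G z) `^ p := powR_ge0 _ _.
    rewrite /flux; apply: (le_trans (powR_D_le _ (- convection f g T i z (U z)) q0)).
    rewrite normrN.
    have H1 : `|mu (tclamp T z.2) * (enorm (G z) `^ (p - 2) * G z ord0 i)| `^ (p / (p - 1)) <=
        m1 `^ (p / (p - 1)) * enorm (G z) `^ p.
      have -> : enorm (G z) `^ p = (enorm (G z) `^ (p - 1)) `^ (p / (p - 1)) by rewrite -powRrM pqp.
      rewrite -powRM ?powR_ge0//; apply: ler_powR2 => //.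
      rewrite normrM; apply: ler_pM => //; last exact: enorm_flux_le.
      by rewrite ger0_norm// (le_trans (ltW m00)).
    have H2 := cz i z.
    have S : 2 `^ (p / (p - 1)) * (m1 `^ (p / (p - 1)) + Kq) <= C by rewrite /C lerDr addr_ge0.
    exact: growth_arith (powR_ge0 _ _) (powR_ge0 _ _) Kq0 E0 (Ur0 z) H1 H2 S.
- move=> u U G v W G' regU regW z.
  have UM := ws_bound (reg_weak regU); have WM := ws_bound (reg_weak regW).
  have cz i := (convection_sub_power i z (UM z) (WM z)).1.
  have /andP[h1 h2] := mb z.2.
  have Y := Hr (fun i => convection f g T i z (U z) - convection f g T i z (W z)) (G z - G' z)
    (Kq * `|U z - W z|) cz.
  have D := p_laplacian_monotone (G z) (G' z) p2.
  set S1 := \sum_i _ in D; set S2 := \sum_i _ in Y.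
  have -> : \sum_i (flux p mu f g T U G i z - flux p mu f g T W G' i z) * (G z ord0 i - G' z ord0 i) =
      mu (tclamp T z.2) * S1 - S2.
    rewrite /S1 /S2 mulr_sumr -sumrB; apply: eq_bigr => i _.
    by rewrite /flux !mxE; ring.
  have P0 : 0 <= 2 `^ (1 - p) * enorm (G z - G' z) `^ p by rewrite mulr_ge0 ?powR_ge0.
  have CW : n%:R * r * (Kq * `|U z - W z|) <= C * `|U z - W z|.
    by rewrite mulrA ler_wpM2r// /C addrAC lerDr addr_ge0.
  exact: monotone_arith (ltW m00) h1 P0 D Y CW.
Qed.

End dissipative_solutions.

Section alternatives.
Context {R : realType} {n : nat}.

(** The requirement on (tau, eta) that makes omega^(-(p-1)) harmless over an
    annulus of radius L. *)
Definition eta_scaling (p tau : R) (eta : R -> R) := forall L, 1 <= L ->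
  [/\ 0 < eta L, eta L * L ^+ n <= L `^ p &
      forall s, omega tau (eta L) s `^ (- (p - 1)) <= `|s| + eta L].

(** Here omega = 1, and the volume L^n of the annulus is at most L^p. *)
Lemma eta_scaling_large (p : R) : n%:R <= p -> eta_scaling p 0 (fun=> 1).
Proof.
move=> np L L1; split => //.
  by rewrite mul1r -powR_mulrn ?(le_trans ler01 L1)//; exact: ler_powR.
by move=> s; rewrite /omega oppr0 powRr0 powR1 lerDr.
Qed.

(** Here omega^(-(p-1)) is the square root of s^2 + eta^2, and eta L^n = 1. *)
Lemma eta_scaling_small (p : R) : 2 < p ->
  eta_scaling p (2 * (p - 1))^-1 (fun L => L ^- n).
Proof.
move=> p2 L L1; have L0 : 0 < L := lt_le_trans ltr01 L1.
have Ln : 0 < L ^+ n by rewrite exprn_gt0.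
split; first by rewrite invr_gt0.
  rewrite mulVf ?gt_eqF//; have p0 : 0 <= p by lra.
  by have := ler_powR L1 p0; rewrite powRr0.
move=> s; rewrite /omega -powRrM.
have -> : - (2 * (p - 1))^-1 * - (p - 1) = 2^-1 :> R by field; apply/eqP; lra.
rewrite powR12_sqrt; last by rewrite ltW// rho_gt0// invr_gt0.
set e := L ^- n; have e0 : 0 <= e by rewrite invr_ge0 ltW.
rewrite -(@ler_pXn2r _ 2)// ?nnegrE ?sqrtr_ge0 ?addr_ge0//.
rewrite sqr_sqrtr; last by rewrite /rho addr_ge0// sqr_ge0.
rewrite /rho sqrrD real_normK ?num_real// -addrA lerD2l lerDr mulrn_wge0//.
by rewrite mulr_ge0.
Qed.

(** Both fields vanish at u = 0, f by its growth condition, since kappa + 1 > 0.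
    In the second case the bound on the derivatives makes them Lipschitz on bounded
    sets. *)
Lemma structure_alternatives (p kappa gamma T : R) (F : R -> R)
    (f : 'rV[R]_n -> R -> R -> 'rV[R]_n) (g : R -> R -> 'rV[R]_n) (Ts : \bar R) :
  2 < p -> 0 <= kappa -> (forall t, 0 <= t -> g t 0 = 0) ->
  (forall x t s, 0 <= t -> enorm (f x t s) <= F t * `|s| `^ (kappa + 1)) ->
  0 < T -> (T%:E < Ts)%E ->
  (n%:R <= p /\
   forall M T' : R, 0 < M -> 0 < T' -> (T'%:E < Ts)%E ->
     exists Kf Kg : R, forall x t a b,
       0 <= t <= T' -> `|a| <= M -> `|b| <= M ->
       enorm (f x t a - f x t b) <= Kf * `|a - b| `^ (1 - p^-1) /\
       enorm (g t a - g t b) <= Kg * `|a - b| `^ (1 - p^-1))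
  \/
  (p < n%:R /\ 1 - 2 / p <= kappa /\ 1 - 2 / p <= gamma /\
   forall M T' : R, 0 < M -> 0 < T' -> (T'%:E < Ts)%E ->
     exists Fu Gu : R, forall x t a,
       0 <= t <= T' -> `|a| <= M ->
       derivable (f x t) a 1 /\ derivable (g t) a 1 /\
       enorm ('D_1 (f x t) a) <= Fu * `|a| `^ kappa /\
       enorm ('D_1 (g t) a) <= Gu * `|a| `^ gamma) ->
  exists tau eta, [/\ 0 <= tau < 2^-1, eta_scaling p tau eta &
    forall M, 0 < M -> exists2 K, 0 <= K & forall x t, 0 <= t <= T ->
      sub_power p tau M K (f x t) /\ sub_power p tau M K (g t)].
Proof.
move=> p2 k0 g0 fF T0 TTs alt.
have f00 x t i : 0 <= t <= T -> f x t 0 ord0 i = 0.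
  move=> /andP[t0 _]; apply/eqP; rewrite -normr_le0.
  apply: (le_trans (coord_le_enorm _ _)); apply: (le_trans (fF x t 0 t0)).
  by rewrite normr0 powR0 ?mulr0//; apply/eqP; lra.
have g00 t i : 0 <= t <= T -> g t 0 ord0 i = 0.
  by move=> /andP[t0 _]; rewrite g0// mxE.
have weaken tau M K K' (k : R -> 'rV[R]_n) : K <= K' -> sub_power p tau M K k -> sub_power p tau M K' k.
  move=> KK Hk a b i aM bM; have [h1 h2] := Hk a b i aM bM; split.
    by apply: (le_trans h1); rewrite ler_wpM2r ?powR_ge0.
  by apply: (le_trans h2); rewrite ler_wpM2r ?powR_ge0.
case: alt => [[np H]|[np [kp [gp H]]]].
- exists 0, (fun=> 1); split; [by rewrite lexx invr_gt0 ltr0n|exact: eta_scaling_large|].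
  move=> M M0; have [Kf [Kg HK]] := H M T M0 T0 TTs.
  exists (`|Kf| + `|Kg|); first by rewrite addr_ge0.
  move=> x t tT; split.
    apply: (@weaken _ _ `|Kf|); first by rewrite lerDl.
    apply: sub_power_holder => [|i|a b aM bM]; [exact: ltW|exact: f00|].
    by have [] := HK x t a b tT aM bM.
  apply: (@weaken _ _ `|Kg|); first by rewrite lerDr.
  apply: sub_power_holder => [|i|a b aM bM]; [exact: ltW|exact: g00|].
  by have [] := HK x t a b tT aM bM.
- exists (2 * (p - 1))^-1, (fun L => L ^- n); split; last 2 first.
  + exact: eta_scaling_small.
  + move=> M M0; have [Fu [Gu HFG]] := H M T M0 T0 TTs.
    have pM := powR_ge0 (2 * M) p^-1.
    have g1 : 0 <= gamma.
      apply: le_trans gp; rewrite subr_ge0 ler_pdivrMr ?mul1r; lra.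
    have C1 : 0 <= `|Fu| * M `^ kappa by rewrite mulr_ge0 ?powR_ge0.
    have C2 : 0 <= `|Gu| * M `^ gamma by rewrite mulr_ge0 ?powR_ge0.
    have K1 : 0 <= `|Fu| * M `^ kappa * (1 + (2 * M) `^ p^-1) by rewrite mulr_ge0// addr_ge0.
    have K2 : 0 <= `|Gu| * M `^ gamma * (1 + (2 * M) `^ p^-1) by rewrite mulr_ge0// addr_ge0.
    have bound (C e a d : R) : 0 <= e -> `|a| <= M -> d <= C * `|a| `^ e -> d <= `|C| * M `^ e.
      move=> e0 aM h; apply: (le_trans h).
      apply: (@le_trans _ _ (`|C| * `|a| `^ e)); first by rewrite ler_wpM2r ?powR_ge0// ler_norm.
      by rewrite ler_wpM2l//; apply: ler_powR2.
    exists (`|Fu| * M `^ kappa * (1 + (2 * M) `^ p^-1) + `|Gu| * M `^ gamma * (1 + (2 * M) `^ p^-1)).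
      exact: addr_ge0.
    move=> x t tT; split.
      apply: (@weaken _ _ (`|Fu| * M `^ kappa * (1 + (2 * M) `^ p^-1))); first by rewrite lerDl.
      apply: sub_power_lipschitz => // [|i|a aM]; [exact: ltW|exact: f00|].
      have [d1 [d2 [h1 h2]]] := HFG x t a tT aM; split => //; exact: bound h1.
    apply: (@weaken _ _ (`|Gu| * M `^ gamma * (1 + (2 * M) `^ p^-1))); first by rewrite lerDr.
    apply: sub_power_lipschitz => // [|i|a aM]; [exact: ltW|exact: g00|].
    have [d1 [d2 [h1 h2]]] := HFG x t a tT aM; split => //; exact: bound h2.
  + have q0 : 0 < 2 * (p - 1) by lra.
    rewrite invr_ge0 (ltW q0)/= ltf_pV2 ?posrE//; lra.
Qed.

Lemma exists_between (T : R) (Ts : \bar R) : (T%:E < Ts)%E ->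
  exists2 T', T < T' & (T'%:E < Ts)%E.
Proof.
case: Ts => [r| |//].
  by rewrite lte_fin => Tr; exists ((T + r) / 2); rewrite ?lte_fin; lra.
by move=> _; exists (T + 1); [rewrite ltrDl|exact: ltry].
Qed.

End alternatives.

(** * Comparison at every time *)

Section all_times.
Context {R : realType} {n : nat}.
Local Notation V := ('rV[R]_n * measurableTypeR R)%type.
Local Notation leb := (@lebesgue_rV R n).
Local Notation leb1 := (@lebesgue_measure R).

(** The integral over space is a nonnegative function of time with integral 0. *)
Lemma ae_slice_ae (h : V -> R) : ig lebV h -> (forall z, 0 <= h z) ->
  {ae lebV, forall z, h z = 0} ->
  {ae leb1, forall t, {ae leb, forall x, h (x, t) = 0}}.
Proof.
move=> igh h0 hae.
have mG := @measurable_fubini_G _ _ _ _ R leb leb1 (EFin \o h) igh.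
have G0 t : (0 <= fubini_G leb (EFin \o h) t)%E by apply: integral_ge0 => x _; rewrite lee_fin.
have I0 : \int[lebV]_z h z = 0.
  by rewrite (@I_ae _ _ _ _ _ (fun=> 0)) ?I_0//; exact: ig_meas igh.
have : (\int[leb1]_t `|fubini_G leb (EFin \o h) t| = 0)%E.
  under eq_integral do rewrite gee0_abs//.
  rewrite (@integral21_prod_meas1 _ _ _ _ R leb leb1 (EFin \o h) igh).
  by have := I_fin igh; rewrite I0.
move=> /(ae_eq_integral_abs leb1 measurableT mG) GE.
apply: filterS2 GE (ae_slice_ig igh) => t /(_ Logic.I) Gt igt.
apply: I_eq0_ae => //; rewrite -lee_fin I_fin//.
by rewrite /fubini_G /= in Gt; rewrite Gt.
Qed.

Lemma exists_in_itv_ae (a b : R) (P : R -> Prop) : a < b ->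
  {ae leb1, forall t, P t} -> exists2 t, a <= t <= b & P t.
Proof.
move=> ab [N [mN N0 PN]]; apply: contrapT => nP.
have sub : `[a, b]%classic `<=` N.
  move=> t; rewrite /= in_itv/= => tab; apply: PN => Pt; apply: nP; by exists t.
have : (leb1 `[a, b]%classic <= leb1 N)%E by apply: le_measure => //; rewrite inE.
by rewrite N0 lebesgue_measure_itv/= lte_fin ab -EFinB lee_fin subr_le0 leNgt ab.
Qed.

Lemma halfway (t m : R) : 0 < m -> t < t + m / 2.
Proof. by move=> m0; rewrite ltrDl divr_gt0. Qed.

Lemma halfway_lt (t t' d d' s : R) : let m := Num.min (Num.min d d') (s - t) in
  0 < m -> t' <= t + m / 2 -> [/\ t' - t < d, t' - t < d' & t' < s].
Proof.
move=> m m0 h.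
have md : m <= d by rewrite /m !ge_min lexx.
have md' : m <= d' by rewrite /m !ge_min lexx orbT.
have ms : m <= s - t by rewrite /m !ge_min lexx orbT.
move: m m0 h md md' ms => m m0 h md md' ms; split; lra.
Qed.

Variables (U W : V -> R) (T T1 : R).
Hypothesis T1T : T1 <= T.
Hypothesis igU : ig lebV U.
Hypothesis igW : ig lebV W.
Hypothesis sliceU : forall t, ig leb (fun x => U (x, t)).
Hypothesis sliceW : forall t, ig leb (fun x => W (x, t)).
Hypothesis contU : forall N e t0, 0 < e -> 0 <= t0 <= T ->
  exists2 d, 0 < d & forall t, 0 <= t <= T -> `|t - t0| < d ->
    \int[leb]_x (\1_(ball_rV N : set 'rV[R]_n) x * `|U (x, t) - U (x, t0)|) <= e.
Hypothesis contW : forall N e t0, 0 < e -> 0 <= t0 <= T ->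
  exists2 d, 0 < d & forall t, 0 <= t <= T -> `|t - t0| < d ->
    \int[leb]_x (\1_(ball_rV N : set 'rV[R]_n) x * `|W (x, t) - W (x, t0)|) <= e.
Hypothesis UW : {ae lebV, forall z : V, 0 < z.2 < T1 -> U z <= W z}.

(** Almost every time t' > t has ordered slices; let t' tend to t and use
    continuity in L^1 on balls. *)
Lemma ordered_at_all_times t : 0 < t < T1 -> {ae leb, forall x, U (x, t) <= W (x, t)}.
Proof.
move=> /andP[t0 tT1].
have tT : 0 <= t <= T by rewrite (ltW t0)/= (le_trans (ltW tT1)).
pose A := [set z : V | 0 < z.2 < T1].
have mA : measurable A.
  rewrite (_ : A = [set: 'rV[R]_n] `*` `]0, T1[%classic); first exact: measurableX.
  by apply/seteqP; split=> [z zT|z [_]]; rewrite /A /= ?in_itv.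
have igw := igB igU igW; have mw := ig_meas igw.
pose h (z : V) : R := \1_A z * pos (U z - W z).
have mh : measurable_fun setT h.
  apply: measurable_funM; first exact: measurable_indic.
  exact: measurable_comp_continuous continuous_pos mw.
have h0 z : 0 <= h z by rewrite mulr_ge0 ?pos_ge0// indicE.
have igh : ig lebV h.
  apply: ig_dom (ig_abs igw) => // z; rewrite ger0_norm//.
  have i1 : \1_A z <= 1 :> R by rewrite indicE lern1 leq_b1.
  by apply: le_trans (pos_le_norm _); rewrite ler_piMl ?pos_ge0.
have hae : {ae lebV, forall z, h z = 0}.
  apply: filterS UW => z zUW; rewrite /h indicE.
  have [zA|zA] := pselect (A z); last by rewrite memNset// mul0r.
  by rewrite pos_eq0 ?mulr0// subr_le0; exact: zUW.
have slices := ae_slice_ae igh h0 hae.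
have small k : {ae leb, forall x, ball_cut (rad2 k.+1%:R (x, t)) * pos (U (x, t) - W (x, t)) = 0}.
  have L0 : 0 < k.+1%:R :> R by [].
  have b0 (x : 'rV[R]_n) : 0 <= ball_cut (rad2 k.+1%:R (x, t)) * pos (U (x, t) - W (x, t)).
    by have /andP[c0 _] := ball_cut_itv (rad2 k.+1%:R ((x, t) : V)); rewrite mulr_ge0 ?pos_ge0.
  have mk : measurable_fun setT (fun x : 'rV[R]_n =>
      ball_cut (rad2 k.+1%:R (x, t)) * pos (U (x, t) - W (x, t))).
    apply: (measurable_slice (f := fun z => ball_cut (rad2 k.+1%:R z) * pos (U z - W z))).
    apply: measurable_funM; last exact: measurable_comp_continuous continuous_pos mw.
    apply: measurable_comp_continuous; last exact: measurable_rad2.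
    by apply: continuous_is_derive => s; exact: is_derive_ball_cut.
  have le e : 0 < e -> (\int[leb]_x (ball_cut (rad2 k.+1%:R (x, t)) * pos (U (x, t) - W (x, t)))%:E <= (2 * e)%:E)%E.
    move=> e0.
    have [d d0 Hd] := contU (2 * k.+1%:R) e0 tT; have [d' d'0 Hd'] := contW (2 * k.+1%:R) e0 tT.
    have m0 : 0 < Num.min (Num.min d d') (T1 - t) by rewrite !lt_min d0 d'0 subr_gt0.
    have [t' /andP[tt' t'm] ht'] := exists_in_itv_ae (halfway t m0) slices.
    have [ltd ltd' ltT] := halfway_lt m0 t'm.
    have t'T1 : 0 < t' < T1 by rewrite (lt_le_trans t0 tt').
    have t'T : 0 <= t' <= T by case/andP: t'T1 => h1 h2; rewrite (ltW h1) (le_trans (ltW h2)).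
    have nt : `|t' - t| = t' - t by rewrite ger0_norm// subr_ge0.
    have U1 : {ae leb, forall x, U (x, t') <= W (x, t')}.
      apply: filterS ht' => x; rewrite /h indicE mem_set// mul1r => px.
      rewrite leNgt; apply/negP => wx; move: px; rewrite pos_id; last by rewrite subr_ge0 ltW.
      by move/eqP; rewrite subr_eq0 gt_eqF.
    apply: (layer_excess sliceU sliceW L0 U1).
      under eq_Rintegral do rewrite distrC; by apply: Hd; rewrite ?nt.
    under eq_Rintegral do rewrite distrC; by apply: Hd'; rewrite ?nt.
  have [igk _] := ig_ge0 mk b0 (le 1 ltr01).
  apply: I_eq0_ae => //; apply/ler_addgt0Pr => e e0; rewrite add0r.
  have e20 : 0 < e / 2 by rewrite divr_gt0.
  by rewrite -lee_fin I_fin//; have := le _ e20; rewrite mulrC divfK.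
have : {ae leb, forall x k, ball_cut (rad2 k.+1%:R (x, t)) * pos (U (x, t) - W (x, t)) = 0}.
  exact/ae_foralln.
apply: filterS => x Hx.
have h1 : 0 < 1 :> R by [].
near \oo => k.
have rk : rad2 k.+1%:R (x, t) <= 1 by near: k; exact: near_rad2_le.
have := Hx k; rewrite ball_cut_eq1// mul1r => px.
rewrite leNgt; apply/negP => wx; move: px; rewrite pos_id; last by rewrite subr_ge0 ltW.
by move/eqP; rewrite subr_eq0 gt_eqF.
Unshelve. all: by end_near. Qed.

End all_times.

Theorem proposition3p3 (R : realType) (n : nat) (p kappa gamma : R)
    (mu F : R -> R)
    (f : 'rV[R]_n -> R -> R -> 'rV[R]_n) (g : R -> R -> 'rV[R]_n)
    (Ts : \bar R) (T : R)
    (u0 v0 : 'rV[R]_n -> R) (u v : 'rV[R]_n -> R -> R) :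
  (1 <= n)%N -> 2 < p -> 0 <= kappa ->
  {within [set t : R | 0 <= t], continuous mu} ->
  (forall t, 0 <= t -> 0 < mu t) ->
  {within [set z : 'rV[R]_n * R * R | 0 <= z.1.2],
    continuous (fun z => f z.1.1 z.1.2 z.2)} ->
  {within [set z : R * R | 0 <= z.1], continuous (fun z => g z.1 z.2)} ->
  (forall t, 0 <= t -> g t 0 = 0) ->
  {within [set t : R | 0 <= t], continuous F} ->
  (forall x t s, 0 <= t -> enorm (f x t s) <= F t * `|s| `^ (kappa + 1)) ->
  0 < T -> (T%:E < Ts)%E ->
  u0 \in Lfun (@lebesgue_rV R n) 1%E -> u0 \in Lfun (@lebesgue_rV R n) +oo%E ->
  v0 \in Lfun (@lebesgue_rV R n) 1%E -> v0 \in Lfun (@lebesgue_rV R n) +oo%E ->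
  solution p mu f g Ts u0 u -> solution p mu f g Ts v0 v ->
  (n%:R <= p /\
   forall M T' : R, 0 < M -> 0 < T' -> (T'%:E < Ts)%E ->
     exists Kf Kg : R, forall x t a b,
       0 <= t <= T' -> `|a| <= M -> `|b| <= M ->
       enorm (f x t a - f x t b) <= Kf * `|a - b| `^ (1 - p^-1) /\
       enorm (g t a - g t b) <= Kg * `|a - b| `^ (1 - p^-1))
  \/
  (p < n%:R /\ 1 - 2 / p <= kappa /\ 1 - 2 / p <= gamma /\
   forall M T' : R, 0 < M -> 0 < T' -> (T'%:E < Ts)%E ->
     exists Fu Gu : R, forall x t a,
       0 <= t <= T' -> `|a| <= M ->
       derivable (f x t) a 1 /\ derivable (g t) a 1 /\
       enorm ('D_1 (f x t) a) <= Fu * `|a| `^ kappa /\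
       enorm ('D_1 (g t) a) <= Gu * `|a| `^ gamma) ->
  {ae (@lebesgue_rV R n), forall x, u0 x <= v0 x} ->
  forall t, 0 < t <= T -> {ae (@lebesgue_rV R n), forall x, u x t <= v x t}.
Proof.
move=> _ p2 k0 cmu mu0 cf cg g0 _ fF T0 TTs _ _ _ _.
move=> [uC [uL [[Du [uLW uDE]] uinit]]] [vC [vL [[Dv [vLW vDE]] vinit]]] alt uv0 t /andP[t0 tT].
have [T' TT' T'Ts] := exists_between TTs.
have T'0 : 0 < T' := lt_trans T0 TT'.
have [Cu HCu] := uL T' (conj T'0 T'Ts); have [Cv HCv] := vL T' (conj T'0 T'Ts).
pose M := `|Cu| + `|Cv| + 1.
have M0 : 0 < M by rewrite ltr_wpDl.
have CuM : Cu <= M by rewrite (le_trans (ler_norm _))// /M -addrA lerDl addr_ge0.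
have CvM : Cv <= M by rewrite (le_trans (ler_norm _))// /M addrAC lerDr addr_ge0.
have uM s : 0 <= s <= T' -> ('N[@lebesgue_rV R n]_1[EFin \o (u ^~ s)] <= M%:E)%E /\
    ('N[@lebesgue_rV R n]_(+oo)[EFin \o (u ^~ s)] <= M%:E)%E.
  by move=> /HCu[h1 h2]; split; [apply: (le_trans h1)|apply: (le_trans h2)]; rewrite lee_fin.
have vM s : 0 <= s <= T' -> ('N[@lebesgue_rV R n]_1[EFin \o (v ^~ s)] <= M%:E)%E /\
    ('N[@lebesgue_rV R n]_(+oo)[EFin \o (v ^~ s)] <= M%:E)%E.
  by move=> /HCv[h1 h2]; split; [apply: (le_trans h1)|apply: (le_trans h2)]; rewrite lee_fin.
have [tau [eta [tau_itv eta_sc HK]]] := structure_alternatives p2 k0 g0 fF T'0 T'Ts alt.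
have hbd M' : 0 < M' -> exists H0, forall x s a i, `|a| <= M' ->
    `|f x (tclamp T' s) a ord0 i| <= H0 /\ `|g (tclamp T' s) a ord0 i| <= H0.
  move=> M'0; have [K K0 HKM] := HK M' M'0.
  exists (K * M' `^ ((1 + 2 * tau) * (1 - p^-1))) => x s a i aM.
  have [Hf Hg] := HKM x _ (tclamp_itv s (ltW T'0)).
  have e0 : 0 <= (1 + 2 * tau) * (1 - p^-1).
    case/andP: tau_itv => h1 _; apply: mulr_ge0; first lra.
    by rewrite subr_ge0 invf_le1; lra.
  have pM : K * `|a| `^ ((1 + 2 * tau) * (1 - p^-1)) <= K * M' `^ ((1 + 2 * tau) * (1 - p^-1)).
    by rewrite ler_wpM2l//; apply: ler_powR2.
  have [_ h1] := Hf a a i aM aM; have [_ h2] := Hg a a i aM aM.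
  by split; [exact: le_trans h1 pM|exact: le_trans h2 pM].
have [U [G regU]] := solution_regular p2 T'0 cmu mu0 cf cg hbd T'Ts uC uLW uDE M0 uM.
have [W [G' regW]] := solution_regular p2 T'0 cmu mu0 cf cg hbd T'Ts vC vLW vDE M0 vM.
have [K K0 HKM] := HK M M0.
have [c [C [c0 C0 dis mono]]] := regular_dissipative p2 T'0 cmu mu0 K0
  (fun x s sT => (HKM x s sT).1) (fun s sT => (HKM 0 s sT).2).
(* Two margins are needed: the order is obtained up to the zero T1 of the time
   cutoff, and T1 < T' leaves room for the kernels. *)
have T1_itv : T < (T + T') / 2 < T' by apply/andP; split; lra.
have /andP[TT1 T1T'] := T1_itv.
have T10 : 0 < (T + T') / 2 := lt_trans T0 TT1.
have z0 : 0 <= (0 : R) <= T' by rewrite lexx ltW.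
have init : {ae @lebesgue_rV R n, forall x, U (x, 0) <= W (x, 0)}.
  apply: filterS2 (filterI (reg_ae regU z0) (reg_ae regW z0)) (filterI uv0 (filterI uinit vinit)).
  by move=> x [-> ->] [uv [-> ->]].
have UW := comparison_ae p2 T10 T1T' c0 C0 tau_itv (dis _ _ _ regU) (dis _ _ _ regW) eta_sc
  (mono _ _ _ _ _ _ regU regW) (reg_slice regU) (reg_slice regW)
  (fun N e e0 => reg_cont regU N e0 z0) (fun N e e0 => reg_cont regW N e0 z0) init.
have tT1 : 0 < t < (T + T') / 2 by rewrite t0 (le_lt_trans tT).
have tT' : 0 <= t <= T' by rewrite ltW//= (le_trans tT)// ltW.
have := ordered_at_all_times (ltW T1T') (reg_ig regU) (reg_ig regW) (reg_slice regU) (reg_slice regW)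
  (fun N e s => @reg_cont _ _ _ _ _ _ _ _ _ _ _ regU N e s)
  (fun N e s => @reg_cont _ _ _ _ _ _ _ _ _ _ _ regW N e s) UW tT1.
apply: filterS2 (filterI (reg_ae regU tT') (reg_ae regW tT')) => x [<- <-].
exact: id.
Qed.
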